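(* Let $N\ge 2$, let $\sigma_c>0$ with $\sigma_c\neq1$, and let $a\in\mathbb{N}$. Let $D_0\subset\mathbb{R}^N$ be a ball, and let $\Omega\supset\supset D_0$ be a bounded domain whose boundary is made of regular points for the Dirichlet Laplacian. Then the pair $(D_0,\Omega)$ satisfies some overdetermination of type $(a,1)$ if and only if $D_0$ and $\Omega$ are concentric balls.
   Context: $\mathbb{N}$ is the set of positive integers. A domain is a connected open set; $A\subset\subset B$ means $\overline A\subset B$. A boundary point is regular for the Dirichlet Laplacian if it is regular in the classical (Wiener) sense. Two-phase problem: for bounded domains $D\subset\subset\Omega$ of $\mathbb{R}^N$ with $\Omega\setminus\overline D$ connected and a constant $\sigma_c>0$, set $\sigma:=\sigma_c\chi_D+\chi_{\Omega\setminus D}$ ($\chi$ = characteristic function), and let $u\in H_0^1(\Omega)$ be the unique weak solution of $\operatorname{div}(\sigma\nabla u)=N$ in $\Omega$, $u=0$ on $\partial\Omega$, that is $-\int_\Omega\langle\sigma\nabla u,\nabla\varphi\rangle\,dx=N\int_\Omega\varphi\,dx$ for all $\varphi\in H_0^1(\Omega)$. For a subdomain $\omega\subset\subset\Omega$ with $\partial\omega\cap\partial D=\varnothing$, $\partial\omega$ is an overdetermined level set for $u$ if both $u$ and $|\nabla u|$ are constant on $\partial\omega$. For nonnegative integers $a,b$, the pair $(D,\Omega)$ (or its solution $u$) satisfies an overdetermination of type $(a,b)$ if there exist domains $\omega_1,\dots,\omega_{a+b}$, each with connected boundary, such that $\omega_1\subset\subset\dots\subset\subset\omega_a\subset\subset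 D\subset\subset\omega_{a+1}\subset\subset\dots\subset\subset\omega_{a+b}\subset\subset\Omega$ and each $\partial\omega_i$ is an overdetermined level set for $u$ (the constant values of $u$ and $|\nabla u|$ may depend on $i$). *)

(* Defs.v *)
From HB Require Import structures.
From mathcomp Require Import all_boot all_order all_algebra.
From mathcomp Require Import all_classical all_reals all_analysis.

Set Implicit Arguments.
Unset Strict Implicit.
Unset Printing Implicit Defensive.

Import Order.TTheory GRing.Theory Num.Theory.
Import numFieldNormedType.Exports.

Local Open Scope classical_set_scope.
Local Open Scope ring_scope.

(* R^n is 'rV[R]_n.  The library norm on 'rV[R]_n is the sup norm: it gives the
   usual topology, but Euclidean lengths and balls are defined here. *)
Section euclidean.
Context {R : realType} {n : nat}.
Implicit Types (x y c : 'rV[R]_n) (A B D : set 'rV[R]_n).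

Definition dotr x y : R := \sum_(i < n) x 0 i * y 0 i.

Definition enorm x : R := Num.sqrt (dotr x x).

Definition eball c (r : R) : set 'rV[R]_n := [set x | enorm (x - c) < r].

Definition boundary A : set 'rV[R]_n := closure A `\` A°.

Definition domain A : Prop := [/\ open A, connected A & A !=set0].

Definition compactly_contained A B : Prop := closure A `<=` B.

Definition is_eball A : Prop := exists c r, 0 < r /\ A = eball c r.

Definition concentric_balls A B : Prop :=
  exists c r s, [/\ 0 < r, 0 < s, A = eball c r & B = eball c s].

End euclidean.

Fact row_display : measure_display.
Proof. exact: default_measure_display. Qed.

(* The product sigma-algebra on R^n, generated by the coordinate functions; as
   the topology of R is second countable, it is the Borel sigma-algebra. *)
Section measurable_row.
Context {R : realType} {n : nat}.

Let coor (i : 'I_n) (x : 'rV[R]_n) : measurableTypeR R := x 0 i.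

Let row_set0 : g_sigma_preimage coor set0.
Proof. exact: sigma_algebra0. Qed.

Let row_setC A : g_sigma_preimage coor A -> g_sigma_preimage coor (~` A).
Proof. exact: sigma_algebraC. Qed.

Let row_bigcup (F : _^nat) : (forall i, g_sigma_preimage coor (F i)) ->
  g_sigma_preimage coor (\bigcup_i (F i)).
Proof. exact: sigma_algebra_bigcup. Qed.

HB.instance Definition _ := @isMeasurable.Build
  row_display 'rV[R]_n
  (g_sigma_preimage coor) row_set0 row_setC row_bigcup.

Lemma measurable_coord (i : 'I_n) :
  measurable_fun [set: 'rV[R]_n] (fun x => x 0 i : measurableTypeR R).
Proof.
move=> _ Y mY; rewrite setTI; apply: sub_sigma_algebra => /=.
rewrite -bigcup_seq/=; exists i => /=; first by rewrite mem_index_enum.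
by exists Y => //; rewrite setTI.
Qed.

Lemma measurable_fun_row d (T : measurableType d) (f : T -> 'rV[R]_n) :
  (forall i, measurable_fun [set: T] (fun t => f t 0 i : measurableTypeR R)) ->
  measurable_fun [set: T] f.
Proof.
move=> mf.
suff sub : g_sigma_preimage (fun i => coor i \o f) `<=` measurable.
  rewrite g_sigma_preimage_comp in sub.
  by move=> _ A mA; apply: sub; exists A.
apply: smallest_sub; first exact: sigma_algebra_measurable.
rewrite -bigcup_seq/=; apply: bigcup_sub => i _.
by move=> A [B mB <-]; exact: mf.
Qed.

End measurable_row.

Section lebesgue_row.
Context {R : realType}.

Definition consr n (p : measurableTypeR R * 'rV[R]_n) : 'rV[R]_n.+1 :=
  row_mx (p.1)%:M p.2.

Lemma measurable_consr n : measurable_fun setT (@consr n).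
Proof.
apply: measurable_fun_row => i; rewrite /consr.
under eq_fun do rewrite (mxE _ _ 0 i).
case: split_ordP => j _.
- rewrite (_ : (fun _ => _) = fst :> (_ -> measurableTypeR R)).
    exact: measurable_fst.
  by apply: funext => -[x y] /=; rewrite mxE !ord1 eqxx mulr1n.
- exact: (measurableT_comp (measurable_coord j) measurable_snd).
Qed.

Section step.
Variables (n : nat) (mu : {sigma_finite_measure set 'rV[R]_n -> \bar R}).

Definition lebesgue_step : set 'rV[R]_n.+1 -> \bar R :=
  pushforward (lebesgue_measure \x mu)%E (@consr n).

Let lebesgue_step0 : lebesgue_step set0 = 0%E.
Proof. by rewrite /lebesgue_step /pushforward preimage_set0 measure0. Qed.

Let lebesgue_step_ge0 A : (0 <= lebesgue_step A)%E.
Proof. by apply: integral_ge0 => x _; exact: measure_ge0. Qed.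

Let lebesgue_step_sigma_additive : semi_sigma_additive lebesgue_step.
Proof.
have mc A : measurable A -> measurable (@consr n @^-1` A).
  by move=> mA; rewrite -[X in measurable X]setTI; exact: measurable_consr.
move=> F mF tF mUF; rewrite /lebesgue_step /pushforward preimage_bigcup.
apply: measure_semi_sigma_additive.
- by move=> k; exact: mc.
- apply/trivIsetP => /= i j _ _ ij; rewrite -preimage_setI.
  by move/trivIsetP : tF => /(_ _ _ _ _ ij) ->//; rewrite preimage_set0.
- by rewrite -preimage_bigcup; exact: mc.
Qed.

HB.instance Definition _ := isMeasure.Build _ _ _ lebesgue_step
  lebesgue_step0 lebesgue_step_ge0 lebesgue_step_sigma_additive.

Let lebesgue_step_sigma_finite : sigma_finite setT lebesgue_step.
Proof.
pose g (x : 'rV[R]_n.+1) : measurableTypeR R * 'rV[R]_n :=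
  (x 0 0, \row_j x 0 (lift 0 j)).
have mg : measurable_fun setT g.
  apply/measurable_fun_pair; first exact: measurable_coord.
  apply: measurable_fun_row => j; under eq_fun do rewrite mxE.
  exact: measurable_coord.
have gK p : g (consr p) = p.
  case: p => x y; rewrite /g /consr; congr pair.
    by rewrite mxE; case: split_ordP => // j; rewrite mxE !ord1 eqxx mulr1n.
  apply/rowP => j; rewrite mxE.
  have -> : lift 0 j = rshift 1 j :> 'I_(1 + n) by apply: val_inj.
  exact: row_mxEr.
have /sigma_finiteP[F [UF ndF mF]] := sigma_finiteT (@lebesgue_measure R).
have /sigma_finiteP[G [UG ndG mG]] := sigma_finiteT mu.
exists (fun k => g @^-1` (F k `*` G k)).
  apply/esym; rewrite -subTset => x _.
  have [[k _ Fk] [l _ Gl]] : (\bigcup_k F k) (g x).1 /\ (\bigcup_k G k) (g x).2.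
    by rewrite -UF -UG.
  exists (maxn k l) => //; split.
  - by move: Fk; exact/subsetPset/ndF/leq_maxl.
  - by move: Gl; exact/subsetPset/ndG/leq_maxr.
move=> k; have [mFk Fkoo] := mF k; have [mGk Gkoo] := mG k; split.
  by rewrite -[X in measurable X]setTI; apply: mg => //; exact: measurableX.
rewrite /lebesgue_step /pushforward -comp_preimage.
rewrite (_ : g \o @consr n = id); last by apply: funext => p; exact: gK.
by rewrite product_measure1E// lte_mul_pinfty// ge0_fin_numE.
Qed.

HB.instance Definition _ := Measure_isSigmaFinite.Build _ _ _ lebesgue_step
  lebesgue_step_sigma_finite.

End step.

(* Lebesgue measure on R^n, on R^(n+1) the image of the product of the
   one-dimensional and n-dimensional Lebesgue measures under consr. *)
Fixpoint lebesgue_row n : {sigma_finite_measure set 'rV[R]_n -> \bar R} :=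
  if n is m.+1 then lebesgue_step (lebesgue_row m) else \d_(0 : 'rV[R]_0).

End lebesgue_row.

Section calculus.
Context {R : realType} {n : nat}.
Implicit Types (f h phi : 'rV[R]_n -> R) (U Omega : set 'rV[R]_n).

Definition partial (i : 'I_n) f : 'rV[R]_n -> R := 'D_(delta_mx 0 i) f.

Definition grad f (x : 'rV[R]_n) : 'rV[R]_n := \row_i partial i f x.

Definition laplacian f (x : 'rV[R]_n) : R := \sum_(i < n) partial i (partial i f) x.

Definition smooth f : Prop :=
  forall (s : seq 'I_n) x, differentiable (foldr partial f s) x.

Definition test_function Omega phi : Prop :=
  let supp := closure [set x | phi x != 0] in
  [/\ smooth phi, compact supp & supp `<=` Omega].

(* To be used for an open set U. *)
Definition C2_on U f : Prop := forall x, U x ->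
  [/\ differentiable f x,
      forall i, differentiable (partial i f) x &
      forall i j, {for x, continuous (partial i (partial j f))}].

Definition harmonic_on U h : Prop :=
  C2_on U h /\ forall x, U x -> laplacian h x = 0.

End calculus.

(* Regularity of a boundary point for the Dirichlet Laplacian, in the sense of
   Perron and Wiener: for all continuous boundary data the Perron solution
   attains its datum at the point. *)
Section regular_points.
Context {R : realType} {n : nat}.
Implicit Types (Omega : set 'rV[R]_n) (v f : 'rV[R]_n -> R).

Definition subharmonic_on Omega v : Prop := forall c r h,
  0 < r -> closure (eball c r) `<=` Omega ->
  {within closure (eball c r), continuous h} ->
  harmonic_on (eball c r) h ->
  (forall x, boundary (eball c r) x -> v x <= h x) ->
  forall x, eball c r x -> v x <= h x.

Definition subfunction Omega f v : Prop :=
  [/\ {within closure Omega, continuous v}, subharmonic_on Omega v &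
      forall x, boundary Omega x -> v x <= f x].

Definition perron_solution Omega f (x : 'rV[R]_n) : R :=
  sup [set v x | v in subfunction Omega f].

Definition regular_point Omega (x0 : 'rV[R]_n) : Prop :=
  boundary Omega x0 /\
  forall f, {within boundary Omega, continuous f} ->
    perron_solution Omega f x @[x --> within Omega (nbhs x0)] --> f x0.

End regular_points.

Section sobolev.
Context {R : realType} {n : nat}.
Implicit Types (Omega : set 'rV[R]_n) (u f : 'rV[R]_n -> R)
  (g : 'rV[R]_n -> 'rV[R]_n).

Definition L2 Omega f : Prop :=
  measurable_fun Omega (f : 'rV[R]_n -> measurableTypeR R) /\
  (\int[lebesgue_row n]_(x in Omega) (f x ^+ 2)%:E < +oo)%E.

Definition weak_gradient Omega u g : Prop :=
  forall phi, test_function Omega phi -> forall i,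
    (\int[lebesgue_row n]_(x in Omega) (u x * partial i phi x)) =
    - (\int[lebesgue_row n]_(x in Omega) (g x 0 i * phi x)).

(* H1 Omega u g and H01 Omega u g: u belongs to H^1(Omega), respectively to
   H^1_0(Omega), with weak gradient g. *)
Definition H1 Omega u g : Prop :=
  [/\ L2 Omega u, forall i, L2 Omega (fun x => g x 0 i) &
      weak_gradient Omega u g].

Definition H01 Omega u g : Prop :=
  H1 Omega u g /\
  exists phi : nat -> 'rV[R]_n -> R,
    [/\ forall k, test_function Omega (phi k),
      (\int[lebesgue_row n]_(x in Omega) ((phi k x - u x) ^+ 2)%:E)%E
        @[k --> \oo] --> 0%E &
      (\int[lebesgue_row n]_(x in Omega) (enorm (grad (phi k) x - g x) ^+ 2)%:E)%E
        @[k --> \oo] --> 0%E].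

End sobolev.

Section two_phase.
Context {R : realType} {n : nat}.
Implicit Types (D Omega : set 'rV[R]_n) (u : 'rV[R]_n -> R).

Definition conductivity (sigma_c : R) D Omega (x : 'rV[R]_n) : R :=
  sigma_c * \1_D x + \1_(Omega `\` D) x.

Definition two_phase_solution (sigma_c : R) D Omega u : Prop :=
  exists2 g, H01 Omega u g &
    forall phi h, H01 Omega phi h ->
      - (\int[lebesgue_row n]_(x in Omega)
          (conductivity sigma_c D Omega x * dotr (g x) (h x))) =
      n%:R * (\int[lebesgue_row n]_(x in Omega) phi x).

(* A weak solution is determined almost everywhere only; its values and its
   gradient on a level set are those of its differentiable representative v on
   the open set Omega `\` boundary D, which contains boundary omega. *)
Definition overdetermined_level_set D Omega u (omega : set 'rV[R]_n) : Prop :=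
  [/\ domain omega, compactly_contained omega Omega,
      boundary omega `&` boundary D = set0 &
      exists v : 'rV[R]_n -> R,
        [/\ forall x, (Omega `\` boundary D) x -> differentiable v x,
            {ae lebesgue_row n, forall x, Omega x -> v x = u x},
            exists c, forall x, boundary omega x -> v x = c &
            exists d, forall x, boundary omega x -> enorm (grad v x) = d]].

(* omega 0, ..., omega (a + b - 1) are the domains omega_1, ..., omega_(a+b):
   the first a lie inside D and the last b between D and Omega. *)
Definition overdetermination_type (a b : nat) D Omega u : Prop :=
  exists omega : nat -> set 'rV[R]_n,
    (forall i, (i < a + b)%N ->
      [/\ domain (omega i), connected (boundary (omega i)) &
          overdetermined_level_set D Omega u (omega i)]) /\
    sorted (fun A B => `[< compactly_contained A B >])
      (mkseq omega a ++
       D :: rcons (mkseq (fun i => omega (a + i)%N) b) Omega).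

(* Since the weak solution is unique, the existential quantifier is harmless. *)
Definition pair_overdetermination_type (sigma_c : R) (a b : nat) D Omega : Prop :=
  exists2 u, two_phase_solution sigma_c D Omega u &
    overdetermination_type a b D Omega u.

End two_phase.

(* Main.v *)
(* In the innermost domain, u solves sg * laplacian u = n with constant Cauchy
   data, so Weinberger's proof of Serrin's theorem, followed by unique
   continuation, makes u a quadratic polynomial on the ball D0, possibly centred
   elsewhere: a radial part plus a linear one, b . (x - c).  The transmission
   problem across the sphere with this inner solution is solved explicitly
   outside, by a radial quadratic polynomial plus a dipole
   (p + q |x - c|^-n) (b . (x - c)); by Weyl's lemma and unique continuation this
   is u in the rest of Omega.  On the boundary of the outermost level domain the
   two constraints on u and |grad u| eliminate b . (x - c) and leave a nontrivial
   polynomial equation for |x - c| unless b = 0; as that boundary is connected,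
   |x - c| would be constant on it, and comparing the directions b and - b gives
   b = 0.  So u coincides outside D0 with a radial function U, smooth near the
   boundary of Omega.  If U did not vanish at a boundary point, then u / U, which
   is 1 on Omega near this point, would be a limit of test functions of Omega;
   hence the complement of Omega would have zero capacity there, and the point
   would not be regular.  Thus the boundary of Omega lies on a sphere centred
   at c, and Omega is a ball.  *)

Require Import Defs.
From HB Require Import structures.
From mathcomp Require Import all_boot all_order all_algebra.
From mathcomp Require Import all_classical all_reals all_analysis.
From mathcomp Require Import measurable_realfun.
From mathcomp Require Import ring lra zify.

Set Implicit Arguments.
Unset Strict Implicit.
Unset Printing Implicit Defensive.

Import Order.TTheory GRing.Theory Num.Theory.
Import numFieldNormedType.Exports.

Local Open Scope classical_set_scope.
Local Open Scope ring_scope.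

(** * Smooth functions *)

(** The level domains and Omega have no boundary regularity, so no surface integral is taken. Green
    identities are integrals over the whole space of smooth functions with bounded support; a
    boundary or a sphere enters through cut-offs [step] of a scalar function that is constant on it
    (w in Serrin's theorem, |x-c|^2 at the interface). A flux disappears when the normal component
    of the field decays linearly while the cut-off has slope k on a shell of width 1/k. In Weyl's
    lemma the mollifier varies with its scale by the Laplacian of a test function. Unique
    continuation rests on a weighted integral of e(y+rtz) e(y+(r/t)z) that does not depend on t:
    vanishing on a small ball spreads to geometric means of radii. Regular points are defined by
    Perron solutions, whereas u is a Sobolev limit of test functions. The bridge is a smooth
    function of small energy, at least 1 near the complement; its mollification is almost
    superharmonic and, slightly corrected, dominates every subfunction. Conversely, for concentric
    balls sigma grad u = x - c, and u is written with positive parts, which are limits of test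
    functions. *)

Section smooth_calculus.
Context {R : realType} {n : nat}.
Implicit Types (f g : 'rV[R]_n -> R) (h : R -> R).

(** [smooth] speaks of lists of directions, which do not distribute over products or compositions;
    counting the order of differentiability gives a statement that passes through the Leibniz and
    chain rules by induction. *)
Fixpoint smk (k : nat) f : Prop :=
  if k is k'.+1 then
    (forall x, differentiable f x) /\ forall i, smk k' (partial i f)
  else True.

Fixpoint smk1 (k : nat) h : Prop :=
  if k is k'.+1 then (forall x, derivable h x 1) /\ smk1 k' (derive1 h)
  else True.

Definition smooth1 h := forall k, smk1 k h.

Lemma smooth_partial f i : smooth f -> smooth (partial i f).
Proof.
move=> sf s x.
have -> : foldr partial (partial i f) s = foldr partial f (rcons s i).
  by rewrite -cats1 foldr_cat.
exact: sf.
Qed.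

Lemma smooth_diff f x : smooth f -> differentiable f x.
Proof. by move=> /(_ [::] x). Qed.

(** [foldr partial f s] differentiates along the last entry of [s] first, hence the induction on
    lists from the right. *)
Lemma smoothP f : smooth f <-> forall k, smk k f.
Proof.
split=> [sf k|H s].
  elim: k f sf => //= k IH f sf; split=> [x|i]; first exact: smooth_diff.
  by apply: IH; exact: smooth_partial.
elim/last_ind: s f H => [f H x|s i IH f H x]; first by have [] := H 1%N.
rewrite -cats1 foldr_cat /=; apply: IH => k.
by have [_] := H k.+1; exact.
Qed.

Lemma smkS k f : smk k.+1 f -> smk k f.
Proof.
elim: k f => // k IH f [df H]; split=> // i; apply: IH; exact: H.
Qed.

Lemma partial_cst i (c : R) : partial i (fun=> c : R) = (fun=> 0 : R) :> ('rV[R]_n -> R).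
Proof. by apply/funext => x; rewrite /partial derive_cst. Qed.

Lemma partialD i f g : (forall x, differentiable f x) ->
  (forall x, differentiable g x) ->
  partial i (fun x => f x + g x) = fun x => partial i f x + partial i g x.
Proof.
move=> df dg; apply/funext => x.
by rewrite /partial; apply: deriveD; exact: diff_derivable.
Qed.

Lemma partialN i f : (forall x, differentiable f x) ->
  partial i (fun x => - f x) = fun x => - partial i f x.
Proof.
move=> df; apply/funext => x.
by rewrite /partial; apply: deriveN; exact: diff_derivable.
Qed.

Lemma partialM i f g : (forall x, differentiable f x) ->
  (forall x, differentiable g x) ->
  partial i (fun x => f x * g x) =
  fun x => partial i f x * g x + f x * partial i g x.
Proof.
move=> df dg; apply/funext => x; rewrite /partial.
have -> := @deriveM R _ f g x (delta_mx 0 i) (diff_derivable (df x))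
  (diff_derivable (dg x)).
by rewrite /GRing.scale/= addrC mulrC.
Qed.

Lemma partial_comp i h f : (forall x, differentiable f x) ->
  (forall x, derivable h x 1) ->
  partial i (fun x => h (f x)) = fun x => derive1 h (f x) * partial i f x.
Proof.
move=> df dh; apply/funext => x; rewrite /partial.
have dh' : differentiable h (f x) by apply/derivable1_diffP.
rewrite deriveE; last exact: differentiable_comp.
rewrite (@diff_comp R _ _ _ f h x) //= -(deriveE (delta_mx 0 i)) //.
by rewrite (diff1E dh') /= mulrC.
Qed.

Lemma partial_coord i j :
  partial i (fun x : 'rV[R]_n => x 0 j) = fun=> (i == j)%:R.
Proof.
apply/funext => x; rewrite /partial deriveE; last exact: differentiable_coord.
have l : linear (fun N : 'rV[R]_n => N 0 j : R) by move=> k M N; rewrite !mxE.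
pose glM := GRing.isLinear.Build _ _ _ _ _ l.
pose gL : {linear 'rV[R]_n -> R} := HB.pack (fun N : 'rV[R]_n => N 0 j : R) glM.
have -> : (fun N : 'rV[R]_n => N 0 j) = gL by [].
rewrite diff_lin; last by move=> y; exact: coord_continuous.
by rewrite /= mxE eqxx eq_sym.
Qed.

Lemma smooth_cst (c : R) : smooth ((fun=> c) : 'rV[R]_n -> R).
Proof.
apply/smoothP => k; elim: k c => //= k IH c; split=> [x|i].
  exact: differentiable_cst.
by rewrite partial_cst.
Qed.

Lemma smooth_coord j : smooth (fun x : 'rV[R]_n => x 0 j).
Proof.
apply/smoothP => -[|k] //=; split=> [x|i]; first exact: differentiable_coord.
rewrite partial_coord; move: k; apply/smoothP; exact: smooth_cst.
Qed.

Lemma smkD k f g : smk k f -> smk k g -> smk k (fun x => f x + g x).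
Proof.
elim: k f g => //= k IH f g [df Hf] [dg Hg]; split=> [x|i].
  exact: differentiableD.
by rewrite partialD //; apply: IH.
Qed.

Lemma smoothD f g : smooth f -> smooth g -> smooth (fun x => f x + g x).
Proof. by move=> /smoothP sf /smoothP sg; apply/smoothP => k; exact: smkD. Qed.

Lemma smoothN f : smooth f -> smooth (fun x => - f x).
Proof.
move=> /smoothP sf; apply/smoothP => k; move: f {sf}(sf k).
elim: k => //= k IH f [df Hf]; split=> [x|i]; first exact: differentiableN.
by rewrite partialN //; apply: IH.
Qed.

Lemma smoothB f g : smooth f -> smooth g -> smooth (fun x => f x - g x).
Proof. by move=> sf sg; apply: smoothD => //; exact: smoothN. Qed.

Lemma smkM k f g : smk k f -> smk k g -> smk k (fun x => f x * g x).
Proof.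
elim: k f g => // k IH f g sf sg; have [df Hf] := sf; have [dg Hg] := sg.
split=> [x|i]; first exact: differentiableM.
rewrite -/(smk k _) partialM //; apply: smkD; apply: IH.
- exact: Hf.
- exact: smkS.
- exact: smkS.
- exact: Hg.
Qed.

Lemma smoothM f g : smooth f -> smooth g -> smooth (fun x => f x * g x).
Proof. by move=> /smoothP sf /smoothP sg; apply/smoothP => k; exact: smkM. Qed.

Lemma smoothZ (c : R) f : smooth f -> smooth (fun x => c * f x).
Proof. by move=> sf; apply: smoothM => //; exact: smooth_cst. Qed.

Lemma smoothX f k : smooth f -> smooth (fun x => f x ^+ k).
Proof.
move=> sf; elim: k => [|k IH]; first exact: (smooth_cst 1).
by under eq_fun do rewrite exprS; exact: smoothM.
Qed.

Lemma smooth_sum (I : Type) (r : seq I) (P : pred I) (F : I -> 'rV[R]_n -> R) :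
  (forall i, smooth (F i)) -> smooth (fun x => \sum_(i <- r | P i) F i x).
Proof.
move=> sF; elim: r => [|a r IH].
  by under eq_fun do rewrite big_nil; exact: smooth_cst.
under eq_fun do rewrite big_cons.
by case: (P a) => //; exact: smoothD.
Qed.

Lemma smkcomp k h f : smk1 k h -> smk k f -> smk k (fun x => h (f x)).
Proof.
elim: k h f => // k IH h f [dh sh] sf; have [df Hf] := sf.
split=> [x|i].
  by apply: differentiable_comp => //; apply/derivable1_diffP; exact: dh.
rewrite -/(smk k _) partial_comp //; apply: smkM; last exact: Hf.
by apply: IH => //; exact: smkS.
Qed.

Lemma smooth_comp h f : smooth1 h -> smooth f -> smooth (fun x => h (f x)).
Proof. by move=> sh /smoothP sf; apply/smoothP => k; exact: smkcomp. Qed.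

Lemma smooth_laplacian f : smooth f -> smooth (laplacian f).
Proof. by move=> sf; apply: smooth_sum => i; do 2 apply: smooth_partial. Qed.

Lemma smooth_continuous f : smooth f -> continuous f.
Proof. by move=> sf x; apply: differentiable_continuous; exact: smooth_diff. Qed.

Lemma partial_sum (I : Type) (r : seq I) (P : pred I) (F : I -> 'rV[R]_n -> R) i :
  (forall j, smooth (F j)) ->
  partial i (fun x => \sum_(j <- r | P j) F j x) =
  fun x => \sum_(j <- r | P j) partial i (F j) x.
Proof.
move=> sF; elim: r => [|a r IH].
  by under eq_fun do rewrite big_nil; rewrite partial_cst; apply/funext => x; rewrite big_nil.
under eq_fun do rewrite big_cons; apply/funext => x; rewrite big_cons.
case: (P a); last by rewrite IH.
rewrite partialD; first by rewrite IH.
- by move=> y; exact: smooth_diff.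
- by move=> y; apply: smooth_diff; exact: smooth_sum.
Qed.

Lemma partialZ i (c : R) f : smooth f ->
  partial i (fun x => c * f x) = fun x => c * partial i f x.
Proof.
move=> sf; rewrite partialM; last 2 first.
- by move=> x; exact: differentiable_cst.
- by move=> x; exact: smooth_diff.
by rewrite partial_cst; apply/funext => x; rewrite mul0r add0r.
Qed.

Lemma diff_grad f x v : differentiable f x ->
  'D_v f x = \sum_i v 0 i * partial i f x.
Proof.
move=> df; rewrite deriveE // {1}(row_sum_delta v) linear_sum /=.
by apply: eq_bigr => i _; rewrite linearZ /= /partial deriveE.
Qed.

Lemma derivable_line f x v s : differentiable f (x + s *: v) ->
  derivable (fun s : R => f (x + s *: v)) s 1 /\
  derive1 (fun s : R => f (x + s *: v)) s = \sum_i v 0 i * partial i f (x + s *: v).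
Proof.
move=> df.
have dl : is_diff s (fun s : R => x + s *: v) (fun r => r *: v).
  have : is_diff s (cst x + *:%R^~ v) (0 + *:%R^~ v) by apply: is_diffD.
  by rewrite add0r.
have D : differentiable (fun s : R => f (x + s *: v)) s.
  by apply: (@differentiable_comp _ _ _ _ (fun s : R => x + s *: v)).
split; first exact/derivable1_diffP.
rewrite derive1E' // (@diff_comp _ _ _ _ (fun s : R => x + s *: v) f) //=.
by rewrite diff_val scale1r -deriveE // diff_grad.
Qed.

Lemma is_diff_affine (p : 'rV[R]_n) (r : R) (x : 'rV[R]_n) :
  is_diff x (fun z : 'rV[R]_n => p + r *: z) (fun z => r *: z).
Proof.
have : is_diff x (cst p + r \*: idfun) (0 + r \*: idfun) by apply: is_diffD.
by rewrite add0r.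
Qed.

Lemma differentiable_affine (p : 'rV[R]_n) (r : R) f x : (forall x, differentiable f x) ->
  differentiable (fun z => f (p + r *: z)) x.
Proof.
move=> df; have := is_diff_affine p r x => dl.
by apply: (@differentiable_comp _ _ _ _ (fun z => p + r *: z)).
Qed.

Lemma partial_affine (p : 'rV[R]_n) (r : R) i f : (forall x, differentiable f x) ->
  partial i (fun z => f (p + r *: z)) = fun z => r * partial i f (p + r *: z).
Proof.
move=> df; apply/funext => x; have := is_diff_affine p r x => dl.
rewrite /partial !deriveE //; last exact: differentiable_affine.
have key (g : 'rV[R]_n -> 'rV[R]_n) : is_diff x g ( *:%R r) ->
    'd (f \o g) x 'e_i = r * 'd f (g x) 'e_i.
  move=> dg; have dg' : differentiable g x by exact: ex_diff.
  have E := congr1 (fun F : _ -> _ => F 'e_i) (@diff_comp R _ _ _ g f x dg' (df _)).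
  apply: (etrans E); rewrite /comp.
  have -> : 'd g x = *:%R r :> (_ -> _) by exact: diff_val.
  by rewrite linearZ.
exact: (key _ dl).
Qed.

Lemma smooth_affine (p : 'rV[R]_n) (r : R) f : smooth f ->
  smooth (fun z => f (p + r *: z)).
Proof.
move=> /smoothP sf; apply/smoothP => k; elim: k f sf => // k IH f sf.
have df : forall x, differentiable f x by have [] := sf 1%N.
split=> [|i].
  by move=> x; exact: differentiable_affine.
rewrite -/(smk k _) partial_affine //.
apply: smkM; first by have /smoothP := @smooth_cst r; exact.
by apply: IH => m; have [_] := sf m.+1; exact.
Qed.

End smooth_calculus.

(** * Smooth functions of one real variable *)

Section smooth1_theory.
Context {R : realType}.
Implicit Types (f g : R -> R).

Lemma smk1S k f : smk1 k.+1 f -> smk1 k f.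
Proof. by elim: k f => // k IH f [df H]; split=> //; apply: IH; exact: H. Qed.

Lemma smooth1P f : smooth1 f <-> (forall x, derivable f x 1) /\ smooth1 (derive1 f).
Proof.
split=> [sf|[df sf] [|k]] //; split; first by have [] := sf 1%N.
by move=> k; have [] := sf k.+1.
Qed.

Lemma smooth1_derivable f x : smooth1 f -> derivable f x 1.
Proof. by move=> /smooth1P[]. Qed.

Lemma smooth1_derive f : smooth1 f -> smooth1 (derive1 f).
Proof. by move=> /smooth1P[]. Qed.

Lemma smooth1_continuous f : smooth1 f -> continuous f.
Proof.
move=> sf x; apply: differentiable_continuous; apply/derivable1_diffP.
exact: smooth1_derivable.
Qed.

Lemma derive1D f g : (forall x, derivable f x 1) -> (forall x, derivable g x 1) ->
  derive1 (fun x => f x + g x) = fun x => derive1 f x + derive1 g x.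
Proof. by move=> df dg; apply/funext => x; rewrite !derive1E deriveD. Qed.

Lemma derive1M f g : (forall x, derivable f x 1) -> (forall x, derivable g x 1) ->
  derive1 (fun x => f x * g x) = fun x => derive1 f x * g x + f x * derive1 g x.
Proof.
move=> df dg; apply/funext => x; rewrite !derive1E.
by rewrite (@deriveM _ _ f g x 1 (df x) (dg x)) /GRing.scale/= addrC mulrC.
Qed.

Lemma derive1_compo f g : (forall x, derivable f x 1) -> (forall x, derivable g x 1) ->
  derive1 (fun x => f (g x)) = fun x => derive1 f (g x) * derive1 g x.
Proof. by move=> df dg; apply/funext => x; rewrite (@derive1_comp _ g f). Qed.

Lemma derive1_const (c : R) : derive1 ((fun=> c) : R -> R) = fun=> 0.
Proof. by apply/funext => x; rewrite derive1_cst. Qed.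

Lemma derive1_ident : derive1 (fun x : R => x) = fun=> 1.
Proof. by apply/funext => x; rewrite derive1E derive_id. Qed.

Lemma smooth1_cst (c : R) : smooth1 (fun=> c : R).
Proof.
move=> k; elim: k c => // k IH c; split=> [x|]; first exact: derivable_cst.
by rewrite derive1_const.
Qed.

Lemma smooth1_id : smooth1 (fun x : R => x).
Proof.
case=> // k; split=> [x|]; first exact: derivable_id.
by rewrite derive1_ident; exact: smooth1_cst.
Qed.

Lemma smk1D k f g : smk1 k f -> smk1 k g -> smk1 k (fun x => f x + g x).
Proof.
elim: k f g => // k IH f g [df sf] [dg sg]; split=> [x|].
  exact: derivableD.
by rewrite derive1D //; exact: IH.
Qed.

Lemma smooth1D f g : smooth1 f -> smooth1 g -> smooth1 (fun x => f x + g x).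
Proof. by move=> sf sg k; exact: smk1D. Qed.

Lemma smk1M k f g : smk1 k f -> smk1 k g -> smk1 k (fun x => f x * g x).
Proof.
elim: k f g => // k IH f g sf sg; have [df sf'] := sf; have [dg sg'] := sg.
split=> [x|]; first exact: derivableM.
by rewrite derive1M //; apply: smk1D; apply: IH => //; exact: smk1S.
Qed.

Lemma smooth1M f g : smooth1 f -> smooth1 g -> smooth1 (fun x => f x * g x).
Proof. by move=> sf sg k; exact: smk1M. Qed.

Lemma smooth1N f : smooth1 f -> smooth1 (fun x => - f x).
Proof.
move=> sf; under eq_fun do rewrite -mulN1r.
by apply: smooth1M => //; exact: smooth1_cst.
Qed.

Lemma smk1comp k f g : smk1 k f -> smk1 k g -> smk1 k (fun x => f (g x)).
Proof.
elim: k f g => // k IH f g [df sf'] sg; have [dg sg'] := sg.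
split=> [x|].
  apply/derivable1_diffP; apply: differentiable_comp; exact/derivable1_diffP.
by rewrite derive1_compo //; apply: smk1M => //; apply: IH => //; exact: smk1S.
Qed.

Lemma smooth1_comp f g : smooth1 f -> smooth1 g -> smooth1 (fun x => f (g x)).
Proof. by move=> sf sg k; exact: smk1comp. Qed.

End smooth1_theory.

(** * Euclidean norm, balls and spheres *)

Section euclid.
Context {R : realType} {n : nat}.
Implicit Types (x y z c : 'rV[R]_n).

Lemma dotrC x y : dotr x y = dotr y x.
Proof. by apply: eq_bigr => i _; rewrite mulrC. Qed.

Lemma dotrDl x y z : dotr (x + y) z = dotr x z + dotr y z.
Proof. by rewrite -big_split; apply: eq_bigr => i _; rewrite mxE mulrDl. Qed.

Lemma dotrDr x y z : dotr z (x + y) = dotr z x + dotr z y.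
Proof. by rewrite dotrC dotrDl !(dotrC _ z). Qed.

Lemma dotrZl (a : R) x y : dotr (a *: x) y = a * dotr x y.
Proof. by rewrite mulr_sumr; apply: eq_bigr => i _; rewrite mxE mulrA. Qed.

Lemma dotrZr (a : R) x y : dotr x (a *: y) = a * dotr x y.
Proof. by rewrite dotrC dotrZl dotrC. Qed.

Lemma dotrNl x y : dotr (- x) y = - dotr x y.
Proof. by rewrite -scaleN1r dotrZl mulN1r. Qed.

Lemma dotrNr x y : dotr x (- y) = - dotr x y.
Proof. by rewrite dotrC dotrNl dotrC. Qed.

Lemma dotr0l y : dotr 0 y = 0.
Proof. by rewrite -(scale0r 0) dotrZl mul0r. Qed.

Lemma dotrr_ge0 x : 0 <= dotr x x.
Proof. by apply: sumr_ge0 => i _; rewrite -expr2 sqr_ge0. Qed.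

Lemma dotrr_eq0 x : dotr x x = 0 -> x = 0.
Proof.
move=> /eqP; rewrite psumr_eq0 => [|i _]; last by rewrite -expr2 sqr_ge0.
move=> /allP H; apply/rowP => i; rewrite mxE; apply/eqP.
by have := H i (mem_index_enum _); rewrite -expr2 sqrf_eq0.
Qed.

Lemma dotrrD x y : dotr (x + y) (x + y) = dotr x x + 2 * dotr x y + dotr y y.
Proof. by rewrite dotrDl !dotrDr (dotrC y x); ring. Qed.

Lemma dotr_CS x y : dotr x y ^+ 2 <= dotr x x * dotr y y.
Proof.
have [y0|y0] := eqVneq (dotr y y) 0.
  by rewrite (dotrr_eq0 y0) dotrC !dotr0l expr0n mulr0.
have y_gt0 : 0 < dotr y y by rewrite lt_neqAle eq_sym y0 dotrr_ge0.
have := dotrr_ge0 (dotr y y *: x + (- dotr x y) *: y).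
rewrite dotrrD !dotrZl !dotrZr.
set a := dotr y y; set b := dotr x y; set d := dotr x x => H.
rewrite -(ler_pM2l y_gt0) -/a; nra.
Qed.

Lemma enorm_ge0 x : 0 <= enorm x.
Proof. exact: sqrtr_ge0. Qed.

Lemma enorm_sqr x : enorm x ^+ 2 = dotr x x.
Proof. by rewrite sqr_sqrtr // dotrr_ge0. Qed.

Lemma enormZ (a : R) x : enorm (a *: x) = `|a| * enorm x.
Proof. by rewrite /enorm dotrZl dotrZr mulrA -expr2 sqrtrM ?sqr_ge0 // sqrtr_sqr. Qed.

Lemma enormN x : enorm (- x) = enorm x.
Proof. by rewrite /enorm dotrNl dotrNr opprK. Qed.

Lemma enorm0 : enorm (0 : 'rV[R]_n) = 0.
Proof. by rewrite /enorm dotr0l sqrtr0. Qed.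

Lemma enorm_eq0 x : enorm x = 0 -> x = 0.
Proof. by move=> e0; apply: dotrr_eq0; rewrite -enorm_sqr e0 expr0n. Qed.

Lemma enorm_lt x r : 0 <= r -> (enorm x < r) = (dotr x x < r ^+ 2).
Proof. by move=> r0; rewrite -enorm_sqr ltr_sqr ?nnegrE ?enorm_ge0. Qed.

Lemma enorm_le x r : 0 <= r -> (enorm x <= r) = (dotr x x <= r ^+ 2).
Proof. by move=> r0; rewrite -enorm_sqr ler_sqr ?nnegrE ?enorm_ge0. Qed.

Lemma dotr_le_enorm x y : `|dotr x y| <= enorm x * enorm y.
Proof.
rewrite -(@ler_sqr R) ?nnegrE ?mulr_ge0 ?enorm_ge0 //.
by rewrite exprMn !enorm_sqr real_normK ?num_real // dotr_CS.
Qed.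

Lemma enormD x y : enorm (x + y) <= enorm x + enorm y.
Proof.
rewrite enorm_le ?addr_ge0 ?enorm_ge0 // dotrrD sqrrD !enorm_sqr.
rewrite lerD2r lerD2l mulr_natl lerMn2r /=.
exact: le_trans (ler_norm _) (dotr_le_enorm _ _).
Qed.

Lemma coord_le_enorm x i : `|x 0 i| <= enorm x.
Proof.
rewrite -(@ler_sqr R) ?nnegrE ?enorm_ge0 // enorm_sqr real_normK ?num_real //.
rewrite /dotr (bigD1 i) //= -expr2 lerDl; apply: sumr_ge0 => j _.
by rewrite -expr2 sqr_ge0.
Qed.

Lemma norm_le_enorm x : `|x| <= enorm x.
Proof.
rewrite /Num.norm/= mx_normrE; apply/bigmax_leP; split=> [|[i j] _ /=].
  exact: enorm_ge0.
by rewrite ord1; exact: coord_le_enorm.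
Qed.

Lemma coord_le_norm x i : `|x 0 i| <= `|x|.
Proof.
rewrite {2}/Num.norm/= mx_normrE.
exact: (@le_bigmax _ _ _ 0 (fun ij => `|x ij.1 ij.2|) (0, i)).
Qed.

Lemma enorm_le_norm x : enorm x <= n%:R * `|x|.
Proof.
rewrite enorm_le ?mulr_ge0 //.
apply: (@le_trans _ _ (\sum_(i < n) `|x| ^+ 2)).
  apply: ler_sum => i _; rewrite -expr2 -[leLHS]real_normK ?num_real //.
  by rewrite ler_sqr ?nnegrE // coord_le_norm.
rewrite sumr_const card_ord exprMn -[leLHS]mulr_natl.
apply: ler_wpM2r; first exact: sqr_ge0.
by rewrite -natrX ler_nat; case: n => // m; rewrite expnS leq_pmulr // expn_gt0.
Qed.

(** Radial functions are written in the squared distance, which is smooth at the centre as well, so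
    that a smooth profile always gives a smooth function. *)
Definition sqd c x : R := dotr (x - c) (x - c).

Lemma sqdE c x : sqd c x = \sum_i (x 0 i - c 0 i) * (x 0 i - c 0 i).
Proof. by apply: eq_bigr => i _; rewrite !mxE. Qed.

Lemma sqd_ge0 c x : 0 <= sqd c x. Proof. exact: dotrr_ge0. Qed.

Lemma smooth_coordB c i : smooth (fun x => x 0 i - c 0 i : R).
Proof. by apply: smoothB; [exact: smooth_coord|exact: smooth_cst]. Qed.

Lemma partial_coordB c i j :
  partial i (fun x => x 0 j - c 0 j) = fun=> (i == j)%:R :> R.
Proof.
rewrite (@partialD _ _ i (fun x => x 0 j) (fun=> - c 0 j)).
- by rewrite partial_coord partial_cst; apply/funext => x; rewrite addr0.
- by move=> x; exact: differentiable_coord.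
- by move=> x; exact: differentiable_cst.
Qed.

Lemma smooth_sqd c : smooth (sqd c).
Proof.
rewrite (funext (sqdE c)); apply: smooth_sum => i.
by apply: smoothM; exact: smooth_coordB.
Qed.

Lemma partial_sqd c i : partial i (sqd c) = fun x => 2 * (x 0 i - c 0 i).
Proof.
rewrite (funext (sqdE c)) partial_sum => [|j]; last first.
  by apply: smoothM; exact: smooth_coordB.
apply/funext => x; rewrite (bigD1 i) //= big1 ?addr0 => [|j ji].
  rewrite partialM ?partial_coordB ?eqxx ?mulr1n; first by ring.
  - by move=> y; apply: smooth_diff; exact: smooth_coordB.
  - by move=> y; apply: smooth_diff; exact: smooth_coordB.
rewrite partialM ?partial_coordB; first by rewrite eq_sym (negbTE ji) mulr0n; ring.
- by move=> y; apply: smooth_diff; exact: smooth_coordB.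
- by move=> y; apply: smooth_diff; exact: smooth_coordB.
Qed.

Lemma eballE c r : 0 < r -> eball c r = [set x | sqd c x < r ^+ 2].
Proof. by move=> r0; apply/seteqP; split=> x /=; rewrite /eball/= enorm_lt // ltW. Qed.

Lemma sqd_continuous c : continuous (sqd c).
Proof. exact/smooth_continuous/smooth_sqd. Qed.

Lemma open_sublevel (f : 'rV[R]_n -> R) (a : R) : continuous f ->
  open [set x | f x < a].
Proof. by move=> cf; apply: (@open_comp _ _ f [set y | y < a]) => [x _|]; [exact: cf|exact: open_lt]. Qed.

Lemma closed_sublevel (f : 'rV[R]_n -> R) (a : R) : continuous f ->
  closed [set x | f x <= a].
Proof. by move=> cf; apply: (@closed_comp _ _ f [set y | y <= a]) => [x _|]; [exact: cf|exact: closed_le]. Qed.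

Lemma open_eball c r : open (eball c r).
Proof.
have [r0|r0] := ltP 0 r.
  by rewrite eballE //; apply: open_sublevel; exact: sqd_continuous.
rewrite (_ : eball c r = set0); first exact: open0.
by rewrite -subset0 => x /= xr; have := enorm_ge0 (x - c); rewrite leNgt (lt_le_trans xr).
Qed.

Lemma eball_center c r : 0 < r -> eball c r c.
Proof. by rewrite /eball/= subrr enorm0. Qed.

Lemma nbhs_eball x (O : set 'rV[R]_n) : nbhs x O ->
  exists2 r, 0 < r & eball x r `<=` O.
Proof.
move=> /nbhs_ballP[e /= e0 eO]; exists e => // y xy; apply: eO.
rewrite -ball_normE /ball_/= -normrN opprB.
exact: le_lt_trans (norm_le_enorm _) xy.
Qed.

Lemma eball_sub_closed c r s : r < s -> [set x | enorm (x - c) <= r] `<=` eball c s.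
Proof. by move=> rs x /= xr; exact: le_lt_trans rs. Qed.

Lemma closed_cball c r : closed [set x | enorm (x - c) <= r].
Proof.
have [r0|r0] := leP 0 r.
  rewrite (_ : [set x | _] = [set x | sqd c x <= r ^+ 2]).
    by apply: closed_sublevel; exact: sqd_continuous.
  by apply/seteqP; split=> x /=; rewrite enorm_le.
rewrite (_ : [set x | _] = set0); first exact: closed0.
by rewrite -subset0 => x /= xr; have := enorm_ge0 (x - c); rewrite leNgt (le_lt_trans xr).
Qed.

Lemma closure_eball c r : 0 < r -> closure (eball c r) = [set x | enorm (x - c) <= r].
Proof.
move=> r0; apply/seteqP; split.
  apply: (@subset_trans _ (closure [set x | enorm (x - c) <= r])).
    by apply: closure_subset => x /= /ltW.
  by rewrite -(closure_id _).1 //; exact: closed_cball.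
move=> x /= xr B /nbhs_eball[e e0 eB].
(* A point of the closed ball is moved towards the centre by the fraction [k]: at most 1/2, so that
   1 - k stays positive, and small enough to stay within [e] of the point. *)
pose k := Num.min (2^-1) (e / (2 * r)).
have k0 : 0 < k by rewrite /k lt_min invr_gt0 ltr0n /= divr_gt0 // mulr_gt0.
have k1 : k <= 2^-1 by rewrite /k ge_min lexx.
have k2 : k * r < e.
  apply: (@le_lt_trans _ _ (e / (2 * r) * r)).
    by apply: ler_wpM2r; [exact: ltW|rewrite /k ge_min lexx orbT].
  by rewrite invfM mulrA mulfVK ?gt_eqF // ltr_pdivrMr // ltr_pMr // ltr1n.
exists (x - k *: (x - c)); split.
  rewrite /eball/= (_ : _ - c = (1 - k) *: (x - c)); last first.
    by rewrite scalerBl scale1r addrAC.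
  rewrite enormZ ger0_norm; last by lra.
  apply: (@le_lt_trans _ _ ((1 - k) * r)); first by rewrite ler_wpM2l //; lra.
  by nra.
apply: eB; rewrite /eball/= addrAC subrr sub0r enormN enormZ gtr0_norm //.
by apply: le_lt_trans k2; rewrite ler_wpM2l // ltW.
Qed.

Lemma boundary_open (A : set 'rV[R]_n) : open A -> boundary A = closure A `\` A.
Proof. by move=> oA; rewrite /boundary (interior_id _).1. Qed.

Lemma boundary_eball c r : 0 < r -> boundary (eball c r) = [set x | enorm (x - c) = r].
Proof.
move=> r0; rewrite boundary_open ?closure_eball //; last exact: open_eball.
apply/seteqP; split=> x /=.
  by move=> [H1 /negP H2]; apply/eqP; rewrite eq_le H1 leNgt.
by move=> H; rewrite H lexx; split=> //; rewrite /eball/= H ltxx.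
Qed.

Lemma bounded_cball c r : bounded_set [set x | enorm (x - c) <= r].
Proof.
exists (r + `|c|); split; first exact: num_real.
move=> M rM x /= xr; rewrite -(subrK c x).
apply: (le_trans (ler_normD _ _)); apply: ltW; apply: le_lt_trans rM.
by rewrite lerD2r; apply: le_trans xr; exact: norm_le_enorm.
Qed.

Lemma compact_cball c r : compact [set x | enorm (x - c) <= r].
Proof. by apply: bounded_closed_compact; [exact: bounded_cball|exact: closed_cball]. Qed.

Lemma nbhs_cball x (O : set 'rV[R]_n) : nbhs x O ->
  exists2 r, 0 < r & [set y | enorm (y - x) <= r] `<=` O.
Proof.
move=> /nbhs_eball[r r0 rO]; exists (r / 2); first by rewrite divr_gt0.
by apply: subset_trans rO; apply: eball_sub_closed; rewrite ltr_pdivrMr // ltr_pMr // ltr1n.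
Qed.

Lemma eball_nbhs c r : 0 < r -> nbhs c (eball c r).
Proof. by move=> r0; apply: open_nbhs_nbhs; split; [exact: open_eball|exact: eball_center]. Qed.

End euclid.

(** * Functions of bounded support *)

Section support.
Context {R : realType} {n : nat}.
Implicit Types (f g : 'rV[R]_n -> R).

(** Vanishing outside a large ball, rather than compactness of the support, passes at once to
    products, sums and partial derivatives. *)
Definition bsupp f := exists M, forall x, M < enorm x -> f x = 0.

Lemma partial_near i f g x : (\near x, f x = g x) -> partial i f x = partial i g x.
Proof. exact: near_eq_derive. Qed.

Lemma partial_open i f g (O : set 'rV[R]_n) x : open O -> O x ->
  (forall y, O y -> f y = g y) -> partial i f x = partial i g x.
Proof.
move=> oO Ox fg; apply: partial_near.
by apply: filterS fg _; apply: open_nbhs_nbhs.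
Qed.

Lemma bsupp_partial i f : bsupp f -> bsupp (partial i f).
Proof.
move=> [M fM]; exists M => x Mx.
(* For a negative bound [f] is zero everywhere; for a nonnegative one the exterior of the ball can
   be written with squares, hence is open. *)
have [M0|M0] := ltP M 0.
  rewrite (_ : f = fun=> 0) ?partial_cst //; apply/funext => y; apply: fM.
  exact: lt_le_trans (enorm_ge0 _).
rewrite (@partial_open i f (fun=> 0) [set y | M ^+ 2 < sqd 0 y]) ?partial_cst //=.
- apply: (@open_comp _ _ (sqd 0) [set y | M ^+ 2 < y]); last exact: open_gt.
  by move=> y _; exact: sqd_continuous.
- by rewrite /sqd subr0 -enorm_sqr ltr_sqr ?nnegrE ?enorm_ge0.
- move=> y; rewrite /sqd subr0 -enorm_sqr ltr_sqr ?nnegrE ?enorm_ge0 //.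
  exact: fM.
Qed.

Lemma bsuppMl f g : bsupp f -> bsupp (fun x => f x * g x).
Proof. by move=> [M fM]; exists M => x /fM ->; rewrite mul0r. Qed.

Lemma bsuppMr f g : bsupp g -> bsupp (fun x => f x * g x).
Proof. by move=> [M fM]; exists M => x /fM ->; rewrite mulr0. Qed.

Lemma bsuppD f g : bsupp f -> bsupp g -> bsupp (fun x => f x + g x).
Proof.
move=> [M fM] [N gN]; exists (Num.max M N) => x.
by rewrite gt_max => /andP[/fM -> /gN ->]; rewrite addr0.
Qed.

Lemma bsuppN f : bsupp f -> bsupp (fun x => - f x).
Proof. by move=> [M fM]; exists M => x /fM ->; rewrite oppr0. Qed.

Lemma bsupp_sum (I : Type) (r : seq I) (P : pred I) (F : I -> 'rV[R]_n -> R) :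
  (forall i, bsupp (F i)) -> bsupp (fun x => \sum_(i <- r | P i) F i x).
Proof.
move=> bF; elim: r => [|a r IH]; first by exists 0 => x _; rewrite big_nil.
under eq_fun do rewrite big_cons.
by case: (P a) => //; exact: bsuppD.
Qed.

Lemma bsupp_bounded f : continuous f -> bsupp f ->
  exists2 C, 0 <= C & forall x, `|f x| <= C.
Proof.
move=> cf [M fM].
pose K := [set x : 'rV[R]_n | enorm (x - 0) <= M].
have cK : compact (f @` K).
  by apply: continuous_compact; [exact: continuous_subspaceT|exact: compact_cball].
have [N [_ HN]] := compact_bounded cK.
exists (Num.max 0 (N + 1)) => [|x]; first by rewrite le_max lexx.
have [xM|xM] := leP (enorm x) M; last by rewrite fM // normr0 le_max lexx.
rewrite le_max; apply/orP; right; apply: (HN (N + 1)); first by rewrite ltrDl.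
by exists x => //; rewrite /K/= subr0.
Qed.

End support.

(** * Lebesgue measure and integral on R^n *)

Section row_borel.
Context {R : realType} {n : nat}.
Implicit Types (x y : 'rV[R]_n) (O : set 'rV[R]_n) (f : 'rV[R]_n -> R).

Definition obox (a b : 'rV[R]_n) : set 'rV[R]_n :=
  [set x | forall i, a 0 i < x 0 i < b 0 i].

Lemma measurable_obox a b : measurable (obox a b).
Proof.
rewrite (_ : obox a b = \bigcap_(i in [set: 'I_n])
    ((fun x : 'rV[R]_n => x 0 i : measurableTypeR R) @^-1` `]a 0 i, b 0 i[)).
  apply: fin_bigcap_measurable; first exact: finite_finset.
  by move=> i _; rewrite -[X in measurable X]setTI; exact: measurable_coord.
apply/seteqP; split=> [x H i _ /=|x H i]; first by rewrite in_itv/= H.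
by have := H i Logic.I; rewrite /= in_itv.
Qed.

Lemma norm_lt_coord x (e : R) : 0 < e -> (forall i, `|x 0 i| < e) -> `|x| < e.
Proof.
move=> e0 H; rewrite /Num.norm/= mx_normrE; apply/bigmax_ltP; split=> //.
by move=> [i j] _ /=; rewrite ord1.
Qed.

(** An open set is the union of the boxes inside it with rational centre and half-side 1/(k+1), a
    countable family. *)
Lemma measurable_open O : open O -> measurable O.
Proof.
move=> oO.
pose B (q : 'rV[rat]_n * nat) := obox (\row_i (ratr (q.1 0 i) - (q.2.+1%:R)^-1))
  (\row_i (ratr (q.1 0 i) + (q.2.+1%:R)^-1)) : set 'rV[R]_n.
rewrite (_ : O = \bigcup_(q in [set: 'rV[rat]_n * nat])
    (if `[< B q `<=` O >] then B q else set0)).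
  apply: countable_bigcupT_measurable; first exact: countableP.
  by move=> q; case: ifPn => _; [exact: measurable_obox|exact: measurable0].
apply/seteqP; split=> [x Ox|x [q _]]; last by case: ifPn => // /asboolP; exact.
have /nbhs_ballP[e /= e0 eO] : nbhs x O by apply: open_nbhs_nbhs.
(* Twice the half-side [d] is at most [e]: it covers the way from [x] to the rational centre and
   from there to any point of the box. *)
pose k := Num.truncn (2 / e); pose d : R := k.+1%:R^-1.
have d0 : 0 < d by rewrite invr_gt0 ltr0n.
have de : d + d <= e.
  have h : 2 / e < k.+1%:R := real_truncnS_gt (num_real _).
  rewrite -mulr2n -mulr_natl /d ler_pdivrMr ?ltr0n // mulrC -ler_pdivrMr //.
  exact: ltW.
have qx i : {q : rat | `|x 0 i - ratr q| < d}.
  apply: cid; have [|q] := @rat_in_itvoo R (x 0 i - d) (x 0 i + d).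
    by rewrite ltrD2l gtrN.
  by rewrite in_itv/= => /andP[q1 q2]; exists q; rewrite ltr_distlC q1 q2.
pose q : 'rV[rat]_n := \row_i projT1 (qx i).
have Bx z : B (q, k) z -> forall i, `|z 0 i - ratr (q 0 i)| < d.
  by move=> Bz i; have := Bz i; rewrite !mxE /= ltr_distl.
exists (q, k) => //; case: ifPn => [_ i|/asboolP[]].
  by rewrite !mxE /= -ltr_distl; exact: projT2 (qx i).
move=> z /Bx Bz; apply: eO; rewrite -ball_normE /ball_/=.
apply: norm_lt_coord => // i; rewrite !mxE; apply: lt_le_trans de.
rewrite -(subrK (ratr (q 0 i)) (x 0 i)) -addrA.
apply: (le_lt_trans (ler_normD _ _)); apply: ltrD.
  by rewrite mxE; exact: projT2 (qx i).
by rewrite distrC.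
Qed.

Lemma continuous_measurable_row f : continuous f ->
  measurable_fun [set: 'rV[R]_n] (f : 'rV[R]_n -> measurableTypeR R).
Proof.
move=> cf; apply: (measurability _ (measurable_realfun.RGenOInfty.measurableE R)).
move=> /= _ [_ [a ->]] <-; rewrite setTI; apply: measurable_open.
apply: open_comp; last exact: interval_open.
by move=> x _; exact: cf.
Qed.

End row_borel.

Section boxes.
Context {R : realType}.
Local Notation mu := (lebesgue_row _).

Lemma consr0 n (s : R) (y : 'rV[R]_n) : consr (s, y) 0 0 = s.
Proof. by rewrite /consr mxE; case: split_ordP => // j; rewrite mxE !ord1 eqxx mulr1n. Qed.

Lemma consrS n (s : R) (y : 'rV[R]_n) i : consr (s, y) 0 (lift 0 i) = y 0 i.
Proof.
have -> : lift 0 i = rshift 1 i :> 'I_(1 + n) by apply: val_inj.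
exact: row_mxEr.
Qed.

Lemma obox_measure n (a b : 'rV[R]_n) : (forall i, a 0 i < b 0 i) ->
  (0 < mu (obox a b) < +oo)%E.
Proof.
elim: n a b => [|n IH] a b ab.
  rewrite /= /dirac indicE mem_set ?lte01 ?ltry //.
  by move=> [].
have -> : mu (obox a b) = (lebesgue_measure \x mu)%E
    (`]a 0 0, b 0 0[%classic `*` obox (\row_i a 0 (lift 0 i)) (\row_i b 0 (lift 0 i))).
  rewrite /= /lebesgue_step /pushforward; congr (product_measure1 _ _ _).
  apply/seteqP; split=> [[s y] H|[s y] [/= H1 H2]] /=.
    split=> /=; first by have := H 0; rewrite consr0 in_itv.
    by move=> i; have := H (lift 0 i); rewrite consrS !mxE.
  move=> i; case: (unliftP 0 i) => [j ->|->]; last by rewrite consr0; rewrite in_itv in H1.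
  by have := H2 j; rewrite consrS !mxE.
rewrite product_measure1E //; last exact: measurable_obox.
have /andP[h1 h2] := IH (\row_i a 0 (lift 0 i)) (\row_i b 0 (lift 0 i))
  (fun i => ltac:(rewrite !mxE; exact: ab)).
rewrite /= lebesgue_measure_itv /= lte_fin ab -EFinB; apply/andP; split.
  by rewrite mule_gt0 // lte_fin subr_gt0 ab.
by rewrite lte_mul_pinfty // ?lee_fin ?subr_ge0 ?ltW // fin_numE.
Qed.

Lemma measure_bounded n (A : set 'rV[R]_n) M : measurable A ->
  (forall x, A x -> enorm x <= M) -> (mu A < +oo)%E.
Proof.
move=> mA AM; have [->|/set0P[x0 Ax0]] := eqVneq A set0; first by rewrite measure0.
have M0 : 0 <= M by apply: le_trans (AM _ Ax0); exact: enorm_ge0.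
have ab : forall i, (const_mx (- (M + 1)) : 'rV[R]_n) 0 i < (const_mx (M + 1) : 'rV[R]_n) 0 i.
  by move=> i; rewrite !mxE; lra.
have /andP[_] := obox_measure ab.
apply: le_lt_trans; apply: le_measure; rewrite ?inE //; first exact: measurable_obox.
move=> x /AM xM i; rewrite !mxE -ltr_norml.
apply: le_lt_trans (coord_le_enorm _ _) _; apply: le_lt_trans xM _.
by rewrite ltrDl.
Qed.

Lemma measure_open_gt0 n (O : set 'rV[R]_n) : open O -> O !=set0 -> (0 < mu O)%E.
Proof.
move=> oO [x Ox].
have /nbhs_ballP[e /= e0 eO] : nbhs x O by apply: open_nbhs_nbhs.
have ab : forall i, (\row_i (x 0 i - e) : 'rV[R]_n) 0 i < (\row_i (x 0 i + e) : 'rV[R]_n) 0 i.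
  by move=> i; rewrite !mxE; lra.
have /andP[h _] := obox_measure ab.
apply: (lt_le_trans h); apply: le_measure; rewrite ?inE.
- exact: measurable_obox.
- exact: measurable_open.
move=> z Bz; apply: eO; rewrite -ball_normE /ball_/=; apply: norm_lt_coord => // i.
by have := Bz i; rewrite !mxE -ltr_distlC.
Qed.

End boxes.

(** * Integrable functions and their integrals *)

Section integral_row.
Context {R : realType} {n : nat}.
Local Notation mu := (@lebesgue_row R n).
Implicit Types (f g : 'rV[R]_n -> R).

(** Integrals are taken over the whole space, a domain being an indicator factor ([Int_restrict]);
    all integrands are then total real functions. *)
Definition Int f : R := \int[mu]_x f x.

Definition L1 f : Prop := mu.-integrable setT (EFin \o f).

Definition mfun f : Prop := measurable_fun setT (f : 'rV[R]_n -> measurableTypeR R).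

Lemma L1_mfun f : L1 f -> mfun f.
Proof. by move=> /integrableP[/measurable_EFinP]. Qed.

Lemma mfun_EFin f : mfun f -> measurable_fun setT (EFin \o f).
Proof. by move=> mf; apply/measurable_EFinP. Qed.

Lemma mfun_cst (c : R) : mfun (fun=> c). Proof. exact: measurable_cst. Qed.

Lemma mfunD f g : mfun f -> mfun g -> mfun (fun x => f x + g x).
Proof. exact: measurable_funD. Qed.

Lemma mfunM f g : mfun f -> mfun g -> mfun (fun x => f x * g x).
Proof. exact: measurable_funM. Qed.

Lemma mfunN f : mfun f -> mfun (fun x => - f x).
Proof. by move=> mf; apply: measurableT_comp. Qed.

Lemma mfunB f g : mfun f -> mfun g -> mfun (fun x => f x - g x).
Proof. by move=> mf mg; apply: mfunD => //; exact: mfunN. Qed.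

Lemma mfun_cont f : continuous f -> mfun f.
Proof. exact: continuous_measurable_row. Qed.

Lemma mfun_indic (A : set 'rV[R]_n) : measurable A -> mfun (\1_A).
Proof. by move=> mA; exact: measurable_indic. Qed.

Lemma L1D f g : L1 f -> L1 g -> L1 (fun x => f x + g x).
Proof. by move=> Lf Lg; have := integrableD measurableT Lf Lg. Qed.

Lemma L1Z (c : R) f : L1 f -> L1 (fun x => c * f x).
Proof. by move=> Lf; have := integrableZl measurableT c Lf. Qed.

Lemma L1N f : L1 f -> L1 (fun x => - f x).
Proof. by move=> Lf; under eq_fun do rewrite -mulN1r; exact: L1Z. Qed.

Lemma L1B f g : L1 f -> L1 g -> L1 (fun x => f x - g x).
Proof. by move=> Lf Lg; apply: L1D => //; exact: L1N. Qed.

Lemma L1_0 : L1 (fun=> 0).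
Proof. exact: integrable0. Qed.

Lemma L1_sum (I : Type) (r : seq I) (P : pred I) (F : I -> 'rV[R]_n -> R) :
  (forall i, L1 (F i)) -> L1 (fun x => \sum_(i <- r | P i) F i x).
Proof.
move=> LF; elim: r => [|a r IH].
  by under eq_fun do rewrite big_nil; exact: L1_0.
under eq_fun do rewrite big_cons.
by case: (P a) => //; exact: L1D.
Qed.

Lemma L1_le f g : mfun f -> L1 g -> (forall x, `|f x| <= g x) -> L1 f.
Proof.
move=> mf Lg fg; apply: (le_integrable measurableT _ _ Lg).
  exact: mfun_EFin mf.
by move=> x _ /=; rewrite lee_fin (le_trans (fg x)) // ler_norm.
Qed.

Lemma L1_abs f : L1 f -> L1 (fun x => `|f x|).
Proof. by move=> Lf; have := integrable_abse Lf. Qed.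

Lemma L1Ml f g C : L1 f -> mfun g -> (forall x, `|g x| <= C) ->
  L1 (fun x => f x * g x).
Proof.
move=> Lf mg gC; apply: (@L1_le _ (fun x => C * `|f x|)).
- by apply: mfunM => //; exact: L1_mfun.
- exact/L1Z/L1_abs.
- by move=> x; rewrite normrM mulrC ler_wpM2r.
Qed.

Lemma L1_indic (A : set 'rV[R]_n) M : measurable A -> (forall x, A x -> enorm x <= M) ->
  L1 (\1_A).
Proof.
move=> mA AM; apply/integrableP; split; first exact: mfun_EFin (mfun_indic mA).
under eq_integral => x _ do rewrite /= ger0_norm ?indic_ge0 //.
by rewrite integral_indic // setIT; exact: measure_bounded AM.
Qed.

Lemma L1_bsupp_bounded f C : mfun f -> (forall x, `|f x| <= C) -> bsupp f -> L1 f.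
Proof.
move=> mf fC [M fM].
have mA : measurable [set x : 'rV[R]_n | enorm (x - 0) <= M].
  rewrite -(setCK [set x | _]); apply: measurableC; apply: measurable_open.
  exact/closed_openC/closed_cball.
apply: (@L1_le _ (fun x => C * \1_[set x : 'rV[R]_n | enorm (x - 0) <= M] x)) => //.
  by apply/L1Z/(@L1_indic _ M) => // x /=; rewrite subr0.
move=> x; rewrite indicE; case: (boolP (x \in _)) => [_|xM]; first by rewrite mulr1.
rewrite mulr0 fM ?normr0 // ltNge; apply/negP => H; move/negP: xM; apply.
by rewrite inE /= subr0.
Qed.

Lemma L1_bsupp f : continuous f -> bsupp f -> L1 f.
Proof.
move=> cf bf; have [C _ fC] := bsupp_bounded cf bf.
exact: (L1_bsupp_bounded (mfun_cont cf) fC).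
Qed.

Lemma IntD f g : L1 f -> L1 g -> Int (fun x => f x + g x) = Int f + Int g.
Proof. exact: RintegralD. Qed.

Lemma IntB f g : L1 f -> L1 g -> Int (fun x => f x - g x) = Int f - Int g.
Proof. exact: RintegralB. Qed.

Lemma IntZ (c : R) f : L1 f -> Int (fun x => c * f x) = c * Int f.
Proof. by move=> Lf; rewrite /Int RintegralZl. Qed.

Lemma IntN f : L1 f -> Int (fun x => - f x) = - Int f.
Proof. by move=> Lf; under eq_fun do rewrite -mulN1r; rewrite IntZ // mulN1r. Qed.

Lemma Int0 : Int (fun=> 0) = 0.
Proof. by rewrite /Int Rintegral_cst // mul0r. Qed.

Lemma Int_sum (I : Type) (r : seq I) (P : pred I) (F : I -> 'rV[R]_n -> R) :
  (forall i, L1 (F i)) ->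
  Int (fun x => \sum_(i <- r | P i) F i x) = \sum_(i <- r | P i) Int (F i).
Proof.
move=> LF; elim: r => [|a r IH].
  by under eq_fun do rewrite big_nil; rewrite Int0 big_nil.
under eq_fun do rewrite big_cons; rewrite big_cons.
by case: (P a) => //; rewrite IntD ?IH //; exact: L1_sum.
Qed.

Lemma le_Int f g : L1 f -> L1 g -> (forall x, f x <= g x) -> Int f <= Int g.
Proof. by move=> Lf Lg fg; apply: le_Rintegral. Qed.

Lemma Int_ge0 f : (forall x, 0 <= f x) -> 0 <= Int f.
Proof. by move=> f0; apply: Rintegral_ge0. Qed.

Lemma abs_Int f : L1 f -> `|Int f| <= Int (fun x => `|f x|).
Proof. by move=> Lf; apply: le_normr_Rintegral. Qed.

Lemma L1_fin f : L1 f -> (\int[mu]_x (f x)%:E)%E = (Int f)%:E.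
Proof.
move=> Lf; rewrite /Int /Rintegral fineK //.
exact: integrable_fin_num.
Qed.

Lemma Int_cvg (F : nat -> 'rV[R]_n -> R) f G :
  (forall k, mfun (F k)) -> mfun f -> L1 G ->
  (forall k x, `|F k x| <= G x) ->
  (forall x, F k x @[k --> \oo] --> f x) ->
  L1 f /\ Int (F k) @[k --> \oo] --> Int f.
Proof.
move=> mF mf LG FG Ff.
have [||||| Lf _ H] := @dominated_convergence _ _ R mu setT measurableT
   (fun k => EFin \o F k) (EFin \o f) (EFin \o G).
- by move=> k; exact: mfun_EFin (mF k).
- exact: mfun_EFin mf.
- by apply/aeW => x _; apply: cvg_EFin; [exact: nearW|exact: Ff].
- exact: LG.
- by apply/aeW => x k _ /=; rewrite lee_fin.
split=> //; have LF k : L1 (F k) by exact: L1_le (FG k).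
move: H; rewrite /= (L1_fin Lf).
by under eq_fun do rewrite (L1_fin (LF _)); move=> /fine_cvg.
Qed.

Lemma Int_ae_eq f g : mfun f -> mfun g -> {ae mu, forall x, f x = g x} -> Int f = Int g.
Proof.
move=> mf mg fg; rewrite /Int /Rintegral; congr fine.
apply: ae_eq_integral => //; [exact: mfun_EFin mf|exact: mfun_EFin mg|].
by apply: filterS fg => x -> _.
Qed.

Lemma Int_restrict (A : set 'rV[R]_n) f : measurable A ->
  \int[mu]_(x in A) f x = Int (fun x => \1_A x * f x).
Proof.
move=> mA; rewrite /Int /Rintegral integral_mkcond; congr fine.
apply: eq_integral => x _; rewrite /patch indicE.
by case: ifP => _; rewrite ?mul1r ?mul0r.
Qed.

Lemma Int_eq0_ae f : L1 f -> (forall x, 0 <= f x) -> Int f = 0 ->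
  {ae mu, forall x, f x = 0}.
Proof.
move=> Lf f0 If.
have mf : measurable_fun setT (EFin \o f) by exact: mfun_EFin (L1_mfun Lf).
have [h _] := ae_eq_integral_abs mu measurableT mf.
have : (\int[mu]_x `|(EFin \o f) x|)%E = 0%E.
  under eq_integral => x _ do rewrite /= ger0_norm //.
  by rewrite L1_fin // If.
by move=> /h; apply: filterS => x /(_ Logic.I) [].
Qed.

Lemma ae_open (O : set 'rV[R]_n) (P : set 'rV[R]_n) : open O -> O !=set0 ->
  {ae mu, forall x, P x} -> exists2 x, O x & P x.
Proof.
move=> oO O0 [N [mN N0 PN]]; apply: contrapT => H.
have ON : O `<=` N.
  by move=> x Ox; apply: PN => /= Px; apply: H; exists x.
have := measure_open_gt0 oO O0; rewrite ltNge => /negP; apply.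
by rewrite -N0; apply: le_measure; rewrite ?inE //; exact: measurable_open.
Qed.

Lemma Int_cont_eq0 f : continuous f -> L1 f -> (forall x, 0 <= f x) -> Int f = 0 ->
  forall x, f x = 0.
Proof.
move=> cf Lf f0 If x; apply: contrapT => /eqP fx.
have oO : open [set y | f y != 0].
  apply: (@open_comp _ _ f [set y | y != 0]) => [y _|]; first exact: cf.
  exact: open_neq.
have [y /eqP] := ae_open oO (ex_intro _ x fx) (Int_eq0_ae Lf f0 If).
by [].
Qed.

End integral_row.

(** * Fubini, integration by parts, differentiation under the integral *)

Section integration_by_parts.
Context {R : realType}.

Lemma integral_derive1_eq0 (g : R -> R) M : (forall x, derivable g x 1) ->
  continuous (derive1 g) -> (forall x, M < `|x| -> g x = 0) ->
  (\int[lebesgue_measure]_x (derive1 g x)%:E)%E = 0%E.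
Proof.
move=> dg cg gM.
pose A := `|M| + 1.
have A0 : 0 < A by rewrite ltr_wpDl.
have MA : M < A by rewrite (le_lt_trans (ler_norm M)) // ltrDl.
have gz x : A <= `|x| -> derive1 g x = 0.
  move=> Ax; rewrite derive1E.
  have H : \near x, g x = (fun=> 0 : R) x.
    have : nbhs x [set y : R | M < `|y|].
      apply: open_nbhs_nbhs; split; last exact: lt_le_trans Ax.
      apply: (@open_comp _ _ (fun y : R => `|y|) [set y | M < y]); last exact: open_gt.
      by move=> y _; exact: norm_continuous.
    by apply: filterS => y /gM.
  by rewrite (near_eq_derive _ H) derive_cst.
transitivity (\int[lebesgue_measure]_(x in `[(- A)%R, A%R]) (derive1 g x)%:E)%E.
  rewrite [RHS]integral_mkcond; apply: eq_integral => x _; rewrite /patch.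
  case: ifPn => // /negP xA; rewrite gz //.
  rewrite leNgt; apply/negP => /ltW; rewrite ler_norml => H; apply: xA.
  by rewrite inE /= in_itv.
transitivity ((g A)%:E - (g (- A)%R)%:E)%E.
  apply: (@continuous_FTC2 R (derive1 g) g (- A) A).
  - by rewrite gtrN.
  - exact: continuous_subspaceT.
  - have cg' : continuous g.
      by move=> x; apply: differentiable_continuous; exact/derivable1_diffP.
    split=> [x _||].
    + exact: dg.
    + exact: cvg_at_right_filter (cg' _).
    + exact: cvg_at_left_filter (cg' _).
  - by [].
by rewrite !gM ?normrN ?ger0_norm ?subee // ltW.
Qed.

Lemma measurable_consr_comp n (f : 'rV[R]_n.+1 -> R) : mfun f ->
  measurable_fun [set: measurableTypeR R * 'rV[R]_n]
    (fun p => f (consr p) : measurableTypeR R).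
Proof. by move=> mf; apply: measurableT_comp mf (@measurable_consr R n). Qed.

Lemma L1_consr n (f : 'rV[R]_n.+1 -> R) : L1 f ->
  (lebesgue_measure \x lebesgue_row n)%E.-integrable
    [set: measurableTypeR R * 'rV[R]_n] (fun p => (f (consr p))%:E).
Proof.
move=> Lf; have mf := L1_mfun Lf; apply/integrableP; split.
  by apply/measurable_EFinP; exact: measurable_consr_comp.
have := integrable_lty measurableT (integrable_abse Lf).
rewrite /= (_ : lebesgue_row n.+1 = pushforward (lebesgue_measure \x lebesgue_row n)%E (@consr R n) :> (set _ -> _)) //.
rewrite ge0_integral_pushforward //.
  exact: measurable_consr.
exact: (mfun_EFin (measurableT_comp (@normr_measurable R setT) mf)).
Qed.

Lemma Int_consr12 n (f : 'rV[R]_n.+1 -> R) : L1 f ->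
  (\int[lebesgue_row n.+1]_x (f x)%:E)%E =
  (\int[lebesgue_measure]_s \int[lebesgue_row n]_y (f (consr (s, y)))%:E)%E.
Proof.
move=> Lf; have Lp := L1_consr Lf.
rewrite (_ : \int[_]_x _ = \int[(lebesgue_measure \x lebesgue_row n)]_p (f (consr p))%:E)%E.
  by rewrite -(integral12_prod_meas1 Lp).
rewrite -(@integral_pushforward _ _ _ _ _ _ (@measurable_consr R n) _ setT (EFin \o f)) //.
exact: mfun_EFin (L1_mfun Lf).
Qed.

Lemma Int_consr21 n (f : 'rV[R]_n.+1 -> R) : L1 f ->
  (\int[lebesgue_row n.+1]_x (f x)%:E)%E =
  (\int[lebesgue_row n]_y \int[lebesgue_measure]_s (f (consr (s, y)))%:E)%E.
Proof.
move=> Lf; rewrite (Int_consr12 Lf).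
exact: (Fubini (L1_consr Lf)).
Qed.

Lemma consrD n (s t : R) (y z : 'rV[R]_n) :
  consr (s + t, y + z) = consr (s, y) + consr (t, z).
Proof.
apply/rowP => i; rewrite [RHS]mxE.
by case: (unliftP 0 i) => [j ->|->]; rewrite ?consrS ?consr0 ?mxE.
Qed.

Lemma consrZ n (r s : R) (y : 'rV[R]_n) : consr (r * s, r *: y) = r *: consr (s, y).
Proof.
apply/rowP => i; rewrite [RHS]mxE.
by case: (unliftP 0 i) => [j ->|->]; rewrite ?consrS ?consr0 ?mxE.
Qed.

Lemma consr10 n : consr (1, 0) = 'e_0 :> 'rV[R]_n.+1.
Proof.
apply/rowP => i; rewrite [RHS]mxE eqxx /=.
by case: (unliftP 0 i) => [j ->|->]; rewrite ?consrS ?consr0 ?mxE ?eqxx.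
Qed.

Lemma consr0e n (j : 'I_n) : consr (0, 'e_j) = 'e_(lift 0 j) :> 'rV[R]_n.+1.
Proof.
apply/rowP => i; rewrite [RHS]mxE eqxx /=.
case: (unliftP 0 i) => [k ->|->]; rewrite ?consrS ?consr0 ?mxE ?eqxx //=.
Qed.

Lemma enorm_consr n (s : R) (y : 'rV[R]_n) :
  enorm (consr (s, y)) ^+ 2 = s ^+ 2 + enorm y ^+ 2.
Proof.
rewrite !enorm_sqr /dotr big_ord_recl consr0 expr2; congr (_ + _).
by apply: eq_bigr => i _; rewrite consrS.
Qed.

Lemma enorm_consr_ge n (s : R) (y : 'rV[R]_n) :
  `|s| <= enorm (consr (s, y)) /\ enorm y <= enorm (consr (s, y)).
Proof.
split; rewrite -(@ler_sqr R) ?nnegrE ?enorm_ge0 // enorm_consr.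
  by rewrite real_normK ?num_real // lerDl sqr_ge0.
by rewrite lerDr sqr_ge0.
Qed.

Lemma continuous_consr n (s : R) : continuous (fun y : 'rV[R]_n => consr (s, y)).
Proof.
move=> y O /nbhs_eball[r r0 rO]; apply: filterS (eball_nbhs y r0) => z zy.
apply: rO; rewrite /eball/= -[X in _ - X]scale1r -scaleNr -consrZ -consrD.
rewrite enorm_lt ?ltW // -enorm_sqr enorm_consr mulN1r subrr expr0n add0r scaleN1r.
by rewrite ltr_sqr ?nnegrE ?enorm_ge0 ?ltW.
Qed.

Lemma continuous_consrl n (y : 'rV[R]_n) : continuous (fun s : R => consr (s, y)).
Proof.
move=> s O /nbhs_eball[r r0 rO].
have : nbhs s (ball s r) by exact: nbhsx_ballx.
apply: filterS => z; rewrite -ball_normE /ball_/= => zs.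
apply: rO; rewrite /eball/= -[X in _ - X]scale1r -scaleNr -consrZ -consrD.
rewrite enorm_lt ?ltW // -enorm_sqr enorm_consr scaleN1r subrr enorm0 expr0n addr0 mulN1r.
by rewrite -[ltLHS]real_normK ?num_real // ltr_sqr ?nnegrE ?(ltW r0) // distrC.
Qed.

(** Induction on the dimension. If [i] is the first coordinate, it is integrated first and the
    fundamental theorem applies; otherwise the induction hypothesis is applied to the slices. The
    hypotheses concern the direction ['e_i] alone, because they pass to slices by equality of
    difference quotients. *)
Lemma Int_partial n (F : 'rV[R]_n -> R) i : (forall x, derivable F x 'e_i) ->
  continuous (partial i F) -> bsupp F -> Int (partial i F) = 0.
Proof.
elim: n F i => [|n IH] F i dF cF bF; first by case: i {dF cF}.
have LF : L1 (partial i F) by apply: L1_bsupp => //; exact: bsupp_partial.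
have [M FM] := bF.
case: (unliftP 0 i) => [j ij|i0].
  rewrite /Int /Rintegral Int_consr12 // integral0_eq // => s _.
  have dE y : (fun h : R => h^-1 *: ((F \o shift (consr (s, y))) (h *: 'e_i) - F (consr (s, y)))) =
      (fun h => h^-1 *: (((fun y => F (consr (s, y))) \o shift y) (h *: 'e_j) - F (consr (s, y)))).
    by apply/funext => h /=; rewrite ij -consr0e -consrZ -consrD mulr0 add0r.
  have E : (fun y => partial i F (consr (s, y))) = partial j (fun y => F (consr (s, y))).
    by apply/funext => y; rewrite /partial /derive dE.
  have D y : derivable (fun y => F (consr (s, y))) y 'e_j.
    by have := dF (consr (s, y)); rewrite /derivable dE.
  have c1 : continuous (partial j (fun y => F (consr (s, y)))).
    rewrite -E => y; apply: (@continuous_comp _ _ _ (fun y => consr (s, y)) (partial i F)).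
      exact: continuous_consr.
    exact: cF.
  have b1 : bsupp (fun y => F (consr (s, y))).
    exists M => y My; apply: FM; apply: lt_le_trans My _.
    by have [] := enorm_consr_ge s y.
  under eq_integral => y _ do rewrite -[partial i F _]/((fun y => partial i F (consr (s, y))) y) E.
  rewrite L1_fin; first by rewrite IH.
  by apply: L1_bsupp => //; exact: bsupp_partial.
rewrite /Int /Rintegral Int_consr21 // integral0_eq // => y _.
have dE s : (fun h : R => h^-1 *: ((F \o shift (consr (s, y))) (h *: 'e_i) - F (consr (s, y)))) =
    (fun h => h^-1 *: (((fun s => F (consr (s, y))) \o shift s) (h *: 1) - F (consr (s, y)))).
  apply/funext => h /=; rewrite i0 -consr10 -consrZ -consrD scaler0 add0r.
  by rewrite /GRing.scale /= mulr1.
have D s : derivable (fun s => F (consr (s, y))) s 1.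
  by have := dF (consr (s, y)); rewrite /derivable dE.
have E : (fun s => partial i F (consr (s, y))) = derive1 (fun s => F (consr (s, y))).
  by apply/funext => s; rewrite derive1E /partial /derive dE.
under eq_integral => s _ do rewrite -[partial i F _]/((fun s => partial i F (consr (s, y))) s) E.
apply: (@integral_derive1_eq0 (fun s : R => F (consr (s, y))) M).
- exact: D.
- rewrite -E => s; apply: (@continuous_comp _ _ _ (fun s => consr (s, y)) (partial i F)).
    exact: continuous_consrl.
  exact: cF.
- move=> s Ms; apply: FM; apply: lt_le_trans Ms _.
  by have [] := enorm_consr_ge s y.
Qed.

Lemma Int_partial_smooth n (F : 'rV[R]_n -> R) i : smooth F -> bsupp F ->
  Int (partial i F) = 0.
Proof.
move=> sF bF; apply: Int_partial => //.
  by move=> x; apply: diff_derivable; exact: smooth_diff.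
exact/smooth_continuous/smooth_partial.
Qed.

Lemma Int_by_parts n (f g : 'rV[R]_n -> R) i : smooth f -> smooth g ->
  bsupp f \/ bsupp g ->
  Int (fun x => partial i f x * g x) = - Int (fun x => f x * partial i g x).
Proof.
move=> sf sg bfg.
have b1 : bsupp (fun x => f x * g x) by case: bfg => ?; [exact: bsuppMl|exact: bsuppMr].
have := @Int_partial_smooth _ _ i (smoothM sf sg) b1.
rewrite partialM; [|by move=> x; exact: smooth_diff..].
rewrite IntD; first by move=> /eqP; rewrite addr_eq0 => /eqP.
- apply: L1_bsupp; first by apply/smooth_continuous/smoothM => //; exact: smooth_partial.
  by case: bfg => ?; [exact/bsuppMl/bsupp_partial|exact: bsuppMr].
- apply: L1_bsupp; first by apply/smooth_continuous/smoothM => //; exact: smooth_partial.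
  by case: bfg => ?; [exact: bsuppMl|exact/bsuppMr/bsupp_partial].
Qed.

Lemma Int_derive n (f : R -> 'rV[R]_n -> R) (G : 'rV[R]_n -> R) u v a :
  a \in `]u, v[ -> (forall s x, s \in `]u, v[ -> derivable (f^~ x) s 1) ->
  (forall s, s \in `]u, v[ -> L1 (f s)) -> L1 G ->
  (forall s x, s \in `]u, v[ -> `|derive1 (f^~ x) s| <= G x) ->
  derivable (fun s => Int (f s)) a 1 /\
  derive1 (fun s => Int (f s)) a = Int (fun x => derive1 (f^~ x) a).
Proof.
move=> auv df Lf LG fG.
have G0 x : 0 <= G x by exact: le_trans (fG a x auv).
have H1 x : `]u, v[%classic x -> L1 (f x) by move=> xuv; exact: Lf.
have H2 x y : `]u, v[%classic x -> [set: 'rV[R]_n] y -> derivable (f^~ y) x 1.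
  by move=> xuv _; exact: df.
have H3 x y : `]u, v[%classic x -> [set: 'rV[R]_n] y -> `|partial1of2 f x y| <= G y.
  by move=> xuv _; exact: fG.
split; first exact: (derivable_under_integral measurableT auv H1 H2 G0 LG H3).
exact: (differentiation_under_integral measurableT auv H1 H2 G0 LG H3).
Qed.

End integration_by_parts.

(** * Mean values, symmetry of second derivatives, Taylor bounds *)

Section taylor.
Context {R : realType} {n : nat}.
Implicit Types (f : 'rV[R]_n -> R) (x v : 'rV[R]_n).

Lemma mvt_line f x v h : (forall x, differentiable f x) -> 0 < h ->
  exists2 s, 0 < s < h &
    f (x + h *: v) - f x = h * \sum_i v 0 i * partial i f (x + s *: v).
Proof.
move=> df h0.
pose g (s : R) := f (x + s *: v).
have dg (s : R) : is_derive s 1 g (\sum_i v 0 i * partial i f (x + s *: v)).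
  have [d1 d2] := derivable_line (df (x + s *: v)).
  by apply: DeriveDef => //; rewrite -derive1E.
have cg : {within `[0, h], continuous g}.
  apply: continuous_subspaceT => s; apply: differentiable_continuous.
  by apply/derivable1_diffP; have [] := derivable_line (df (x + s *: v)).
have [s] := MVT h0 (fun s _ => dg s) cg.
rewrite in_itv /= => sh; rewrite /g scale0r addr0 subr0 => E.
by exists s => //; rewrite E mulrC.
Qed.

Lemma mvt_coord f x i h : (forall x, differentiable f x) -> 0 < h ->
  exists2 s, 0 < s < h & f (x + h *: 'e_i) - f x = h * partial i f (x + s *: 'e_i).
Proof.
move=> df h0; have [s sh E] := mvt_line x 'e_i df h0; exists s => //.
rewrite E (bigD1 i) //= big1 ?addr0 => [|j ji]; last by rewrite mxE (negbTE ji) andbF mul0r.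
by rewrite mxE !eqxx mul1r.
Qed.

(** The mean value theorem is applied to f(y + h e_j) - f(y) along e_i, then to [partial i f] along
    e_j. The left side is symmetric in i and j. *)
Lemma second_difference f x i j h : smooth f -> 0 < h ->
  exists s r, [/\ 0 < s < h, 0 < r < h &
    f (x + h *: 'e_i + h *: 'e_j) - f (x + h *: 'e_i) - f (x + h *: 'e_j) + f x =
    h ^+ 2 * partial j (partial i f) (x + s *: 'e_i + r *: 'e_j)].
Proof.
move=> sf h0.
pose g := fun y => f (h *: 'e_j + 1 *: y) + - f y.
have d1 y : differentiable (fun y => f (h *: 'e_j + 1 *: y)) y.
  by apply: smooth_diff; exact: smooth_affine.
have d2 y : differentiable (fun y => - f y) y.
  by apply: smooth_diff; exact: smoothN.
have dg y : differentiable g y by exact: differentiableD.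
have [s sh Es] := mvt_coord x i dg h0.
have [r rh Er] := mvt_coord (x + s *: 'e_i) j
  (fun y => smooth_diff y (smooth_partial i sf)) h0.
exists s, r; split => //.
transitivity (g (x + h *: 'e_i) - g x).
  rewrite /g !scale1r ![h *: 'e_j + _]addrC.
  by move: (f _) (f _) (f _) (f _) => p q u w; ring.
have df y : differentiable f y by exact: smooth_diff.
rewrite Es /g partialD // partial_affine // partialN // mul1r scale1r.
rewrite [h *: 'e_j + _]addrC Er expr2; ring.
Qed.

Lemma continuous_eball (g : 'rV[R]_n -> R) x (e : R) : continuous g -> 0 < e ->
  exists2 d, 0 < d & forall y, enorm (y - x) < d -> `|g y - g x| < e.
Proof.
move=> cg e0.
have : nbhs x [set y | `|g y - g x| < e].
  have : nbhs x (g @^-1` ball (g x) e) by apply: cg; exact: nbhsx_ballx.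
  by apply: filterS => y; rewrite /= -ball_normE /ball_/= distrC.
by move=> /nbhs_eball[d d0 dP]; exists d.
Qed.

Lemma enorm_delta i : enorm ('e_i : 'rV[R]_n) = 1.
Proof.
rewrite /enorm /dotr (bigD1 i) //= big1 ?addr0 => [|j ji].
  by rewrite mxE !eqxx mulr1 sqrtr1.
by rewrite mxE (negbTE ji) andbF mul0r.
Qed.

(** The same symmetric second difference represents both mixed derivatives at points close to [x].
    If one exceeded the other at [x], continuity would keep them apart at these points, where their
    values agree. *)
Lemma schwarz f i j x : smooth f -> partial i (partial j f) x = partial j (partial i f) x.
Proof.
move=> sf; apply/eqP; rewrite eq_le; apply/andP.
have aux (p q u w : R) : q < p -> u = w -> `|w - p| < (p - q) / 2 ->
    `|u - q| < (p - q) / 2 -> False.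
  by move=> qp ->; rewrite !ltr_distl => /andP[b1 _] /andP[_ b2]; lra.
have H k l : partial k (partial l f) x <= partial l (partial k f) x.
  rewrite leNgt; apply/negP => lt.
  set e := (partial k (partial l f) x - partial l (partial k f) x) / 2.
  have e0 : 0 < e by rewrite divr_gt0 // subr_gt0.
  have [d1 d10 D1] := continuous_eball x (smooth_continuous (smooth_partial k (smooth_partial l sf))) e0.
  have [d2 d20 D2] := continuous_eball x (smooth_continuous (smooth_partial l (smooth_partial k sf))) e0.
  pose h := Num.min d1 d2 / 2.
  have h0 : 0 < h by rewrite divr_gt0 // lt_min d10.
  have hd : h + h <= Num.min d1 d2 by rewrite -splitr.
  have [s [r [sh rh E1]]] := second_difference x k l sf h0.
  have [s' [r' [sh' rh' E2]]] := second_difference x l k sf h0.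
  have near (p q : R) (k' l' : 'I_n) : 0 < p < h -> 0 < q < h ->
      enorm (x + p *: 'e_k' + q *: 'e_l' - x) < Num.min d1 d2.
    move=> /andP[p0 ph] /andP[q0 qh]; rewrite addrAC [x + _]addrC addrK.
    apply: (le_lt_trans (enormD _ _)).
    rewrite !enormZ !enorm_delta !mulr1 !gtr0_norm //.
    by apply: lt_le_trans hd; exact: ltrD.
  have /D2 B2 : enorm (x + s *: 'e_k + r *: 'e_l - x) < d2.
    by apply: (lt_le_trans (near _ _ _ _ sh rh)); rewrite ge_min lexx orbT.
  have /D1 B1 : enorm (x + s' *: 'e_l + r' *: 'e_k - x) < d1.
    by apply: (lt_le_trans (near _ _ _ _ sh' rh')); rewrite ge_min lexx.
  have E : partial l (partial k f) (x + s *: 'e_k + r *: 'e_l) =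
           partial k (partial l f) (x + s' *: 'e_l + r' *: 'e_k).
    apply: (mulfI (lt0r_neq0 (exprn_gt0 2 h0))); apply: (etrans (esym E1)).
    apply: (etrans _ E2); rewrite [x + h *: 'e_l + _]addrAC.
    by move: (f _) (f _) (f _) (f _) => p q u w; ring.
  exact: (aux _ _ _ _ lt E B1 B2).
by split; exact: H.
Qed.

Lemma taylor_bound f C x v : smooth f ->
  (forall i j y, `|partial i (partial j f) y| <= C) ->
  `|f (x + v) - f x - \sum_i v 0 i * partial i f x| <= n%:R * (n%:R * C) * `|v| ^+ 2.
Proof.
move=> sf fC.
have [s s01] := mvt_line x v (fun y => smooth_diff y sf) ltr01.
rewrite scale1r mul1r => ->; rewrite -sumrB.
apply: le_trans (ler_norm_sum _ _ _) _.
rewrite -mulrA -[leRHS]/(n%:R * (n%:R * C * `|v| ^+ 2)) -[X in X%:R * (_ * _)]card_ord mulr_natl -sumr_const.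
apply: ler_sum => i _; rewrite -mulrBr normrM.
have /andP[s0 s1] := s01.
have [r rs ->] := mvt_line x v (fun y => smooth_diff y (smooth_partial i sf)) s0.
have -> : n%:R * C * `|v| ^+ 2 = `|v| * (n%:R * C * `|v|) by rewrite expr2; ring.
rewrite normrM (gtr0_norm s0).
apply: ler_pM; [by []|by rewrite mulr_ge0 // ltW|exact: coord_le_norm|].
apply: (@le_trans _ _ `|\sum_j v 0 j * partial j (partial i f) (x + r *: v)|).
  by rewrite ler_piMl // ltW.
apply: le_trans (ler_norm_sum _ _ _) _.
rewrite -mulrA -[X in X%:R * _]card_ord mulr_natl -sumr_const.
apply: ler_sum => j _; rewrite normrM mulrC.
by apply: ler_pM => //; exact: coord_le_norm.
Qed.

(** A quadratic remainder identifies the differential; this is how convolutions are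
    differentiated. *)
Lemma differentiable_taylor f (g : 'I_n -> R) x C :
  (forall v, `|f (x + v) - f x - \sum_i v 0 i * g i| <= C * `|v| ^+ 2) ->
  differentiable f x /\ forall i, partial i f x = g i.
Proof.
move=> H.
have l : linear (fun v : 'rV[R]_n => \sum_i v 0 i * g i : R).
  move=> k u v; rewrite scaler_sumr -big_split; apply: eq_bigr => i _.
  by rewrite !mxE mulrDl -mulrA.
pose glM := GRing.isLinear.Build _ _ _ _ _ l.
pose L : {linear 'rV[R]_n -> R} := HB.pack (fun v : 'rV[R]_n => \sum_i v 0 i * g i : R) glM.
have cL : continuous L.
  apply: smooth_continuous; apply: smooth_sum => i.
  by apply: smoothM; [exact: smooth_coord|exact: smooth_cst].
have HL : f \o shift x = cst (f x) + L +o_ (0 : 'rV[R]_n) id.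
  apply/eqaddoP => e e0.
  pose D := `|C| + 1.
  have D0 : 0 < D by rewrite ltr_wpDl.
  have : nbhs (0 : 'rV[R]_n) (ball (0 : 'rV[R]_n) (e / D)).
    by apply: nbhsx_ballx; rewrite divr_gt0.
  apply: filterS => v; rewrite -ball_normE /ball_/= sub0r normrN => vD.
  have -> : (f \o shift x - (cst (f x) + L)) v = f (x + v) - f x - \sum_i v 0 i * g i.
    by rewrite [x + v]addrC -addrA -opprD.
  apply: (le_trans (H v)).
  rewrite expr2 mulrA ler_wpM2r //.
  apply: (@le_trans _ _ (D * `|v|)).
    by rewrite ler_wpM2r // (le_trans (ler_norm C)) // lerDl.
  by rewrite mulrC -ler_pdivlMr // ltW.
have dL : 'd f x = L :> (_ -> _) := diff_unique cL HL.
have df : differentiable f x by apply/diff_locallyP; rewrite dL.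
split=> // i; rewrite /partial deriveE // dL /= (bigD1 i) //= big1 ?addr0 => [|j ji].
  by rewrite mxE !eqxx mul1r.
by rewrite mxE (negbTE ji) andbF mul0r.
Qed.

End taylor.

(** * Mollification and Weyl's lemma *)

Section bump.
Context {R : realType}.

(** The powers of 1/s make the span of this family closed under differentiation, so that one
    computation of the derivative gives the smoothness of all members. *)
Definition betak (k : nat) (s : R) : R :=
  if 0 < s then s^-1 ^+ k * expR (- s^-1) else 0.

Lemma betak_ge0 k s : 0 <= betak k s.
Proof.
rewrite /betak; case: ifPn => // s0.
by rewrite mulr_ge0 ?expR_ge0 // exprn_ge0 // invr_ge0 ltW.
Qed.

Lemma betak_le0 k s : s <= 0 -> betak k s = 0.
Proof. by rewrite leNgt /betak => /negbTE ->. Qed.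

Lemma betak_gt0 k s : 0 < s -> 0 < betak k s.
Proof. by move=> s0; rewrite /betak s0 mulr_gt0 ?expR_gt0 // exprn_gt0 // invr_gt0. Qed.

(** Take the m-th power of x/(m+1) <= exp(x/(m+1)). *)
Lemma exprn_le_expR (m : nat) (x : R) : 0 <= x ->
  x ^+ m <= (m.+1)%:R ^+ m * expR x.
Proof.
move=> x0.
have h : x / m.+1%:R <= expR (x / m.+1%:R).
  by apply: le_trans (expR_ge1Dx _); rewrite lerDr.
have : (x / m.+1%:R) ^+ m <= expR (x / m.+1%:R) ^+ m.
  by rewrite lerXn2r ?nnegrE ?expR_ge0 // divr_ge0.
rewrite -expRM_natr exprMn exprVn ler_pdivrMr ?exprn_gt0 // mulrC => /le_trans; apply.
apply: ler_wpM2l; first exact: exprn_ge0.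
rewrite ler_expR mulrAC ler_pdivrMr //; apply: ler_wpM2l => //.
by rewrite ler_nat.
Qed.

(** The quadratic bound makes the difference quotient at 0 tend to 0. *)
Lemma betak_le_sqr k s : betak k s <= (k.+3)%:R ^+ k.+2 * s ^+ 2.
Proof.
rewrite /betak; case: ifPn => [s0|_]; last by rewrite mulr_ge0 ?sqr_ge0 ?exprn_ge0.
have si : 0 <= s^-1 by rewrite invr_ge0 ltW.
have := exprn_le_expR k.+2 si.
rewrite expRN ler_pdivrMr ?expR_gt0 // => H.
rewrite -(@ler_pM2r _ (s^-1 ^+ 2)) ?exprn_gt0 ?invr_gt0 //.
rewrite -exprD addn2 (le_trans H) //.
rewrite [leRHS](_ : _ = (k.+3)%:R ^+ k.+2 * expR s^-1 * (s * s^-1) ^+ 2).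
  by rewrite mulfV ?gt_eqF // expr1n mulr1.
by rewrite exprMn; ring.
Qed.

Lemma is_derive_betak k (s : R) :
  is_derive s 1 (betak k : R -> R) (betak k.+2 s - k%:R * betak k.+1 s).
Proof.
have [s0|s0|s0] := ltgtP s 0.
- rewrite !betak_le0 ?ltW // mulr0 subr0.
  have H0 : is_derive s 1 (fun=> 0 : R) (0 : R) by exact: is_derive_cst.
  apply: near_eq_is_derive H0.
  have : nbhs s [set y | y < 0] by apply: open_nbhs_nbhs; split => //; exact: open_lt.
  by apply: filterS => y /ltW /betak_le0 ->.
- have sn : s != 0 by rewrite gt_eqF.
  have Hd : is_derive s 1 (fun y : R => y^-1 ^+ k * expR (- y^-1))
    (betak k.+2 s - k%:R * betak k.+1 s).
    have d1 : is_derive s 1 (fun y : R => y^-1) (- s ^- 2).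
      apply: (is_derive_eq (@is_deriveV R id s 1 1 sn (is_derive_id s 1))).
      by rewrite /GRing.scale /= mulr1.
    have d2 : is_derive s 1 (fun y : R => - y^-1) (s ^- 2).
      by apply: (is_derive_eq (is_deriveN d1)); rewrite opprK.
    have d3 : is_derive s 1 (fun y : R => expR (- y^-1)) (expR (- s^-1) * s ^- 2).
      exact: (is_derive1_comp (is_derive_expR _) d2).
    have d4 : is_derive s 1 (fun y : R => y^-1 ^+ k) (- (k%:R * s^-1 ^+ k.+1)).
      case: k => [|k]; first by rewrite mul0r oppr0; exact: is_derive_cst.
      have -> : (fun y : R => y^-1 ^+ k.+1) = (fun y : R => y^-1) ^+ k.+1.
        by apply/funext => y; rewrite exprfctE.
      apply: (is_derive_eq (is_deriveX k.+1 d1)).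
      rewrite /GRing.scale /= -exprVn mulrN; congr (- _).
      by rewrite -mulrA -exprD addn2.
    apply: (is_derive_eq (is_deriveM d4 d3)).
    rewrite /betak s0 /GRing.scale /= -exprVn.
    by set u := expR _; set w := s^-1; rewrite !exprS; ring.
  apply: near_eq_is_derive Hd.
  have : nbhs s [set y | 0 < y] by apply: open_nbhs_nbhs; split => //; exact: open_gt.
  by apply: filterS => y /= y0; rewrite /betak y0.
- rewrite s0 !betak_le0 // mulr0 subr0.
  have H : h^-1 *: ((betak k \o shift 0) (h *: 1) - betak k 0) @[h --> 0^'] --> (0 : R).
    apply/cvgr0Pnorm_le => e e0.
    pose D : R := (k.+3)%:R ^+ k.+2.
    have D0 : 0 < D by rewrite exprn_gt0.
    have : nbhs (0 : R) (ball (0 : R) (e / D)) by apply: nbhsx_ballx; rewrite divr_gt0.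
    move=> /nbhs_dnbhs; apply: filterS => h.
    rewrite -ball_normE /ball_/= sub0r normrN ltr_pdivlMr // => he.
    rewrite addr0 /GRing.scale /= mulr1 (@betak_le0 k 0) // subr0 normrM normfV.
    rewrite (ger0_norm (betak_ge0 _ _)).
    have [->|h0] := eqVneq h 0; first by rewrite normr0 invr0 mul0r ltW.
    rewrite mulrC ler_pdivrMr ?normr_gt0 //.
    apply: le_trans (betak_le_sqr k h) _; rewrite -[h ^+ 2]real_normK ?num_real //.
    rewrite expr2 mulrA ler_wpM2r // mulrC; exact: ltW.
  apply: DeriveDef; first by apply/cvg_ex; exists 0.
  exact: (cvg_lim _ H).
Qed.

Lemma derive1_betak k : derive1 (betak k) =
  fun s => betak k.+2 s + - (k%:R * betak k.+1 s).
Proof. by apply/funext => s; rewrite derive1E; have := is_derive_betak k s => -[_ ->]. Qed.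

Lemma smooth1_betak k : smooth1 (betak k).
Proof.
move=> m; elim: m k => // m IH k; split=> [s|].
  by have := is_derive_betak k s => -[].
rewrite derive1_betak; apply: smk1D; first exact: IH.
have -> : (fun s => - (k%:R * betak k.+1 s)) = fun s => (- k%:R) * betak k.+1 s.
  by apply/funext => s; rewrite mulNr.
by apply: smk1M; [exact: smooth1_cst|exact: IH].
Qed.

Lemma betak0_le s r : s <= r -> betak 0 s <= betak 0 r.
Proof.
move=> sr; rewrite {1}/betak; case: ifPn => [s0|_]; last exact: betak_ge0.
have r0 : 0 < r by exact: lt_le_trans sr.
by rewrite /betak r0 !expr0 !mul1r ler_expR lerN2 lef_pV2.
Qed.

(* Since beta(1-s) >= 1/e exactly when s <= 0, this is a smooth step from 0 to 1. *)
Definition step (s : R) : R :=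
  (betak 0 (betak 0 1))^-1 * betak 0 (betak 0 1 - betak 0 (1 - s)).

Lemma step_den_gt0 : 0 < betak 0 (betak 0 1) :> R.
Proof. by do 2 apply: betak_gt0. Qed.

Lemma step_ge0 s : 0 <= step s.
Proof. by rewrite mulr_ge0 ?betak_ge0 // invr_ge0 betak_ge0. Qed.

Lemma step_le0 s : s <= 0 -> step s = 0.
Proof.
move=> s0; rewrite /step (@betak_le0 0 (_ - _)) ?mulr0 // subr_le0.
by apply: betak0_le; rewrite lerDl oppr_ge0.
Qed.

Lemma step_ge1 s : 1 <= s -> step s = 1.
Proof.
move=> s1; rewrite /step (@betak_le0 0 (1 - s)) ?subr_le0 // subr0 mulVf //.
by rewrite gt_eqF // step_den_gt0.
Qed.

Lemma step_le1 s : step s <= 1.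
Proof.
rewrite /step mulrC ler_pdivrMr ?step_den_gt0 // mul1r; apply: betak0_le.
by rewrite gerBl betak_ge0.
Qed.

Lemma step_gt0 s : 0 < s -> 0 < step s.
Proof.
move=> s0; rewrite mulr_gt0 ?invr_gt0 ?step_den_gt0 //; apply: betak_gt0.
rewrite subr_gt0 /betak ltr01 !expr0 !mul1r; case: ifPn => [s1|_]; last exact: expR_gt0.
rewrite ltr_expR ltrN2 invr1 invf_gt1 //; first by rewrite gtrBl.
Qed.

Lemma smooth1_step : smooth1 step.
Proof.
apply: smooth1M; first exact: smooth1_cst.
apply: (@smooth1_comp _ _ (fun s => betak 0 1 - betak 0 (1 - s))); first exact: smooth1_betak.
apply: smooth1D; first exact: smooth1_cst.
apply: smooth1N; apply: (@smooth1_comp _ _ (fun s : R => 1 - s)); first exact: smooth1_betak.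
apply: smooth1D; first exact: smooth1_cst.
by apply: smooth1N; exact: smooth1_id.
Qed.

Lemma step_nd s r : s <= r -> step s <= step r.
Proof.
move=> sr; rewrite ler_wpM2l ?invr_ge0 ?betak_ge0 //; apply: betak0_le.
by rewrite lerD2l lerN2; apply: betak0_le; rewrite lerD2l lerN2.
Qed.

Lemma nondecreasing_derive1_ge0 (g : R -> R) s : derivable g s 1 ->
  (forall x y, x <= y -> g x <= g y) -> 0 <= derive1 g s.
Proof.
move=> dg ndg; rewrite derive1E /derive.
apply: limr_ge => //.
apply: filterS (nbhs_dnbhs_neq (0 : R)) => h h0.
rewrite /GRing.scale /= mulr1; have [hp|hn] := ltP 0 h.
  by rewrite mulr_ge0 ?invr_ge0 ?(ltW hp) // subr_ge0 ndg // lerDr ltW.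
by rewrite mulr_le0 ?invr_le0 // subr_le0 ndg // gerDr.
Qed.

Lemma derive1_step_ge0 s : 0 <= derive1 step s.
Proof.
apply: nondecreasing_derive1_ge0; last exact: step_nd.
exact/smooth1_derivable/smooth1_step.
Qed.

Lemma bounded_derive1 (g : R -> R) (a b : R) : smooth1 g ->
  (forall s, s <= a -> g s = g a) -> (forall s, b <= s -> g s = g b) ->
  exists2 C, 0 < C & forall s, `|derive1 g s| <= C.
Proof.
move=> sg ga gb.
have cg : continuous (derive1 g) by exact/smooth1_continuous/smooth1_derive.
have cK : compact (derive1 g @` `[a, b]).
  by apply: continuous_compact; [exact: continuous_subspaceT|exact: segment_compact].
have [N [_ HN]] := compact_bounded cK.
have g0 s c (O : set R) : open O -> O s -> (forall y, O y -> g y = c) -> derive1 g s = 0.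
  move=> oO Os gc; rewrite derive1E.
  have H : \near s, g s = (fun=> c : R) s.
    by apply: filterS gc _; apply: open_nbhs_nbhs.
  by rewrite (near_eq_derive _ H) derive_cst.
exists (Num.max 1 (N + 1)) => [|s]; first by rewrite lt_max ltr01.
have [sa|sa] := ltP s a.
  have -> : derive1 g s = 0.
    apply: (@g0 s (g a) [set y | y < a]); [exact: open_lt|by []|].
    by move=> y /ltW /ga.
  by rewrite normr0 le_max ler01.
have [bs|bs] := ltP b s.
  have -> : derive1 g s = 0.
    apply: (@g0 s (g b) [set y | b < y]); [exact: open_gt|by []|].
    by move=> y /ltW /gb.
  by rewrite normr0 le_max ler01.
rewrite le_max; apply/orP; right; apply: (HN (N + 1)); first by rewrite ltrDl.
by exists s => //=; rewrite in_itv /= sa bs.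
Qed.

Lemma bounded_derive1_step : exists2 C : R, 0 < C & forall s, `|derive1 step s| <= C.
Proof.
apply: (@bounded_derive1 _ 0 1); first exact: smooth1_step.
  by move=> s s0; rewrite !step_le0.
by move=> s s1; rewrite !step_ge1.
Qed.

(** [step] is at its minimum at all these points, the endpoint 0 included, so Fermat's theorem
    applies. *)
Lemma derive1_step_le0 (s : R) : s <= 0 -> derive1 step s = 0.
Proof.
move=> s0; rewrite derive1E; apply: derive_val.
apply: (@derive1_at_min R step (s - 1) (s + 1)) => [|t _||t _].
- by rewrite lerD2l; apply: (@le_trans _ _ 0); rewrite ?oppr_le0.
- by apply: smooth1_derivable; exact: smooth1_step.
- by rewrite in_itv /= gtrDl ltrDl oppr_lt0 !ltr01.
- by rewrite (step_le0 s0) step_ge0.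
Qed.

Lemma derive1_step_ge1 (s : R) : 1 <= s -> derive1 step s = 0.
Proof.
move=> s1; rewrite derive1E; apply: derive_val.
apply: (@derive1_at_max R step (s - 1) (s + 1)) => [|t _||t _].
- by rewrite lerD2l; apply: (@le_trans _ _ 0); rewrite ?oppr_le0.
- by apply: smooth1_derivable; exact: smooth1_step.
- by rewrite in_itv /= gtrDl ltrDl oppr_lt0 !ltr01.
- by rewrite (step_ge1 s1) step_le1.
Qed.

End bump.

(** * Convolution of an integrable function with a smooth kernel *)

Section convolution.
Context {R : realType} {n : nat}.
Implicit Types (e k f : 'rV[R]_n -> R) (x y : 'rV[R]_n).

Definition conv e k x : R := Int (fun y => e y * k (x - y)).

Lemma bsupp_shift k x : bsupp k -> bsupp (fun y => k (x - y)).
Proof.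
move=> [M kM]; exists (M + enorm x) => y My; apply: kM.
have : enorm y <= enorm (x - y) + enorm x.
  rewrite -{1}(subrK x y); apply: (le_trans (enormD _ _)).
  by rewrite -enormN opprB.
lra.
Qed.

Lemma reflectE k x : (fun y => k (x - y)) = (fun y => k (x + (-1) *: y)).
Proof. by apply/funext => y; rewrite scaleN1r. Qed.

Lemma smooth_reflect k x : smooth k -> smooth (fun y => k (x - y)).
Proof. by move=> sk; rewrite reflectE; exact: smooth_affine. Qed.

Lemma partial_reflect k x i : smooth k ->
  partial i (fun y => k (x - y)) = fun y => - partial i k (x - y).
Proof.
move=> sk; rewrite reflectE partial_affine; last by move=> z; exact: smooth_diff.
by apply/funext => y; rewrite mulN1r scaleN1r.
Qed.

Lemma smooth_bounded k : smooth k -> bsupp k -> exists2 C, 0 <= C & forall x, `|k x| <= C.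
Proof. by move=> sk; apply: bsupp_bounded; exact: smooth_continuous. Qed.

Lemma L1_conv e k x : L1 e -> smooth k -> bsupp k -> L1 (fun y => e y * k (x - y)).
Proof.
move=> Le sk bk; have [C _ kC] := smooth_bounded sk bk.
apply: (@L1Ml _ _ e _ C) => //.
exact: mfun_cont (smooth_continuous (smooth_reflect x sk)).
Qed.

Lemma second_partials_bounded k : smooth k -> bsupp k ->
  exists2 C, 0 <= C & forall i j x, `|partial i (partial j k) x| <= C.
Proof.
move=> sk bk.
have H (p : 'I_n * 'I_n) : {C | 0 <= C /\ forall x, `|partial p.1 (partial p.2 k) x| <= C}.
  apply: cid; have [||C C0 HC] := @smooth_bounded (partial p.1 (partial p.2 k)).
  - by do 2 apply: smooth_partial.
  - by do 2 apply: bsupp_partial.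
  by exists C.
exists (\sum_p projT1 (H p)).
  by apply: sumr_ge0 => p _; have [] := projT2 (H p).
move=> i j x; rewrite (bigD1 (i, j)) //=.
have [_ /(_ x) Hx] := projT2 (H (i, j)).
apply: (le_trans Hx); rewrite lerDl.
by apply: sumr_ge0 => p _; have [] := projT2 (H p).
Qed.

(** [e] is merely integrable: the uniform quadratic Taylor bound of [k], integrated against |e|, is
    a quadratic bound for the convolution. *)
Lemma diff_conv e k x : L1 e -> smooth k -> bsupp k ->
  differentiable (conv e k) x /\ forall i, partial i (conv e k) x = conv e (partial i k) x.
Proof.
move=> Le sk bk.
have [C C0 kC] := second_partials_bounded sk bk.
apply: (@differentiable_taylor _ _ _ _ _ (n%:R * (n%:R * C) * Int (fun y => `|e y|))) => v.
have Lp i : L1 (fun y => e y * partial i k (x - y)).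
  by apply: L1_conv => //; [exact: smooth_partial|exact: bsupp_partial].
have -> : conv e k (x + v) - conv e k x - \sum_i v 0 i * conv e (partial i k) x =
    Int (fun y => e y * (k (x - y + v) - k (x - y) - \sum_i v 0 i * partial i k (x - y))).
  have -> : \sum_i v 0 i * conv e (partial i k) x =
      Int (fun y => \sum_i v 0 i * (e y * partial i k (x - y))).
    by rewrite Int_sum => [|i]; [apply: eq_bigr => i _; rewrite IntZ|exact: L1Z].
  rewrite /conv -IntB; [|exact: L1_conv..].
  rewrite -IntB.
  - congr Int; apply/funext => y; rewrite [x + v - y]addrAC !mulrBr mulr_sumr.
    by congr (_ - _); apply: eq_bigr => i _; rewrite mulrCA.
  - by apply: L1B; exact: L1_conv.
  - by apply: L1_sum => i; exact: L1Z.
have mg : mfun (fun y => k (x - y + v) - k (x - y) - \sum_i v 0 i * partial i k (x - y)).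
  apply: mfun_cont; apply: smooth_continuous; apply: smoothB.
    apply: smoothB; last exact: smooth_reflect.
    have -> : (fun y => k (x - y + v)) = (fun y => k (x + v - y)).
      by apply/funext => y; rewrite addrAC.
    exact: smooth_reflect.
  apply: smooth_sum => i; apply: smoothZ; apply: smooth_reflect.
  exact: smooth_partial.
pose D := n%:R * (n%:R * C) * `|v| ^+ 2.
have Lg : L1 (fun y => e y * (k (x - y + v) - k (x - y) - \sum_i v 0 i * partial i k (x - y))).
  by apply: (@L1Ml _ _ e _ D) => // y; exact: taylor_bound.
apply: le_trans (abs_Int Lg) _.
rewrite mulrAC -/D -IntZ; last exact: L1_abs.
apply: le_Int; [exact: L1_abs|exact/L1Z/L1_abs|].
move=> y; rewrite normrM mulrC ler_wpM2r //; exact: taylor_bound.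
Qed.

Lemma partial_conv e k i : L1 e -> smooth k -> bsupp k ->
  partial i (conv e k) = conv e (partial i k).
Proof. by move=> Le sk bk; apply/funext => x; have [_] := diff_conv x Le sk bk. Qed.

Lemma smooth_conv e k : L1 e -> smooth k -> bsupp k -> smooth (conv e k).
Proof.
move=> Le sk bk; apply/smoothP => m; elim: m k sk bk => // m IH k sk bk.
split=> [x|i]; first by have [] := diff_conv x Le sk bk.
by rewrite partial_conv //; apply: IH; [exact: smooth_partial|exact: bsupp_partial].
Qed.

Lemma laplacian_conv e k : L1 e -> smooth k -> bsupp k ->
  laplacian (conv e k) = conv e (laplacian k).
Proof.
move=> Le sk bk; apply/funext => x.
transitivity (\sum_i conv e (partial i (partial i k)) x).
  apply: eq_bigr => i _; rewrite partial_conv // partial_conv //.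
    exact: smooth_partial.
  exact: bsupp_partial.
rewrite /conv -Int_sum; first by congr Int; apply/funext => y; rewrite mulr_sumr.
move=> i; apply: L1_conv => //.
  by do 2 apply: smooth_partial.
by do 2 apply: bsupp_partial.
Qed.

End convolution.

(** * Weighted means and Weyl's lemma *)

Section weyl.
Context {R : realType} {n : nat}.
Implicit Types (e f phi : 'rV[R]_n -> R) (g : R -> R) (x y c : 'rV[R]_n).

Lemma enormBC x y : enorm (x - y) = enorm (y - x).
Proof. by rewrite -enormN opprB. Qed.

Lemma laplacian_affine (p : 'rV[R]_n) (r : R) f z : smooth f ->
  laplacian (fun z => f (p + r *: z)) z = r ^+ 2 * laplacian f (p + r *: z).
Proof.
move=> sf; rewrite /laplacian mulr_sumr; apply: eq_bigr => i _.
have E1 := partial_affine p r i (fun y => smooth_diff y sf).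
have E2 := partial_affine p r i (fun y => smooth_diff y (smooth_partial i sf)).
have E3 := partialZ i r (smooth_affine p r (smooth_partial i sf)).
by rewrite E1 E3 E2 mulrA -expr2.
Qed.

Lemma smooth_radial g c : smooth1 g -> smooth (fun x => g (sqd c x)).
Proof. by move=> sg; apply: smooth_comp => //; exact: smooth_sqd. Qed.

Lemma partial_radial g c i : smooth1 g ->
  partial i (fun x => g (sqd c x)) = fun x => derive1 g (sqd c x) * (2 * (x 0 i - c 0 i)).
Proof.
move=> sg; rewrite partial_comp ?partial_sqd //.
- by move=> x; apply: smooth_diff; exact: smooth_sqd.
- by move=> x; exact: smooth1_derivable.
Qed.

Lemma laplacian_radial g c x : smooth1 g -> laplacian (fun x => g (sqd c x)) x =
  2 * n%:R * derive1 g (sqd c x) + 4 * sqd c x * derive1 (derive1 g) (sqd c x).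
Proof.
move=> sg; have sg' := smooth1_derive sg.
have sB i : smooth (fun x => 2 * (x 0 i - c 0 i)) by apply: smoothZ; exact: smooth_coordB.
transitivity (\sum_i (derive1 (derive1 g) (sqd c x) * 4 * ((x 0 i - c 0 i) * (x 0 i - c 0 i)) +
    2 * derive1 g (sqd c x))).
  apply: eq_bigr => i _; rewrite partial_radial // partialM.
  - rewrite partial_radial // partialZ ?partial_coordB ?eqxx; last exact: smooth_coordB.
    by rewrite mulr1n; ring.
  - by move=> y; apply: smooth_diff; exact: smooth_radial.
  - by move=> y; apply: smooth_diff.
rewrite big_split /= -mulr_sumr -sqdE sumr_const card_ord -mulr_natl; ring.
Qed.

Lemma smooth1_scale g (l : R) : smooth1 g -> smooth1 (fun s => g (l * s)).
Proof.
move=> sg; apply: smooth1_comp => //.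
by apply: smooth1M; [exact: smooth1_cst|exact: smooth1_id].
Qed.

Lemma derive1_scale g (l : R) : smooth1 g ->
  derive1 (fun s => g (l * s)) = fun s => l * derive1 g (l * s).
Proof.
move=> sg; rewrite (@derive1_compo _ g (fun s => l * s)).
- rewrite (@derive1M _ (fun=> l) (fun s => s)).
  + by rewrite derive1_const derive1_ident; apply/funext => s; rewrite mul0r add0r mulr1 mulrC.
  + by move=> y; exact: derivable_cst.
  + by move=> y; exact: derivable_id.
- by move=> y; exact: smooth1_derivable.
- by move=> y; apply: smooth1_derivable; apply: smooth1M; [exact: smooth1_cst|exact: smooth1_id].
Qed.

(* [Phi] is the potential of the mollifier profile [moll]: moll = - 2 Phi'. *)
Definition Phi (s : R) : R := betak 0 (1 - s).
Definition moll (s : R) : R := 2 * betak 2 (1 - s).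

Lemma smooth1_1B g : smooth1 g -> smooth1 (fun s => g (1 - s)).
Proof.
move=> sg; apply: smooth1_comp => //; apply: smooth1D; first exact: smooth1_cst.
by apply: smooth1N; exact: smooth1_id.
Qed.

Lemma smooth1_Phi : smooth1 Phi.
Proof. by apply: smooth1_1B; exact: smooth1_betak. Qed.

Lemma smooth1_moll : smooth1 moll.
Proof. by apply: smooth1M; [exact: smooth1_cst|apply: smooth1_1B; exact: smooth1_betak]. Qed.

Lemma derive1_Phi : derive1 Phi = fun s => - 2^-1 * moll s.
Proof.
rewrite /Phi (@derive1_compo _ (betak 0) (fun s => 1 - s)).
- rewrite (@derive1D _ (fun=> 1) (fun s => - s)).
  + rewrite derive1_const derive1_betak; apply/funext => s; rewrite /moll.
    by rewrite derive1E deriveN ?derive_id; [field|exact: derivable_id].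
  + by move=> y; exact: derivable_cst.
  + by move=> y; apply: smooth1_derivable; apply: smooth1N; exact: smooth1_id.
- by move=> y; apply: smooth1_derivable; exact: smooth1_betak.
- by move=> y; apply: smooth1_derivable; apply: (@smooth1_1B id); exact: smooth1_id.
Qed.

Lemma moll_ge0 s : 0 <= moll s.
Proof. by rewrite mulr_ge0 ?betak_ge0. Qed.

Lemma moll_gt0 s : s < 1 -> 0 < moll s.
Proof. by move=> s1; rewrite mulr_gt0 // betak_gt0 // subr_gt0. Qed.

Lemma moll_ge1 s : 1 <= s -> moll s = 0.
Proof. by move=> s1; rewrite /moll betak_le0 ?mulr0 // subr_le0. Qed.

Lemma Phi_ge1 s : 1 <= s -> Phi s = 0.
Proof. by move=> s1; rewrite /Phi betak_le0 // subr_le0. Qed.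

(** For a profile vanishing beyond 1 the kernel lives on the ball of radius 1/l. With the inverse
    radius as parameter no negative power occurs inside the profile. *)
Definition kern g (l : R) : 'rV[R]_n -> R := fun z => g (l ^+ 2 * sqd 0 z).

Lemma sqd0 x : sqd 0 x = enorm x ^+ 2.
Proof. by rewrite /sqd subr0 enorm_sqr. Qed.

Lemma sqd_enorm c x : sqd c x = enorm (x - c) ^+ 2.
Proof. by rewrite /sqd enorm_sqr. Qed.

Lemma smooth_kern g l : smooth1 g -> smooth (kern g l).
Proof. by move=> sg; apply: (@smooth_radial (fun s => g (l ^+ 2 * s))); exact: smooth1_scale. Qed.

Lemma kern_supp g l z : (forall s, 1 <= s -> g s = 0) -> 0 < l ->
  l^-1 <= enorm z -> kern g l z = 0.
Proof.
move=> g1 l0 lz; apply: g1; rewrite sqd0 -exprMn -[leLHS](expr1n _ 2).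
rewrite ler_sqr ?nnegrE ?mulr_ge0 ?enorm_ge0 ?(ltW l0) //.
by rewrite mulrC -ler_pdivrMr // mul1r.
Qed.

Lemma bsupp_kern g l : (forall s, 1 <= s -> g s = 0) -> 0 < l -> bsupp (kern g l).
Proof. by move=> g1 l0; exists l^-1 => z /ltW; exact: kern_supp. Qed.

Lemma kern_neq0 g l z : (forall s, 1 <= s -> g s = 0) -> 0 < l ->
  kern g l z != 0 -> enorm z < l^-1.
Proof.
by move=> g1 l0; apply: contraNltn || rewrite ltNge; apply: contra => lz; apply/eqP; exact: kern_supp.
Qed.

(** A weighted mean of [e] over the ball of radius 1/l about [x], times the constant [mass]. *)
Definition wmean e (l : R) x : R := l ^+ n * conv e (kern moll l) x.

(* The rescaled mollifier varies with the scale by the Laplacian of a test function. *)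
Lemma is_derive_wmean_kernel (t l : R) : 0 < l ->
  is_derive l 1 (fun l : R => l ^+ n * moll (l ^+ 2 * t))
    (l ^+ n * (l^-1 * (n%:R * moll (l ^+ 2 * t) + 2 * (l ^+ 2 * t) * derive1 moll (l ^+ 2 * t)))).
Proof.
move=> l0; have ln : l != 0 by rewrite gt_eqF.
have d1 : is_derive l 1 (fun l : R => l ^+ n) (n%:R * l ^+ n.-1).
  have -> : (fun l : R => l ^+ n) = id ^+ n by apply/funext => y; rewrite exprfctE.
  by apply: (is_derive_eq (is_deriveX n (is_derive_id l 1))); rewrite /GRing.scale /= mulr1.
have d2 : is_derive l 1 (fun l : R => l ^+ 2 * t) (2 * l * t).
  have -> : (fun l : R => l ^+ 2 * t) = (id ^+ 2) * cst t by apply/funext => y; rewrite mulrfctE exprfctE.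
  apply: (is_derive_eq (is_deriveM (is_deriveX 2 (is_derive_id l 1)) (is_derive_cst t l 1))).
  by rewrite /GRing.scale /= mulr0 add0r expr1 mulr1; ring.
have d3 : is_derive l 1 (fun l : R => moll (l ^+ 2 * t)) (derive1 moll (l ^+ 2 * t) * (2 * l * t)).
  apply: (is_derive1_comp _ d2); rewrite derive1E; apply: derivableP.
  exact/smooth1_derivable/smooth1_moll.
apply: (is_derive_eq (is_deriveM d1 d3)); rewrite /GRing.scale /=.
have -> : n%:R * l ^+ n.-1 = l ^+ n * l^-1 * n%:R :> R.
  case: n => [|m]; first by rewrite !mul0r mulr0.
  by rewrite /= exprS [l * _]mulrC mulfK // mulrC.
by field.
Qed.

(** The bracket is the one produced by differentiating the rescaled mollifier in [l]; this is what
    the choice moll = -2 Phi' achieves. *)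
Lemma laplacian_kernPhi l x y : laplacian (kern Phi l) (x - y) =
  - (l ^+ 2) * (n%:R * moll (l ^+ 2 * sqd x y) +
     2 * (l ^+ 2 * sqd x y) * derive1 moll (l ^+ 2 * sqd x y)).
Proof.
have sS : smooth1 (fun s => Phi (l ^+ 2 * s)) by apply: smooth1_scale; exact: smooth1_Phi.
have -> := @laplacian_radial _ 0 (x - y) sS.
rewrite derive1_scale; last exact: smooth1_Phi.
have -> : sqd 0 (x - y) = sqd x y by rewrite sqd0 sqd_enorm -enormN opprB.
have sd : smooth1 (derive1 Phi) by apply/smooth1_derive/smooth1_Phi.
have -> : derive1 (fun s => l ^+ 2 * derive1 Phi (l ^+ 2 * s)) =
    fun s => l ^+ 2 * (l ^+ 2 * derive1 (derive1 Phi) (l ^+ 2 * s)).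
  rewrite (@derive1M _ (fun=> l ^+ 2) (fun s => derive1 Phi (l ^+ 2 * s))).
  - by rewrite derive1_const derive1_scale //; apply/funext => s; rewrite mul0r add0r.
  - by move=> z; exact: derivable_cst.
  - by move=> z; apply: smooth1_derivable; exact: smooth1_scale.
have -> : derive1 (derive1 Phi) = fun s => - 2^-1 * derive1 moll s.
  rewrite derive1_Phi (@derive1M _ (fun=> - 2^-1) moll).
  - by rewrite derive1_const; apply/funext => s; rewrite mul0r add0r.
  - by move=> z; exact: derivable_cst.
  - by move=> z; apply: smooth1_derivable; exact: smooth1_moll.
by rewrite derive1_Phi /=; field.
Qed.

Lemma moll_bound : exists2 C, 0 <= C & forall s, 0 <= s ->
  `|n%:R * moll s + 2 * s * derive1 moll s| <= C.
Proof.
pose h s := n%:R * moll s + 2 * s * derive1 moll s.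
have ch : continuous h.
  apply: smooth1_continuous; apply: smooth1D.
    by apply: smooth1M; [exact: smooth1_cst|exact: smooth1_moll].
  apply: smooth1M; last by apply: smooth1_derive; exact: smooth1_moll.
  by apply: smooth1M; [exact: smooth1_cst|exact: smooth1_id].
have cK : compact (h @` `[0, 1]).
  by apply: continuous_compact; [exact: continuous_subspaceT|exact: segment_compact].
have [N [_ HN]] := compact_bounded cK.
exists (Num.max 0 (N + 1)) => [|s s0]; first by rewrite le_max lexx.
have [s1|s1] := leP s 1.
  rewrite le_max; apply/orP; right; apply: (HN (N + 1)); first by rewrite ltrDl.
  by exists s => //=; rewrite in_itv /= s0 s1.
have -> : derive1 moll s = 0.
  rewrite derive1E.
  have H : \near s, moll s = (fun=> 0 : R) s.
    have : nbhs s [set y | 1 < y] by apply: open_nbhs_nbhs; split => //; exact: open_gt.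
    by apply: filterS => y /ltW /moll_ge1.
  by rewrite (near_eq_derive _ H) derive_cst.
by rewrite (moll_ge1 (ltW s1)) !mulr0 addr0 normr0 le_max lexx.
Qed.

Lemma wmeanE e l x : wmean e l x = l ^+ n * Int (fun y => e y * moll (l ^+ 2 * sqd x y)).
Proof.
congr (_ * Int _); apply/funext => y; rewrite /kern.
by rewrite sqd0 -enormN opprB -sqd_enorm.
Qed.

Lemma L1_moll e l x : L1 e -> 0 < l -> L1 (fun y => e y * moll (l ^+ 2 * sqd x y)).
Proof.
move=> Le l0.
have -> : (fun y => e y * moll (l ^+ 2 * sqd x y)) = fun y => e y * kern moll l (x - y).
  by apply/funext => y; rewrite /kern sqd0 -enormN opprB -sqd_enorm.
apply: L1_conv => //; first exact/smooth_kern/smooth1_moll.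
by apply: bsupp_kern => //; exact: moll_ge1.
Qed.

(** The derivative of the mean in the scale is, up to a factor, the integral of [e] against the
    Laplacian of a smooth function vanishing at distance [r] from [x] and beyond, which is zero by
    hypothesis. *)
Lemma wmean_const e x (r : R) : 0 < r -> L1 e ->
  (forall phi, smooth phi -> (forall y, r <= enorm (y - x) -> phi y = 0) ->
     Int (fun y => e y * laplacian phi y) = 0) ->
  forall l1 l2, r^-1 <= l1 -> l1 <= l2 -> wmean e l1 x = wmean e l2 x.
Proof.
move=> r0 Le He l1 l2 rl1; rewrite le_eqVlt => /predU1P[->//|l12].
have l10 : 0 < l1 by apply: lt_le_trans rl1; rewrite invr_gt0.
have [C C0 HC] := moll_bound.
pose D l t := l ^+ n * (l^-1 * (n%:R * moll (l ^+ 2 * t) + 2 * (l ^+ 2 * t) * derive1 moll (l ^+ 2 * t))).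
have dK (l : R) y : 0 < l -> is_derive l 1 (fun l : R => e y * (l ^+ n * moll (l ^+ 2 * sqd x y))) (e y * D l (sqd x y)).
  move=> l0; have H := is_derive_wmean_kernel (sqd x y) l0.
  exact: (is_deriveZ (e y) H).
pose f (l : R) y := e y * (l ^+ n * moll (l ^+ 2 * sqd x y)).
have Lf l : 0 < l -> L1 (f l).
  move=> l0; have -> : f l = fun y => l ^+ n * (e y * moll (l ^+ 2 * sqd x y)).
    by apply/funext => y; rewrite /f mulrCA.
  by apply: L1Z; exact: L1_moll.
have WE l : 0 < l -> wmean e l x = Int (f l).
  move=> l0; rewrite wmeanE -IntZ; last exact: L1_moll.
  by congr Int; apply/funext => y; rewrite /f mulrCA.
have D0 l : r^-1 <= l -> Int (fun y => e y * D l (sqd x y)) = 0.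
  move=> rl; have l0 : 0 < l by apply: lt_le_trans rl; rewrite invr_gt0.
  pose phi y := kern Phi l (x - y).
  have sP : smooth (kern Phi l) by apply: smooth_kern; exact: smooth1_Phi.
  have bP : bsupp (kern Phi l) by apply: bsupp_kern => //; exact: Phi_ge1.
  have Elap y : laplacian phi y = laplacian (kern Phi l) (x - y).
    rewrite /phi reflectE; apply: (etrans (laplacian_affine x (-1) y sP)).
    by rewrite sqrrN expr1n mul1r scaleN1r.
  have := He phi (smooth_reflect x sP) _.
  have -> : (fun y => e y * laplacian phi y) = fun y => - (l ^+ 2) * (l / l ^+ n) * (e y * D l (sqd x y)).
    apply/funext => y; rewrite Elap laplacian_kernPhi /D.
    have : l ^+ n != 0 by rewrite expf_neq0 // gt_eqF.
    have : l != 0 by rewrite gt_eqF.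
    set u := _ * moll _ + _; move: u (l ^+ n) (e y) => u w p l1' w0; field.
    by rewrite l1' w0.
  rewrite IntZ; last first.
    have -> : (fun y => e y * D l (sqd x y)) = fun y => - (l ^+ n / (l ^+ 2 * l)) * (e y * laplacian (kern Phi l) (x - y)).
      apply/funext => y; rewrite laplacian_kernPhi /D.
      have : l != 0 by rewrite gt_eqF.
      by set u := _ * moll _ + _; move: u (l ^+ n) (e y) => u w p l1'; field.
    apply: L1Z; apply: L1_conv => //; first exact: smooth_laplacian.
    by apply: bsupp_sum => i; do 2 apply: bsupp_partial.
  move=> H; have /eqP : - l ^+ 2 * (l / l ^+ n) * Int (fun y => e y * D l (sqd x y)) = 0.
    apply: H => y ry; apply: kern_supp => //; first exact: Phi_ge1.
    rewrite -enormN opprB; apply: le_trans ry.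
    by rewrite -[leRHS]invrK lef_pV2 // posrE invr_gt0.
  rewrite !mulf_eq0 oppr_eq0 sqrf_eq0 invr_eq0 (gt_eqF l0) expf_eq0 (gt_eqF l0) andbF /=.
  by move=> /eqP.
(* The open interval around [l1, l2] stays away from 0 and is bounded, which gives one integrable
   bound for the derivatives under the integral. *)
have key (l : R) : l1 / 2 < l < l2 + 1 -> r^-1 <= l -> is_derive l 1 (fun l => Int (f l)) (0 : R).
  move=> lb rl.
  pose K := (l2 + 1) ^+ n * ((l1 / 2)^-1 * C).
  have i1 : l \in `](l1 / 2), (l2 + 1)[ by rewrite in_itv.
  have pos s : s \in `](l1 / 2), (l2 + 1)[ -> 0 < s.
    by rewrite in_itv /= => /andP[+ _]; apply: lt_trans; rewrite divr_gt0.
  have dE s y : 0 < s -> derive1 (f^~ y) s = e y * D s (sqd x y).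
    by move=> s0; rewrite derive1E; have [_ ->] := dK s y s0.
  have dd s y : s \in `](l1 / 2), (l2 + 1)[ -> derivable (f^~ y) s 1.
    by move=> /pos s0; have [] := dK s y s0.
  have bd s y : s \in `](l1 / 2), (l2 + 1)[ -> `|derive1 (f^~ y) s| <= K * `|e y|.
    move=> sI; have s0 := pos _ sI; rewrite dE // normrM mulrC ler_wpM2r //.
    move: sI; rewrite in_itv /= => /andP[s1 s2].
    rewrite normrM ger0_norm ?exprn_ge0 ?(ltW s0) //.
    apply: ler_pM => //; first by rewrite exprn_ge0 // ltW.
      by rewrite lerXn2r ?nnegrE ?(ltW s0) ?(ltW s2) // ltW // (lt_trans s0).
    rewrite normrM ger0_norm ?invr_ge0 ?(ltW s0) //.
    apply: ler_pM => //; first by rewrite invr_ge0 ltW.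
      by rewrite lef_pV2 ?posrE ?divr_gt0 // ltW.
    by apply: HC; rewrite mulr_ge0 ?sqd_ge0 // exprn_ge0 // ltW.
  have [d1 d2] := @Int_derive _ _ f (fun y => K * `|e y|) (l1 / 2) (l2 + 1) l i1 dd
    (fun s sI => Lf s (pos s sI)) (L1Z K (L1_abs Le)) bd.
  apply: DeriveDef => //; rewrite -derive1E d2 -[RHS](D0 l rl).
  by congr Int; apply/funext => y; rewrite dE // pos.
have [s sI E] : exists2 s, s \in `]l1, l2[ & Int (f l2) - Int (f l1) = 0 * (l2 - l1).
  apply: (@MVT R (fun l => Int (f l)) (fun=> 0)) => //.
    move=> s; rewrite in_itv /= => /andP[s1 s2]; apply: key; last exact: le_trans (ltW s1).
    by rewrite (lt_trans _ s1) ?(lt_trans s2) ?ltrDl // ltr_pdivrMr // ltr_pMr // ltr1n.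
  apply: continuous_in_subspaceT => s; rewrite inE /= in_itv /= => /andP[s1 s2].
  apply: differentiable_continuous; apply/derivable1_diffP.
  have [] // := key s; last exact: le_trans s1.
  by rewrite (lt_le_trans _ s1) ?(le_lt_trans s2) ?ltrDl // ltr_pdivrMr // ltr_pMr // ltr1n.
rewrite (WE _ l10) (WE _ (lt_trans l10 l12)).
by apply/esym/eqP; rewrite -subr_eq0 E mul0r.
Qed.

Lemma kern_moll_ge0 l z : 0 <= kern moll l z.
Proof. exact: moll_ge0. Qed.

Definition mass : R := Int (kern moll 1).

Lemma mass_gt0 : 0 < mass.
Proof.
have sk : smooth (kern moll 1) by apply: smooth_kern; exact: smooth1_moll.
have bk : bsupp (kern moll 1) by apply: bsupp_kern => //; exact: moll_ge1.
have m0 : 0 <= mass by apply: Int_ge0 => z; exact: kern_moll_ge0.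
rewrite lt_neqAle m0 andbT eq_sym; apply/eqP => mz.
have := Int_cont_eq0 (smooth_continuous sk) (L1_bsupp (smooth_continuous sk) bk)
  (kern_moll_ge0 1) mz 0.
by apply/eqP; rewrite gt_eqF // /kern /sqd subrr dotr0l mulr0 moll_gt0.
Qed.

Lemma measurable_eball c (r : R) : measurable (eball c r).
Proof. by apply: measurable_open; exact: open_eball. Qed.

Lemma L1_eball c (r : R) : L1 (\1_(eball c r)).
Proof.
apply: (@L1_indic _ _ _ (r + enorm c)); first exact: measurable_eball.
move=> x xc; rewrite -(subrK c x); apply: (le_trans (enormD _ _)).
by rewrite lerD2r ltW.
Qed.

Lemma Int_laplacian phi : smooth phi -> bsupp phi -> Int (laplacian phi) = 0.
Proof.
move=> sp bp; rewrite /laplacian Int_sum => [|i].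
  by rewrite big1 // => i _; apply: Int_partial_smooth; [exact: smooth_partial|exact: bsupp_partial].
apply: L1_bsupp; last by do 2 apply: bsupp_partial.
by apply: smooth_continuous; do 2 apply: smooth_partial.
Qed.

Lemma laplacian_local phi x (r : R) : (forall y, r <= enorm (y - x) -> phi y = 0) ->
  forall y, r < enorm (y - x) -> laplacian phi y = 0.
Proof.
move=> p0 y ry; have oO : open (~` [set z : 'rV[R]_n | enorm (z - x) <= r]).
  exact/closed_openC/closed_cball.
have O0 z : (~` [set z : 'rV[R]_n | enorm (z - x) <= r]) z -> phi z = (fun=> 0 : R) z.
  by move=> /negP; rewrite -ltNge => /ltW /p0.
have P i z : (~` [set z : 'rV[R]_n | enorm (z - x) <= r]) z -> partial i phi z = (fun=> 0 : R) z.
  by move=> Oz; rewrite (partial_open i oO Oz O0) partial_cst.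
have Oy : (~` [set z : 'rV[R]_n | enorm (z - x) <= r]) y by apply/negP; rewrite -ltNge.
by rewrite /laplacian big1 // => i _; rewrite (partial_open i oO Oy (P i)) partial_cst.
Qed.

(** The total weight is found without a change of variables. With [e] the indicator of a large ball,
    [wmean_const] removes the dependence on [l]. By parts, the gradient of the convolution vanishes
    along the segment from 0 to [x], which removes the dependence on [x]. *)
Lemma Int_moll (l : R) x : 0 < l -> l ^+ n * Int (fun y => moll (l ^+ 2 * sqd x y)) = mass.
Proof.
move=> l0; pose r := Num.max 1 l^-1.
have r0 : 0 < r by rewrite lt_max ltr01.
(* The ball of radius [A] about 0 contains the ball of radius [r] about [x] and, since r >= 1, the
   unit balls about all points of the segment from 0 to [x]. *)
pose A := r + enorm x + 1; pose e := \1_(eball (0 : 'rV[R]_n) A) : 'rV[R]_n -> R.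
have e1 y : enorm (y - x) <= r -> e y = 1.
  move=> yr; rewrite /e indicE mem_set // /eball/= subr0 -(subrK x y).
  by apply: (le_lt_trans (enormD _ _)); rewrite /A; lra.
have Le : L1 e by exact: L1_eball.
have He phi : smooth phi -> (forall y, r <= enorm (y - x) -> phi y = 0) ->
    Int (fun y => e y * laplacian phi y) = 0.
  move=> sp p0; rewrite -(@Int_laplacian phi) //; last first.
    exists (r + enorm x) => y ry; apply: p0.
    have := enormD (y - x) x; rewrite subrK; lra.
  congr Int; apply/funext => y; have [yr|yr] := leP (enorm (y - x)) r.
    by rewrite e1 // mul1r.
  by rewrite (laplacian_local p0) // mulr0.
have W1 k : r^-1 <= k -> wmean e k x = k ^+ n * Int (fun y => moll (k ^+ 2 * sqd x y)).
  move=> rk; have k0 : 0 < k by apply: lt_le_trans rk; rewrite invr_gt0.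
  rewrite wmeanE; congr (_ * Int _); apply/funext => y.
  have [yr|yr] := leP (enorm (y - x)) r; first by rewrite e1 // mul1r.
  rewrite moll_ge1 ?mulr0 // sqd_enorm -enormN opprB -exprMn -[leLHS](expr1n _ 2).
  rewrite ler_sqr ?nnegrE ?mulr_ge0 ?enorm_ge0 ?(ltW k0) //.
  apply: (@le_trans _ _ (k * r)); first by rewrite -ler_pdivrMr // mul1r.
  by rewrite ler_wpM2l ?(ltW k0) // -enormN opprB ltW.
have rl : r^-1 <= l by rewrite -[leRHS]invrK lef_pV2 ?posrE ?invr_gt0 // le_max lexx orbT.
have r1 : r^-1 <= 1 by rewrite invf_le1 // le_max lexx.
have WC k1 k2 : r^-1 <= k1 -> r^-1 <= k2 -> wmean e k1 x = wmean e k2 x.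
  move=> h1 h2; have [h|/ltW h] := leP k1 k2; first exact: (wmean_const r0 Le He).
  by apply/esym; exact: (wmean_const r0 Le He).
rewrite -W1 // (WC l 1) // W1 // expr1n mul1r expr1n /mass.
have sk : smooth (kern moll 1) by apply: smooth_kern; exact: smooth1_moll.
have bk : bsupp (kern moll 1) by apply: bsupp_kern => //; exact: moll_ge1.
have CE z : enorm z <= enorm x -> conv e (kern moll 1) z = Int (fun y => kern moll 1 (z - y)).
  move=> zx; congr Int; apply/funext => y.
  have [->|] := eqVneq (kern moll 1 (z - y)) 0; first by rewrite mulr0.
  move=> /(kern_neq0 moll_ge1 ltr01); rewrite invr1 => zy.
  rewrite /e indicE mem_set ?mul1r // /eball/= subr0.
  have := enormD (y - z) z; rewrite subrK (enormBC y z) => H.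
  have : 1 <= r by rewrite le_max lexx.
  rewrite /A; lra.
have sc : smooth (conv e (kern moll 1)) by exact: smooth_conv.
have P0 i z : enorm z <= enorm x -> partial i (conv e (kern moll 1)) z = 0.
  move=> zx; rewrite partial_conv // /conv.
  transitivity (- Int (partial i (fun y => kern moll 1 (z - y)))).
    rewrite partial_reflect // -IntN; last first.
      apply: L1_bsupp; first by apply/smooth_continuous/smoothN/smooth_reflect/smooth_partial.
      by apply/bsuppN/bsupp_shift/bsupp_partial.
    congr Int; apply/funext => y; rewrite opprK.
    have [->|] := eqVneq (partial i (kern moll 1) (z - y)) 0; first by rewrite mulr0.
    move=> py; rewrite /e indicE mem_set ?mul1r // /eball/= subr0.
    have zy : enorm (z - y) <= 1.
      rewrite leNgt; apply/negP => zy; move: py; apply/negP; rewrite negbK; apply/eqP.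
      have oO : open (~` [set z : 'rV[R]_n | enorm (z - 0) <= 1]).
        exact/closed_openC/closed_cball.
      rewrite (@partial_open _ _ i _ (fun=> 0 : R) _ (z - y) oO) ?partial_cst //=.
        by apply/negP; rewrite -ltNge subr0.
      move=> w /negP; rewrite subr0 -ltNge => /ltW w1; apply: kern_supp => //.
        exact: moll_ge1.
      by rewrite invr1.
    have := enormD (y - z) z; rewrite subrK (enormBC y z) => H.
    have : 1 <= r by rewrite le_max lexx.
    rewrite /A; lra.
  rewrite Int_partial_smooth ?oppr0 //; first exact: smooth_reflect.
  exact: bsupp_shift.
have := mvt_line 0 x (fun y => smooth_diff y sc) ltr01.
rewrite scale1r add0r => -[s /andP[s0 s1]]; rewrite big1 ?mulr0 => [/eqP|i _]; last first.
  rewrite add0r P0 ?mulr0 // enormZ gtr0_norm // ler_piMl ?enorm_ge0 //; exact: ltW.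
have x0 : enorm (0 : 'rV[R]_n) <= enorm x by rewrite enorm0 enorm_ge0.
rewrite subr_eq0 (CE x (lexx _)) (CE 0 x0) => /eqP E.
transitivity (Int (fun y => kern moll 1 (x - y))).
  by congr Int; apply/funext => y; rewrite /kern sqd0 sqd_enorm -enormN opprB expr1n.
rewrite E; congr Int; apply/funext => y; rewrite /kern sqd0 sub0r enormN.
by rewrite -sqd0.
Qed.

(** As [smooth] is a property of functions on the whole space, local regularity is expressed by
    agreement with such a function on a ball. *)
Definition loc_harm (O : set 'rV[R]_n) e := forall x, O x -> exists r f,
  [/\ 0 < r, smooth f & forall y, eball x r y -> laplacian f y = 0 /\ e y = f y].

Lemma conv_test_eq0 e phi x : L1 e ->
  Int (fun y => e y * laplacian (fun y => phi (x - y)) y) = 0 -> smooth phi ->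
  conv e (laplacian phi) x = 0.
Proof.
move=> Le H sp; apply: (etrans _ H).
have E y : laplacian phi (x - y) = laplacian (fun y => phi (x - y)) y.
  rewrite reflectE; apply/esym/(etrans (laplacian_affine x (-1) y sp)).
  by rewrite sqrrN expr1n mul1r scaleN1r.
rewrite /conv; apply: (congr1 Int); apply/funext => y.
exact: (congr1 (fun w => e y * w) (E y)).
Qed.

(** The mean over a ball inside [O] does not depend on its radius, and at a continuity point of [e]
    it tends to the value of [e]. For a fixed radius [r] the mean is a convolution, hence one smooth
    function serving all points whose closed [r]-ball lies in [O]; this uniformity gives smoothness
    around compact subsets. *)
Lemma weyl (O : set 'rV[R]_n) e : open O -> L1 e ->
  (forall phi, smooth phi ->
     (exists x r, [set y | enorm (y - x) <= r] `<=` O /\ forall y, r <= enorm (y - x) -> phi y = 0) ->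
     Int (fun y => e y * laplacian phi y) = 0) ->
  exists f, (forall r, 0 < r -> exists2 E, smooth E & forall x, [set y | enorm (y - x) <= r] `<=` O ->
      laplacian E x = 0 /\ f x = E x) /\
    forall x, O x -> {for x, continuous e} -> f x = e x.
Proof.
move=> oO Le He.
have WC x r : 0 < r -> [set y | enorm (y - x) <= r] `<=` O ->
    forall l1 l2, r^-1 <= l1 -> r^-1 <= l2 -> wmean e l1 x = wmean e l2 x.
  move=> r0 rO l1 l2 h1 h2.
  have H phi : smooth phi -> (forall y, r <= enorm (y - x) -> phi y = 0) ->
      Int (fun y => e y * laplacian phi y) = 0.
    by move=> sp p0; apply: He => //; exists x, r.
  have [h|/ltW h] := leP l1 l2; first exact: (wmean_const r0 Le H).
  by apply/esym; exact: (wmean_const r0 Le H).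
(* The radius picked at each point is immaterial, by [WC]. *)
have rx x : {r | O x -> 0 < r /\ [set y | enorm (y - x) <= r] `<=` O}.
  apply: cid; have [Ox|nOx] := pselect (O x); last by exists 0.
  by have [r r0 rO] := nbhs_cball (open_nbhs_nbhs (conj oO Ox)); exists r.
pose f x := mass^-1 * wmean e (projT1 (rx x))^-1 x.
have m0 : mass != 0 by rewrite gt_eqF // mass_gt0.
have fE x r : 0 < r -> [set y | enorm (y - x) <= r] `<=` O ->
    f x = mass^-1 * wmean e r^-1 x.
  move=> r0 rO; rewrite /f; congr (_ * _).
  have Ox : O x by apply: rO; rewrite /= subrr enorm0 ltW.
  have [s0 sO] := projT2 (rx x) Ox; move: (projT1 (rx x)) s0 sO => s s0 sO.
  have [rs|sr] := leP r s; first by apply: (WC x s) => //; rewrite lef_pV2.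
  by apply: (WC x r) => //; rewrite lef_pV2 // ltW.
exists f; split.
  move=> r r0; pose l := r^-1.
  have l0 : 0 < l by rewrite invr_gt0.
  have sk : smooth (kern moll l) by apply: smooth_kern; exact: smooth1_moll.
  have bk : bsupp (kern moll l) by apply: bsupp_kern => //; exact: moll_ge1.
  exists (fun x => (mass^-1 * l ^+ n) * conv e (kern moll l) x).
    by apply: smoothZ; exact: smooth_conv.
  move=> y sub; split; last by rewrite (fE y r r0 sub) /wmean; exact: mulrA.
  have sc : smooth (conv e (kern moll l)) by exact: smooth_conv.
  transitivity (\sum_i (mass^-1 * l ^+ n) * partial i (partial i (conv e (kern moll l))) y).
    apply: eq_bigr => i _; rewrite (partialZ i _ sc).
    by rewrite (partialZ i _ (smooth_partial i sc)).
  rewrite -mulr_sumr -[X in _ * X]/(laplacian _ y) laplacian_conv // conv_test_eq0 ?mulr0 //.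
  apply: He; first exact: smooth_reflect.
  exists y, r; split; first exact: sub.
  move=> z rz; apply: kern_supp => //; first exact: moll_ge1.
  by rewrite /l invrK enormBC.
move=> x Ox ce; have [r r0 rO] := nbhs_cball (open_nbhs_nbhs (conj oO Ox)).
apply/eqP; rewrite -subr_eq0 -normr_le0; apply/ler_addgt0Pl => eps eps0; rewrite addr0.
have : nbhs x [set y | `|e x - e y| < eps].
  have : nbhs x (e @^-1` ball (e x) eps) by apply: ce; exact: nbhsx_ballx.
  by apply: filterS => y; rewrite /= -ball_normE.
move=> /nbhs_eball[s s0 sP].
pose q := Num.min r s.
have q0 : 0 < q by rewrite lt_min r0.
have qO : [set y | enorm (y - x) <= q] `<=` O.
  by move=> y /= yq; apply: rO; apply: (le_trans yq); rewrite ge_min lexx.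
have qi : 0 < q^-1 by rewrite invr_gt0.
have Lm : L1 (fun y => moll (q^-1 ^+ 2 * sqd x y)).
  apply: L1_bsupp.
    apply: smooth_continuous; apply: (@smooth_radial (fun s => moll (q^-1 ^+ 2 * s))).
    by apply: smooth1_scale; exact: smooth1_moll.
  exists (q + enorm x) => y qy; apply: moll_ge1; rewrite sqd_enorm -exprMn -[leLHS](expr1n _ 2).
  rewrite ler_sqr ?nnegrE ?mulr_ge0 ?enorm_ge0 ?(ltW qi) // mulrC ler_pdivlMr // mul1r.
  have := enormD (y - x) x; rewrite subrK; lra.
rewrite (@fE x q) // wmeanE.
have -> : mass^-1 * (q^-1 ^+ n * Int (fun y => e y * moll (q^-1 ^+ 2 * sqd x y))) - e x =
    mass^-1 * (q^-1 ^+ n * Int (fun y => e y * moll (q^-1 ^+ 2 * sqd x y) - e x * moll (q^-1 ^+ 2 * sqd x y))).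
  rewrite IntB; [|exact: L1_moll|exact: L1Z].
  by rewrite IntZ // mulrBr [q^-1 ^+ n * (e x * _)]mulrCA Int_moll // mulrBr [_ * (e x * _)]mulrCA mulVf // mulr1.
have Ld : L1 (fun y => e y * moll (q^-1 ^+ 2 * sqd x y) - e x * moll (q^-1 ^+ 2 * sqd x y)).
  by apply: L1B; [exact: L1_moll|exact: L1Z].
rewrite !normrM (gtr0_norm (_ : 0 < mass^-1)) ?invr_gt0 ?mass_gt0 // gtr0_norm ?exprn_gt0 //.
rewrite mulrC ler_pdivrMr ?mass_gt0 // -{1}(Int_moll x qi) mulrCA ler_wpM2l ?exprn_ge0 ?(ltW qi) //.
apply: (le_trans (abs_Int Ld)); rewrite -IntZ //.
apply: le_Int; [exact: L1_abs|exact: L1Z|].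
move=> y; rewrite -mulrBl normrM (ger0_norm (moll_ge0 _)).
have [yq|yq] := ltP (enorm (y - x)) q.
  apply: ler_wpM2r; first exact: moll_ge0.
  rewrite distrC; apply: ltW; apply: sP; apply: (lt_le_trans yq).
  by rewrite ge_min lexx orbT.
rewrite moll_ge1 ?mulr0 // sqd_enorm -exprMn -[leLHS](expr1n _ 2).
by rewrite ler_sqr ?nnegrE ?mulr_ge0 ?enorm_ge0 ?(ltW qi) // mulrC ler_pdivlMr // mul1r.
Qed.

Lemma loc_harm_uniform (O : set 'rV[R]_n) f : open O ->
  (forall r, 0 < r -> exists2 E, smooth E & forall x, [set y | enorm (y - x) <= r] `<=` O ->
      laplacian E x = 0 /\ f x = E x) -> loc_harm O f.
Proof.
move=> oO H x Ox; have [r r0 rO] := nbhs_cball (open_nbhs_nbhs (conj oO Ox)).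
have [E sE HE] := H (r / 2) (divr_gt0 r0 (ltr0Sn _ 1)).
exists (r / 2), E; split => //; first by rewrite divr_gt0.
move=> y xy; apply: HE => z /= zy; apply: rO => /=.
rewrite -(subrK y z) -addrA; apply: (le_trans (enormD _ _)).
by rewrite [leRHS]splitr; apply: lerD => //; exact: ltW.
Qed.

End weyl.

(** * Unique continuation and the maximum principle *)

Section unique_continuation.
Context {R : realType} {n : nat}.
Implicit Types (e f g : 'rV[R]_n -> R) (x y c : 'rV[R]_n).

Lemma continuous_bigsum (I : Type) (r : seq I) (F : I -> 'rV[R]_n -> R) :
  (forall i, continuous (F i)) -> continuous (fun x => \sum_(i <- r) F i x).
Proof.
move=> cF; elim: r => [|a r IH].
  by under eq_fun do rewrite big_nil; exact: cst_continuous.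
under eq_fun do rewrite big_cons.
by move=> x; apply: (@continuousD _ _ _ (F a) (fun x => \sum_(j <- r) F j x)); [exact: cF|exact: IH].
Qed.

(* Green's identity against the radial weight: the Euler field is symmetric on
   functions that are harmonic on the unit ball. *)
Lemma euler_symmetric f g : smooth f -> smooth g ->
  (forall z, enorm z < 1 -> laplacian f z = 0) ->
  (forall z, enorm z < 1 -> laplacian g z = 0) ->
  Int (fun z => kern moll 1 z * (\sum_i z 0 i * (partial i f z * g z - f z * partial i g z))) = 0.
Proof.
move=> sf sg hf hg.
have sP : smooth (kern Phi 1 : 'rV[R]_n -> R) by apply: smooth_kern; exact: smooth1_Phi.
have bP : bsupp (kern Phi 1 : 'rV[R]_n -> R) by apply: bsupp_kern => //; exact: Phi_ge1.
have sW i : smooth (fun z => partial i f z * g z - f z * partial i g z).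
  by apply: smoothB; apply: smoothM => //; exact: smooth_partial.
have dP (i : 'I_n) (z : 'rV[R]_n) : partial i (kern Phi 1) z = - (kern moll 1 z * z 0 i).
  have sS : smooth1 (fun s : R => Phi (1 ^+ 2 * s)) by apply: smooth1_scale; exact: smooth1_Phi.
  have -> := @partial_radial _ _ _ 0 i sS; rewrite /kern.
  rewrite derive1_scale; last exact: smooth1_Phi.
  by rewrite derive1_Phi expr1n mxE subr0; field.
have H : Int (fun z => \sum_i partial i (fun z => kern Phi 1 z * (partial i f z * g z - f z * partial i g z)) z) = 0.
  rewrite Int_sum => [|i].
    rewrite big1 // => i _; apply: Int_partial_smooth; first exact: smoothM.
    exact: bsuppMl.
  apply: L1_bsupp; first by apply: smooth_continuous; apply: smooth_partial; exact: smoothM.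
  by apply: bsupp_partial; exact: bsuppMl.
apply/eqP; rewrite -oppr_eq0; apply/eqP; rewrite -IntN; last first.
  apply: L1_bsupp.
    apply: smooth_continuous; apply: smoothM; first by apply: smooth_kern; exact: smooth1_moll.
    apply: smooth_sum => i; apply: smoothM; first exact: smooth_coord.
    exact: sW.
  by apply: bsuppMl; apply: bsupp_kern => //; exact: moll_ge1.
rewrite -[RHS]H; congr Int; apply/funext => z.
have E i : partial i (fun z => kern Phi 1 z * (partial i f z * g z - f z * partial i g z)) z =
   - (kern moll 1 z * (z 0 i * (partial i f z * g z - f z * partial i g z))) +
   kern Phi 1 z * (partial i (partial i f) z * g z - f z * partial i (partial i g) z).
  have df y : differentiable f y by exact: smooth_diff.
  have dg y : differentiable g y by exact: smooth_diff.
  have dfi y : differentiable (partial i f) y by apply: smooth_diff; exact: smooth_partial.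
  have dgi y : differentiable (partial i g) y by apply: smooth_diff; exact: smooth_partial.
  have M1 := @partialM _ _ i (kern Phi 1) _ (fun y => smooth_diff y sP) (fun y => smooth_diff y (sW i)).
  have M2 := partialM i dfi dg.
  have M3 := partialM i df dgi.
  have s2 : smooth (fun z => partial i f z * g z) by apply: smoothM => //; exact: smooth_partial.
  have s3 : smooth (fun z => f z * partial i g z) by apply: smoothM => //; exact: smooth_partial.
  have M4 := partialD i (fun y => smooth_diff y s2) (fun y => smooth_diff y (smoothN s3)).
  have M5 := partialN i (fun y => smooth_diff y s3).
  rewrite M1 M4 M5 M2 M3 dP.
  move: (kern moll 1 z) (kern Phi 1 z) (z 0 i) (f z) (g z) => a b t u v.
  by move: (partial i (partial i f) z) (partial i (partial i g) z) (partial i f z) (partial i g z) => p q r s; ring.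
have L (k u v : R) (p q : 'I_n -> R) : (\sum_i p i = 0 /\ \sum_i q i = 0) \/ k = 0 ->
    \sum_i k * (p i * v - u * q i) = 0.
  rewrite -mulr_sumr sumrB -mulr_suml -mulr_sumr.
  by move=> [[-> ->]|->]; rewrite ?mul0r // mulr0 subrr mulr0.
rewrite (eq_bigr _ (fun i _ => E i)) big_split /= sumrN -mulr_sumr -[LHS]addr0; congr (_ + _).
apply/esym/L; have [z1|z1] := ltP (enorm z) 1.
  by left; split; [exact: (hf z z1)|exact: (hg z z1)].
by right; apply: kern_supp; [exact: Phi_ge1|exact: ltr01|rewrite invr1].
Qed.

(** A three spheres principle. The weighted integral of e(y + r t z) e(y + (r/t) z) has zero
    derivative in t by [euler_symmetric]. At t = r/R0 the first factor only sees radii below r^2/R0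
    < r0, where [e] vanishes; at t = 1 the integrand is a weighted square. *)
Lemma uc_step e y (R0 r0 r : R) : smooth e ->
  (forall z, eball y R0 z -> laplacian e z = 0) ->
  0 < r0 -> 0 < r -> r < R0 -> r ^+ 2 < r0 * R0 ->
  (forall z, eball y r0 z -> e z = 0) -> forall z, eball y r z -> e z = 0.
Proof.
move=> se he r00 r_gt0 rR rr e0.
have R00 : 0 < R0 by exact: lt_trans rR.
(* tau in [r / R0, 1] parametrises pairs of radii r tau, r / tau of fixed product *)
pose t1 := r / R0; have t10 : 0 < t1 by rewrite divr_gt0.
have t11 : t1 < 1 by rewrite ltr_pdivrMr // mul1r.
have rt1 : r * t1 < r0 by rewrite /t1 mulrA ltr_pdivrMr // -expr2.
pose F t z := kern moll 1 z * (e (y + (r * t) *: z) * e (y + (r / t) *: z)).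
have sk : smooth (kern moll 1 : 'rV[R]_n -> R) by apply: smooth_kern; exact: smooth1_moll.
have bk : bsupp (kern moll 1 : 'rV[R]_n -> R) by apply: bsupp_kern => //; exact: moll_ge1.
have sF t : smooth (F t).
  by apply: smoothM => //; apply: smoothM; exact: smooth_affine.
have LF t : L1 (F t) by apply: L1_bsupp; [exact: smooth_continuous|exact: bsuppMl].
pose A t := fun z => e (y + (r * t) *: z).
pose B t := fun z => e (y + (r / t) *: z).
have sA t : smooth (A t) by exact: smooth_affine.
have sB t : smooth (B t) by exact: smooth_affine.
pose G t z := t^-1 * (kern moll 1 z * (\sum_i z 0 i * (partial i (A t) z * B t z - A t z * partial i (B t) z))).
have dl (a : R) z : is_derive a 1 (fun a => e (y + a *: z)) (\sum_i z 0 i * partial i e (y + a *: z)).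
  have [d1 d2] := @derivable_line _ _ e y z a (smooth_diff _ se).
  by apply: DeriveDef => //; rewrite -derive1E.
have dF (t : R) z : 0 < t -> is_derive t 1 (fun t => F t z) (G t z).
  move=> t0; have tn : t != 0 by rewrite gt_eqF.
  have i1 : is_derive t 1 (fun t : R => r * t) r.
    by apply: (is_derive_eq (is_deriveZ r (is_derive_id t 1))); rewrite /GRing.scale /= mulr1.
  have i2 : is_derive t 1 (fun t : R => r / t) (- (r / t ^+ 2)).
    apply: (is_derive_eq (is_deriveZ r (@is_deriveV R id t 1 1 tn (is_derive_id t 1)))).
    by rewrite /GRing.scale /= mulr1 mulrN.
  have c1 := is_derive1_comp (dl (r * t) z) i1.
  have c2 := @is_derive1_comp R (fun a => e (y + a *: z)) (fun t => r / t) t _ _ (dl (r / t) z) i2.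
  apply: (is_derive_eq (is_deriveZ (kern moll 1 z) (is_deriveM c1 c2))).
  have PA i : partial i (A t) z = (r * t) * partial i e (y + (r * t) *: z).
    by rewrite /A partial_affine // => w; exact: smooth_diff.
  have PB i : partial i (B t) z = (r / t) * partial i e (y + (r / t) *: z).
    by rewrite /B partial_affine // => w; exact: smooth_diff.
  apply: (@etrans _ _ (kern moll 1 z *
      (A t z * ((\sum_i z 0 i * partial i e (y + (r / t) *: z)) * - (r / t ^+ 2)) +
       B t z * ((\sum_i z 0 i * partial i e (y + (r * t) *: z)) * r)))) => //.
  have SE : \sum_i z 0 i * (partial i (A t) z * B t z - A t z * partial i (B t) z) =
      r * t * B t z * (\sum_i z 0 i * partial i e (y + (r * t) *: z)) -
      r / t * A t z * (\sum_i z 0 i * partial i e (y + (r / t) *: z)).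
    rewrite !mulr_sumr -sumrB; apply: eq_bigr => i _; rewrite PA PB.
    by move: (partial i e _) (partial i e _) (A t z) (B t z) (z 0 i) => p q u v w; ring.
  rewrite /G SE; move: (\sum_i _) (\sum_i _) (A t z) (B t z) (kern moll 1 z) => p q u v w.
  by field.
have G0 t : 0 < t -> t1 <= t <= 1 -> Int (G t) = 0.
  move=> t0 /andP[tt1 tt2]; rewrite IntZ; last first.
    apply: L1_bsupp; last exact: bsuppMl.
    apply: smooth_continuous; apply: smoothM => //; apply: smooth_sum => i.
    apply: smoothM; first exact: smooth_coord.
    by apply: smoothB; apply: smoothM => //; exact: smooth_partial.
  rewrite euler_symmetric ?mulr0 // => z z1; rewrite (laplacian_affine _ _ _ se) he ?mulr0 //.
    rewrite /eball/= [y + _]addrC addrK enormZ gtr0_norm ?mulr_gt0 //.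
    apply: le_lt_trans rR; rewrite -mulrA ler_piMr ?(ltW r_gt0) //.
    by rewrite mulr_ile1 ?enorm_ge0 ?(ltW t0) ?(ltW z1).
  rewrite /eball/= [y + _]addrC addrK enormZ gtr0_norm ?divr_gt0 //.
  have rtR : r / t <= R0 by rewrite ler_pdivrMr // mulrC -ler_pdivrMr.
  have [->|rt] := eqVneq (enorm z) 0; first by rewrite mulr0.
  apply: lt_le_trans rtR; rewrite gtr_pMr // divr_gt0 //.
have bound : exists2 C, 0 <= C & forall t z, t \in `](t1 / 2), 2[ -> `|G t z| <= C * \1_(eball (0 : 'rV[R]_n) 1) z.
  (* Both radii r t and r/t stay below [r3] for t between t1/2 and 2. *)
  pose r3 := 2 * r / t1 + 2 * r.
  have r30 : 0 < r3 by rewrite addr_gt0 ?divr_gt0 ?mulr_gt0.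
  have cb (h : 'rV[R]_n -> R) : continuous h -> exists2 C, 0 <= C & forall w, enorm (w - y) <= r3 -> `|h w| <= C.
    move=> ch; have cK : compact (h @` [set w | enorm (w - y) <= r3]).
      by apply: continuous_compact; [exact: continuous_subspaceT|exact: (@compact_cball R n y r3)].
    have [N [_ HN]] := compact_bounded cK.
    exists (Num.max 0 (N + 1)) => [|w wr]; first by rewrite le_max lexx.
    by rewrite le_max; apply/orP; right; apply: (HN (N + 1)); [rewrite ltrDl|exists w].
  have [Ce Ce0 HCe] := cb e (smooth_continuous se).
  have cS : continuous (fun w => \sum_i `|partial i e w|).
    apply: continuous_bigsum => i w; apply: (@continuous_comp _ _ _ (partial i e) (fun s : R => `|s|)).
      exact: smooth_continuous (smooth_partial i se) w.
    exact: norm_continuous.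
  have [Cp Cp0 HCp] := cb (fun w => \sum_i `|partial i e w|) cS.
  have [Cm Cm0 HCm] := bsupp_bounded (smooth_continuous sk) bk.
  exists ((t1 / 2)^-1 * (Cm * (n%:R * (r3 * Cp * Ce + Ce * (r3 * Cp))))).
    have r3' := ltW r30.
    have t1' : 0 <= (t1 / 2)^-1 by rewrite invr_ge0 divr_ge0 // ltW.
    by repeat (apply: mulr_ge0 => // || apply: addr_ge0 => //).
  move=> t z; rewrite in_itv /= => /andP[ta tb].
  have t0 : 0 < t by apply: lt_trans ta; rewrite divr_gt0.
  rewrite indicE; case: (boolP (z \in _)) => [|nz]; last first.
    rewrite mulr0 /G (@kern_supp _ _ moll) ?mul0r ?mulr0 ?normr0 //; first exact: moll_ge1.
    rewrite invr1 leNgt; apply/negP => z1; move/negP: nz; apply.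
    by rewrite inE /eball/= subr0.
  rewrite inE /eball/= subr0 => z1; rewrite mulr1 /G.
  have a1 : r * t <= r3.
    have h1 : 0 <= 2 * r / t1 by rewrite divr_ge0 ?(ltW t10) // mulr_ge0 // ltW.
    have h2 : r * t <= r * 2 by rewrite (ler_pM2l r_gt0) ltW.
    rewrite /r3; lra.
  have a2 : r / t <= r3.
    have h1 : 0 <= 2 * r by rewrite mulr_ge0 // ltW.
    have h2 : r / t <= r * (2 / t1).
      by rewrite (ler_pM2l r_gt0) -[2 / t1]invrK lef_pV2 ?posrE ?invr_gt0 ?divr_gt0 // invf_div ltW.
    have h3 : 2 * r / t1 = r * (2 / t1) by ring.
    rewrite /r3 h3; lra.
  have zr a : 0 < a -> a <= r3 -> enorm (y + a *: z - y) <= r3.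
    move=> a0 ar; rewrite [y + _]addrC addrK enormZ gtr0_norm //.
    by apply: le_trans ar; rewrite ler_piMr // ltW.
  have rt0 : 0 < r * t by rewrite mulr_gt0.
  have rt0' : 0 < r / t by rewrite divr_gt0.
  have PS (i : 'I_n) w : `|partial i e w| <= `|\sum_i `|partial i e w| |.
    rewrite [leRHS]ger0_norm; last by apply: sumr_ge0.
    by rewrite (bigD1 i) //= lerDl sumr_ge0.
  have PA i : `|partial i (A t) z| <= r3 * Cp.
    rewrite /A partial_affine; last by move=> w; exact: smooth_diff.
    rewrite normrM gtr0_norm //; apply: ler_pM => //; first exact: ltW.
    exact: le_trans (PS _ _) (HCp _ (zr _ rt0 a1)).
  have PB i : `|partial i (B t) z| <= r3 * Cp.
    rewrite /B partial_affine; last by move=> w; exact: smooth_diff.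
    rewrite normrM gtr0_norm //; apply: ler_pM => //; first exact: ltW.
    exact: le_trans (PS _ _) (HCp _ (zr _ rt0' a2)).
  rewrite normrM gtr0_norm ?invr_gt0 //; apply: ler_pM => //; first by rewrite invr_ge0 ltW.
    by rewrite lef_pV2 ?posrE ?divr_gt0 // ltW.
  rewrite normrM; apply: ler_pM => //.
  apply: (le_trans (ler_norm_sum _ _ _)).
  rewrite -[X in X%:R * _]card_ord mulr_natl -sumr_const; apply: ler_sum => i _.
  rewrite normrM -[leRHS]mul1r; apply: ler_pM => //.
    by apply: (le_trans (coord_le_enorm _ _)); exact: ltW.
  apply: (le_trans (ler_normB _ _)); rewrite !normrM; apply: lerD; apply: ler_pM => //.
    exact: HCe (zr _ rt0' a2).
  exact: HCe (zr _ rt0 a1).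
have [C C0 HC] := bound.
have key (t : R) : t1 <= t <= 1 -> is_derive t 1 (fun t => Int (F t)) (0 : R).
  move=> tI; have /andP[ta tb] := tI; have t0 : 0 < t by exact: lt_le_trans ta.
  have i1 : t \in `](t1 / 2), 2[.
    rewrite in_itv /=; apply/andP; split; last by rewrite (le_lt_trans tb) // ltr1n.
    by apply: lt_le_trans ta; rewrite ltr_pdivrMr // ltr_pMr // ltr1n.
  have pos s : s \in `](t1 / 2), 2[ -> 0 < s.
    by rewrite in_itv /= => /andP[+ _]; apply: lt_trans; rewrite divr_gt0.
  have dE s z : 0 < s -> derive1 (F^~ z) s = G s z.
    by move=> s0; rewrite derive1E; have [_ ->] := dF s z s0.
  have dd s z : s \in `](t1 / 2), 2[ -> derivable (F^~ z) s 1.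
    by move=> /pos s0; have [] := dF s z s0.
  have bd s z : s \in `](t1 / 2), 2[ -> `|derive1 (F^~ z) s| <= C * \1_(eball (0 : 'rV[R]_n) 1) z.
    by move=> sI; rewrite dE ?HC // pos.
  have [d1 d2] := @Int_derive _ _ F _ (t1 / 2) 2 t i1 dd (fun s _ => LF s)
     (L1Z C (L1_eball 0 1)) bd.
  apply: DeriveDef => //; rewrite -derive1E d2 -[RHS](G0 t t0 tI).
  by congr Int; apply/funext => z; rewrite dE.
have [s _ E] : exists2 s, s \in `]t1, 1[ & Int (F 1) - Int (F t1) = 0 * (1 - t1).
  apply: (@MVT R (fun t => Int (F t)) (fun=> 0)) => //.
    by move=> s; rewrite in_itv /= => /andP[s1 s2]; apply: key; rewrite !ltW.
  apply: continuous_in_subspaceT => s; rewrite inE /= in_itv /= => sI.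
  apply: differentiable_continuous; apply/derivable1_diffP.
  by have [] := key s sI.
have Ft1 : Int (F t1) = 0.
  rewrite -[RHS](@Int0 R n); congr Int; apply/funext => z; rewrite /F.
  have [z1|z1] := ltP (enorm z) 1; last first.
    by rewrite (@kern_supp _ _ moll) ?mul0r ?invr1 //; exact: moll_ge1.
  rewrite e0 ?mul0r ?mulr0 // /eball/= [y + _]addrC addrK enormZ (gtr0_norm (mulr_gt0 r_gt0 t10)).
  apply: le_lt_trans rt1; apply: ler_piMr; last exact: ltW.
  by apply: mulr_ge0; exact: ltW.
have F1 : Int (F 1) = 0 by move/eqP: E; rewrite mul0r Ft1 subr0 => /eqP.
have Fz := Int_cont_eq0 (smooth_continuous (sF 1)) (LF 1) _ F1.
move=> z zr; have := Fz _ (r^-1 *: (z - y)).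
rewrite /F mulr1 divr1 scalerA mulfV ?gt_eqF // scale1r [y + _]addrC subrK => H.
have kp : 0 < kern moll 1 (r^-1 *: (z - y)).
  rewrite /kern moll_gt0 // expr1n mul1r sqd0 enormZ gtr0_norm ?invr_gt0 //.
  by rewrite expr_lt1 ?mulr_ge0 ?invr_ge0 ?enorm_ge0 ?(ltW r_gt0) // mulrC ltr_pdivrMr // mul1r.
have : kern moll 1 (r^-1 *: (z - y)) * (e z * e z) == 0.
  apply/eqP; apply: H => w; apply: mulr_ge0; first exact: kern_moll_ge0.
  by rewrite -expr2 sqr_ge0.
by rewrite mulf_eq0 (gt_eqF kp) mulf_eq0 orbb => /eqP.
Qed.

(** [uc_step] enlarges a radius s of vanishing to any value below the geometric mean of s and R0,
    which exceeds s as long as s < R0; the supremum of these radii is therefore R0. *)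
Lemma uc_ball e y (R0 r0 : R) : smooth e ->
  (forall z, eball y R0 z -> laplacian e z = 0) -> 0 < r0 -> r0 <= R0 ->
  (forall z, eball y r0 z -> e z = 0) -> forall z, eball y R0 z -> e z = 0.
Proof.
move=> se he r00 rR e0.
pose S := [set r : R | r0 <= r <= R0 /\ forall z, eball y r z -> e z = 0].
have S0 : S r0 by split => //; rewrite lexx.
have hS : has_sup S by split; [exists r0|exists R0 => r [/andP[]]].
have r0s : r0 <= sup S by exact: sup_upper_bound.
have s0 : 0 < sup S by exact: lt_le_trans r0s.
have sR : sup S <= R0 by apply: ge_sup; [exists r0|move=> r [/andP[]]].
have eS z : eball y (sup S) z -> e z = 0.
  move=> zs; have d0 : 0 < sup S - enorm (z - y) by rewrite subr_gt0.
  have [r [rI rz] /ltW] := sup_adherent d0 hS.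
  rewrite opprB addrCA subrr addr0 le_eqVlt => /predU1P[E|]; last exact: rz.
  have [r' [_ rz'] Hr'] := sup_adherent (divr_gt0 d0 (ltr0Sn _ 1)) hS.
  by apply: rz'; apply: lt_trans Hr'; lra.
have [sRlt|Rs] := ltP (sup S) R0; last first.
  by move=> z zR; apply: eS; exact: lt_le_trans Rs.
exfalso.
pose r := (sup S + Num.min R0 (sup S * R0 / sup S)) / 2.
have R00 : 0 < R0 by exact: lt_trans sRlt.
(* Small enough for (s + d/2)^2 < s R0, where s is the supremum. *)
pose d := Num.min (R0 - sup S) (sup S * (R0 - sup S) / (2 * (sup S + R0))).
have d0 : 0 < d.
  by rewrite lt_min subr_gt0 sRlt /= divr_gt0 ?mulr_gt0 ?subr_gt0 ?addr_gt0.
have d1 : d <= R0 - sup S by rewrite ge_min lexx.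
have d2 : d * (2 * (sup S + R0)) <= sup S * (R0 - sup S).
  by rewrite -ler_pdivlMr ?mulr_gt0 ?addr_gt0 // ge_min lexx orbT.
have := @uc_step e y R0 (sup S) (sup S + d / 2) se he s0 _ _ _ eS.
set r' := sup S + d / 2 => H.
have Sr' : S r'.
  split; first by rewrite /r'; lra.
  by apply: H; rewrite /r'; [lra|lra|nra].
have := sup_upper_bound hS Sr'; rewrite /r'; lra.
Qed.

Lemma loc_harm_ball (O : set 'rV[R]_n) e x : loc_harm O e -> O x ->
  exists2 r, 0 < r & forall z r', eball x r z -> 0 < r' ->
    (forall w, eball z r' w -> e w = 0) -> forall w, eball x r w -> e w = 0.
Proof.
move=> he Ox; have [r [f [r0 sf hf]]] := he x Ox.
(* For z in the ball of radius r/4 about [x], the ball of radius r/2 about z contains that ball and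
   stays in the ball of radius r about [x]. *)
exists (r / 4); first by rewrite divr_gt0.
move=> z r' zr r'0 e0 w wr.
have sub v : eball z (r / 2) v -> eball x r v.
  rewrite /eball/= => vz; rewrite -(subrK z v) -addrA.
  apply: (le_lt_trans (enormD _ _)); rewrite /eball/= in zr.
  by move: zr vz; set p := enorm _; set q := enorm _; lra.
have H : forall v, eball z (r / 2) v -> f v = 0.
  apply: (@uc_ball f z (r / 2) (Num.min r' (r / 2))) => //.
  - by move=> v /sub /hf[].
  - by rewrite lt_min r'0 divr_gt0.
  - by rewrite ge_min lexx orbT.
  - move=> v; rewrite /eball/= lt_min => /andP[v1 v2].
    by have [_ <-] := hf v (sub v v2); exact: e0.
have wz : eball z (r / 2) w.
  rewrite /eball/= -(subrK x w) -addrA; apply: (le_lt_trans (enormD _ _)).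
  rewrite (enormBC x z); rewrite /eball/= in zr wr.
  by move: zr wr; set p := enorm _; set q := enorm _; lra.
by have [_ ->] := hf w (sub w wz); exact: H.
Qed.

(** The points around which [e] vanishes form an open set, and [loc_harm_ball] makes it relatively
    closed in [O]. *)
Lemma unique_continuation (O : set 'rV[R]_n) e p (r : R) : open O -> connected O ->
  loc_harm O e -> O p -> 0 < r -> (forall z, eball p r z -> e z = 0) ->
  forall x, O x -> e x = 0.
Proof.
move=> oO cO he Op r0 ep.
pose Z := [set x | exists2 s, 0 < s & forall z, eball x s z -> e z = 0].
have oZ : open Z.
  rewrite openE => x [s s0 sx].
  apply: filterS (eball_nbhs x (divr_gt0 s0 (ltr0Sn _ 1))) => z zx.
  exists (s / 2); first by rewrite divr_gt0.
  move=> w wz; apply: sx; rewrite /eball/= -(subrK z w) -addrA.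
  apply: (le_lt_trans (enormD _ _)); rewrite /eball/= in zx wz.
  by move: zx wz; set a := enorm _; set b := enorm _; lra.
have : Z `&` O = O.
  apply: cO.
  - by exists p; split => //; exists r.
  - by exists Z => //; rewrite setIC.
  - exists (closure Z); first exact: closed_closure.
    apply/seteqP; split=> x [zx Ox]; split => //; first exact: subset_closure.
    have [s s0 H] := loc_harm_ball he zx.
    have [z [[s' s'0 z0] zs]] := Ox _ (eball_nbhs x s0).
    by exists s => //; exact: (H z s').
move=> ZO x Ox; have [s s0 sx] : Z x by rewrite -ZO in Ox; case: Ox.
exact/sx/eball_center.
Qed.

End unique_continuation.

(** * Maximum principle and gluing of smooth functions *)

Section maximum_principle.
Context {R : realType} {n : nat}.
Implicit Types (w f g h : 'rV[R]_n -> R) (x y : 'rV[R]_n) (O : set 'rV[R]_n).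

Definition ebounded O := exists M, forall x, O x -> enorm x <= M.

Lemma ebounded_closure O M : (forall x, O x -> enorm x <= M) ->
  forall x, closure O x -> enorm x <= M.
Proof.
move=> OM x Ox; have : closure [set y : 'rV[R]_n | enorm (y - 0) <= M] x.
  by apply: closure_subset Ox => y /OM; rewrite /= subr0.
by rewrite -(closure_id _).1 /= ?subr0 //; exact: closed_cball.
Qed.

Lemma compact_closure O : ebounded O -> compact (closure O).
Proof.
move=> [M OM]; apply: (@subclosed_compact _ _ [set y : 'rV[R]_n | enorm (y - 0) <= M]).
- exact: closed_closure.
- exact: compact_cball.
- by move=> x /(ebounded_closure OM) /=; rewrite subr0.
Qed.

Lemma attains_max (K : set 'rV[R]_n) f : compact K -> K !=set0 -> {within K, continuous f} ->
  exists2 x, K x & forall y, K y -> f y <= f x.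
Proof.
move=> cK K0 cf; have [c cK' H] := compact_EVT_max K0 cK cf.
by exists c; [rewrite inE in cK'|move=> y Ky; apply: H; rewrite inE].
Qed.

Lemma near_pos g x : continuous g -> 0 < g x ->
  exists2 r, 0 < r & forall y, eball x r y -> 0 < g y.
Proof.
move=> cg g0; have [r r0 H] := continuous_eball x cg g0.
by exists r => // y /H; rewrite ltr_distl subrr => /andP[].
Qed.

(** Along the one of the directions ['e_i] and its opposite in which the first derivative is
    nonnegative, a positive second derivative would make [w] increase strictly. *)
Lemma second_derivative_max w x i : smooth w ->
  (exists2 r, 0 < r & forall y, eball x r y -> w y <= w x) ->
  partial i (partial i w) x <= 0.
Proof.
move=> sw [r r0 Hr]; rewrite leNgt; apply/negP => pos.
have sp := smooth_partial i sw.
have [s s0 Hs] := near_pos (smooth_continuous (smooth_partial i sp)) pos.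
pose h := Num.min r s / 2.
have m0 : 0 < Num.min r s by rewrite lt_min r0.
have h0 : 0 < h by rewrite divr_gt0.
have hm : h < Num.min r s by rewrite ltr_pdivrMr // ltr_pMr // ltr1n.
have hr : h < r by apply: lt_le_trans hm _; rewrite ge_min lexx.
have hs : h < s by apply: lt_le_trans hm _; rewrite ge_min lexx orbT.
have mv (a : R) k f : `|a| = 1 -> smooth f -> 0 < k ->
    exists2 q, 0 < q < k & f (x + k *: (a *: 'e_i)) - f x = k * (a * partial i f (x + q *: (a *: 'e_i))).
  move=> a1 sf k0; have [q qk E] := mvt_line x (a *: 'e_i) (fun y => smooth_diff y sf) k0.
  exists q => //; rewrite E (bigD1 i) //= big1 ?addr0 => [|j ji].
    by rewrite !mxE !eqxx mulr1.
  by rewrite !mxE (negbTE ji) andbF mulr0 mul0r.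
have inb (a : R) k t : `|a| = 1 -> 0 < k -> k < t -> eball x t (x + k *: (a *: 'e_i)).
  move=> a1 k0 kt; rewrite /eball/= [x + _]addrC addrK !enormZ enorm_delta a1 !mulr1.
  by rewrite gtr0_norm.
have bad (a : R) : `|a| = 1 -> a * a = 1 -> 0 <= a * partial i w x -> False.
  move=> a1 aa ap.
  have [q /andP[q0 qh] E] := mv a h w a1 sw h0.
  have [p /andP[p0 pq] E2] := mv a q _ a1 sp q0.
  have H1 : w (x + h *: (a *: 'e_i)) <= w x by apply: Hr; exact: inb.
  have H2 : 0 < partial i (partial i w) (x + p *: (a *: 'e_i)).
    by apply: Hs; apply: inb => //; rewrite (lt_trans pq) // (lt_trans qh).
  have H3 : a * partial i w (x + q *: (a *: 'e_i)) =
      a * partial i w x + q * partial i (partial i w) (x + p *: (a *: 'e_i)).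
    have -> : partial i w (x + q *: (a *: 'e_i)) =
       partial i w x + q * (a * partial i (partial i w) (x + p *: (a *: 'e_i))) by rewrite -E2 addrCA subrr addr0.
    by rewrite mulrDr; congr (_ + _); rewrite [a * (q * _)]mulrCA [a * (a * _)]mulrA aa mul1r.
  move: E; rewrite H3 => E.
  have : 0 < w (x + h *: (a *: 'e_i)) - w x.
    rewrite E; apply: mulr_gt0 => //; apply: ltr_wpDl => //; exact: mulr_gt0.
  by rewrite subr_gt0 ltNge H1.
have [h1|h1] := leP 0 (partial i w x).
  by apply: (bad 1); rewrite ?normr1 ?mulr1 ?mul1r.
apply: (bad (-1)); rewrite ?normrN ?normr1 ?mulN1r ?opprK //.
by rewrite oppr_ge0 ltW.
Qed.

Lemma laplacian_local_max w x : smooth w ->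
  (exists2 r, 0 < r & forall y, eball x r y -> w y <= w x) -> laplacian w x <= 0.
Proof.
move=> sw H; rewrite -oppr_ge0 -sumrN; apply: sumr_ge0 => i _; rewrite oppr_ge0.
exact: second_derivative_max.
Qed.

Lemma laplacianD f g x : smooth f -> smooth g ->
  laplacian (fun y => f y + g y) x = laplacian f x + laplacian g x.
Proof.
move=> sf sg; rewrite /laplacian -big_split; apply: eq_bigr => i _ /=.
have E1 := partialD i (fun y => smooth_diff y sf) (fun y => smooth_diff y sg).
have E2 := partialD i (fun y => smooth_diff y (smooth_partial i sf)) (fun y => smooth_diff y (smooth_partial i sg)).
by rewrite E1 E2.
Qed.

Lemma laplacianZ (k : R) f x : smooth f -> laplacian (fun y => k * f y) x = k * laplacian f x.
Proof.
move=> sf; rewrite /laplacian mulr_sumr; apply: eq_bigr => i _ /=.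
by rewrite (partialZ i k sf) (partialZ i k (smooth_partial i sf)).
Qed.

Lemma laplacian_sqd c x : laplacian (sqd c) x = 2 * n%:R.
Proof.
rewrite /laplacian (eq_bigr (fun=> 2)) => [|i _].
  by rewrite sumr_const card_ord mulr_natr.
rewrite partial_sqd (partialZ i 2 (smooth_coordB c i)) partial_coordB eqxx mulr1n.
by rewrite mulr1.
Qed.

(** Adding a small multiple of |x|^2 makes the Laplacian positive, which excludes interior maxima;
    on the bounded set [O] this addition stays below a prescribed [e]. *)
Lemma max_principle O w m : (0 < n)%N -> open O -> ebounded O -> smooth w ->
  (forall x, O x -> 0 <= laplacian w x) -> (forall x, boundary O x -> w x <= m) ->
  forall x, O x -> w x <= m.
Proof.
move=> n0 oO [M OM] sw lw wm x Ox.
apply/ler_addgt0Pr => e e0.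
pose d := e / (M ^+ 2 + 1).
have M1 : 0 < M ^+ 2 + 1 by rewrite ltr_wpDl ?sqr_ge0.
have d0 : 0 < d by rewrite divr_gt0.
pose v y := w y + d * sqd 0 y.
have sv : smooth v by apply: smoothD => //; apply: smoothZ; exact: smooth_sqd.
have [z Kz vz] : exists2 z, closure O z & forall y, closure O y -> v y <= v z.
  apply: attains_max; first by apply: compact_closure; exists M.
    by exists x; exact: subset_closure.
  by apply: continuous_subspaceT; exact: smooth_continuous.
have nOz : ~ O z.
  move=> Oz; have [r r0 rO] := nbhs_eball (open_nbhs_nbhs (conj oO Oz)).
  have : laplacian v z <= 0.
    by apply: laplacian_local_max => //; exists r => // y /rO Oy; apply: vz; exact: subset_closure.
  rewrite /v laplacianD //; last by apply: smoothZ; exact: smooth_sqd.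
  rewrite (laplacianZ d z (smooth_sqd 0)) laplacian_sqd leNgt => /negP; apply.
  by rewrite ltr_wpDl ?lw // mulr_gt0 // mulr_gt0 // ltr0n.
have bz : boundary O z by rewrite boundary_open.
have vx : v x <= v z by apply: vz; exact: subset_closure.
have xs : 0 <= d * sqd 0 x by rewrite mulr_ge0 ?sqd_ge0 // ltW.
have zs : d * sqd 0 z <= e.
  rewrite /d mulrAC ler_pdivrMr // ler_wpM2l ?(ltW e0) //.
  have M0 : 0 <= M by apply: le_trans (OM _ Ox); exact: enorm_ge0.
  have zM := ebounded_closure OM Kz.
  rewrite sqd0; apply: (@le_trans _ _ (M ^+ 2)); last by rewrite lerDl.
  by rewrite ler_sqr ?nnegrE ?enorm_ge0.
have := wm z bz; move: vx; rewrite /v; lra.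
Qed.

Lemma near_differentiable f g x : (\near x, f x = g x) -> differentiable f x ->
  differentiable g x.
Proof.
move=> fg /diff_locallyP[cd /eqaddoP E].
have gx : g x = f x by exact/esym/(nbhs_singleton fg).
have HL : g \o shift x = cst (g x) + 'd f x +o_ (0 : 'rV[R]_n) id.
  apply/eqaddoP => e e0; have := E e e0.
  have : nbhs (0 : 'rV[R]_n) [set v | f (v + x) = g (v + x)].
    have [r r0 Hr] := nbhs_eball fg.
    apply: filterS (eball_nbhs 0 r0) => v; rewrite /eball/= subr0 => vr.
    by apply: Hr; rewrite /eball/= addrK.
  apply: filterS2 => v /= fgv; rewrite gx.
  by have -> : (g \o shift x - (cst (f x) + 'd f x)) v = (f \o shift x - (cst (f x) + 'd f x)) v
    by rewrite /= /GRing.add /= /GRing.opp /= fgv.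
have dL := diff_unique cd HL.
by apply/diff_locallyP; rewrite dL.
Qed.

(** Serves for functions cut by an indicator, which agree locally with a smooth function or with
    0. *)
Lemma smooth_local h : (forall x, exists f (U : set 'rV[R]_n), [/\ smooth f, open U, U x &
  forall y, U y -> h y = f y]) -> smooth h.
Proof.
move=> H s x; have [f [U [sf oO Ox hf]]] := H x.
have E : forall y, U y -> foldr partial h s y = foldr partial f s y.
  elim: s => [|i s IH] y Oy /=; first exact: hf.
  exact: partial_open IH.
have NE : \near x, foldr partial f s x = foldr partial h s x.
  by apply: filterS (open_nbhs_nbhs (conj oO Ox)) => y /E ->.
exact: near_differentiable NE (sf s x).
Qed.

End maximum_principle.

(** * Serrin's theorem *)

Section serrin.
Context {R : realType} {n : nat}.
Implicit Types (w f g h : 'rV[R]_n -> R) (x y : 'rV[R]_n) (O : set 'rV[R]_n).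

Definition hess w i j x : R := partial i (partial j w) x.
Definition gsq w x : R := \sum_k partial k w x * partial k w x.

Lemma smooth_gsq w : smooth w -> smooth (gsq w).
Proof.
by move=> sw; apply: smooth_sum => k; apply: smoothM; exact: smooth_partial.
Qed.

Lemma gsq_grad w x : gsq w x = enorm (grad w x) ^+ 2.
Proof. by rewrite enorm_sqr; apply: eq_bigr => i _; rewrite mxE. Qed.

Lemma partial_gsq w i : smooth w ->
  partial i (gsq w) = fun x => \sum_k 2 * (partial k w x * partial i (partial k w) x).
Proof.
move=> sw; have sk k : smooth (partial k w) by exact: smooth_partial.
rewrite /gsq (partial_sum _ _ i (fun k => smoothM (sk k) (sk k))).
apply/funext => x; apply: eq_bigr => k _.
have E := partialM i (fun y => smooth_diff y (sk k)) (fun y => smooth_diff y (sk k)).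
by rewrite E; move: (partial i (partial k w) x) (partial k w x) => p q; ring.
Qed.

Lemma schwarz_fun w i j : smooth w -> partial i (partial j w) = partial j (partial i w).
Proof. by move=> sw; apply/funext => x; exact: schwarz. Qed.

Lemma partial_laplacian w k x : smooth w ->
  partial k (laplacian w) x = \sum_i partial i (partial i (partial k w)) x.
Proof.
move=> sw; have s2 i : smooth (partial i (partial i w)) by do 2 apply: smooth_partial.
rewrite /laplacian (partial_sum _ _ k s2); apply: eq_bigr => i _.
have -> : partial i (partial k w) = partial k (partial i w) by exact: schwarz_fun.
by apply: schwarz; exact: smooth_partial.
Qed.

(** Bochner's formula in flat space: by symmetry the third derivatives regroup into the gradient of
    the Laplacian. *)
Lemma laplacian_gsq w x : smooth w ->
  laplacian (gsq w) x = 2 * (\sum_i \sum_k hess w i k x * hess w i k x) +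
    2 * (\sum_k partial k w x * partial k (laplacian w) x).
Proof.
move=> sw; have sk k : smooth (partial k w) by exact: smooth_partial.
have ski i k : smooth (partial i (partial k w)) by exact: smooth_partial.
rewrite /laplacian.
transitivity (\sum_i \sum_k 2 * (hess w i k x * hess w i k x + partial k w x * partial i (partial i (partial k w)) x)).
  apply: eq_bigr => i _.
  have sM k : smooth (fun x => partial k w x * partial i (partial k w) x) by exact: smoothM.
  rewrite (partial_gsq i sw) (partial_sum _ _ i (fun k => smoothZ 2 (sM k))).
  apply: eq_bigr => k _; rewrite (partialZ i 2 (sM k)).
  have E := partialM i (fun y => smooth_diff y (sk k)) (fun y => smooth_diff y (ski i k)).
  by rewrite E.
under eq_bigr do rewrite -mulr_sumr big_split /=.
rewrite -mulr_sumr big_split /= mulrDr; congr (_ + _); congr (_ * _).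
rewrite exchange_big /=; apply: eq_bigr => k _.
by rewrite -mulr_sumr; congr (_ * _); rewrite partial_laplacian.
Qed.

(* Weinberger's P-function *)
Definition Pfun w x : R := gsq w x + - 2 * w x.

Lemma smooth_Pfun w : smooth w -> smooth (Pfun w).
Proof. by move=> sw; apply: smoothD; [exact: smooth_gsq|exact: smoothZ]. Qed.

Lemma partial_laplacian_const w O (k : R) x i : open O -> O x ->
  (forall y, O y -> laplacian w y = k) -> partial i (laplacian w) x = 0.
Proof. by move=> oO Ox lw; rewrite (@partial_open _ _ i _ (fun=> k) O x) // partial_cst. Qed.

Lemma sum_delta (i : 'I_n) (F : 'I_n -> R) : \sum_j F j * (i == j)%:R = F i.
Proof.
rewrite (bigD1 i) //= eqxx mulr1 big1 ?addr0 // => j ji.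
by rewrite eq_sym (negbTE ji) mulr0.
Qed.

Lemma sum_affine (p q r : 'I_n -> R) :
  \sum_i (p i - 2 * q i + r i) = \sum_i p i - 2 * \sum_i q i + \sum_i r i.
Proof. by rewrite big_split sumrB /= -mulr_sumr. Qed.

(** As the Hessian H has trace n, |H|^2 - n = |H - I|^2. So [Pfun w] is subharmonic, and its
    Laplacian vanishes only where H is the identity. *)
Lemma laplacian_Pfun w O x : open O -> O x -> smooth w ->
  (forall y, O y -> laplacian w y = n%:R) ->
  laplacian (Pfun w) x = 2 * \sum_i \sum_j (hess w i j x - (i == j)%:R) ^+ 2.
Proof.
move=> oO Ox sw lw.
rewrite /Pfun (laplacianD x (smooth_gsq sw) (smoothZ (-2) sw)) (laplacianZ (-2) x sw).
have Z : \sum_k partial k w x * partial k (laplacian w) x = 0.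
  by apply: big1 => k _; rewrite (partial_laplacian_const k oO Ox lw) mulr0.
have lw' : \sum_i hess w i i x = n%:R by exact: lw.
rewrite (laplacian_gsq x sw) Z mulr0 addr0 (lw x Ox).
have -> : \sum_i \sum_j (hess w i j x - (i == j)%:R) ^+ 2 =
    \sum_i (\sum_j hess w i j x * hess w i j x - 2 * hess w i i x + 1).
  apply: eq_bigr => i _.
  transitivity (\sum_j (hess w i j x * hess w i j x - 2 * (hess w i j x * (i == j)%:R) + (i == j)%:R * (i == j)%:R)).
    by apply: eq_bigr => j _; rewrite expr2; ring.
  rewrite sum_affine sum_delta; congr (_ + _).
  by rewrite (sum_delta i (fun j => (i == j)%:R)) eqxx.
rewrite (sum_affine _ (fun i => hess w i i x)) lw' sumr_const card_ord -[1 *+ n]/(n%:R).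
by move: (\sum_i \sum_k _) (n%:R : R) => p q; ring.
Qed.

Definition ydw w x : R := \sum_k x 0 k * partial k w x.

Lemma smooth_ydw w : smooth w -> smooth (ydw w).
Proof.
move=> sw; apply: smooth_sum => k; apply: smoothM; first exact: smooth_coord.
exact: smooth_partial.
Qed.

Lemma partial_ydw w i : smooth w ->
  partial i (ydw w) = fun x => partial i w x + \sum_k x 0 k * hess w i k x.
Proof.
move=> sw; have sk k : smooth (partial k w) by exact: smooth_partial.
rewrite /ydw (partial_sum _ _ i (fun k => smoothM (smooth_coord k) (sk k))).
apply/funext => x.
transitivity (\sum_k (partial k w x * (i == k)%:R + x 0 k * hess w i k x)).
  apply: eq_bigr => k _.
  have E := partialM i (fun y => smooth_diff y (smooth_coord k)) (fun y => smooth_diff y (sk k)).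
  by rewrite E partial_coord [_%:R * _]mulrC.
by rewrite big_split /= sum_delta.
Qed.

(* Pohozaev-type field, orthogonal to grad w where w = 0 and |grad w| = d *)
Definition Zfield (d : R) w i x : R :=
  ydw w x * partial i w x + (- 2^-1 * (gsq w x + d ^+ 2)) * x 0 i +
  (- n%:R * w x) * x 0 i + ((n%:R - 1) * w x) * partial i w x.

Lemma smooth_Zfield d w i : smooth w -> smooth (Zfield d w i).
Proof.
move=> sw; have sk k : smooth (partial k w) by exact: smooth_partial.
have sc : smooth (fun x : 'rV[R]_n => x 0 i) by exact: smooth_coord.
apply: smoothD; last by apply: smoothM => //; exact: smoothZ.
apply: smoothD; last by apply: smoothM => //; exact: smoothZ.
apply: smoothD; first by apply: smoothM => //; exact: smooth_ydw.
apply: smoothM => //; apply: smoothZ; apply: smoothD; first exact: smooth_gsq.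
exact: smooth_cst.
Qed.

Lemma partial_Zfield d w i x : smooth w ->
  partial i (Zfield d w i) x =
  ((partial i w x + \sum_k x 0 k * hess w i k x) * partial i w x + ydw w x * hess w i i x) +
  (- 2^-1 * (\sum_k 2 * (partial k w x * hess w i k x)) * x 0 i - 2^-1 * (gsq w x + d ^+ 2)) +
  (- n%:R * partial i w x * x 0 i - n%:R * w x) +
  ((n%:R - 1) * partial i w x * partial i w x + (n%:R - 1) * w x * hess w i i x).
Proof.
move=> sw; have si : smooth (partial i w) by exact: smooth_partial.
have sc : smooth (fun x : 'rV[R]_n => x 0 i) by exact: smooth_coord.
have sy := smooth_ydw sw; have sg := smooth_gsq sw.
have s2 : smooth (fun x => gsq w x + d ^+ 2) by apply: smoothD => //; exact: smooth_cst.
have s3 : smooth (fun x => - 2^-1 * (gsq w x + d ^+ 2)) by exact: smoothZ.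
have s4 : smooth (fun x => - n%:R * w x) by exact: smoothZ.
have s5 : smooth (fun x => (n%:R - 1) * w x) by exact: smoothZ.
have D f := fun (sf : smooth f) y => smooth_diff y sf.
have E1 := partialM i (D _ sy) (D _ si).
have E2 := partialM i (D _ s3) (D _ sc).
have E3 := partialM i (D _ s4) (D _ sc).
have E4 := partialM i (D _ s5) (D _ si).
have T1 := smoothM sy si; have T2 := smoothM s3 sc; have T3 := smoothM s4 sc; have T4 := smoothM s5 si.
have A1 := partialD i (D _ (smoothD (smoothD T1 T2) T3)) (D _ T4).
have A2 := partialD i (D _ (smoothD T1 T2)) (D _ T3).
have A3 := partialD i (D _ T1) (D _ T2).
have G1 := partialD i (D _ sg) (D _ (@smooth_cst R n (d ^+ 2))).
rewrite /Zfield A1 A2 A3 E1 E2 E3 E4 (partialZ i _ s2) G1 (partialZ i _ sw) (partialZ i _ sw).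
rewrite partial_ydw // partial_gsq // partial_cst partial_coord eqxx mulr1n /hess addr0.
by rewrite !mulr1 -!mulNr.
Qed.

(** With zero flux through the boundary the integral of d^2 - P is zero, and P <= d^2 then forces
    equality. *)
Lemma div_Zfield d w x : smooth w -> laplacian w x = n%:R ->
  \sum_i partial i (Zfield d w i) x = - (n%:R / 2) * (d ^+ 2 - Pfun w x).
Proof.
move=> sw lw.
have lw' : \sum_i hess w i i x = n%:R by exact: lw.
transitivity (\sum_i (partial i w x * partial i w x + \sum_k x 0 k * hess w i k x * partial i w x +
    ydw w x * hess w i i x - \sum_k x 0 i * hess w k i x * partial k w x
    - 2^-1 * (gsq w x + d ^+ 2) - n%:R * (x 0 i * partial i w x) - n%:R * w x +
    (n%:R - 1) * (partial i w x * partial i w x) + (n%:R - 1) * w x * hess w i i x)).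
  apply: eq_bigr => i _; rewrite partial_Zfield //.
  have -> : \sum_k x 0 k * hess w i k x * partial i w x =
      (\sum_k x 0 k * hess w i k x) * partial i w x by rewrite mulr_suml.
  have -> : \sum_k x 0 i * hess w k i x * partial k w x =
      2^-1 * (\sum_k 2 * (partial k w x * hess w i k x)) * x 0 i.
    rewrite -mulr_sumr mulKf ?pnatr_eq0 // mulr_suml; apply: eq_bigr => k _.
    rewrite {2}/hess schwarz // -/(hess w k i x).
    by move: (hess w k i x) (partial k w x) (x 0 i) => p q r; ring.
  move: (hess w i i x) (partial i w x) (x 0 i) (\sum_k _) (\sum_k _) (ydw w x) (gsq w x) (w x) => p q r s t u v z.
  by ring.
rewrite !(sumrB, big_split) /= -!mulr_sumr lw' -/(gsq w x) -/(ydw w x).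
rewrite [X in _ + _ * n%:R - X](exchange_big_dep xpredT) //=.
have fin (q u v z m s1 s2 : R) : s1 = m * (v + d ^+ 2) -> s2 = m * z ->
    v + q + u * m - q - 2^-1 * s1 - m * u - m * s2 + (m - 1) * v + (m - 1) * z * m =
    - (m / 2) * (d ^+ 2 - (v + - 2 * z)) by move=> -> ->; field.
by apply: fin; rewrite sumr_const card_ord mulr_natl.
Qed.

(** Each term contains a factor that vanishes on the boundary, [gsq w x - d ^+ 2] or [w x]; nearby
    the product is therefore small. *)
Lemma grad_dot_Zfield d w x :
  \sum_i partial i w x * Zfield d w i x =
  2^-1 * ydw w x * (gsq w x - d ^+ 2) + w x * (- n%:R * ydw w x + (n%:R - 1) * gsq w x).
Proof.
transitivity (\sum_i (ydw w x * (partial i w x * partial i w x)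
   + (- 2^-1 * (gsq w x + d ^+ 2) - n%:R * w x) * (x 0 i * partial i w x) +
   (n%:R - 1) * w x * (partial i w x * partial i w x))).
  apply: eq_bigr => i _; rewrite /Zfield.
  by move: (partial i w x) (x 0 i) (ydw w x) (gsq w x) (w x) => q r u v z; ring.
rewrite !big_split /= -!mulr_sumr -/(gsq w x) -/(ydw w x).
by move: (ydw w x) (gsq w x) (w x) => u v z; field.
Qed.

(** The points of the closure with g <= 0 form a compact subset of [O], on which [w] has a negative
    maximum. *)
Lemma boundary_near O g : open O -> ebounded O -> continuous g ->
  forall w, continuous w -> (forall x, boundary O x -> w x = 0) -> (forall x, O x -> w x < 0) ->
  (forall x, boundary O x -> 0 < g x) ->
  exists2 e, 0 < e & forall x, O x -> - w x < e -> 0 < g x.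
Proof.
move=> oO bO cg w cw w0 wneg g0.
pose K := closure O `&` [set x | g x <= 0].
have cK : compact K.
  apply: (@subclosed_compact _ _ (closure O)); last by move=> x [].
    by apply: closedI; [exact: closed_closure|exact: closed_sublevel].
  exact: compact_closure.
have KO x : K x -> O x.
  move=> [xO gx]; apply: contrapT => nO.
  by have := g0 x; rewrite boundary_open // => /(_ (conj xO nO)); rewrite ltNge => /negP; apply.
have [[z Kz]|K0] := pselect (K !=set0); last first.
  exists 1 => // x Ox _; rewrite ltNge; apply/negP => gx; apply: K0; exists x.
  by split; [exact: subset_closure|].
have [m Km Hm] : exists2 m, K m & forall y, K y -> w y <= w m.
  by apply: attains_max => //; [exists z|exact: continuous_subspaceT].
exists (- w m); first by rewrite oppr_gt0; exact/wneg/KO.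
move=> x Ox; rewrite ltrN2 => wx; rewrite ltNge; apply/negP => gx.
have := Hm x (conj (subset_closure Ox) gx); by rewrite leNgt wx.
Qed.

(* Vanishes near the boundary of O, since w < 0 in O and w = 0 on the boundary. *)
Definition cutw O w (e : R) x : R := \1_O x * step (- e^-1 * w x - 1).

Lemma cutw_props O w (e : R) : open O -> ebounded O -> smooth w -> 0 < e ->
  (forall x, boundary O x -> w x = 0) -> (forall x, O x -> w x < 0) ->
  [/\ smooth (cutw O w e), bsupp (cutw O w e) &
     forall i, partial i (cutw O w e) = fun x =>
       \1_O x * (derive1 step (- e^-1 * w x - 1) * (- e^-1 * partial i w x))].
Proof.
move=> oO [M OM] sw e0 w0 wneg.
pose g x := step (- e^-1 * w x - 1).
have sin : smooth (fun x => - e^-1 * w x - 1).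
  by apply: smoothB; [exact: smoothZ|exact: smooth_cst].
have sg : smooth g by apply: smooth_comp => //; exact: smooth1_step.
pose C := closure O `&` [set x | w x <= - e].
have clC : closed C.
  apply: closedI; first exact: closed_closure.
  exact: closed_sublevel (smooth_continuous sw).
have CO x : C x -> O x.
  move=> [xO /= wx]; apply: contrapT => nO.
  by have := w0 x; rewrite boundary_open // => /(_ (conj xO nO)); lra.
have inO x : O x -> cutw O w e x = g x by move=> Ox; rewrite /cutw indicE mem_set // mul1r.
have outC x : ~ C x -> cutw O w e x = (fun=> 0 : R) x.
  move=> nC; rewrite /cutw indicE; case: (boolP (x \in O)) => [|_]; last by rewrite mul0r.
  rewrite inE => Ox; rewrite mul1r step_le0 // subr_le0 mulNr mulrC -mulNr ler_pdivrMr // mul1r.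
  rewrite lerNl leNgt; apply/negP => wx; apply: nC; split; first exact: subset_closure.
  exact: ltW.
have oC : open (~` C) by exact: closed_openC.
have dst : (forall s : R, derivable (@step R) s 1) by move=> s; exact/smooth1_derivable/smooth1_step.
split.
- apply: smooth_local => x; have [Ox|nOx] := pselect (O x).
    by exists g, O; split.
  exists (fun=> 0), (~` C); split => //; first exact: smooth_cst.
  by move=> /CO.
- exists M => x Mx; rewrite /cutw indicE memNset ?mul0r // => /OM.
  by rewrite leNgt Mx.
- move=> i; apply/funext => x; have [Ox|nOx] := pselect (O x); last first.
    rewrite (@partial_open _ _ i _ (fun=> 0 : R) (~` C) x) //; last by move=> /CO.
    by rewrite partial_cst indicE memNset ?mul0r.
  rewrite (@partial_open _ _ i _ g O x) // /g.
  have E := partial_comp i (fun y => smooth_diff y sin) dst.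
  have E2 := partialD i (fun y => smooth_diff y (smoothZ (- e^-1) sw)) (fun y => smooth_diff y (@smooth_cst R n (-1))).
  by rewrite E E2 (partialZ i _ sw) partial_cst addr0 indicE mem_set // mul1r.
Qed.

Lemma absurd_bound (p q : R) : 0 < p -> 0 <= p * q -> p * (2 * (q + 1)) <= p * q -> False.
Proof. by move=> p0 pq; rewrite mulrCA mulrDr mulr1; lra. Qed.

(** Fluxes are measured in the layer e < -w < 2e, where the cut-off [cutw] varies. The integral of
    |grad w|^2 against its slope is at most n |O| for every e, and |Z . grad w| <= k |grad w|^2 in a
    thin layer. So the integral of d^2 - P against the cut-off is at most a constant times k, for
    arbitrary k > 0. *)
Theorem serrin O (G : set 'rV[R]_n) w (d : R) : (0 < n)%N -> open O -> ebounded O -> O !=set0 ->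
  open G -> closure O `<=` G -> smooth w -> (forall x, G x -> laplacian w x = n%:R) ->
  (forall x, boundary O x -> w x = 0) -> (forall x, boundary O x -> enorm (grad w x) = d) ->
  forall x i j, O x -> hess w i j x = (i == j)%:R.
Proof.
move=> n0 oO bO [x0 Ox0] oG OG sw lw w0 wd.
have OG' x : O x -> G x by move=> Ox; apply: OG; exact: subset_closure.
have n0' : 0 < n%:R :> R by rewrite ltr0n.
have sP := smooth_Pfun sw.
have bG x : boundary O x -> G x by move=> [/OG].
have Pb x : boundary O x -> Pfun w x = d ^+ 2.
  by move=> bx; rewrite /Pfun gsq_grad wd // w0 // mulr0 addr0.
have PO : forall x, O x -> Pfun w x <= d ^+ 2.
  apply: (max_principle n0 oO bO sP) => x Ox; last by rewrite Pb.
  rewrite (laplacian_Pfun oG (OG' _ Ox) sw lw) mulr_ge0 //.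
  by apply: sumr_ge0 => i _; apply: sumr_ge0 => j _; exact: sqr_ge0.
have wle : forall x, O x -> w x <= 0.
  apply: (max_principle n0 oO bO sw) => x Ox; last by rewrite w0.
  by rewrite lw //; exact: OG'.
have wneg x : O x -> w x < 0.
  move=> Ox; rewrite lt_neqAle wle // andbT; apply/eqP => wx.
  have [r r0 rO] := nbhs_eball (open_nbhs_nbhs (conj oO Ox)).
  have : laplacian w x <= 0.
    by apply: laplacian_local_max => //; exists r => // y /rO /wle; rewrite wx.
  by rewrite (lw _ (OG' _ Ox)) leNgt n0'.
have d2 : 0 < d ^+ 2.
  have := PO _ Ox0; have := wneg _ Ox0; have : 0 <= gsq w x0 by rewrite gsq_grad sqr_ge0.
  by rewrite /Pfun; lra.
suff PE x : O x -> Pfun w x = d ^+ 2.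
  move=> x i j Ox; have := laplacian_Pfun oG (OG' _ Ox) sw lw.
  have -> : laplacian (Pfun w) x = 0.
    apply: big1 => k _; rewrite (@partial_open _ _ k _ (fun=> 0 : R) O x) ?partial_cst //.
    by move=> y Oy; rewrite (@partial_open _ _ k _ (fun=> d ^+ 2) O y) ?partial_cst.
  move=> /esym/eqP; rewrite mulf_eq0 pnatr_eq0 /= psumr_eq0 => [/allP H|k _]; last first.
    by apply: sumr_ge0 => l _; exact: sqr_ge0.
  have := H i (mem_index_enum _); rewrite psumr_eq0 => [/allP H2|k _]; last exact: sqr_ge0.
  by have := H2 j (mem_index_enum _); rewrite sqrf_eq0 subr_eq0 => /eqP.
move=> Ox; apply/eqP; rewrite eq_le PO //= leNgt; apply/negP => Plt.
have [M OM] := bO.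
have cut (e : R) (e0 : 0 < e) := cutw_props oO bO sw e0 w0 wneg.
pose F e y := cutw O w e y * (d ^+ 2 - Pfun w y).
have F0 e y : 0 <= F e y.
  rewrite /F /cutw indicE; case: (boolP (y \in O)) => [|_]; last by rewrite !mul0r.
  by rewrite inE => Oy; rewrite mul1r mulr_ge0 ?step_ge0 // subr_ge0 PO.
have sF e : 0 < e -> smooth (F e).
  move=> /cut[sc _ _]; apply: smoothM => //; apply: smoothB => //; exact: smooth_cst.
have LF e : 0 < e -> L1 (F e).
  move=> e0; have [_ bc _] := cut e e0.
  by apply: L1_bsupp; [exact: smooth_continuous (sF e e0)|exact: bsuppMl].
(* With this scale the argument of the cut-off at [x] is 1. *)
pose e1 := - w x / 2.
have e10 : 0 < e1 by rewrite divr_gt0 // oppr_gt0 wneg.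
have I1 : 0 < Int (F e1).
  rewrite lt_neqAle Int_ge0 // andbT; apply/eqP => /esym I0.
  have := Int_cont_eq0 (smooth_continuous (sF _ e10)) (LF _ e10) (F0 e1) I0 x.
  apply/eqP; rewrite mulf_neq0 //; last by rewrite subr_eq0 gt_eqF.
  rewrite /cutw indicE mem_set // mul1r gt_eqF //; apply: step_gt0.
  have wn : w x != 0 by rewrite lt_eqF // wneg.
  have -> : - e1^-1 * w x = 2 by rewrite /e1; field; rewrite wn.
  lra.
have Imono e : 0 < e -> e <= e1 -> Int (F e1) <= Int (F e).
  move=> e0 ee; apply: le_Int; [exact: LF|exact: LF|] => y.
  rewrite /F /cutw indicE; case: (boolP (y \in O)) => [|_]; last by rewrite !mul0r.
  rewrite inE => Oy; rewrite !mul1r; apply: ler_wpM2r; first by rewrite subr_ge0; exact: PO.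
  apply: step_nd; rewrite lerD2r !mulNr lerN2; apply: ler_wnM2r; first exact: ltW (wneg _ Oy).
  by rewrite lef_pV2.
have IB : L1 (\1_O) by apply: (@L1_indic _ _ _ M) => //; exact: measurable_open.
(* This is the integral of the Laplacian of [w] over [O]. *)
pose K := n%:R * Int (\1_O : 'rV[R]_n -> R).
have K0 : 0 <= K by rewrite mulr_ge0 // Int_ge0 // => y; rewrite indicE.
pose D e y := \1_O y * (e^-1 * derive1 step (- e^-1 * w y - 1)).
have D0 e y : 0 < e -> 0 <= D e y.
  by move=> e0; rewrite !mulr_ge0 ?indicE ?invr_ge0 ?(ltW e0) ?derive1_step_ge0.
have ibp e (Z : 'I_n -> 'rV[R]_n -> R) : 0 < e -> (forall i, smooth (Z i)) ->
    L1 (fun y => D e y * \sum_i partial i w y * Z i y) /\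
    Int (fun y => cutw O w e y * \sum_i partial i (Z i) y) =
    Int (fun y => D e y * \sum_i partial i w y * Z i y).
  move=> e0 sZ; have [sc bc pc] := cut e e0.
  have E : (fun y => D e y * \sum_i partial i w y * Z i y) =
      fun y => \sum_i (- (partial i (cutw O w e) y * Z i y)).
    apply/funext => y; rewrite mulr_sumr; apply: eq_bigr => i _; rewrite pc /D.
    by move: (partial i w y) (derive1 step _) (\1_O y) (Z i y) => p q r s; ring.
  have L i : L1 (fun y => - (partial i (cutw O w e) y * Z i y)).
    apply: L1N; apply: L1_bsupp; last by apply: bsuppMl; exact: bsupp_partial.
    by apply: smooth_continuous; apply: smoothM => //; exact: smooth_partial.
  split; first by rewrite E; exact: L1_sum.
  rewrite E Int_sum //.
  have -> : (fun y => cutw O w e y * \sum_i partial i (Z i) y) =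
      fun y => \sum_i (cutw O w e y * partial i (Z i) y) by apply/funext => y; rewrite mulr_sumr.
  rewrite Int_sum => [|i]; last first.
    apply: L1_bsupp; last exact: bsuppMl.
    by apply: smooth_continuous; apply: smoothM => //; exact: smooth_partial.
  apply: eq_bigr => i _; rewrite IntN.
    by rewrite (Int_by_parts i sc (sZ i) (or_introl bc)) opprK.
  by rewrite -[X in L1 X]opprK; have := L1N (L i); congr L1; apply/funext => y; rewrite opprK.
have DK e : 0 < e -> L1 (fun y => D e y * gsq w y) /\ Int (fun y => D e y * gsq w y) <= K.
  move=> e0; have [L E] := ibp e (fun i => partial i w) e0 (fun i => smooth_partial i sw).
  split => //; have [sc bc pc] := cut e e0.
  rewrite -E /K -IntZ //; apply: le_Int.
  - apply: L1_bsupp; last exact: bsuppMl.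
    apply: smooth_continuous; apply: smoothM => //; exact: smooth_laplacian.
  - exact: L1Z.
  - move=> y; rewrite /cutw indicE; case: (boolP (y \in O)) => [|_]; last by rewrite !mul0r mulr0.
    rewrite inE => Oy; rewrite mul1r mulr1 -/(laplacian w y) (lw _ (OG' _ Oy)).
    by rewrite ler_piMl ?step_le1.
pose ZZ y := \sum_i partial i w y * Zfield d w i y.
have sZZ : smooth ZZ.
  by apply: smooth_sum => i; apply: smoothM; [exact: smooth_partial|exact: smooth_Zfield].
(* near the boundary, Z . grad w is small compared with |grad w|^2 *)
have est k : 0 < k -> exists2 e, 0 < e & (n%:R / 2) * Int (F e) <= k * K /\ e <= e1.
  move=> k0.
  have [e2 e20 He2] : exists2 e, 0 < e & forall y, O y -> - w y < e -> 0 < k ^+ 2 * gsq w y ^+ 2 - ZZ y ^+ 2.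
    apply: (boundary_near oO bO _ (smooth_continuous sw) w0 wneg) => [|y yb].
      apply: smooth_continuous; apply: smoothB; last exact: smoothX.
      by apply: smoothZ; apply: smoothX; exact: smooth_gsq.
    rewrite /ZZ grad_dot_Zfield w0 // mul0r addr0 gsq_grad wd // subrr mulr0 expr0n subr0.
    exact: mulr_gt0 (exprn_gt0 2 k0) (exprn_gt0 2 d2).
  (* The slope of the cut-off is carried by -w <= 2 e, which e <= e2/3 places inside -w < e2. *)
  pose e := Num.min e1 (e2 / 3).
  have e0 : 0 < e by rewrite lt_min e10 divr_gt0.
  exists e => //; split; last by rewrite ge_min lexx.
  have [sc bc pc] := cut e e0.
  have [LZ EZ] := ibp e (Zfield d w) e0 (fun i => smooth_Zfield d i sw).
  have [LK HK] := DK e e0.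
  have -> : (n%:R / 2) * Int (F e) = - Int (fun y => D e y * ZZ y).
    rewrite -EZ -IntZ; last exact: LF.
    rewrite -IntN; last first.
      apply: L1_bsupp; last exact: bsuppMl.
      apply: smooth_continuous; apply: smoothM => //; apply: smooth_sum => i.
      by apply: smooth_partial; exact: smooth_Zfield.
    congr Int; apply/funext => y; rewrite /F /cutw indicE.
    case: (boolP (y \in O)) => [|_]; last by rewrite !mul0r mulr0 oppr0.
    rewrite inE => Oy; rewrite (div_Zfield d sw (lw _ (OG' _ Oy))).
    by move: (step _) (Pfun w y) => p q; ring.
  apply: le_trans (ler_norm _) _; rewrite normrN.
  apply: le_trans (abs_Int LZ) _.
  apply: (@le_trans _ _ (k * Int (fun y => D e y * gsq w y))); last by rewrite ler_wpM2l // ltW.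
  rewrite -IntZ //; apply: le_Int; [exact: L1_abs|exact: L1Z|].
  move=> y; rewrite normrM (ger0_norm (D0 e y e0)) mulrCA.
  have [Oy|nOy] := pselect (O y); last first.
    by rewrite /D indicE memNset // !mul0r.
  have [we|we] := ltP (- w y) e2.
    rewrite ler_wpM2l ?D0 // -(@ler_sqr R) ?nnegrE ?mulr_ge0 ?(ltW k0) //; last by rewrite gsq_grad sqr_ge0.
    by rewrite real_normK ?num_real // exprMn ltW // -subr_gt0 He2.
  suff -> : D e y = 0 by rewrite !mul0r.
  have s1 : 1 < - e^-1 * w y - 1.
    have : 3 <= - w y / e.
      rewrite ler_pdivlMr // mulrC; apply: le_trans we.
      by rewrite -ler_pdivlMr // ge_min lexx orbT.
    by move: (e^-1) (w y) => p q; nra.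
  by rewrite /D derive1_step_ge1 ?(ltW s1) // !mulr0.
(* Chosen so that k K falls below half of the fixed positive quantity (n/2) Int (F e1). *)
pose k := (n%:R / 2) * Int (F e1) / (2 * (K + 1)).
have K1 : 0 < 2 * (K + 1) by rewrite mulr_gt0 // ltr_wpDl.
have k0 : 0 < k by rewrite divr_gt0 // mulr_gt0 // divr_gt0.
have [e e0 [H1 H2]] := est k k0.
have H3 : (n%:R / 2) * Int (F e1) <= k * K.
  by apply: le_trans H1; rewrite ler_wpM2l ?Imono // divr_ge0.
have : k * (2 * (K + 1)) = (n%:R / 2) * Int (F e1) by rewrite /k divfK // gt_eqF.
move=> E; move: H3; rewrite -E; have := mulr_ge0 (ltW k0) K0; move: k0.
exact: absurd_bound.
Qed.

End serrin.

(** * Transmission across a sphere *)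

Section power.
Context {R : realType}.
Implicit Types (p : R -> R) (a c s : R).

(* Equal to s for s >= a / 2 and never below a / 4, so that its real powers are smooth. *)
Definition posid a s : R := a / 4 + step (4 / a * s - 1) * (s - a / 4).

Lemma posidE a s : 0 < a -> a / 2 <= s -> posid a s = s.
Proof.
move=> a0 as2; rewrite /posid step_ge1 ?mul1r; first by rewrite addrC subrK.
have : 4 / a * (a / 2) <= 4 / a * s by rewrite ler_wpM2l // divr_ge0 // ltW.
have -> : 4 / a * (a / 2) = 2 by field; rewrite gt_eqF.
lra.
Qed.

Lemma posid_gt0 a s : 0 < a -> 0 < posid a s.
Proof.
move=> a0; have [h|h] := leP s (a / 4).
  rewrite /posid step_le0 ?mul0r ?addr0; first by rewrite divr_gt0.
  have : 4 / a * s <= 4 / a * (a / 4) by rewrite ler_wpM2l // divr_ge0 // ltW.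
  have -> : 4 / a * (a / 4) = 1 by field; rewrite gt_eqF.
  by rewrite subr_le0.
by rewrite /posid ltr_pwDl ?divr_gt0 // mulr_ge0 ?step_ge0 // subr_ge0 ltW.
Qed.

Lemma smooth1_posid a : smooth1 (posid a).
Proof.
have sB (b : R) : smooth1 (fun s : R => s + b).
  by apply: smooth1D; [exact: smooth1_id|exact: smooth1_cst].
apply: smooth1D; first exact: smooth1_cst.
apply: smooth1M; last exact: sB.
apply: smooth1_comp; first exact: smooth1_step.
exact: (smooth1_scale (4 / a) (sB (-1))).
Qed.

(** The real power s^c where s >= a/2, continued to a positive smooth function on the line. *)
Definition power a c s : R := expR (c * ln (posid a s)).

Lemma power_gt0 a c s : 0 < power a c s. Proof. exact: expR_gt0. Qed.

Lemma powerD1 a c s : 0 < a -> power a c s = posid a s * power a (c - 1) s.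
Proof.
move=> a0; rewrite /power -{2}(lnK (posid_gt0 s a0)) -expRD; congr expR.
by move: (ln _) => t; ring.
Qed.

Lemma is_derive_power a c s : 0 < a ->
  is_derive s 1 (power a c) (c * derive1 (posid a) s * power a (c - 1) s).
Proof.
move=> a0; have p0 := posid_gt0 s a0.
have dp : is_derive s 1 (posid a) (derive1 (posid a) s).
  by rewrite derive1E; apply: derivableP; apply: smooth1_derivable; exact: smooth1_posid.
have dl : is_derive s 1 (fun s => ln (posid a s)) ((posid a s)^-1 * derive1 (posid a) s).
  exact: (@is_derive1_comp _ (@ln R) _ _ _ _ (is_derive1_ln p0)).
have dc : is_derive s 1 (fun s => c * ln (posid a s)) (c * ((posid a s)^-1 * derive1 (posid a) s)).
  exact: is_deriveZ.
have de := @is_derive1_comp _ (@expR R) (fun s => c * ln (posid a s)) _ _ _ (is_derive_expR _) dc.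
apply: (is_derive_eq de).
rewrite -/(power a c s) powerD1 //; move: p0; move: (posid a s) (derive1 _ s) (power _ _ _) => u v w u0.
by field; rewrite gt_eqF.
Qed.

Lemma derive1_power a c : 0 < a ->
  derive1 (power a c) = fun s => c * derive1 (posid a) s * power a (c - 1) s.
Proof.
move=> a0; apply/funext => s; rewrite derive1E.
by apply: derive_val; exact: is_derive_power.
Qed.

Lemma smooth1_power a c : 0 < a -> smooth1 (power a c).
Proof.
(* The derivative of a smooth factor times a power is again of this form, with the exponent lowered
   by one; the induction runs over this larger class. *)
move=> a0; suff H k : forall p c, smooth1 p -> smk1 k (fun s => p s * power a c s).
  move=> k; have := H k (fun=> 1) c (smooth1_cst 1).
  by congr smk1; apply/funext => s; rewrite mul1r.
have dw d s : derivable (power a d) s 1 by apply: ex_derive; exact: is_derive_power.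
elim: k => [//|k IH] p d sp /=.
have dp s : derivable p s 1 by exact: smooth1_derivable.
split; first by move=> s; apply: derivableM.
rewrite (derive1M dp (dw d)) derive1_power //.
pose q s := derive1 p s * posid a s + d * (p s * derive1 (posid a) s).
have sq : smooth1 q.
  apply: smooth1D; first by apply: smooth1M; [exact: smooth1_derive|exact: smooth1_posid].
  apply: smooth1M; first exact: smooth1_cst.
  by apply: smooth1M => //; apply: smooth1_derive; exact: smooth1_posid.
have := IH q (d - 1) sq; congr smk1; apply/funext => s.
rewrite /q (@powerD1 a d) //.
by move: (derive1 p s) (p s) (posid a s) (derive1 _ s) (power _ _ _) => u v w x y; ring.
Qed.

Lemma derive1_posid a s : 0 < a -> a / 2 < s -> derive1 (posid a) s = 1.
Proof.
move=> a0 as2; rewrite derive1E.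
have H : \near s, posid a s = id s.
  have : nbhs s [set r | a / 2 < r] by apply: open_nbhs_nbhs; split => //; exact: open_gt.
  by apply: filterS => r /ltW /(posidE a0).
by rewrite (near_eq_derive _ H) derive_id.
Qed.

Lemma derive1_powerE a c s : 0 < a -> a / 2 < s ->
  derive1 (power a c) s = c * power a (c - 1) s.
Proof. by move=> a0 as2; rewrite derive1_power // derive1_posid // mulr1. Qed.

Lemma derive2_powerE a c s : 0 < a -> a / 2 < s ->
  derive1 (derive1 (power a c)) s = c * ((c - 1) * power a (c - 1 - 1) s).
Proof.
move=> a0 as2; rewrite [LHS]derive1E.
have H : \near s, derive1 (power a c) s = c * power a (c - 1) s.
  have : nbhs s [set r | a / 2 < r] by apply: open_nbhs_nbhs; split => //; exact: open_gt.
  by apply: filterS => r /(derive1_powerE c a0).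
rewrite (near_eq_derive _ H) -derive1_powerE // -derive1E.
have dp r : derivable (power a (c - 1)) r 1 by apply: smooth1_derivable; exact: smooth1_power.
have dc (r : R) : derivable (fun=> c : R) r 1 by exact: derivable_cst.
have E := derive1M dc dp.
by rewrite E derive1_const mul0r add0r.
Qed.

Lemma power_sqr a (k : nat) s : 0 < a -> 0 < s -> a / 2 <= s ^+ 2 ->
  power a (- (k%:R / 2)) (s ^+ 2) = (s ^+ k)^-1.
Proof.
move=> a0 s0 as2; rewrite /power posidE // lnXn // mulNr expRN; congr (_^-1).
rewrite -[X in _ = X]lnK ?posrE ?exprn_gt0 // lnXn //; congr expR.
by rewrite -[ln s *+ 2]mulr_natl -[RHS]mulr_natl mulrA divfK // pnatr_eq0.
Qed.

End power.

(** * Divergence theorem outside a sphere *)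

Section cut.
Context {R : realType} {n : nat}.
Implicit Types (Z : 'I_n -> 'rV[R]_n -> R) (c x : 'rV[R]_n) (g : R -> R).

Lemma Int_div_radial g c Z : smooth1 g -> (forall i, smooth (Z i)) -> (forall i, bsupp (Z i)) ->
  Int (fun x => g (sqd c x) * \sum_i partial i (Z i) x) =
  - Int (fun x => derive1 g (sqd c x) * (2 * \sum_i (x 0 i - c 0 i) * Z i x)).
Proof.
move=> sg sZ bZ; have sG := smooth_radial c sg.
have -> : (fun x => g (sqd c x) * \sum_i partial i (Z i) x) =
    fun x => \sum_i (g (sqd c x) * partial i (Z i) x) by apply/funext => x; rewrite mulr_sumr.
have -> : (fun x => derive1 g (sqd c x) * (2 * \sum_i (x 0 i - c 0 i) * Z i x)) =
    fun x => \sum_i (partial i (fun x => g (sqd c x)) x * Z i x).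
  apply/funext => x; rewrite !mulr_sumr; apply: eq_bigr => i _; rewrite partial_radial //.
  by move: (derive1 g _) (x 0 i - c 0 i) (Z i x) => p q r; ring.
rewrite !Int_sum -?sumrN => [|i|i]; last 2 first.
- apply: L1_bsupp; last exact: bsuppMr.
  by apply: smooth_continuous; apply: smoothM => //; exact: smooth_partial.
- apply: L1_bsupp; last by apply: bsuppMr; exact: bsupp_partial.
  by apply: smooth_continuous; apply: smoothM => //; exact: smooth_partial.
apply: eq_bigr => i _.
by rewrite (Int_by_parts i sG (sZ i) (or_intror (bZ i))) opprK.
Qed.

Lemma mfun_outside c (a : R) : mfun (\1_[set x | a < sqd c x]).
Proof.
apply: mfun_indic; apply: measurable_open.
have -> : [set x | a < sqd c x] = [set x | - sqd c x < - a].
  by apply/seteqP; split => x /=; rewrite ltrN2.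
by apply: open_sublevel => x; apply: continuousN; exact: sqd_continuous.
Qed.

Lemma smooth1_cutoff (l a b : R) : smooth1 (fun s => step (l * (s - a) + b)).
Proof.
apply: smooth1_comp; first exact: smooth1_step.
apply: smooth1D; last exact: smooth1_cst.
apply: smooth1M; first exact: smooth1_cst.
by apply: smooth1D; [exact: smooth1_id|exact: smooth1_cst].
Qed.

Lemma derive1_cutoff (l a b s : R) :
  derive1 (fun s => step (l * (s - a) + b)) s = l * derive1 step (l * (s - a) + b).
Proof.
have sB : smooth1 (fun s : R => l * (s - a) + b).
  apply: smooth1D; last exact: smooth1_cst.
  apply: smooth1M; first exact: smooth1_cst.
  by apply: smooth1D; [exact: smooth1_id|exact: smooth1_cst].
rewrite (derive1_compo (f := step)) => [|r|r]; last 2 first.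
- exact/smooth1_derivable/smooth1_step.
- exact: smooth1_derivable.
rewrite mulrC; congr (_ * _); rewrite derive1E.
by apply: derive_val; apply: is_derive_eq; rewrite /GRing.scale /=; ring.
Qed.

Lemma cvg_step_outside (t a : R) :
  step ((k.+1)%:R * (t - a)) @[k --> \oo] --> (((a < t)%R : nat)%:R : R).
Proof.
have [h|h] := ltP a t => /=; last first.
  rewrite (_ : (fun _ => _) = fun=> 0); first exact: cvg_cst.
  by apply/funext => k; rewrite step_le0 // mulr_ge0_le0 // subr_le0.
apply: cvg_near_cst; near=> k; rewrite step_ge1 // -ler_pdivrMr ?subr_gt0 //.
rewrite div1r; apply: (@le_trans _ _ k%:R); last by rewrite ler_nat.
near: k; exact: nbhs_infty_ger.
Unshelve. all: by end_near. Qed.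

Lemma cvg_step_inside (t a : R) :
  step ((k.+1)%:R * (a - t)) @[k --> \oo] --> (((t < a)%R : nat)%:R : R).
Proof. exact: cvg_step_outside. Qed.

(** The field has no normal component on the sphere. The cut-off step(k (|x-c|^2 - a)) has slope of
    order k on a shell where the normal component is of order 1/k: the error terms are bounded and
    tend to 0 pointwise, so dominated convergence applies. *)
Lemma cut_div c (a K : R) Z : (forall i, smooth (Z i)) -> (forall i, bsupp (Z i)) ->
  (forall x, a < sqd c x -> `|\sum_i (x 0 i - c 0 i) * Z i x| <= K * (sqd c x - a)) ->
  L1 (fun x => \1_[set x | a < sqd c x] x * \sum_i partial i (Z i) x) /\
  Int (fun x => \1_[set x | a < sqd c x] x * \sum_i partial i (Z i) x) = 0.
Proof.
move=> sZ bZ ZK.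
pose dv x := \sum_i partial i (Z i) x; pose yz x := \sum_i (x 0 i - c 0 i) * Z i x.
have sdv : smooth dv by apply: smooth_sum => i; exact: smooth_partial.
have bdv : bsupp dv by apply: bsupp_sum => i; exact: bsupp_partial.
have syz : smooth yz by apply: smooth_sum => i; apply: smoothM => //; exact: smooth_coordB.
have byz : bsupp yz by apply: bsupp_sum => i; exact: bsuppMr.
have [C C0 HC] := @bounded_derive1_step R.
pose l k : R := (k.+1)%:R; have l0 k : 0 < l k by rewrite ltr0n.
pose g k s := step (l k * (s - a) + 0).
have sg k : smooth1 (g k) by exact: smooth1_cutoff.
have E k := Int_div_radial c (sg k) sZ bZ.
have [LA cA] : L1 (fun x => \1_[set x | a < sqd c x] x * dv x) /\
    Int (fun x => g k (sqd c x) * dv x) @[k --> \oo] -->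
    Int (fun x => \1_[set x | a < sqd c x] x * dv x).
  apply: (@Int_cvg _ _ _ _ (fun x => `|dv x|)).
  - move=> k; apply: mfun_cont; apply: smooth_continuous; apply: smoothM => //.
    exact: smooth_radial.
  - by apply: mfunM; [exact: mfun_outside|apply: mfun_cont; exact: smooth_continuous].
  - by apply: L1_abs; apply: L1_bsupp => //; exact: smooth_continuous.
  - by move=> k x; rewrite normrM ler_piMl // ger0_norm ?step_ge0 ?step_le1.
  - move=> x; apply: cvgMl; rewrite indicE /g.
    under eq_fun do rewrite addr0.
    rewrite (_ : x \in _ = (a < sqd c x)); first exact: cvg_step_outside.
    by apply/idP/idP; rewrite inE.
split=> //; apply: (cvg_unique (@norm_hausdorff _ _) cA).
have [_ cB] : L1 (fun _ : 'rV[R]_n => 0 : R) /\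
    Int (fun x => derive1 (g k) (sqd c x) * (2 * yz x)) @[k --> \oo] --> Int (fun x : 'rV[R]_n => 0 : R).
  have [M HM] := byz.
  apply: (@Int_cvg _ _ _ _ (fun x => (2 * `|K| * C) * \1_[set x | enorm (x - 0) <= M] x)).
  - move=> k; apply: mfun_cont; apply: smooth_continuous; apply: smoothM; last exact: smoothZ.
    by apply: (smooth_radial c); exact: smooth1_derive.
  - exact: mfun_cst.
  - apply: L1Z; apply: (@L1_indic _ _ _ M) => [|x]; last by rewrite /= subr0.
    rewrite -[X in measurable X]setCK; apply: measurableC; apply: measurable_open.
    by apply: closed_openC; exact: closed_cball.
  - move=> k x; rewrite derive1_cutoff addr0 -/(l k).
    have [xM|Mx] := leP (enorm (x - 0)) M; last first.
      have -> : yz x = 0 by apply: HM; rewrite -[x]subr0.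
      by rewrite !mulr0 normr0 indicE; apply: mulr_ge0 => //; apply: mulr_ge0 (ltW C0); exact: mulr_ge0.
    have B0 : 0 <= 2 * `|K| * C by apply: mulr_ge0 (ltW C0); exact: mulr_ge0.
    rewrite indicE mem_set // mulr1.
    have [h|h] := leP (sqd c x) a.
      have -> : derive1 step (l k * (sqd c x - a)) = 0 :> R.
        apply: derive1_step_le0; rewrite mulr_ge0_le0 ?subr_le0 //; exact: ltW.
      by rewrite mulr0 mul0r normr0.
    have [h1|h1] := leP (l k * (sqd c x - a)) 1; last first.
      by rewrite derive1_step_ge1 ?(ltW h1) // mulr0 mul0r normr0.
    have H1 := ZK x h; have H2 := HC (l k * (sqd c x - a)).
    rewrite !normrM [`|2|]ger0_norm // [`|l k|]gtr0_norm // -/(yz x).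
    have H3 : l k * `|yz x| <= `|K|.
      apply: (@le_trans _ _ (l k * (`|K| * (sqd c x - a)))).
        rewrite ler_wpM2l ?(ltW (l0 k)) //; apply: le_trans H1 _.
        by rewrite ler_wpM2r ?ler_norm // subr_ge0 ltW.
      by rewrite mulrCA ler_piMr.
    have -> : l k * `|derive1 step (l k * (sqd c x - a))| * (2 * `|yz x|) =
       2 * ((l k * `|yz x|) * `|derive1 step (l k * (sqd c x - a))|).
      by move: (l k) `|derive1 _ _| `|yz x| => p q r; ring.
    by rewrite -[X in _ <= X]mulrA ler_wpM2l // ler_pM // mulr_ge0 // ltW.
  - move=> x; apply: cvg_near_cst; near=> k; rewrite derive1_cutoff addr0 -/(l k).
    have [h|h] := leP (sqd c x) a.
      by rewrite derive1_step_le0 ?mulr0 ?mul0r // mulr_ge0_le0 ?subr_le0 // ltW.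
    rewrite derive1_step_ge1 ?mulr0 ?mul0r // -ler_pdivrMr ?subr_gt0 // div1r.
    apply: (@le_trans _ _ k%:R); last by rewrite /l ler_nat.
    near: k; exact: nbhs_infty_ger.
have -> : (fun k => Int (fun x => g k (sqd c x) * dv x)) =
   (fun k => - Int (fun x => derive1 (g k) (sqd c x) * (2 * yz x))).
  by apply/funext => k; exact: E.
by rewrite -oppr0; apply: cvgN; move: cB; rewrite Int0.
Unshelve. all: by end_near. Qed.

(** Up to the factor l, the cut-off step(l (s - a) + s0) has derivative step'(s0) > 0 on the sphere,
    and at any other point this derivative is 0 for large l. Integration by parts against a
    truncated radial field bounds its integral by a multiple of 1/l, so the sphere carries no
    mass. *)
Lemma sphere_null c (a : R) : 0 < a -> {ae lebesgue_row n, forall x, sqd c x != a}.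
Proof.
move=> a0.
pose psi x := step (a + 2 - sqd c x).
have spsi : smooth psi.
  apply: (@smooth_radial _ _ (fun s => step (a + 2 - s)) c).
  have -> : (fun s => step (a + 2 - s)) = fun s => step ((-1) * (s - (a + 2)) + 0).
    by apply/funext => s; congr step; ring.
  exact: smooth1_cutoff.
have bpsi : bsupp psi.
  have [M HM] := bounded_cball c (a + 2).
  exists (n%:R * (M + 1)) => x xM; rewrite /psi step_le0 //.
  rewrite leNgt; apply/negP => h.
  have : enorm (x - c) <= a + 2.
    rewrite enorm_le; last by rewrite addr_ge0 // ltW.
    by rewrite -/(sqd c x); nra.
  move=> /(HM.2 (M + 1) _ x) H; have /H : M < M + 1 by rewrite ltrDl.
  have := enorm_le_norm x => e1 e2; move: xM; rewrite ltNge => /negP; apply.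
  by apply: le_trans e1 _; rewrite ler_wpM2l.
pose Z i x := (x 0 i - c 0 i) * psi x.
have sZ i : smooth (Z i) by apply: smoothM => //; exact: smooth_coordB.
have bZ i : bsupp (Z i) by exact: bsuppMr.
pose dv x := \sum_i partial i (Z i) x; pose yz x := \sum_i (x 0 i - c 0 i) * Z i x.
have yzE x : yz x = sqd c x * psi x.
  by rewrite /yz sqdE mulr_suml; apply: eq_bigr => i _; rewrite mulrA.
have sdv : smooth dv by apply: smooth_sum => i; exact: smooth_partial.
have bdv : bsupp dv by apply: bsupp_sum => i; exact: bsupp_partial.
have syz : smooth yz by apply: smooth_sum => i; apply: smoothM => //; exact: smooth_coordB.
have byz : bsupp yz by apply: bsupp_sum => i; exact: bsuppMr.
have [C C0 HC] := @bounded_derive1_step R.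
(* A point of positive slope exists because [step] grows from 0 to 1. *)
have [s0 [s00 s01 ds0]] : exists s0 : R, [/\ 0 < s0, s0 < 1 & 0 < derive1 step s0].
  have dst s : derivable (@step R) s 1 by exact/smooth1_derivable/smooth1_step.
  have [| |s] := @MVT R step (derive1 step) 0 1 ltr01.
  - by move=> s _; rewrite derive1E; exact: derivableP.
  - by apply: continuous_subspaceT; apply: smooth1_continuous; exact: smooth1_step.
  rewrite in_itv /= => /andP[s0 s1]; rewrite step_ge1 // step_le0 // !subr0 mulr1 => E.
  by exists s; split => //; rewrite -E.
pose l k : R := (k.+1)%:R; have l0 k : 0 < l k by rewrite ltr0n.
pose g k s := step (l k * (s - a) + s0).
have sg k : smooth1 (g k) by exact: smooth1_cutoff.
have E k := Int_div_radial c (sg k) sZ bZ.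
pose A : set 'rV[R]_n := [set x | sqd c x = a].
have mA : measurable A.
  rewrite -[X in measurable X]setCK; apply: measurableC; apply: measurable_open.
  apply: closed_openC; have -> : A = [set x | sqd c x <= a] `&` [set x | - sqd c x <= - a].
    by apply/seteqP; split => x /= => [->|[h1]]; rewrite lerN2 // => h2; apply/eqP; rewrite eq_le h1.
  apply: closedI; apply: closed_sublevel; first exact: sqd_continuous.
  by move=> x; apply: continuousN; exact: sqd_continuous.
have [L2' c2] : L1 (fun x => \1_A x * (2 * derive1 step s0 * yz x)) /\
    Int (fun x => derive1 step (l k * (sqd c x - a) + s0) * (2 * yz x)) @[k --> \oo] -->
    Int (fun x => \1_A x * (2 * derive1 step s0 * yz x)).
  apply: (@Int_cvg _ _ _ _ (fun x => C * (2 * `|yz x|))).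
  - move=> k; apply: mfun_cont; apply: smooth_continuous; apply: smoothM; last exact: smoothZ.
    apply: (@smooth_radial _ _ (fun s => derive1 step (l k * (s - a) + s0)) c).
    apply: (@smooth1_comp _ (derive1 step) (fun s => l k * (s - a) + s0)).
      by apply: smooth1_derive; exact: smooth1_step.
    apply: smooth1D; last exact: smooth1_cst.
    apply: smooth1M; first exact: smooth1_cst.
    by apply: smooth1D; [exact: smooth1_id|exact: smooth1_cst].
  - apply: mfunM; first exact: mfun_indic.
    by apply: mfun_cont; apply: smooth_continuous; exact: smoothZ.
  - apply: L1Z; apply: L1Z; apply: L1_abs.
    by apply: L1_bsupp => //; exact: smooth_continuous.
  - by move=> k x; rewrite !normrM [`|2|]ger0_norm // ler_wpM2r // mulr_ge0.
  - move=> x; rewrite indicE.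
    have [e|/eqP ne] := eqVneq (sqd c x) a.
      rewrite mem_set // mul1r e subrr.
      have -> : (fun k => derive1 step (l k * 0 + s0) * (2 * yz x)) = (fun=> 2 * derive1 step s0 * yz x).
        by apply/funext => k; rewrite mulr0 add0r mulrCA mulrA.
      exact: cvg_cst.
    rewrite memNset // mul0r; apply: cvg_near_cst; near=> k.
    have lk : `|sqd c x - a|^-1 * 2 <= l k.
      apply: (@le_trans _ _ k%:R); last by rewrite /l ler_nat.
      near: k; exact: nbhs_infty_ger.
    have d0 : 0 < `|sqd c x - a| by rewrite normr_gt0 subr_eq0; exact/eqP.
    have lk' : 2 <= l k * `|sqd c x - a|.
      by rewrite -ler_pdivrMr // mulrC.
    have [h|h] := ltP (sqd c x) a.
      rewrite derive1_step_le0 ?mul0r //; move: lk'; rewrite ltr0_norm ?subr_lt0 // mulrN; lra.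
    rewrite derive1_step_ge1 ?mul0r //; move: lk'; rewrite ger0_norm ?subr_ge0 //; lra.
have c1 : Int (fun x => derive1 step (l k * (sqd c x - a) + s0) * (2 * yz x)) @[k --> \oo] --> (0 : R).
  have Ldv : L1 (fun x => `|dv x|) by apply: L1_abs; apply: L1_bsupp => //; exact: smooth_continuous.
  have Ek k : Int (fun x => derive1 step (l k * (sqd c x - a) + s0) * (2 * yz x)) =
      - ((l k)^-1 * Int (fun x => g k (sqd c x) * dv x)).
    rewrite E mulrN opprK -IntZ.
      congr Int; apply/funext => x; by rewrite derive1_cutoff -!mulrA mulKf // gt_eqF.
    apply: L1_bsupp; last by apply: bsuppMr; apply: bsuppMr.
    apply: smooth_continuous; apply: smoothM; last exact: smoothZ.
    by apply: (smooth_radial c); exact: smooth1_derive.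
  apply/cvgr0Pnorm_le => e e0; near=> k; rewrite Ek normrN normrM gtr0_norm ?invr_gt0 //.
  have Lk : L1 (fun x => g k (sqd c x) * dv x).
    apply: L1_bsupp; last exact: bsuppMr.
    by apply: smooth_continuous; apply: smoothM sdv; exact: (smooth_radial c (sg k)).
  have B : `|Int (fun x => g k (sqd c x) * dv x)| <= Int (fun x => `|dv x|).
    apply: le_trans (abs_Int Lk) _; apply: le_Int => // [|x]; first exact: L1_abs.
    by rewrite normrM ler_piMl // ger0_norm ?step_ge0 ?step_le1.
  apply: (le_trans (ler_wpM2l (ltW _) B)); first by rewrite invr_gt0.
  rewrite mulrC ler_pdivrMr // mulrC -ler_pdivrMr //.
  apply: (@le_trans _ _ k%:R); last by rewrite /l ler_nat.
  near: k; exact: nbhs_infty_ger.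
have I0 : Int (fun x => \1_A x * (2 * derive1 step s0 * yz x)) = 0.
  exact: (cvg_unique (@norm_hausdorff _ _) c2 c1).
have : {ae lebesgue_row n, forall x, \1_A x * (2 * derive1 step s0 * yz x) = 0}.
  apply: Int_eq0_ae => // x; rewrite yzE indicE; apply: mulr_ge0 => //.
  apply: mulr_ge0 (mulr_ge0 (sqd_ge0 _ _) (step_ge0 _)); apply: mulr_ge0 (ltW ds0) => //.
apply: filterS => x; have [e|//] := eqVneq (sqd c x) a.
rewrite indicE mem_set // mul1r yzE e /psi e step_ge1 ?mulr1; last lra.
by move=> /eqP; rewrite !mulf_eq0 pnatr_eq0 /= (gt_eqF ds0) (gt_eqF a0).
Unshelve. all: by end_near. Qed.

End cut.

(** * Green identities, dipoles and the explicit transmission solution *)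

Section transmission.
Context {R : realType} {n : nat}.
Implicit Types (f phi : 'rV[R]_n -> R) (x b c : 'rV[R]_n) (P : R -> R).

Definition gdot f g x : R := \sum_i partial i f x * partial i g x.

Lemma smooth_gdot f g : smooth f -> smooth g -> smooth (gdot f g).
Proof. by move=> sf sg; apply: smooth_sum => i; apply: smoothM; exact: smooth_partial. Qed.

Lemma bsupp_gdot f g : bsupp g -> bsupp (gdot f g).
Proof. by move=> bg; apply: bsupp_sum => i; apply: bsuppMr; exact: bsupp_partial. Qed.

Lemma partial_smul f g i x : smooth f -> smooth g ->
  partial i (fun x => f x * g x) x = partial i f x * g x + f x * partial i g x.
Proof.
move=> sf sg; have E := partialM i (fun y => smooth_diff y sf) (fun y => smooth_diff y sg).
by rewrite E.
Qed.

Lemma partial_sadd f g i x : smooth f -> smooth g ->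
  partial i (fun x => f x + g x) x = partial i f x + partial i g x.
Proof.
move=> sf sg; have E := partialD i (fun y => smooth_diff y sf) (fun y => smooth_diff y sg).
by rewrite E.
Qed.

Lemma div_mul_grad f phi x : smooth f -> smooth phi ->
  \sum_i partial i (fun x => f x * partial i phi x) x = f x * laplacian phi x + gdot f phi x.
Proof.
move=> sf sp; rewrite /laplacian /gdot mulr_sumr -big_split; apply: eq_bigr => i _ /=.
rewrite partial_smul //; last exact: smooth_partial.
by rewrite addrC.
Qed.

Lemma L1_smooth_bsupp f : smooth f -> bsupp f -> L1 f.
Proof. by move=> sf; apply: L1_bsupp; exact: smooth_continuous. Qed.

Lemma Int_green f phi : smooth f -> smooth phi -> bsupp phi \/ bsupp f ->
  Int (fun x => f x * laplacian phi x) = - Int (gdot f phi).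
Proof.
move=> sf sp bb.
have sZ i : smooth (fun x => f x * partial i phi x) by apply: smoothM => //; exact: smooth_partial.
have bZ i : bsupp (fun x => f x * partial i phi x).
  by case: bb => bb; [apply: bsuppMr; exact: bsupp_partial|exact: bsuppMl].
have E : Int (fun x => \sum_i partial i (fun x => f x * partial i phi x) x) = 0.
  rewrite Int_sum => [|i]; first by apply: big1 => i _; exact: Int_partial_smooth.
  by apply: L1_smooth_bsupp; [exact: smooth_partial|exact: bsupp_partial].
apply/eqP; rewrite -subr_eq0 opprK -IntD; last 2 first.
- apply: L1_smooth_bsupp; first by apply: smoothM => //; exact: smooth_laplacian.
  case: bb => bb; last exact: bsuppMl.
  by apply: bsuppMr; apply: bsupp_sum => i; do 2 apply: bsupp_partial.
- apply: L1_smooth_bsupp; first exact: smooth_gdot.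
  case: bb => bb; first exact: bsupp_gdot.
  by apply: bsupp_sum => i; apply: bsuppMl; exact: bsupp_partial.
apply/eqP; rewrite -[RHS]E; congr Int; apply/funext => x.
by rewrite div_mul_grad.
Qed.

Lemma gdotC f g : gdot f g = gdot g f.
Proof. by apply/funext => x; apply: eq_bigr => i _; rewrite mulrC. Qed.

Lemma Int_green2 f phi : smooth f -> smooth phi -> bsupp phi ->
  Int (fun x => f x * laplacian phi x) = Int (fun x => phi x * laplacian f x).
Proof.
move=> sf sp bp; apply: (etrans (Int_green sf sp (or_introl bp))).
by rewrite gdotC; symmetry; exact: (Int_green sp sf (or_intror bp)).
Qed.

Definition lin b c x : R := \sum_i b 0 i * (x 0 i - c 0 i).

Lemma lin_dotr b c x : lin b c x = dotr b (x - c).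
Proof. by apply: eq_bigr => i _; rewrite !mxE. Qed.

Lemma smooth_lin b c : smooth (lin b c).
Proof. by apply: smooth_sum => i; apply: smoothZ; exact: smooth_coordB. Qed.

Lemma partial_lin b c i : partial i (lin b c) = fun=> b 0 i.
Proof.
rewrite /lin (partial_sum _ _ i (fun j => smoothZ (b 0 j) (smooth_coordB c j))).
apply/funext => x; under eq_bigr do rewrite (partialZ i _ (smooth_coordB c _)) partial_coordB.
exact: sum_delta.
Qed.

Lemma laplacian_lin b c x : laplacian (lin b c) x = 0.
Proof. by apply: big1 => i _; rewrite partial_lin partial_cst. Qed.

Definition dipole P b c x : R := P (sqd c x) * lin b c x.

Lemma smooth_dipole P b c : smooth1 P -> smooth (dipole P b c).
Proof. by move=> sP; apply: smoothM; [exact: smooth_radial|exact: smooth_lin]. Qed.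

Lemma partial_dipole P b c i x : smooth1 P -> partial i (dipole P b c) x =
  derive1 P (sqd c x) * (2 * (x 0 i - c 0 i)) * lin b c x + P (sqd c x) * b 0 i.
Proof.
move=> sP; rewrite partial_smul ?partial_radial ?partial_lin //; first exact: smooth_radial.
exact: smooth_lin.
Qed.

Lemma laplacian_mul f g x : smooth f -> smooth g ->
  laplacian (fun x => f x * g x) x = laplacian f x * g x + 2 * gdot f g x + f x * laplacian g x.
Proof.
move=> sf sg; rewrite /laplacian /gdot mulr_suml !mulr_sumr -!big_split.
apply: eq_bigr => i _ /=.
have si : smooth (partial i f) by exact: smooth_partial.
have sj : smooth (partial i g) by exact: smooth_partial.
have -> : partial i (fun x => f x * g x) = fun x => partial i f x * g x + f x * partial i g x.
  by apply/funext => y; exact: partial_smul.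
rewrite partial_sadd ?partial_smul //; try exact: smoothM.
move: (partial i (partial i f) x) (partial i (partial i g) x) (partial i f x) (partial i g x).
by move=> u v w z; ring.
Qed.

Lemma laplacian_dipole P b c x : smooth1 P -> laplacian (dipole P b c) x =
  2 * ((n%:R + 2) * derive1 P (sqd c x) + 2 * sqd c x * derive1 (derive1 P) (sqd c x)) * lin b c x.
Proof.
move=> sP; rewrite laplacian_mul; [|exact: smooth_radial|exact: smooth_lin].
rewrite laplacian_lin laplacian_radial // /gdot.
have -> : \sum_i partial i (fun x => P (sqd c x)) x * partial i (lin b c) x =
    2 * derive1 P (sqd c x) * lin b c x.
  rewrite /lin mulr_sumr; apply: eq_bigr => i _; rewrite partial_radial // partial_lin.
  by move: (derive1 P _) (x 0 i - c 0 i) (b 0 i) => u v w; ring.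
by move: (sqd c x) (lin b c x) (derive1 P (sqd c x)) (derive1 (derive1 P) (sqd c x)) => z w u v; ring.
Qed.

(** Supplies the linear decay required by [cut_div]: the mean value theorem on a bounded range of
    radii, the bounded support beyond it. *)
Lemma lip_cut (S : R -> R) (psi : 'rV[R]_n -> R) c (a : R) : smooth1 S -> S a = 0 ->
  continuous psi -> bsupp psi ->
  exists K : R, forall x, a < sqd c x -> `|S (sqd c x) * psi x| <= K * (sqd c x - a).
Proof.
move=> sS Sa cpsi [M HM].
have [C C0 HC] := bsupp_bounded cpsi (ex_intro _ M HM).
pose T := (`|M| + enorm c) ^+ 2.
have tT x : sqd c x > T -> psi x = 0.
  move=> tx; apply: HM; rewrite ltNge; apply/negP => xM; move: tx; rewrite ltNge => /negP; apply.
  rewrite sqd_enorm /T ler_sqr ?nnegrE ?addr_ge0 ?enorm_ge0 //.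
  apply: le_trans (enormD _ _) _; rewrite enormN lerD2r.
  exact: le_trans xM (ler_norm _).
have cS' : {within `[a, Num.max a T], continuous (fun s => `|derive1 S s|)}.
  apply: continuous_subspaceT => s; apply: continuous_comp; last exact: norm_continuous.
  by apply: smooth1_continuous; exact: smooth1_derive.
have aT : a <= Num.max a T by rewrite le_max lexx.
have [m _ Hm] := EVT_max aT cS'.
exists (`|derive1 S m| * C) => x ax.
have [tT'|tT'] := ltP T (sqd c x).
  by rewrite tT // mulr0 normr0 mulr_ge0 ?subr_ge0 ?(ltW ax) // mulr_ge0.
have [|s|] := @MVT R S (derive1 S) a (sqd c x) ax.
- by move=> s _; rewrite derive1E; apply: derivableP; exact: smooth1_derivable.
- by apply: continuous_subspaceT; exact: smooth1_continuous.
move=> s; rewrite in_itv /= => /andP[s1 s2]; rewrite Sa subr0 => ->.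
rewrite normrM normrM [`|sqd c x - a|]gtr0_norm ?subr_gt0 //.
rewrite mulrAC ler_wpM2r ?subr_ge0 ?(ltW ax) // ler_pM // Hm //.
by rewrite in_itv /= (ltW s1) /= le_max (le_trans (ltW s2) tT') orbT.
Qed.

(** Here [a] is the squared radius of the sphere. [Pa] matches the values of [uin] and [uout] on it,
    [dPa] the normal components of sg grad uin and grad uout, and [P2] makes the dipole harmonic
    outside. *)
Variables (c b : 'rV[R]_n) (a sg k : R) (P : R -> R).
Hypotheses (sg0 : 0 < sg) (sP : smooth1 P) (Pa : P a = sg^-1)
  (dPa : P a + 2 * a * derive1 P a = 1)
  (P2 : forall s, a < s -> (n%:R + 2) * derive1 P s + 2 * s * derive1 (derive1 P) s = 0).

Definition uin x : R := sg^-1 * (2^-1 * sqd c x + lin b c x + k).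
Definition uout x : R := 2^-1 * sqd c x + dipole P b c x + (sg^-1 * (2^-1 * a + k) - 2^-1 * a).

Lemma smooth_uin : smooth uin.
Proof.
apply: smoothZ; apply: smoothD; last exact: smooth_cst.
by apply: smoothD; [apply: smoothZ; exact: smooth_sqd|exact: smooth_lin].
Qed.

Lemma smooth_uout : smooth uout.
Proof.
apply: smoothD; last exact: smooth_cst.
by apply: smoothD; [apply: smoothZ; exact: smooth_sqd|exact: smooth_dipole].
Qed.

Lemma laplacian_uin x : laplacian uin x = sg^-1 * n%:R.
Proof.
have s1 : smooth (fun x => 2^-1 * sqd c x) by apply: smoothZ; exact: smooth_sqd.
have s2 : smooth (fun x => 2^-1 * sqd c x + lin b c x) by apply: smoothD => //; exact: smooth_lin.
have s3 : smooth (fun x => 2^-1 * sqd c x + lin b c x + k) by apply: smoothD => //; exact: smooth_cst.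
have s4 := smooth_cst (n := n) k; have s5 := smooth_lin b c.
rewrite /uin (laplacianZ _ x s3) (laplacianD x s2 s4) (laplacianD x s1 s5).
rewrite (laplacianZ _ x (smooth_sqd c)) laplacian_sqd laplacian_lin addr0 mulKf ?pnatr_eq0 //.
by rewrite [laplacian (fun=> k) x]big1 ?addr0 // => i _; rewrite !partial_cst.
Qed.

Let out := [set x | a < sqd c x].
(** The two jumps at the sphere: [W] vanishes there, and [V] has zero normal derivative there. *)
Let W x := uout x - uin x.
Let V x := uout x + - sg * uin x.

Let sW : smooth W. Proof. by apply: smoothB; [exact: smooth_uout|exact: smooth_uin]. Qed.
Let sV : smooth V. Proof. by apply: smoothD; [exact: smooth_uout|apply: smoothZ; exact: smooth_uin]. Qed.

Let VE x : V x = dipole (fun s => P s - 1) b c x + (sg^-1 * (2^-1 * a + k) - 2^-1 * a - k).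
Proof.
rewrite /V /uout /uin /dipole; move: (sqd c x) (lin b c x) (P (sqd c x)) => s l p.
by field; rewrite gt_eqF.
Qed.

Let sP1 : smooth1 (fun s => P s - 1).
Proof. by apply: smooth1D => //; exact: smooth1_cst. Qed.

Let dP1 : derive1 (fun s => P s - 1) = derive1 P.
Proof.
rewrite derive1D => [|s|s]; last 2 first.
- exact: smooth1_derivable.
- exact: derivable_cst.
by apply/funext => s; rewrite derive1_const addr0.
Qed.

Let partial_V i x : partial i V x =
  derive1 P (sqd c x) * (2 * (x 0 i - c 0 i)) * lin b c x + (P (sqd c x) - 1) * b 0 i.
Proof.
rewrite (_ : V = fun x => dipole (fun s => P s - 1) b c x + (sg^-1 * (2^-1 * a + k) - 2^-1 * a - k)).
  rewrite partial_sadd; [|exact: smooth_dipole|exact: smooth_cst].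
  by rewrite partial_dipole // partial_cst addr0 dP1.
by apply/funext => y; exact: VE.
Qed.

Let laplacian_V x : out x -> laplacian V x = 0.
Proof.
move=> ox.
rewrite (_ : V = fun x => dipole (fun s => P s - 1) b c x + (sg^-1 * (2^-1 * a + k) - 2^-1 * a - k)).
  rewrite laplacianD; [|exact: smooth_dipole|exact: smooth_cst].
  rewrite laplacian_dipole // dP1 P2 // mulr0 mul0r add0r.
  by apply: big1 => i _; rewrite !partial_cst.
by apply/funext => y; exact: VE.
Qed.

(** The counterpart of [weak_laplacian] for the function equal to [uin] inside and [uout] outside;
    the difference of the two identities expresses harmonicity across the sphere. Green's formula
    for [uin] in the whole space is combined with [cut_div] for the fields W grad phi and phi grad
    V. *)
Lemma transmission phi : smooth phi -> bsupp phi ->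
  Int (fun x => uin x * laplacian phi x) + Int (fun x => \1_out x * ((uout x - uin x) * laplacian phi x)) =
  n%:R * Int phi + (sg - 1) * Int (fun x => (1 - \1_out x) * gdot uin phi x).
Proof.
move=> sp bp.
have si i : smooth (partial i phi) by exact: smooth_partial.
have su := smooth_uin.
have L f : smooth f -> bsupp f -> L1 (fun x => \1_out x * f x).
  move=> sf bf; have := @L1Ml _ _ f (\1_out) 1 (L1_smooth_bsupp sf bf) (mfun_outside c a).
  have B x : `|\1_out x : R| <= 1 by rewrite indicE; case: (_ \in _); rewrite ?normr1 ?normr0.
  move=> /(_ B).
  by congr L1; apply/funext => x; rewrite mulrC.
have sgW := smooth_gdot sW sp; have bgW := bsupp_gdot W bp.
have sgu := smooth_gdot su sp; have bgu := bsupp_gdot uin bp.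
have sgV := smooth_gdot sV sp; have bgV := bsupp_gdot V bp.
have sl : smooth (laplacian phi) by exact: smooth_laplacian.
have bl : bsupp (laplacian phi) by apply: bsupp_sum => i; do 2 apply: bsupp_partial.
have H1 : Int (fun x => \1_out x * (W x * laplacian phi x)) = - Int (fun x => \1_out x * gdot W phi x).
  pose Z i x := W x * partial i phi x.
  pose yp x := \sum_i (x 0 i - c 0 i) * partial i phi x.
  have syp : smooth yp by apply: smooth_sum => i; apply: smoothM => //; exact: smooth_coordB.
  have byp : bsupp yp by apply: bsupp_sum => i; apply: bsuppMr; exact: bsupp_partial.
  have sS : smooth1 (fun s => P s - P a) by apply: smooth1D => //; exact: smooth1_cst.
  have [K1 HK1] : exists K : R, forall x, a < sqd c x ->
      `|(P (sqd c x) - P a) * (lin b c x * yp x)| <= K * (sqd c x - a).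
    apply: (lip_cut c sS) => //; first by rewrite subrr.
      by apply: smooth_continuous; apply: smoothM => //; exact: smooth_lin.
    exact: bsuppMr.
  have sT : smooth1 (fun s => s - a) by apply: smooth1D; [exact: smooth1_id|exact: smooth1_cst].
  have [K2 HK2] : exists K : R, forall x, a < sqd c x ->
      `|(sqd c x - a) * ((2^-1 * (1 - sg^-1)) * yp x)| <= K * (sqd c x - a).
    apply: (lip_cut c sT) => //; first by rewrite subrr.
      by apply: smooth_continuous; exact: smoothZ.
    exact: bsuppMr.
  have sZ i : smooth (Z i) by exact: smoothM.
  have bZ i : bsupp (Z i) by apply: bsuppMr; exact: bsupp_partial.
  have [] := @cut_div _ _ c a (K1 + K2) Z sZ bZ.
    move=> x ax.
    have -> : \sum_i (x 0 i - c 0 i) * Z i x = (P (sqd c x) - P a) * (lin b c x * yp x) +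
        (sqd c x - a) * ((2^-1 * (1 - sg^-1)) * yp x).
      have -> : \sum_i (x 0 i - c 0 i) * Z i x = W x * yp x.
        by rewrite /yp mulr_sumr; apply: eq_bigr => i _; rewrite /Z mulrCA.
      rewrite /W /uout /uin /dipole Pa; move: (sqd c x) (lin b c x) (yp x) (P (sqd c x)) => s l y p.
      by field; rewrite gt_eqF.
    by apply: le_trans (ler_normD _ _) _; rewrite [leRHS]mulrDl lerD ?HK1 ?HK2.
  move=> _ E; apply/eqP; rewrite -subr_eq0 opprK -IntD; last 2 first.
  - by apply: L; [exact: smoothM|exact: bsuppMr].
  - exact: L.
  apply/eqP; rewrite -[RHS]E; congr Int; apply/funext => x.
  by rewrite -mulrDr div_mul_grad.
have H2 : Int (fun x => \1_out x * gdot V phi x) = 0.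
  pose Z i x := phi x * partial i V x.
  have sS : smooth1 (fun s => P s - 1 + 2 * s * derive1 P s).
    apply: smooth1D => //; apply: smooth1M; last exact: smooth1_derive.
    by apply: smooth1M; [exact: smooth1_cst|exact: smooth1_id].
  have [K HK] : exists K : R, forall x, a < sqd c x ->
      `|(P (sqd c x) - 1 + 2 * sqd c x * derive1 P (sqd c x)) * (lin b c x * phi x)| <= K * (sqd c x - a).
    apply: (lip_cut c sS) => //; first by rewrite addrAC dPa subrr.
      by apply: smooth_continuous; apply: smoothM => //; exact: smooth_lin.
    exact: bsuppMr.
  have sZ i : smooth (Z i) by apply: smoothM => //; exact: smooth_partial.
  have bZ i : bsupp (Z i) by exact: bsuppMl.
  have [] := @cut_div _ _ c a K Z sZ bZ.
    move=> x ax; have -> : \sum_i (x 0 i - c 0 i) * Z i x =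
        (P (sqd c x) - 1 + 2 * sqd c x * derive1 P (sqd c x)) * (lin b c x * phi x); last exact: HK.
    transitivity (\sum_i (derive1 P (sqd c x) * 2 * lin b c x * phi x * ((x 0 i - c 0 i) * (x 0 i - c 0 i)) +
        phi x * (P (sqd c x) - 1) * (b 0 i * (x 0 i - c 0 i)))).
      apply: eq_bigr => i _; rewrite /Z partial_V.
      by move: (derive1 P _) (P _) (lin _ _ _) (phi x) (x 0 i - c 0 i) (b 0 i) => p q l f y d; ring.
    rewrite big_split -!mulr_sumr -sqdE -/(lin b c x) /=.
    by move: (sqd c x) (lin b c x) (phi x) (P (sqd c x)) (derive1 P (sqd c x)) => s l f p q; ring.
  move=> _ E; rewrite -[RHS]E; congr Int; apply/funext => x.
  rewrite div_mul_grad // gdotC indicE; case: (boolP (x \in out)) => [|_]; last by rewrite !mul0r.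
  by rewrite inE => ox; rewrite laplacian_V // mulr0 add0r.
have H3 : Int (fun x => \1_out x * gdot W phi x) = (sg - 1) * Int (fun x => \1_out x * gdot uin phi x).
  have LV := L _ sgV bgV; have Lu := L _ sgu bgu.
  rewrite -[RHS]add0r -H2 -IntZ // -IntD //; last exact: L1Z.
  congr Int; apply/funext => x; rewrite mulrCA -mulrDr; congr (_ * _).
  rewrite /gdot mulr_sumr -big_split; apply: eq_bigr => i _ /=.
  have -> : partial i W x = partial i V x + (sg - 1) * partial i uin x.
    have so := smooth_uout; have sn : smooth (fun x => - uin x) by exact: smoothN.
    have sz : smooth (fun x => - sg * uin x) by exact: smoothZ.
    rewrite /W /V (partial_sadd i x so sn) (partial_sadd i x so sz) (partialZ i _ su).
    have -> : partial i (fun x => - uin x) x = - partial i uin x.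
      by have E := partialN i (fun y => smooth_diff y su); rewrite E.
    by move: (partial i uout x) (partial i uin x) => u v; ring.
  by rewrite mulrDl mulrA.
have Lu1 := L _ sgu bgu; have Lu := L1_smooth_bsupp sgu bgu.
have -> : Int (fun x => (1 - \1_out x) * gdot uin phi x) =
    Int (gdot uin phi) - Int (fun x => \1_out x * gdot uin phi x).
  by rewrite -IntB //; congr Int; apply/funext => x; rewrite mulrBl mul1r.
rewrite H1 H3.
have G1 : Int (fun x => uin x * laplacian phi x) = sg^-1 * n%:R * Int phi.
  rewrite Int_green2 // -IntZ; last exact: L1_smooth_bsupp.
  by congr Int; apply/funext => x; rewrite laplacian_uin mulrC.
have G2 : Int (gdot uin phi) = - (sg^-1 * n%:R * Int phi).
  by rewrite -G1 (Int_green su sp (or_introl bp)) opprK.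
rewrite G1 G2; move: (Int _) (Int _) => u v; field; rewrite gt_eqF //.
Qed.

End transmission.

(** * Weak solutions *)

Section sobolev_theory.
Context {R : realType} {n : nat}.
Local Notation mu := (@lebesgue_row R n).
Implicit Types (f g u phi : 'rV[R]_n -> R) (x y : 'rV[R]_n) (O Omega D : set 'rV[R]_n).

Lemma eint_restrict (A : set 'rV[R]_n) f : measurable A ->
  (\int[mu]_(x in A) (f x)%:E = \int[mu]_x (\1_A x * f x)%:E)%E.
Proof.
move=> mA; rewrite integral_mkcond; apply: eq_integral => x _; rewrite /patch indicE.
by case: ifP => _; rewrite ?mul1r ?mul0r.
Qed.

Lemma mfun_res (A : set 'rV[R]_n) f : measurable A ->
  measurable_fun A (f : 'rV[R]_n -> measurableTypeR R) -> mfun (fun x => \1_A x * f x).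
Proof.
move=> mA mf.
have -> : (fun x => \1_A x * f x) = f \_ A.
  by apply/funext => x; rewrite /patch indicE; case: ifP => _; rewrite ?mul1r ?mul0r.
exact: (iffLR (measurable_restrictT _ mA) mf).
Qed.

Lemma indic_sqr (A : set 'rV[R]_n) x : \1_A x * \1_A x = \1_A x :> R.
Proof. by rewrite indicE; case: (_ \in _); rewrite ?mulr1 ?mulr0. Qed.

Lemma indic_le1 (A : set 'rV[R]_n) x : `|\1_A x : R| <= 1.
Proof. by rewrite indicE; case: (_ \in _); rewrite ?normr1 ?normr0. Qed.

Lemma L1_fun_ge0 f : mfun f -> (forall x, 0 <= f x) -> (\int[mu]_x (f x)%:E < +oo)%E -> L1 f.
Proof.
move=> mf f0 If; apply/integrableP; split; first exact: mfun_EFin.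
by under eq_integral => x _ do rewrite /= (ger0_norm (f0 x)).
Qed.

Lemma L1_indic_open O : open O -> ebounded O -> L1 (\1_O).
Proof. by move=> oO [M OM]; apply: (@L1_indic _ _ _ M) => //; exact: measurable_open. Qed.

Lemma L1_of_L2 O f : open O -> ebounded O -> mfun (fun x => \1_O x * f x) ->
  L1 (fun x => \1_O x * f x ^+ 2) -> L1 (fun x => \1_O x * f x).
Proof.
move=> oO bO mf Lf; apply: (@L1_le _ _ _ (fun x => \1_O x + \1_O x * f x ^+ 2)) => //.
  by apply: L1D => //; exact: L1_indic_open.
move=> x; have -> : \1_O x + \1_O x * f x ^+ 2 = \1_O x * (1 + f x ^+ 2) by rewrite mulrDr mulr1.
rewrite normrM ger0_norm ?indicE // ler_wpM2l // -(@real_normK _ (f x)) ?num_real //.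
by have := normr_ge0 (f x); move: `|f x| => t t0; nra.
Qed.

Lemma L2_res Omega f : open Omega -> ebounded Omega -> L2 Omega f ->
  [/\ mfun (fun x => \1_Omega x * f x), L1 (fun x => \1_Omega x * f x ^+ 2) &
      L1 (fun x => \1_Omega x * f x)].
Proof.
move=> oO bO [mf If]; have mO := measurable_open oO.
have mf' := mfun_res mO mf.
have Lf : L1 (fun x => \1_Omega x * f x ^+ 2).
  apply: L1_fun_ge0 => [|x|].
  - rewrite (_ : (fun x => _) = fun x => (\1_Omega x * f x) * (\1_Omega x * f x)).
      exact: mfunM.
    by apply/funext => x; rewrite mulrACA indic_sqr expr2.
  - by rewrite mulr_ge0 ?sqr_ge0 // indicE.
  - by rewrite -eint_restrict.
by split => //; exact: L1_of_L2.
Qed.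

Lemma L1_ae f g : mfun f -> L1 g -> {ae mu, forall x, f x = g x} -> L1 f.
Proof.
move=> mf Lg fg; apply/integrableP; split; first exact: mfun_EFin.
have /integrableP[_ Ig] := Lg.
rewrite (@ae_eq_integral _ _ _ mu setT (fun x => `|(EFin \o g) x|)%E (fun x => `|(EFin \o f) x|)%E) //.
- by apply: measurableT_comp => //; exact: mfun_EFin.
- by apply: measurableT_comp => //; exact: mfun_EFin (L1_mfun Lg).
- by apply: filterS fg => x /= ->.
Qed.

Lemma mfun_open O f : open O -> (forall x, O x -> {for x, continuous f}) ->
  mfun (fun x => \1_O x * f x).
Proof.
move=> oO cf; apply: mfun_res; first exact: measurable_open.
apply: (measurability _ (measurable_realfun.RGenOInfty.measurableE R)).
move=> /= _ [_ [a ->]] <-; apply: measurable_open.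
rewrite openE => x [Ox] /=; rewrite in_itv /= andbT => fx.
apply: filterI; first exact: open_nbhs_nbhs.
have := cf x Ox; apply; apply: open_nbhs_nbhs; split; first exact: interval_open.
by rewrite /= in_itv /= andbT.
Qed.

Lemma ae_eq_open O f g : open O -> (forall x, O x -> {for x, continuous f}) ->
  (forall x, O x -> {for x, continuous g}) -> {ae mu, forall x, O x -> f x = g x} ->
  forall x, O x -> f x = g x.
Proof.
move=> oO cf cg fg x Ox; apply/eqP; apply: contrapT => /negP fgx.
have d0 : 0 < `|f x - g x| by rewrite normr_gt0 subr_eq0.
have ch : {for x, continuous (fun y => `|f y - g y|)}.
  apply: (continuous_comp (f := fun y => f y - g y) (g := fun t => `|t|)).
    by apply: continuousB; [exact: cf|exact: cg].
  exact: norm_continuous.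
have N : nbhs x (O `&` [set y | 0 < `|f y - g y|]).
  apply: filterI; first exact: open_nbhs_nbhs.
  by apply: (ch [set t | 0 < t]); apply: open_nbhs_nbhs; split => //; exact: open_gt.
have [r r0 rO] := nbhs_eball N.
have [y yr] := ae_open (@open_eball _ _ x r) (ex_intro _ x (@eball_center _ _ x r r0)) fg.
by have [Oy /= +] := rO y yr => /[swap] /(_ Oy) ->; rewrite subrr normr0 ltxx.
Qed.

Lemma test_intro Omega (C : set 'rV[R]_n) phi : smooth phi -> compact C -> closed C ->
  C `<=` Omega -> (forall x, ~ C x -> phi x = 0) -> test_function Omega phi.
Proof.
move=> sp cC clC CO phi0.
have sub : closure [set x | phi x != 0] `<=` C.
  rewrite [X in _ `<=` X](closure_id C).1 //; apply: closure_subset => x /= px.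
  by apply: contrapT => nC; rewrite phi0 // eqxx in px.
split => //; last exact: subset_trans sub CO.
by apply: (subclosed_compact _ cC sub); exact: closed_closure.
Qed.

Lemma test_elim Omega phi : test_function Omega phi ->
  exists C, [/\ compact C, closed C, C `<=` Omega & forall x, ~ C x -> phi x = 0].
Proof.
move=> [sp cp pO]; exists (closure [set x | phi x != 0]); split => //.
  exact: closed_closure.
move=> x nx; apply/eqP; apply: contrapT => /negP px; apply: nx; exact: subset_closure.
Qed.

Lemma bsupp_compact f (C : set 'rV[R]_n) : compact C -> (forall x, ~ C x -> f x = 0) -> bsupp f.
Proof.
move=> /compact_bounded[M [_ HM]] f0; exists (n%:R * (M + 1)) => x xM; apply: f0 => Cx.
have /HM/(_ x Cx) xM1 : M < M + 1 by rewrite ltrDl.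
move: xM; rewrite ltNge => /negP; apply.
by apply: le_trans (enorm_le_norm x) _; rewrite ler_wpM2l.
Qed.

Lemma test_smooth Omega phi : test_function Omega phi -> smooth phi.
Proof. by case. Qed.

Lemma test_bsupp Omega phi : test_function Omega phi -> bsupp phi.
Proof. by move=> /test_elim[C [cC _ _ C0]]; exact: bsupp_compact C0. Qed.

Lemma test_out Omega phi x : test_function Omega phi -> ~ Omega x -> phi x = 0.
Proof. by move=> /test_elim[C [_ _ CO C0]] nx; apply: C0 => /CO. Qed.

Lemma test_partial Omega phi i : test_function Omega phi -> test_function Omega (partial i phi).
Proof.
move=> tp; have sp := test_smooth tp; have [C [cC clC CO C0]] := test_elim tp.
apply: (test_intro _ cC clC CO); first exact: smooth_partial.
move=> x nx; rewrite (@partial_open _ _ i _ (fun=> 0 : R) (~` C) x) ?partial_cst //.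
exact: closed_openC.
Qed.

Lemma test_mull Omega f phi : smooth f -> test_function Omega phi ->
  test_function Omega (fun x => f x * phi x).
Proof.
move=> sf tp; have sp := test_smooth tp; have [C [cC clC CO C0]] := test_elim tp.
apply: (test_intro _ cC clC CO); first exact: smoothM.
by move=> x nx; rewrite C0 // mulr0.
Qed.

Lemma test_indic Omega f phi x : test_function Omega phi ->
  \1_Omega x * f x * phi x = f x * phi x.
Proof.
move=> tp; rewrite indicE; case: (boolP (x \in Omega)) => [_|]; first by rewrite mul1r.
by rewrite notin_setE => nx; rewrite (test_out tp nx) !mulr0.
Qed.

Lemma mfun_measurable Omega f : measurable Omega -> mfun f ->
  measurable_fun Omega (f : 'rV[R]_n -> measurableTypeR R).
Proof. by move=> mO mf; exact: measurable_funS mf. Qed.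

Lemma L2_intro Omega f : measurable Omega -> mfun f -> L1 (fun x => f x ^+ 2) -> L2 Omega f.
Proof.
move=> mO mf Lf; split; first exact: mfun_measurable.
have L : L1 (fun x => \1_Omega x * f x ^+ 2).
  have := @L1Ml _ _ _ (\1_Omega) 1 Lf (mfun_indic mO) (indic_le1 Omega).
  by congr L1; apply/funext => x; rewrite mulrC.
by rewrite eint_restrict // L1_fin // ltry.
Qed.

Lemma test_L2 Omega phi : measurable Omega -> test_function Omega phi -> L2 Omega phi.
Proof.
move=> mO tp; have sp := test_smooth tp; have bp := test_bsupp tp.
apply: L2_intro => //; first by apply: mfun_cont; exact: smooth_continuous.
apply: L1_smooth_bsupp; first exact: smoothX.
by have := @bsuppMl _ _ _ phi bp; congr bsupp.
Qed.

Lemma test_weak_gradient Omega phi : measurable Omega -> smooth phi ->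
  weak_gradient Omega phi (grad phi).
Proof.
move=> mO sp psi tq i; have sq := test_smooth tq; have bq := test_bsupp tq.
rewrite !Int_restrict //.
have -> : (fun x => \1_Omega x * (phi x * partial i psi x)) = fun x => phi x * partial i psi x.
  by apply/funext => x; rewrite mulrA (test_indic _ _ (test_partial i tq)).
have -> : (fun x => \1_Omega x * (grad phi x 0 i * psi x)) = fun x => partial i phi x * psi x.
  by apply/funext => x; rewrite mulrA (test_indic (fun x => grad phi x 0 i) _ tq) mxE.
by rewrite (Int_by_parts i sp sq (or_intror bq)) opprK.
Qed.

Lemma test_H01 Omega phi : measurable Omega -> test_function Omega phi ->
  H01 Omega phi (grad phi).
Proof.
move=> mO tp; have sp := test_smooth tp; split.
  split; [exact: test_L2|move=> i|exact: test_weak_gradient].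
  rewrite (_ : (fun x => _) = partial i phi); first by apply: test_L2 => //; exact: test_partial.
  by apply/funext => x; rewrite mxE.
exists (fun=> phi); split => //.
  rewrite (_ : (fun _ => _) = fun=> 0%E); first exact: cvg_cst.
  by apply/funext => k; apply: integral0_eq => x _; rewrite subrr expr0n.
rewrite (_ : (fun _ => _) = fun=> 0%E); first exact: cvg_cst.
by apply/funext => k; apply: integral0_eq => x _; rewrite subrr enorm0 expr0n.
Qed.

(* On Omega the conductivity is 1 + (sg - 1) \1_D. *)
Record weak_solution (sg : R) D Omega u (G : 'I_n -> 'rV[R]_n -> R) : Prop := WeakSolution {
  weak_L1 : L1 (fun x => \1_Omega x * u x);
  weak_grad_L1 : forall i, L1 (G i);
  weak_grad : forall phi i, test_function Omega phi ->
    Int (fun x => \1_Omega x * u x * partial i phi x) = - Int (fun x => G i x * phi x);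
  weak_eq : forall phi, test_function Omega phi ->
    - (Int (fun x => \sum_i G i x * partial i phi x) +
       (sg - 1) * Int (fun x => \1_D x * \sum_i G i x * partial i phi x)) = n%:R * Int phi
}.

Lemma test_mulr_L1 Omega phi f : L1 f -> test_function Omega phi -> L1 (fun x => f x * phi x).
Proof.
move=> Lf tp; have cp := smooth_continuous (test_smooth tp).
have [C C0 HC] := bsupp_bounded cp (test_bsupp tp).
by apply: (L1Ml Lf _ HC); exact: mfun_cont.
Qed.

Lemma L1_indicM (A : set 'rV[R]_n) f : measurable A -> L1 f -> L1 (fun x => \1_A x * f x).
Proof.
move=> mA Lf; have := @L1Ml _ _ f (\1_A) 1 Lf (mfun_indic mA) (indic_le1 A).
by congr L1; apply/funext => x; rewrite mulrC.
Qed.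

(** The gradient is extended by 0 outside [Omega], which makes its components integrable on the
    whole space. *)
Lemma two_phase_weak sg D Omega u : open Omega -> ebounded Omega -> measurable D -> D `<=` Omega ->
  two_phase_solution sg D Omega u -> exists G, weak_solution sg D Omega u G.
Proof.
move=> oO bO mD DO [g [[Lu Lg wg] _] we].
have mO := measurable_open oO.
have LG i := L2_res oO bO (Lg i); have [_ _ Lu'] := L2_res oO bO Lu.
exists (fun i x => \1_Omega x * g x 0 i); split => //.
- by move=> i; have [] := LG i.
- move=> phi i tp; have := wg phi tp i; rewrite !Int_restrict //.
  by under eq_fun do rewrite mulrA; under [in RHS]eq_fun do rewrite mulrA.
- move=> phi tp; have := we phi _ (test_H01 mO tp); rewrite !Int_restrict //.
  have -> : (fun x => \1_Omega x * phi x) = phi.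
    by apply/funext => x; have := test_indic (fun=> 1) x tp; rewrite mulr1 mul1r.
  move=> <-; congr (- _).
  have Ls : L1 (fun x => \sum_i \1_Omega x * g x 0 i * partial i phi x).
    apply: L1_sum => i; apply: (@test_mulr_L1 Omega); last exact: test_partial.
    by have [] := LG i.
  rewrite -IntZ; last exact: L1_indicM.
  rewrite -IntD //; last by apply: L1Z; exact: L1_indicM.
  congr Int; apply/funext => x; rewrite /conductivity.
  have -> : dotr (g x) (grad phi x) = \sum_i g x 0 i * partial i phi x.
    by apply: eq_bigr => i _; rewrite mxE.
  have -> : \sum_i \1_Omega x * g x 0 i * partial i phi x = \1_Omega x * \sum_i g x 0 i * partial i phi x.
    by rewrite mulr_sumr; apply: eq_bigr => i _; rewrite mulrA.
  move: (\sum_i _) => s; rewrite !indicE in_setD.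
  case: (boolP (x \in D)) => [|_]; last by case: (x \in Omega) => /=; ring.
  by rewrite inE => /DO/mem_set -> /=; ring.
Qed.

(** By definition of the weak gradient, G against grad phi becomes [u] against the Laplacian of
    [phi]; only the contrast of conductivities keeps the gradient, as a term on [D]. *)
Lemma weak_laplacian sg D Omega u G phi : weak_solution sg D Omega u G -> test_function Omega phi ->
  Int (fun x => \1_Omega x * u x * laplacian phi x) =
  n%:R * Int phi + (sg - 1) * Int (fun x => \1_D x * \sum_i G i x * partial i phi x).
Proof.
move=> ws tp; have Lu := weak_L1 ws.
have L i := test_mulr_L1 Lu (test_partial i (test_partial i tp)).
have L2 i := test_mulr_L1 (weak_grad_L1 ws i) (test_partial i tp).
rewrite -(weak_eq ws tp) opprD addrNK.
transitivity (Int (fun x => \sum_i \1_Omega x * u x * partial i (partial i phi) x)).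
  by congr Int; apply/funext => x; rewrite /laplacian mulr_sumr.
rewrite !Int_sum // -sumrN; apply: eq_bigr => i _.
by rewrite (weak_grad ws i (test_partial i tp)).
Qed.

End sobolev_theory.

(** * The solution inside the ball *)

Section inside.
Context {R : realType} {n : nat}.
Local Notation mu := (@lebesgue_row R n).
Implicit Types (f g u v phi : 'rV[R]_n -> R) (x y c b : 'rV[R]_n) (O Omega : set 'rV[R]_n).

Lemma affine_on_ball f x0 c (r : R) : smooth f ->
  (forall x i j, eball x0 r x -> hess f i j x = 0) ->
  exists b k, forall x, eball x0 r x -> f x = lin b c x + k.
Proof.
move=> sf h0.
have seg x s : eball x0 r x -> 0 < s < 1 -> eball x0 r (x0 + s *: (x - x0)).
  move=> xr /andP[s0 s1]; rewrite /eball /= addrAC subrr add0r enormZ gtr0_norm //.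
  by apply: le_lt_trans xr; rewrite ler_piMl ?enorm_ge0 // ltW.
have mean g x : smooth g -> eball x0 r x -> (forall i y, eball x0 r y -> partial i g y = 0) ->
    g x = g x0.
  move=> sg xr dg; have [s s01 E] := mvt_line x0 (x - x0) (fun y => smooth_diff y sg) (@ltr01 R).
  move: E; rewrite scale1r mul1r [x0 + _]addrC subrK => E; apply/eqP; rewrite -subr_eq0 E; apply/eqP.
  by apply: big1 => i _; rewrite dg ?mulr0 //; exact: seg.
have sp j : smooth (partial j f) by exact: smooth_partial.
have dc j x : eball x0 r x -> partial j f x = partial j f x0.
  by move=> xr; apply: mean => // i y yr; exact: h0.
pose b := grad f x0; pose h x := f x - lin b c x.
have sh : smooth h by apply: smoothB => //; exact: smooth_lin.
exists b, (h x0) => x xr.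
have -> : h x0 = h x.
  symmetry; apply: mean => // i y yr.
  have sl : smooth (fun x => - lin b c x) by apply: smoothN; exact: smooth_lin.
  rewrite /h (partial_sadd i y sf sl) (dc i y yr).
  have E := partialN i (fun y => smooth_diff y (smooth_lin b c)).
  by rewrite E partial_lin mxE subrr.
by rewrite /h addrC subrK.
Qed.

(** With the margin [rho], the uniform part of [weyl] gives a single smooth function on a
    neighbourhood of the closed level domain. *)
Lemma ball_gap c (r : R) (K : set 'rV[R]_n) : 0 < r -> compact K -> K `<=` eball c r ->
  exists r1 rho, [/\ 0 < rho, K `<=` eball c r1 &
    forall x, eball c r1 x -> [set y | enorm (y - x) <= rho] `<=` eball c r].
Proof.
move=> r0 cK Kr.
have [r1 [r10 r1r Kr1]] : exists r1, [/\ 0 <= r1, r1 < r & forall y, K y -> enorm (y - c) <= r1].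
  have [K0|K0] := pselect (K !=set0); last first.
    by exists 0; split => // y Ky; case: K0; exists y.
  have [m Km Hm] : exists2 m, K m & forall y, K y -> sqd c y <= sqd c m.
    by apply: attains_max => //; apply: continuous_subspaceT; exact: sqd_continuous.
  exists (enorm (m - c)); split; [exact: enorm_ge0|exact: Kr|].
  by move=> y Ky; rewrite enorm_le ?enorm_ge0 // enorm_sqr; exact: Hm.
have d0 : 0 < (r - r1) / 3 by rewrite divr_gt0 // subr_gt0.
exists (r1 + (r - r1) / 3), ((r - r1) / 3); split => //.
  by move=> y /Kr1 h; rewrite /eball /= (le_lt_trans h) // ltrDl.
move=> x /= xr y /= yx; rewrite /eball /=.
have -> : y - c = (y - x) + (x - c) by rewrite addrA subrK.
apply: le_lt_trans (enormD _ _) _; move: xr yx; rewrite /eball /=.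
by move: (enorm _) (enorm _) => p q; lra.
Qed.

Lemma loc_harmB O f g : loc_harm O f -> smooth g -> (forall x, laplacian g x = 0) ->
  loc_harm O (fun x => f x - g x).
Proof.
move=> hf sg lg x Ox; have [r [h [r0 sh hE]]] := hf x Ox.
have sN : smooth (fun y => - g y) by exact: smoothN.
exists r, (fun x => h x - g x); split => //; first exact: smoothB.
move=> y yr; have [l0 E] := hE y yr; rewrite E; split; last by [].
rewrite (laplacianD y sh sN) l0 add0r.
have -> : (fun y => - g y) = (fun y => -1 * g y) by apply/funext => z; rewrite mulN1r.
by rewrite (laplacianZ _ y sg) lg mulr0.
Qed.

Lemma laplacian_half_sqd c x : laplacian (fun x => 2^-1 * sqd c x) x = n%:R.
Proof. by rewrite (laplacianZ _ x (smooth_sqd c)) laplacian_sqd mulKf // pnatr_eq0. Qed.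

Lemma continuous_indicM O f x : open O -> O x -> {for x, continuous f} ->
  {for x, continuous (fun y => \1_O y * f y)}.
Proof.
move=> oO Ox cf; change ((fun y => \1_O y * f y) @ x --> (\1_O x * f x)).
rewrite indicE mem_set // mul1r.
have N : nbhs x O by apply: open_nbhs_nbhs.
move=> U /cf H; have : nbhs x (O `&` f @^-1` U) by exact: filterI.
move=> [B HB sub]; exists B => //; apply: subset_trans sub _ => y [Oy Uy] /=.
by rewrite indicE mem_set // mul1r.
Qed.

Lemma connected_segments (A : set 'rV[R]_n) c :
  (forall x s, A x -> 0 <= s -> s <= 1 -> A (c + s *: (x - c))) -> connected A.
Proof.
move=> HA; pose S x : set 'rV[R]_n := (fun s : R => c + s *: (x - c)) @` `[0, 1].
have -> : A = \bigcup_(x in A) S x.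
  apply/seteqP; split => [x Ax|y [x Ax [s /=]]].
    exists x => //; exists 1; last by rewrite scale1r addrC subrK.
    by rewrite /= in_itv /= ler01 lexx.
  by rewrite in_itv /= => /andP[s0 s1] <-; exact: HA.
apply: bigcup_connected.
  exists c => x _; exists 0; last by rewrite scale0r addr0.
  by rewrite /= in_itv /= ler01 lexx.
move=> x _; apply: connected_continuous_connected; first exact: segment_connected.
have cS : continuous (fun s : R => c + s *: (x - c)).
  by move=> s; apply: cvgD; [exact: cvg_cst|exact: scalel_continuous].
exact: continuous_subspaceT.
Qed.

Lemma connected_eball c (r : R) : connected (eball c r).
Proof.
apply: (@connected_segments _ c) => x s xr s0 s1; rewrite /eball /= addrAC subrr add0r enormZ ger0_norm //.
by apply: le_lt_trans xr; rewrite ler_piMl // enorm_ge0.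
Qed.

Lemma test_cball O phi x (r : R) : smooth phi -> [set y | enorm (y - x) <= r] `<=` O ->
  (forall y, r <= enorm (y - x) -> phi y = 0) -> test_function O phi.
Proof.
move=> sp rO p0; apply: (test_intro sp _ _ rO); [exact: compact_cball|exact: closed_cball|].
by move=> y /= /negP; rewrite -ltNge => /ltW /p0.
Qed.

Lemma test_sub O Omega phi : O `<=` Omega -> test_function O phi -> test_function Omega phi.
Proof. by move=> OO [sp cp sO]; split => //; exact: subset_trans sO OO. Qed.

Lemma test_indicl O f phi x : test_function O phi -> \1_O x * (f x * phi x) = f x * phi x.
Proof. by move=> tp; rewrite mulrA test_indic. Qed.

Lemma test_laplacian O phi : test_function O phi -> test_function O (laplacian phi).
Proof.
move=> tp; have [C [cC clC CO C0]] := test_elim tp.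
apply: (test_intro _ cC clC CO); first by apply: smooth_laplacian; exact: test_smooth tp.
move=> x nx; apply: big1 => i _.
have z j y : ~ C y -> partial j phi y = 0.
  move=> ny; rewrite (@partial_open _ _ j _ (fun=> 0 : R) (~` C) y) ?partial_cst //.
  exact: closed_openC.
rewrite (@partial_open _ _ i _ (fun=> 0 : R) (~` C) x) ?partial_cst //; first exact: closed_openC.
by move=> y ny; exact: z.
Qed.

Lemma continuous_bounded_on (A : set 'rV[R]_n) f M : (forall x, A x -> enorm x <= M) ->
  continuous f -> exists2 m, 0 <= m & forall x, A x -> `|f x| <= m.
Proof.
move=> AM cf; have cK := @compact_cball R n 0 M.
have [K0|K0] := pselect ([set y : 'rV[R]_n | enorm (y - 0) <= M] !=set0); last first.
  by exists 0 => // x Ax; case: K0; exists x; rewrite /= subr0; exact: AM.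
have [y _ Hy] : exists2 y, enorm (y - 0) <= M & forall x, enorm (x - 0) <= M -> `|f x| <= `|f y|.
  apply: (attains_max cK K0); apply: continuous_subspaceT => x.
  by apply: (continuous_comp (cf x)); exact: norm_continuous.
by exists `|f y| => // x Ax; apply: Hy; rewrite subr0; exact: AM.
Qed.

Lemma L1_indic_cont (A : set 'rV[R]_n) f M : measurable A -> (forall x, A x -> enorm x <= M) ->
  continuous f -> L1 (fun x => \1_A x * f x).
Proof.
move=> mA AM cf; have [m _ Hm] := continuous_bounded_on AM cf.
apply: (@L1_le _ _ _ (fun x => m * \1_A x)).
- by apply: mfunM; [exact: mfun_indic|exact: mfun_cont].
- by apply: L1Z; exact: (L1_indic mA AM).
- move=> x; rewrite indicE; case: (boolP (x \in A)) => [|_]; last by rewrite mul0r normr0 mulr0.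
  by rewrite inE => /Hm; rewrite mul1r mulr1.
Qed.

(** In the ball, sg v - |x-c|^2/2 is weakly harmonic, hence agrees with one smooth function around
    the closure of [om], as [serrin] requires. In [om] the Hessian of sg v is then the identity, so
    the harmonic part is affine near a point, and in the whole ball by unique continuation. *)
Lemma inside_affine sg Omega u G c (r : R) v (om : set 'rV[R]_n) (k0 d : R) : (0 < n)%N -> 0 < sg ->
  open Omega -> ebounded Omega -> 0 < r -> eball c r `<=` Omega ->
  weak_solution sg (eball c r) Omega u G ->
  (forall x, eball c r x -> differentiable v x) ->
  {ae mu, forall x, Omega x -> v x = u x} ->
  open om -> om !=set0 -> closure om `<=` eball c r ->
  (forall x, boundary om x -> v x = k0) ->
  (forall x, boundary om x -> enorm (grad v x) = d) ->
  exists b k, forall x, eball c r x -> v x = uin c b sg k x.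
Proof.
move=> n0 sg0 oO [M OM] r0 DO ws dv vu oom om0 omD vk vd.
set D := eball c r in DO ws dv omD *; have oD : open D by exact: open_eball.
have mD : measurable D by exact: measurable_open.
have DM x : D x -> enorm x <= M by move=> /DO /OM.
have cv x : D x -> {for x, continuous v} by move=> /dv /differentiable_continuous.
have csq : continuous (fun x => 2^-1 * sqd c x).
  by apply: smooth_continuous; apply: smoothZ; exact: smooth_sqd.
pose e x := \1_D x * (sg * v x - 2^-1 * sqd c x).
pose e' x := sg * (\1_D x * (\1_Omega x * u x)) - \1_D x * (2^-1 * sqd c x).
have ce x : D x -> {for x, continuous e}.
  move=> Dx; apply: continuous_indicM => //; apply: continuousB; last exact: csq.
  by apply: continuousM; [exact: cst_continuous|exact: cv].
have me : mfun e.
  apply: mfun_open => // x Dx; apply: continuousB; last exact: csq.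
  by apply: continuousM; [exact: cst_continuous|exact: cv].
have ee' : {ae mu, forall x, e x = e' x}.
  apply: filterS vu => x vu; rewrite /e /e' indicE; case: (boolP (x \in D)) => [|_]; last first.
    by rewrite !mul0r mulr0 subr0.
  by rewrite inE => /DO Ox; rewrite vu // indicE mem_set // !mul1r.
have Ld : L1 (fun x => \1_D x * (\1_Omega x * u x)) by apply: L1_indicM => //; exact: weak_L1 ws.
have Lq : L1 (fun x => \1_D x * (2^-1 * sqd c x)) by exact: (L1_indic_cont mD DM csq).
have Le' : L1 e' by apply: L1B => //; exact: L1Z.
have Le : L1 e by exact: L1_ae ee'.
have [f [fE fe]] : exists f, (forall r, 0 < r -> exists2 E, smooth E &
      forall x, [set y | enorm (y - x) <= r] `<=` D -> laplacian E x = 0 /\ f x = E x) /\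
    forall x, D x -> {for x, continuous e} -> f x = e x.
  apply: weyl => // phi sp [x [r' [r'D p0]]].
  have tD : test_function D phi by exact: test_cball p0.
  have tl := test_laplacian tD.
  have tO := test_sub DO tD.
  have bp := test_bsupp tD; have bl := test_bsupp tl; have sl := test_smooth tl.
  have LuP : L1 (fun x => \1_Omega x * u x * laplacian phi x).
    exact: test_mulr_L1 (weak_L1 ws) tl.
  have -> : Int (fun y => e y * laplacian phi y) =
      sg * Int (fun x => \1_Omega x * u x * laplacian phi x) - Int (fun x => 2^-1 * sqd c x * laplacian phi x).
    rewrite -IntZ // -IntB; last 2 first.
    - exact: L1Z.
    - apply: L1_smooth_bsupp; last exact: bsuppMr.
      by apply: smoothM => //; apply: smoothZ; exact: smooth_sqd.
    apply: Int_ae_eq.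
    - by apply: mfunM => //; apply: mfun_cont; exact: smooth_continuous.
    - apply: mfunB; first exact: L1_mfun (L1Z sg LuP).
      by apply: mfunM; apply: mfun_cont => //; exact: smooth_continuous.
    - apply: filterS ee' => y ->; rewrite /e'.
      have A : \1_D y * laplacian phi y = laplacian phi y.
        by have := test_indicl (fun=> 1) y tl; rewrite mul1r.
      rewrite -{2 3}A; move: (laplacian phi y) (\1_D y) (\1_Omega y) (u y) (sqd c y) => p q o w s.
      ring.
  (* A test function supported in the ball only sees the constant conductivity sg. *)
  have J : Int (fun x => \1_D x * \sum_i G i x * partial i phi x) = Int (fun x => \sum_i G i x * partial i phi x).
    congr Int; apply/funext => y; rewrite mulr_sumr; apply: eq_bigr => i _.
    by rewrite test_indicl //; exact: test_partial.
  have E1 := weak_laplacian ws tO; have E2 := weak_eq ws tO.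
  have E3 : Int (fun x => 2^-1 * sqd c x * laplacian phi x) = n%:R * Int phi.
    rewrite Int_green2 //; last by apply: smoothZ; exact: smooth_sqd.
    rewrite -IntZ; last exact: L1_smooth_bsupp.
    by congr Int; apply/funext => y; rewrite laplacian_half_sqd mulrC.
  rewrite E3 E1; move: E2; rewrite J; move: (Int _) (Int phi) => j p <-; ring.
have fv x : D x -> f x = sg * v x - 2^-1 * sqd c x.
  by move=> Dx; rewrite fe //; [rewrite /e indicE mem_set // mul1r|exact: ce].
have omM x : om x -> enorm x <= M by move=> ox; apply: DM; apply: omD; exact: subset_closure.
have bom : ebounded om by exists M.
have [r1 [rho [rho0 omr1 r1D]]] := ball_gap r0 (compact_closure bom) omD.
have [E sE HE] := fE rho rho0.
have GD x : eball c r1 x -> D x.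
  by move=> /r1D; apply; rewrite /= subrr enorm0 ltW.
have Ev x : eball c r1 x -> E x = sg * v x - 2^-1 * sqd c x.
  by move=> xr; rewrite -fv; [have [_ ->] := HE x (r1D x xr)|exact: GD].
have s1 : smooth (fun x => 2^-1 * sqd c x) by apply: smoothZ; exact: smooth_sqd.
have s2 : smooth (fun x => E x + 2^-1 * sqd c x) by exact: smoothD.
have s3 : smooth ((fun=> - (sg * k0)) : 'rV[R]_n -> R) by exact: smooth_cst.
pose w x := (E x + 2^-1 * sqd c x) + - (sg * k0).
have sw : smooth w by exact: smoothD.
have wv x : eball c r1 x -> w x = sg * v x - sg * k0 by move=> xr; rewrite /w Ev // subrK.
have lw x : eball c r1 x -> laplacian w x = n%:R.
  move=> xr; rewrite /w (laplacianD x s2 s3) (laplacianD x sE s1) laplacian_half_sqd.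
  have [-> _] := HE x (r1D x xr).
  by rewrite add0r [X in _ + X]big1 ?addr0 // => i _; rewrite !partial_cst.
have bG x : boundary om x -> eball c r1 x by move=> [/omr1].
have w0 x : boundary om x -> w x = 0 by move=> bx; rewrite wv ?vk ?subrr //; exact: bG.
have wd x : boundary om x -> enorm (grad w x) = sg * d.
  move=> bx; rewrite -(vd x bx).
  have -> : grad v x = sg^-1 *: grad w x.
    apply/rowP => i; rewrite !mxE.
    have sk : smooth (fun x => w x + sg * k0) by apply: smoothD => //; exact: smooth_cst.
    rewrite (@partial_open _ _ i _ (fun x => sg^-1 * (w x + sg * k0)) (eball c r1) x).
    - by rewrite (partialZ i _ sk) (partial_sadd i x sw (smooth_cst _)) partial_cst addr0.
    - exact: open_eball.
    - exact: bG.
    - by move=> y yr; rewrite wv // subrK mulKf // gt_eqF.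
  by rewrite enormZ gtr0_norm ?invr_gt0 // mulVKf // gt_eqF.
have H := serrin n0 oom bom om0 (@open_eball _ _ c r1) omr1 sw lw w0 wd.
have [x0 ox0] := om0.
have [r2 r20 r2om] := nbhs_eball (open_nbhs_nbhs (conj oom ox0)).
have omG x : om x -> eball c r1 x by move=> ox; apply: omr1; exact: subset_closure.
have [b [k Ek]] : exists b k, forall x, eball x0 r2 x -> E x = lin b c x + k.
  apply: affine_on_ball => // x i j xr; have := H x i j (r2om x xr).
  have pw l y : partial l w y = partial l E y + (y 0 l - c 0 l).
    rewrite /w (partial_sadd l y s2 s3) partial_cst addr0 (partial_sadd l y sE s1).
    by rewrite (partialZ l _ (smooth_sqd c)) partial_sqd mulKf // pnatr_eq0.
  rewrite /hess (_ : partial j w = fun y => partial j E y + (y 0 j - c 0 j)); last first.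
    by apply/funext => y; exact: pw.
  rewrite (partial_sadd i x (smooth_partial j sE) (smooth_coordB c j)) partial_coordB.
  by move=> /(canRL (addrK _)); rewrite subrr.
have hf : loc_harm D f by exact: loc_harm_uniform fE.
have slk : smooth (fun x => lin b c x + k) by apply: smoothD; [exact: smooth_lin|exact: smooth_cst].
have hfl : loc_harm D (fun x => f x - (lin b c x + k)).
  apply: loc_harmB => // x; rewrite (laplacianD x (smooth_lin b c) (smooth_cst k)) laplacian_lin add0r.
  by apply: big1 => i _; rewrite !partial_cst.
have cD : connected D by exact: connected_eball.
have UC := unique_continuation oD cD hfl (GD _ (omG _ ox0)) r20.
exists b, k => x Dx.
have : f x - (lin b c x + k) = 0.
  apply: UC => // z zr; apply/eqP; rewrite subr_eq0 -Ek //; apply/eqP.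
  by have [_ ->] := HE z (r1D z (omG _ (r2om _ zr))).
rewrite fv // /uin => /eqP; rewrite subr_eq0 => /eqP E1.
have -> : 2^-1 * sqd c x + lin b c x + k = sg * v x.
  by rewrite -addrA -E1 addrC subrK.
by rewrite mulKf // gt_eqF.
Qed.

End inside.

(** * The solution outside the ball *)

Section outside.
Context {R : realType} {n : nat}.
Local Notation mu := (@lebesgue_row R n).
Implicit Types (f g u v phi : 'rV[R]_n -> R) (x y c b : 'rV[R]_n) (O Omega : set 'rV[R]_n).

Lemma continuous_open O f g x : open O -> O x -> (forall y, O y -> f y = g y) ->
  {for x, continuous g} -> {for x, continuous f}.
Proof.
move=> oO Ox fg cg; change (f @ x --> f x); rewrite fg //.
have N : nbhs x O by apply: open_nbhs_nbhs.
move=> U /cg H; have : nbhs x (O `&` g @^-1` U) by exact: filterI.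
move=> [B HB sub]; exists B => //; apply: subset_trans sub _ => y [Oy Uy] /=.
by rewrite fg.
Qed.

(** [phi] crosses the sphere, while [u] is known to be [f] only inside. So the derivatives of [phi]
    are multiplied by cut-offs that vanish with their gradient outside the ball and converge to its
    indicator. *)
Lemma inner_flux sg Omega u G c (r : R) f phi : open Omega -> 0 < r ->
  eball c r `<=` Omega -> weak_solution sg (eball c r) Omega u G -> smooth f ->
  {ae mu, forall x, eball c r x -> u x = f x} -> test_function Omega phi ->
  Int (fun x => \1_(eball c r) x * \sum_i G i x * partial i phi x) =
  Int (fun x => \1_(eball c r) x * gdot f phi x).
Proof.
move=> oO r0 DO ws sf uf tp; set D := eball c r in DO ws uf *.
have mD : measurable D by apply: measurable_open; exact: open_eball.
have DE x : D x <-> sqd c x < r ^+ 2 by rewrite /D eballE.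
pose l k : R := (k.+1)%:R; have l0 k : 0 < l k by rewrite ltr0n.
pose g k s := step (- l k * (s - r ^+ 2) + 0).
have gE k x : g k (sqd c x) = step (l k * (r ^+ 2 - sqd c x)).
  by rewrite /g addr0 mulNr -mulrN opprB.
have sg' k : smooth1 (g k) by exact: smooth1_cutoff.
have sp := test_smooth tp.
have LG i : L1 (fun x => G i x * partial i phi x).
  exact: test_mulr_L1 (weak_grad_L1 ws i) (test_partial i tp).
have LS : L1 (fun x => \sum_i G i x * partial i phi x) by exact: L1_sum.
have Lg : L1 (gdot f phi).
  by apply: L1_smooth_bsupp; [exact: smooth_gdot|apply: bsupp_gdot; exact: test_bsupp tp].
have cutk h : L1 h -> Int (fun x => g k (sqd c x) * h x) @[k --> \oo] --> Int (fun x => \1_D x * h x).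
  move=> Lh; have [|||||//] := @Int_cvg R n (fun k x => g k (sqd c x) * h x) (fun x => \1_D x * h x) (fun x => `|h x|).
  - move=> k; apply: mfunM; last exact: L1_mfun.
    by apply: mfun_cont; apply: smooth_continuous; exact: (smooth_radial c (sg' k)).
  - by apply: mfunM; [exact: mfun_indic|exact: L1_mfun].
  - exact: L1_abs.
  - by move=> k x; rewrite normrM ler_piMl // ger0_norm ?step_ge0 ?step_le1.
  - move=> x; apply: cvgMl; rewrite indicE.
    have -> : (fun k => g k (sqd c x)) = fun k => step ((k.+1)%:R * (r ^+ 2 - sqd c x)).
      by apply/funext => k; exact: gE.
    rewrite (_ : x \in _ = (sqd c x < r ^+ 2)); first exact: cvg_step_inside.
    by apply/idP/idP; rewrite inE => /DE.
have E k : Int (fun x => g k (sqd c x) * \sum_i G i x * partial i phi x) =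
    Int (fun x => g k (sqd c x) * gdot f phi x).
  pose psi i x := g k (sqd c x) * partial i phi x.
  have sgk := smooth_radial c (sg' k).
  have tpsi i : test_function Omega (psi i) by apply: test_mull => //; exact: test_partial.
  have spsi i := test_smooth (tpsi i); have bpsi i := test_bsupp (tpsi i).
  have -> : (fun x => g k (sqd c x) * \sum_i G i x * partial i phi x) = fun x => \sum_i G i x * psi i x.
    by apply/funext => x; rewrite mulr_sumr; apply: eq_bigr => i _; rewrite mulrCA.
  have -> : (fun x => g k (sqd c x) * gdot f phi x) = fun x => \sum_i partial i f x * psi i x.
    by apply/funext => x; rewrite mulr_sumr; apply: eq_bigr => i _; rewrite mulrCA.
  have L1a i : L1 (fun x => G i x * psi i x) by exact: test_mulr_L1 (weak_grad_L1 ws i) (tpsi i).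
  have L1b i : L1 (fun x => partial i f x * psi i x).
    by apply: L1_smooth_bsupp; [apply: smoothM => //; exact: smooth_partial|exact: bsuppMr].
  have L1c i : L1 (fun x => \1_Omega x * u x * partial i (psi i) x).
    by apply: test_mulr_L1 (weak_L1 ws) _; exact: test_partial (tpsi i).
  have L1d i : L1 (fun x => f x * partial i (psi i) x).
    apply: L1_smooth_bsupp; first by apply: smoothM => //; exact: smooth_partial.
    by apply: bsuppMr; exact: bsupp_partial.
  rewrite !Int_sum //; apply: oppr_inj; rewrite -!sumrN.
  transitivity (\sum_i Int (fun x => \1_Omega x * u x * partial i (psi i) x)).
    by apply: eq_bigr => i _; rewrite (weak_grad ws i (tpsi i)).
  transitivity (\sum_i Int (fun x => f x * partial i (psi i) x)); last first.
    by apply: eq_bigr => i _; rewrite (Int_by_parts i sf (spsi i) (or_intror (bpsi i))) opprK.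
  apply: eq_bigr => i _; apply: Int_ae_eq; [exact: L1_mfun (L1c i)|exact: L1_mfun (L1d i)|].
  apply: filterS uf => x ufx; have [Dx|nDx] := pselect (D x).
    by rewrite ufx // indicE mem_set ?mul1r //; exact: DO.
  have nx : r ^+ 2 <= sqd c x by rewrite leNgt; apply/negP => /DE.
  suff -> : partial i (psi i) x = 0 by rewrite !mulr0.
  rewrite /psi partial_smul //; last exact: smooth_partial.
  have h : - l k * (sqd c x - r ^+ 2) <= 0 by rewrite mulNr oppr_le0 mulr_ge0 ?subr_ge0 // ltW.
  have d0 : derive1 (g k) (sqd c x) = 0 by rewrite derive1_cutoff addr0 derive1_step_le0 ?mulr0.
  have g0 : g k (sqd c x) = 0 by rewrite /g addr0 step_le0.
  by rewrite partial_radial // d0 g0 !mul0r addr0.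
apply: (cvg_unique (@norm_hausdorff _ _) (cutk _ LS)).
have -> : (fun k => Int (fun x => g k (sqd c x) * \sum_i G i x * partial i phi x)) =
   fun k => Int (fun x => g k (sqd c x) * gdot f phi x) by apply/funext => k; exact: E.
exact: cutk.
Qed.

(** Subtracting the piecewise function [ut] cancels the effect of the jump of conductivity: the
    difference is weakly harmonic in all of [Omega], across the sphere, and vanishes in the ball. *)
Lemma outside_form sg Omega u G c (r : R) b (k : R) P v : 0 < sg ->
  open Omega -> connected Omega -> ebounded Omega -> 0 < r -> eball c r `<=` Omega ->
  weak_solution sg (eball c r) Omega u G ->
  smooth1 P -> P (r ^+ 2) = sg^-1 -> P (r ^+ 2) + 2 * r ^+ 2 * derive1 P (r ^+ 2) = 1 ->
  (forall s, r ^+ 2 < s -> (n%:R + 2) * derive1 P s + 2 * s * derive1 (derive1 P) s = 0) ->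
  {ae mu, forall x, eball c r x -> u x = uin c b sg k x} ->
  (forall x, Omega x -> sqd c x != r ^+ 2 -> differentiable v x) ->
  {ae mu, forall x, Omega x -> v x = u x} ->
  forall x, Omega x -> r ^+ 2 < sqd c x -> v x = uout c b (r ^+ 2) sg k P x.
Proof.
move=> sg0 oO conO [M OM] r0 DO ws sP Pa dPa P2 uu dv vu; set a := r ^+ 2 in Pa dPa P2 dv *.
set D := eball c r in DO ws uu *; have oD : open D by exact: open_eball.
have a0 : 0 < a by rewrite exprn_gt0.
have mD := measurable_open oD; have mO := measurable_open oO.
have DE x : D x <-> sqd c x < a by rewrite /D eballE.
pose ui := uin c b sg k; pose uo := uout c b a sg k P.
have sui : smooth ui by exact: smooth_uin.
have suo : smooth uo by exact: smooth_uout.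
pose out := [set x | a < sqd c x].
have oout : open out.
  have -> : out = [set x | - sqd c x < - a] by apply/seteqP; split => x /=; rewrite ltrN2.
  by apply: open_sublevel => x; apply: continuousN; exact: sqd_continuous.
have mout : measurable out by exact: measurable_open.
(* [Omega] without the sphere: [v] and [ut] are continuous there, and the sphere is negligible by
   [sphere_null]. *)
pose O1 := Omega `&` (D `|` out).
have oO1 : open O1 by apply: openI => //; exact: openU.
have O1E x : O1 x <-> Omega x /\ sqd c x != a.
  rewrite neq_lt; split => [[Ox [/DE ->|h]]|[Ox /orP[/DE Dx|h]]]; split => //.
  - by rewrite [a < _]h orbT.
  - by left.
  - by right.
pose ut x := ui x + \1_out x * (uo x - ui x).
have utD x : D x -> ut x = ui x.
  move=> /DE h; rewrite /ut indicE memNset ?mul0r ?addr0 // /out /= => h2.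
  by have := lt_trans h h2; rewrite ltxx.
have utO x : out x -> ut x = uo x by move=> h; rewrite /ut indicE mem_set // mul1r addrC subrK.
have cut x : O1 x -> {for x, continuous ut}.
  move=> [_ [Dx|ox]].
    by apply: (continuous_open oD Dx utD); exact: smooth_continuous.
  by apply: (continuous_open oout ox utO); exact: smooth_continuous.
have cv x : O1 x -> {for x, continuous v}.
  by move=> /O1E[Ox xa]; apply: differentiable_continuous; exact: dv.
pose e x := \1_O1 x * (v x - ut x).
pose e' x := \1_Omega x * u x - (\1_Omega x * ui x + \1_out x * (\1_Omega x * (uo x - ui x))).
have ce x : O1 x -> {for x, continuous e}.
  by move=> Ox; apply: continuous_indicM => //; apply: continuousB; [exact: cv|exact: cut].
have me : mfun e by apply: mfun_open => // x Ox; apply: continuousB; [exact: cv|exact: cut].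
have ee' : {ae mu, forall x, e x = e' x}.
  have sn := sphere_null c a0.
  apply: filterS2 vu sn => x vx xa; rewrite /e /e' !indicE.
  have [Ox|nOx] := pselect (Omega x); last first.
    have nO1 : ~ O1 x by case.
    by rewrite (memNset nOx) (memNset nO1) !mul0r mulr0 addr0 subr0.
  have O1x : O1 x by apply/O1E.
  by rewrite (mem_set Ox) (mem_set O1x) !mul1r vx // /ut indicE.
have cui := smooth_continuous sui.
have suoi : smooth (fun x => uo x - ui x) by exact: smoothB.
have Lut : L1 (fun x => \1_Omega x * ui x + \1_out x * (\1_Omega x * (uo x - ui x))).
  apply: L1D; first exact: (L1_indic_cont mO OM cui).
  apply: L1_indicM => //; apply: (L1_indic_cont mO OM); exact: smooth_continuous.
have Le' : L1 e' by apply: L1B => //; exact: weak_L1 ws.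
have Le : L1 e by exact: L1_ae ee'.
have [f [fE fe]] : exists f, (forall r, 0 < r -> exists2 E, smooth E &
      forall x, [set y | enorm (y - x) <= r] `<=` Omega -> laplacian E x = 0 /\ f x = E x) /\
    forall x, Omega x -> {for x, continuous e} -> f x = e x.
  apply: weyl => // phi sp [x [r' [r'D p0]]].
  have tO : test_function Omega phi by exact: test_cball p0.
  have tl := test_laplacian tO.
  have bp := test_bsupp tO; have bl := test_bsupp tl; have sl := test_smooth tl.
  have LuP : L1 (fun x => \1_Omega x * u x * laplacian phi x).
    exact: test_mulr_L1 (weak_L1 ws) tl.
  have Li : L1 (fun x => ui x * laplacian phi x).
    by apply: L1_smooth_bsupp; [exact: smoothM|exact: bsuppMr].
  have Lo : L1 (fun x => \1_out x * ((uo x - ui x) * laplacian phi x)).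
    by apply: L1_indicM => //; apply: L1_smooth_bsupp; [exact: smoothM|exact: bsuppMr].
  have Lg : L1 (gdot ui phi) by apply: L1_smooth_bsupp; [exact: smooth_gdot|exact: bsupp_gdot].
  have -> : Int (fun y => e y * laplacian phi y) = Int (fun x => \1_Omega x * u x * laplacian phi x) -
     (Int (fun x => ui x * laplacian phi x) + Int (fun x => \1_out x * ((uo x - ui x) * laplacian phi x))).
    rewrite -IntD // -IntB //; last exact: L1D.
    apply: Int_ae_eq.
    - by apply: mfunM => //; apply: mfun_cont; exact: smooth_continuous.
    - by apply: mfunB; [exact: L1_mfun LuP|exact: L1_mfun (L1D Li Lo)].
    - apply: filterS ee' => y ->; rewrite /e'.
      have A : \1_Omega y * laplacian phi y = laplacian phi y.
        by have := test_indicl (fun=> 1) y tl; rewrite mul1r.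
      rewrite -{3 4}A; move: (laplacian phi y) (\1_out y) (\1_Omega y) (u y) (ui y) (uo y) => p q o w s t.
      ring.
  rewrite (weak_laplacian ws tO) (transmission c b k sg0 sP Pa dPa P2 sp bp).
  rewrite (inner_flux oO r0 DO ws sui uu tO).
  suff -> : Int (fun x => \1_D x * gdot ui phi x) = Int (fun x => (1 - \1_out x) * gdot ui phi x).
    by rewrite subrr.
  have L2' : L1 (fun x => (1 - \1_out x) * gdot ui phi x).
    have -> : (fun x => (1 - \1_out x) * gdot ui phi x) = fun x => gdot ui phi x - \1_out x * gdot ui phi x.
      by apply/funext => y; rewrite mulrBl mul1r.
    by apply: L1B => //; exact: L1_indicM.
  apply: Int_ae_eq; [exact: L1_mfun (L1_indicM mD Lg)|exact: L1_mfun L2'|].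
  apply: filterS (sphere_null c a0) => y ya; congr (_ * _); rewrite !indicE.
  have [h|h] := ltP (sqd c y) a.
    rewrite mem_set ?memNset ?subr0 //; last exact/DE.
    by move=> h2; have := lt_trans h h2; rewrite ltxx.
  have h2 : a < sqd c y by rewrite lt_neqAle eq_sym ya.
  rewrite memNset ?mem_set ?subrr // => /DE; rewrite ltNge => /negP; exact.
have vD x : D x -> v x = ui x.
  apply: (ae_eq_open oD).
  - by move=> y Dy; apply: cv; split; [exact: DO|left].
  - by move=> y _; exact: cui.
  - by apply: filterS2 vu uu => y vy uy Dy; rewrite vy ?uy //; exact: DO.
have hf : loc_harm Omega f by exact: loc_harm_uniform fE.
have Dc : D c by exact: eball_center.
have f0 : forall x, Omega x -> f x = 0.
  apply: (unique_continuation oO conO hf (DO _ Dc) r0) => z zr.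
  have O1z : O1 z by split; [exact: DO|left].
  rewrite (fe z (DO _ zr) (ce z O1z)) /e indicE mem_set // mul1r.
  by apply/eqP; rewrite subr_eq0; apply/eqP; rewrite (utD _ zr); exact: vD.
move=> x Ox xa; have O1x : O1 x by split => //; right.
have := f0 x Ox; rewrite (fe x Ox (ce x O1x)) /e indicE mem_set // mul1r => /eqP.
by rewrite subr_eq0 (utO _ xa) => /eqP.
Qed.

(* The exterior dipole profile p + q t^(-n/2) with the transmission conditions at t = a *)
Definition profile (a sg : R) (s : R) : R :=
  (sg^-1 - (sg^-1 - 1) / n%:R) + ((sg^-1 - 1) / n%:R / power a (- (n%:R / 2)) a) * power a (- (n%:R / 2)) s.

(** The constants solve p + q a^(-n/2) = 1/sg and -n q a^(-n/2) = 2 a P'(a) = 1 - 1/sg. *)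
Lemma profileP (a sg : R) : (0 < n)%N -> 0 < a ->
  [/\ smooth1 (profile a sg), profile a sg a = sg^-1,
    profile a sg a + 2 * a * derive1 (profile a sg) a = 1 &
    forall s, a < s -> (n%:R + 2) * derive1 (profile a sg) s +
       2 * s * derive1 (derive1 (profile a sg)) s = 0].
Proof.
move=> n0 a0; set al : R := - (n%:R / 2); set p := sg^-1 - (sg^-1 - 1) / n%:R.
set q := (sg^-1 - 1) / n%:R / power a al a.
have nn : n%:R != 0 :> R by rewrite pnatr_eq0 -lt0n.
have pn0 : power a al a != 0 by rewrite gt_eqF // power_gt0.
have a2 : a / 2 < a by rewrite ltr_pdivrMr // ltr_pMr // ltr1n.
have spw (d : R) : smooth1 (power a d) by exact: smooth1_power.
have sz (d : R) : smooth1 (fun s => q * power a d s) by apply: smooth1M => //; exact: smooth1_cst.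
have dz (d : R) : derive1 (fun s => q * power a d s) = fun s => q * derive1 (power a d) s.
  have dp (s : R) : derivable (power a d) s 1 by exact: smooth1_derivable.
  have dc (s : R) : derivable (fun=> q : R) s 1 by exact: derivable_cst.
  have E := derive1M dc dp; rewrite E.
  by apply/funext => s; rewrite derive1_const mul0r add0r.
have E1 : derive1 (profile a sg) = fun s => q * derive1 (power a al) s.
  have dq (s : R) : derivable (fun s => q * power a al s) s 1 by apply: smooth1_derivable; exact: sz.
  have dc (s : R) : derivable (fun=> p : R) s 1 by exact: derivable_cst.
  have E := derive1D dc dq; rewrite /profile -/al -/p -/q E dz.
  by apply/funext => s; rewrite derive1_const add0r.
have pa : profile a sg a = sg^-1.
  by rewrite /profile -/al -/p -/q /q divfK // /p subrK.
have sd : smooth1 (derive1 (power a al)) by exact: smooth1_derive.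
split => //.
- by apply: smooth1D; [exact: smooth1_cst|exact: sz].
- rewrite pa E1 derive1_powerE // {2}/al.
  have E2 : a * power a (al - 1) a = power a al a.
    by rewrite [RHS]powerD1 // posidE // ltW.
  have -> : 2 * a * (q * (- (n%:R / 2) * power a (al - 1) a)) = - n%:R * (q * (a * power a (al - 1) a)).
    by move: (power _ _ _) => t; field.
  rewrite E2 /q divfK // mulrC mulrN divfK //; ring.
- move=> s as_; have h : a / 2 < s by exact: lt_trans as_.
  have E2 : derive1 (fun s => q * derive1 (power a al) s) s = q * derive1 (derive1 (power a al)) s.
    have dp (t : R) : derivable (derive1 (power a al)) t 1 by exact: smooth1_derivable.
    have dc (t : R) : derivable (fun=> q : R) t 1 by exact: derivable_cst.
    have E := derive1M dc dp; rewrite E.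
    by rewrite derive1_const mul0r add0r.
  rewrite E1 E2 derive2_powerE // derive1_powerE //.
  have -> : power a (al - 1) s = s * power a (al - 1 - 1) s.
    by rewrite powerD1 // posidE // ltW.
  by rewrite /al; move: (power _ _ _) => t; field.
Qed.

End outside.

(** * Vanishing of the dipole *)

Section rays.
Context {R : realType} {n : nat}.
Implicit Types (x y c b : 'rV[R]_n) (O A : set 'rV[R]_n).

Lemma boundary_meets A O : connected A -> open O -> A `&` O !=set0 ->
  (exists2 x, A x & ~ O x) -> exists2 x, A x & boundary O x.
Proof.
move=> cA oO AO [z Az nOz]; apply: contrapT => H.
have E : A `&` O = A.
  apply: cA => //; first by exists O.
  exists (closure O); first exact: closed_closure.
  apply/seteqP; split => x [Ax Ox]; split => //; first exact: subset_closure.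
  apply: contrapT => nOx; apply: H; exists x => //.
  by rewrite boundary_open.
by apply: nOz; move: Az; rewrite -E => -[].
Qed.

Lemma ray_boundary O c e : open O -> ebounded O -> O c -> 0 < enorm e ->
  exists2 s : R, 0 < s & boundary O (c + s *: e).
Proof.
move=> oO [M OM] Oc e0.
pose L := (M + enorm c + 1) / enorm e.
have M0 : 0 <= M by apply: le_trans (OM c Oc); exact: enorm_ge0.
have L0 : 0 < L by rewrite divr_gt0 // ltr_wpDl // addr_ge0 // enorm_ge0.
pose A : set 'rV[R]_n := (fun s : R => c + s *: e) @` `[0, L].
have cA : connected A.
  apply: connected_continuous_connected; first exact: segment_connected.
  have cS : continuous (fun s : R => c + s *: e).
    by move=> s; apply: cvgD; [exact: cvg_cst|exact: scalel_continuous].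
  exact: continuous_subspaceT.
have A0 : A c by exists 0; rewrite ?scale0r ?addr0 //= in_itv /= lexx ltW.
have AL : A (c + L *: e) by exists L => //=; rewrite in_itv /= lexx ltW.
have [||x [s]] := boundary_meets cA oO.
- by exists c.
- exists (c + L *: e) => // /OM; apply/negP; rewrite -ltNge.
  have := enormD (c + L *: e) (- c); rewrite addrAC subrr add0r enormN enormZ gtr0_norm //.
  by rewrite /L divfK ?gt_eqF // => h; rewrite -(ltrD2r (enorm c)); apply: lt_le_trans h; rewrite ltrDl.
rewrite /= in_itv /= => /andP[s0 _] <- bs; exists s => //.
rewrite lt_neqAle s0 andbT eq_sym; apply/eqP => s00.
by move: bs; rewrite s00 scale0r addr0 boundary_open // => -[].
Qed.

(** An interval with two points is infinite, whereas a nonzero polynomial has finitely many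
    roots. *)
Lemma poly_interval (F : {poly R}) (T : set R) : connected T -> F != 0 ->
  (forall t, T t -> root F t) -> forall s t, T s -> T t -> s = t.
Proof.
move=> /connected_intervalP iT F0 rT.
suff H s t : T s -> T t -> s < t -> False.
  by move=> s t Ts Tt; have [/H|/H|//] := ltgtP s t; [case|case].
move=> Ts Tt st.
pose h (i : nat) := s + (t - s) * (i.+1%:R)^-1.
have ts : 0 < t - s by rewrite subr_gt0.
have hT i : T (h i).
  apply: (iT s t) => //; rewrite /h lerDl mulr_ge0 ?(ltW ts) ?invr_ge0 //=.
  by rewrite addrC -lerBrDr ler_piMr ?(ltW ts) // invf_le1 ?ltr0n // ler1n.
have := @max_poly_roots _ F (map h (iota 0 (size F))) F0.
rewrite size_map size_iota ltnn => H; have //: false; apply: H.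
  by apply/allP => _ /mapP[i _ ->]; exact: rT.
rewrite map_inj_uniq ?iota_uniq // => i j /addrI /(mulfI (lt0r_neq0 ts)) /invr_inj /eqP.
by rewrite eqr_nat => /eqP[].
Qed.

Lemma partial_uout c b (a sg k : R) P i x : smooth1 P -> partial i (uout c b a sg k P) x =
  (1 + 2 * derive1 P (sqd c x) * lin b c x) * (x 0 i - c 0 i) + P (sqd c x) * b 0 i.
Proof.
move=> sP.
have s1 : smooth (fun x => 2^-1 * sqd c x) by apply: smoothZ; exact: smooth_sqd.
have s2 := smooth_dipole b c sP.
have s3 : smooth (fun x => 2^-1 * sqd c x + dipole P b c x) by exact: smoothD.
rewrite /uout (partial_sadd i x s3 (smooth_cst _)) partial_cst addr0 (partial_sadd i x s1 s2).
rewrite partial_dipole // (partialZ i _ (smooth_sqd c)) partial_sqd mulKf ?pnatr_eq0 //.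
by move: (derive1 P _) (P _) (lin _ _ _) (b 0 i) (x 0 i - c 0 i) => p q l f y; ring.
Qed.

Lemma enorm_grad_uout c b (a sg k : R) P x : smooth1 P ->
  enorm (grad (uout c b a sg k P) x) ^+ 2 =
  (1 + 2 * derive1 P (sqd c x) * lin b c x) ^+ 2 * sqd c x +
  2 * (1 + 2 * derive1 P (sqd c x) * lin b c x) * P (sqd c x) * lin b c x +
  P (sqd c x) ^+ 2 * dotr b b.
Proof.
move=> sP; have -> : grad (uout c b a sg k P) x =
    (1 + 2 * derive1 P (sqd c x) * lin b c x) *: (x - c) + P (sqd c x) *: b.
  by apply/rowP => i; rewrite !mxE partial_uout.
rewrite enorm_sqr lin_dotr; move: (1 + _) (P _) => m p.
rewrite dotrrD !(dotrZl, dotrZr) -/(sqd c x) [dotr (x - c) b]dotrC.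
by move: (sqd c x) (dotr b (x - c)) (dotr b b) => s l d; ring.
Qed.

Lemma uout_pos (a sg tau : R) : (0 < n)%N -> 0 < a -> 0 < tau -> a < tau ^+ 2 ->
  let q := (sg^-1 - 1) / n%:R / power a (- (n%:R / 2)) a in
  let p := sg^-1 - (sg^-1 - 1) / n%:R in
  tau ^+ n * @profile R n a sg (tau ^+ 2) = p * tau ^+ n + q /\
  tau ^+ n * tau ^+ 2 * (2 * derive1 (@profile R n a sg) (tau ^+ 2)) = - n%:R * q.
Proof.
move=> n0 a0 t0 at2 q p; set al : R := - (n%:R / 2) in q *.
have a2 : a / 2 < tau ^+ 2 by apply: lt_trans at2; rewrite ltr_pdivrMr // ltr_pMr // ltr1n.
have pw : power a al (tau ^+ 2) = (tau ^+ n)^-1 by exact: power_sqr (ltW a2).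
have tn : tau ^+ n != 0 by rewrite expf_neq0 // gt_eqF.
split.
  rewrite /profile -/al -/p -/q pw mulrDr [q / _]mulrC mulrA mulfV // mul1r; congr (_ + _); exact: mulrC.
have dq (s : R) : derivable (fun s => q * power a al s) s 1.
  apply: smooth1_derivable; apply: smooth1M; [exact: smooth1_cst|exact: smooth1_power].
have dc (r s : R) : derivable (fun=> r : R) s 1 by exact: derivable_cst.
have dp (s : R) : derivable (power a al) s 1 by apply: smooth1_derivable; exact: smooth1_power.
have -> : derive1 (@profile R n a sg) = fun s => q * derive1 (power a al) s.
  have E := derive1D (dc p) dq; have E2 := derive1M (dc q) dp.
  rewrite /profile -/al -/p -/q E E2.
  by apply/funext => s; rewrite !derive1_const !add0r mul0r add0r.
rewrite derive1_powerE // {1}/al.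
have E : tau ^+ n * (tau ^+ 2 * power a (al - 1) (tau ^+ 2)) = 1.
  by rewrite -{1}(posidE a0 (ltW a2)) -powerD1 // pw mulfV.
have -> : - n%:R * q = - n%:R * q * (tau ^+ n * (tau ^+ 2 * power a (al - 1) (tau ^+ 2))).
  by rewrite E mulr1.
move: (tau ^+ n) (tau ^+ 2) (power _ _ _) => u v w.
by field.
Qed.

Lemma opp_values (u v w : R) : u + v = w -> u - v = w -> v = 0.
Proof. lra. Qed.

Lemma sqr_values (d m : R) : (1 + 2 * d * m) ^+ 2 = (1 + 2 * d * - m) ^+ 2 -> d * m = 0.
Proof. lra. Qed.

Lemma double_subn2 : (2 <= n)%N -> (2 * n - 2 + 2 = 2 * n)%N.
Proof. lia. Qed.

Lemma dipole_vanishes c b (a sg k C d : R) O : (2 <= n)%N -> 0 < a -> sg != 1 -> 0 < sg ->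
  open O -> ebounded O -> O c -> connected (boundary O) ->
  (forall x, boundary O x -> a < sqd c x) ->
  (forall x, boundary O x -> uout c b a sg k (@profile R n a sg) x = C) ->
  (forall x, boundary O x -> enorm (grad (uout c b a sg k (@profile R n a sg)) x) = d) ->
  b = 0.
Proof.
move=> n2 a0 sg1 sg0 oO bO Oc cb ab uC gd; apply: contrapT => b0.
have n0 : (0 < n)%N by exact: ltn_trans n2.
have bb : 0 < dotr b b.
  by rewrite lt_neqAle dotrr_ge0 andbT eq_sym; apply/eqP => /dotrr_eq0.
have [sP Pa dPa P2] := @profileP R n a sg n0 a0.
set P := @profile R n a sg in sP Pa dPa P2 uC gd.
set q := (sg^-1 - 1) / n%:R / power a (- (n%:R / 2)) a.
set p := sg^-1 - (sg^-1 - 1) / n%:R.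
have nn : n%:R != 0 :> R by rewrite pnatr_eq0 -lt0n.
have q0 : q != 0.
  apply: mulf_neq0; last by rewrite invr_eq0 gt_eqF // power_gt0.
  apply: mulf_neq0; last by rewrite invr_eq0.
  rewrite subr_eq0.
  by apply/eqP => /(congr1 (fun s => s^-1)); rewrite invrK invr1; exact/eqP.
have uE x : boundary O x -> 2^-1 * sqd c x + P (sqd c x) * lin b c x = C - (sg^-1 * (2^-1 * a + k) - 2^-1 * a).
  by move=> /uC <-; rewrite /uout /dipole addrK.
set C1 := C - _ in uE.
have gE x : boundary O x -> (1 + 2 * derive1 P (sqd c x) * lin b c x) ^+ 2 * sqd c x +
  2 * (1 + 2 * derive1 P (sqd c x) * lin b c x) * P (sqd c x) * lin b c x +
  P (sqd c x) ^+ 2 * dotr b b = d ^+ 2.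
  by move=> /gd <-; rewrite enorm_grad_uout.
have bE x : boundary O x -> [/\ 0 < enorm (x - c), enorm (x - c) ^+ 2 = sqd c x & a < enorm (x - c) ^+ 2].
  move=> bx; have h := ab x bx; rewrite -sqd_enorm; split => //.
  rewrite lt_neqAle enorm_ge0 andbT eq_sym; apply/eqP => e0.
  by move: h; rewrite sqd_enorm e0 expr0n /= ltNge ltW.
(* elimination of the angular variable: the radius is a root of F *)
pose Q : {poly R} := p *: 'X^n + q%:P.
pose Gp : {poly R} := C1%:P - 2^-1 *: 'X^2.
pose H : {poly R} := 'X^2 * Q - (n%:R * q) *: Gp.
(* Let B = b . (x - c). At tau = |x - c|, x on the boundary, [Q] is tau^n P, [Gp] is P B by the
   condition on u, and [H] is tau^(n+2) P (1 + 2 P' B); then [F] is tau^(4n) P^2 (|grad u|^2 - d^2),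
   which vanishes. *)
pose F : {poly R} := 'X^(2 * n - 2) * (H ^+ 2 + 2 *: (H * Q * Gp)) + dotr b b *: Q ^+ 4 - d ^+ 2 *: ('X^(2 * n) * Q ^+ 2).
have FE t : F.[t] = t ^+ (2 * n - 2) * (H.[t] ^+ 2 + 2 * (H.[t] * Q.[t] * Gp.[t])) +
     dotr b b * Q.[t] ^+ 4 - d ^+ 2 * (t ^+ (2 * n) * Q.[t] ^+ 2).
  by rewrite /F !(hornerE, hornerXn, horner_exp).
have QE t : Q.[t] = p * t ^+ n + q by rewrite /Q !(hornerE, hornerXn).
(* At 0 only the term |b|^2 q^4 survives, because 2 n - 2 > 0. *)
have F0 : F != 0.
  apply/eqP => F0; have : F.[0] = 0 by rewrite F0 horner0.
  have m0 : (2 * n - 2 == 0)%N = false by apply/negP => /eqP; lia.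
  have m1 : (2 * n == 0)%N = false by apply/negP => /eqP; lia.
  have m2 : (n == 0)%N = false by apply/negP => /eqP; lia.
  rewrite FE QE !expr0n m0 m1 m2 /= !mul0r !mulr0 !add0r subr0 => /eqP.
  by rewrite mulf_eq0 expf_eq0 (negbTE q0) (gt_eqF bb).
pose T : set R := (fun x => enorm (x - c)) @` boundary O.
have cT : connected T.
  apply: connected_continuous_connected => //; apply: continuous_subspaceT => x.
  apply: (continuous_comp (f := sqd c) (g := Num.sqrt)); first exact: sqd_continuous.
  exact: sqrt_continuous.
have rT t : T t -> root F t.
  move=> [x bx <-]; have [t0 tE at_] := bE x bx; have := uE x bx; have := gE x bx.
  rewrite -tE; set tau := enorm (x - c) in t0 at_ *.
  have [E1 E2] := uout_pos sg n0 a0 t0 at_.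
  move: E1 E2; rewrite -/P -/p -/q; set Pt := P _; set dP := derive1 P _; set B := lin b c x.
  move=> E1 E2 g1 u1; apply/rootP.
  have GE : Gp.[tau] = C1 - 2^-1 * tau ^+ 2 by rewrite /Gp !(hornerE, hornerXn).
  have HE : H.[tau] = tau ^+ 2 * Q.[tau] - n%:R * q * Gp.[tau] by rewrite /H !(hornerE, hornerXn).
  rewrite FE.
  have E3 : Q.[tau] = tau ^+ n * Pt by rewrite QE E1.
  have E4 : Gp.[tau] = Pt * B by rewrite GE -u1 addrAC subrr add0r.
  have E5 : H.[tau] = tau ^+ 2 * (tau ^+ n * Pt) * (1 + 2 * dP * B).
    have nq : n%:R * q = - (tau ^+ n * tau ^+ 2 * (2 * dP)) by rewrite E2 mulNr opprK.
    by rewrite HE E3 E4 nq; move: (tau ^+ n) (tau ^+ 2) => u v; ring.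
  have E6 : tau ^+ (2 * n) = tau ^+ n * tau ^+ n by rewrite mul2n -addnn exprD.
  have E7 : tau ^+ (2 * n - 2) * tau ^+ 2 = tau ^+ n * tau ^+ n.
    by rewrite -exprD -E6 double_subn2.
  rewrite E5 E3 E4 E6 -g1.
  transitivity ((tau ^+ (2 * n - 2) * tau ^+ 2) * (tau ^+ n * Pt) ^+ 2 * ((1 + 2 * dP * B) ^+ 2 * tau ^+ 2 + 2 * (1 + 2 * dP * B) * Pt * B) +
     dotr b b * (tau ^+ n * Pt) ^+ 4 - ((1 + 2 * dP * B) ^+ 2 * tau ^+ 2 + 2 * (1 + 2 * dP * B) * Pt * B + Pt ^+ 2 * dotr b b) * (tau ^+ n * tau ^+ n * (tau ^+ n * Pt) ^+ 2)).
    by move: (tau ^+ (2 * n - 2)) (tau ^+ n) (tau ^+ 2) (dotr b b) => m u v w; ring.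
  rewrite E7; move: (tau ^+ n) (tau ^+ 2) (dotr b b) => u v w; ring.
have Tc := poly_interval cT F0 rT.
(* hence the radius is constant; compare the two points in the directions b and - b *)
have eb : 0 < enorm b by rewrite sqrtr_gt0.
have [s1 s10 bs1] := ray_boundary oO bO Oc eb.
have eNb : 0 < enorm (- b) by rewrite enormN.
have [s2 s20 bs2] := ray_boundary oO bO Oc eNb.
have sub1 : c + s1 *: b - c = s1 *: b by rewrite addrAC subrr add0r.
have sub2 : c + s2 *: - b - c = s2 *: - b by rewrite addrAC subrr add0r.
have s12 : s2 = s1.
  have := Tc (enorm (s1 *: b)) (enorm (s2 *: - b)).
  rewrite !enormZ enormN !gtr0_norm // => H1; apply/esym/(mulIf (lt0r_neq0 eb)); apply: H1.
    by exists (c + s1 *: b) => //=; rewrite sub1 enormZ gtr0_norm.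
  by exists (c + s2 *: - b) => //=; rewrite sub2 enormZ enormN gtr0_norm.
rewrite s12 in bs2 sub2.
have l1 : lin b c (c + s1 *: b) = s1 * dotr b b by rewrite lin_dotr sub1 dotrZr.
have l2 : lin b c (c + s1 *: - b) = - (s1 * dotr b b) by rewrite lin_dotr sub2 dotrZr dotrNr mulrN.
have t12 : sqd c (c + s1 *: - b) = sqd c (c + s1 *: b).
  by rewrite /sqd sub1 sub2 scalerN dotrNl dotrNr opprK.
have u1 := uE _ bs1; have u2 := uE _ bs2; have g1 := gE _ bs1; have g2 := gE _ bs2.
have [t0 tE at_] := bE _ bs1.
have [E1 E2] := uout_pos sg n0 a0 t0 at_.
rewrite -/P -/p -/q tE in E1 E2.
rewrite t12 l2 in u2 g2; rewrite l1 in u1 g1.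
have m0 : s1 * dotr b b != 0 by rewrite mulf_neq0 ?gt_eqF.
have tpos : 0 < sqd c (c + s1 *: b) by rewrite -tE exprn_gt0.
(* Changing the sign of b . (x - c) at a fixed radius leaves u and |grad u| unchanged, which forces
   P = 0 and then P' = 0; but P' is a nonzero multiple of q there. *)
have P0 : P (sqd c (c + s1 *: b)) = 0.
  have : P (sqd c (c + s1 *: b)) * (s1 * dotr b b) = 0.
    by apply: opp_values u1 _; rewrite -mulrN.
  by move=> /eqP; rewrite mulf_eq0 (negbTE m0) orbF => /eqP.
have dP0 : derive1 P (sqd c (c + s1 *: b)) = 0.
  have := g1; rewrite -g2 P0 expr0n /= !(mul0r, mulr0, addr0) => /(mulIf (lt0r_neq0 tpos)).
  move=> E; have : derive1 P (sqd c (c + s1 *: b)) * (s1 * dotr b b) = 0.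
    exact: sqr_values E.
  by move=> /eqP; rewrite mulf_eq0 (negbTE m0) orbF => /eqP.
move: E2; rewrite dP0 !mulr0 => /eqP; rewrite eq_sym mulf_eq0 oppr_eq0 (negbTE nn) (negbTE q0).
by [].
Qed.

End rays.

(** * Capacity and regular boundary points *)

Section comparison.
Context {R : realType} {n : nat}.
Implicit Types (v w f h : 'rV[R]_n -> R) (x y c : 'rV[R]_n) (O Omega : set 'rV[R]_n).

Lemma smooth_C2 O h : smooth h -> C2_on O h.
Proof.
move=> sh x Ox; split; [exact: smooth_diff|move=> i; apply: smooth_diff; exact: smooth_partial|].
by move=> i j; apply: smooth_continuous; do 2 apply: smooth_partial.
Qed.

Definition quad (H : 'I_n -> 'I_n -> R) c x : R :=
  \sum_i (x 0 i - c 0 i) * lin (\row_j H i j) c x.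

Lemma smooth_quad H c : smooth (quad H c).
Proof. by apply: smooth_sum => i; apply: smoothM; [exact: smooth_coordB|exact: smooth_lin]. Qed.

Lemma partial_quad H c k x : (forall i j, H i j = H j i) ->
  partial k (quad H c) x = 2 * lin (\row_j H k j) c x.
Proof.
move=> sH; have s i := smoothM (smooth_coordB c i) (smooth_lin (\row_j H i j) c).
rewrite /quad (partial_sum _ _ k s).
transitivity (\sum_i (lin (\row_j H i j) c x * (k == i)%:R + H k i * (x 0 i - c 0 i))).
  apply: eq_bigr => i _; rewrite partial_smul; [|exact: smooth_coordB|exact: smooth_lin].
  by rewrite partial_coordB partial_lin mxE [H i k]sH mulrC; congr (_ + _); exact: mulrC.
rewrite big_split /= sum_delta [2 * _]mulr_natl mulr2n; congr (_ + _).
by apply: eq_bigr => i _; rewrite mxE.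
Qed.

(** Two applications of the mean value theorem express [f] by its Hessian at intermediate points,
    where it is close to k times the identity. *)
Lemma strict_minimum f c (k : R) : smooth f -> 0 < k -> f c = 0 -> (forall i, partial i f c = 0) ->
  (forall i j, hess f i j c = k * (i == j)%:R) ->
  exists2 r, 0 < r & forall x, eball c r x -> x != c -> 0 < f x.
Proof.
move=> sf k0 fc dfc hf.
(* Each of the n^2 entries of the Hessian may err by this e, and k - n^2 e = e is still positive. *)
have e0 : 0 < k / (n%:R * n%:R + 1) by rewrite divr_gt0 // ltr_wpDl // mulr_ge0.
set e := k / _ in e0.
have [r r0 Hr] : exists2 r, 0 < r & forall i j x, eball c r x -> `|hess f i j x - hess f i j c| < e.
  have H i j : exists2 r, 0 < r & forall y, enorm (y - c) < r -> `|hess f i j y - hess f i j c| < e.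
    apply: continuous_eball => //; apply: smooth_continuous; do 2 apply: smooth_partial; exact: sf.
  have /choice[rr Hrr] : forall p : 'I_n * 'I_n, exists r, 0 < r /\
      forall y, enorm (y - c) < r -> `|hess f p.1 p.2 y - hess f p.1 p.2 c| < e.
    by move=> [i j]; have [r r0 h] := H i j; exists r.
  exists (\big[Num.min/1]_p rr p).
    by elim/big_ind: _ => // [s t s0 t0|p _]; [rewrite lt_min s0|have [] := Hrr p].
  move=> i j x; rewrite /eball /= => xr; have [_ /(_ x)] := Hrr (i, j); apply.
  by apply: lt_le_trans xr _; exact: bigmin_le_cond.
exists r => // x xr xc; pose z := x - c.
have [s /andP[s0 s1]] := mvt_line c z (fun y => smooth_diff y sf) (@ltr01 R).
rewrite scale1r mul1r fc subr0 /z addrC subrK => ->.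
have /choice[t Ht] : forall i, exists t, 0 < t /\ t < s /\
    partial i f (c + s *: z) = s * \sum_j z 0 j * hess f j i (c + t *: z).
  move=> i; have [t /andP[t0 ts] E] := mvt_line c z (fun y => smooth_diff y (smooth_partial i sf)) s0.
  by exists t; split => //; split => //; move: E; rewrite dfc subr0.
have zz : 0 < sqd c x.
  rewrite lt_neqAle sqd_ge0 andbT eq_sym; apply/eqP => /dotrr_eq0 /eqP.
  by rewrite subr_eq0 (negbTE xc).
have near i : eball c r (c + t i *: z).
  have [t0 [ts _]] := Ht i.
  rewrite /eball /= addrAC subrr add0r enormZ gtr0_norm //; apply: le_lt_trans xr.
  by rewrite ler_piMl ?enorm_ge0 // ltW // (lt_trans ts).
have -> : \sum_i (x - c) 0 i * partial i f (c + s *: (x - c)) =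
    s * \sum_i \sum_j z 0 i * (z 0 j * hess f j i (c + t i *: z)).
  rewrite mulr_sumr; apply: eq_bigr => i _; have [_ [_ ->]] := Ht i.
  by rewrite -/z mulrCA mulr_sumr.
apply: mulr_gt0 => //.
have b i j : k * (i == j)%:R * (z 0 i * z 0 j) - e * sqd c x <= z 0 i * (z 0 j * hess f j i (c + t i *: z)).
  have := Hr j i _ (near i); rewrite hf; set hh := hess _ _ _ _ => h.
  have zb l : `|z 0 l| <= enorm z by exact: coord_le_enorm.
  have zz2 : `|z 0 i * z 0 j| <= sqd c x.
    by rewrite normrM sqd_enorm expr2 ler_pM.
  have : `|(z 0 i * z 0 j) * (hh - k * (j == i)%:R)| <= sqd c x * e.
    by rewrite normrM ler_pM // ltW.
  rewrite eq_sym ler_norml => /andP[h1 _].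
  move: h1; set d := (_ == _)%:R; move: (z 0 i) (z 0 j) (sqd c x) => p q u; rewrite -subr_ge0 => h1.
  rewrite -subr_ge0; apply: le_trans h1 _; rewrite le_eqVlt; apply/orP; left; apply/eqP; ring.
apply: (@lt_le_trans _ _ (\sum_i \sum_j (k * (i == j)%:R * (z 0 i * z 0 j) - e * sqd c x))); last first.
  by apply: ler_sum => i _; apply: ler_sum => j _; exact: b.
have -> : \sum_i \sum_j (k * (i == j)%:R * (z 0 i * z 0 j) - e * sqd c x) =
    k * sqd c x - n%:R * (n%:R * (e * sqd c x)).
  transitivity (\sum_i (k * (z 0 i * z 0 i) - n%:R * (e * sqd c x))).
    apply: eq_bigr => i _; rewrite sumrB sumr_const card_ord -[_ *+ n]mulr_natl; congr (_ - _).
    transitivity (\sum_j (k * (z 0 i * z 0 j)) * (i == j)%:R); last exact: (sum_delta i (fun j => k * (z 0 i * z 0 j))).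
    by apply: eq_bigr => j _; rewrite mulrAC.
  rewrite sumrB sumr_const card_ord -[_ *+ n]mulr_natl -mulr_sumr; congr (_ * _ - _).
have -> : k * sqd c x - n%:R * (n%:R * (e * sqd c x)) = (k - n%:R * n%:R * e) * sqd c x.
  by move: (sqd c x) => u; ring.
have ke : k = (n%:R * n%:R + 1) * e.
  by rewrite /e mulrC divfK // gt_eqF // ltr_wpDl // mulr_ge0.
have ke' : k - n%:R * n%:R * e = e by rewrite {1}ke mulrDl mul1r addrAC subrr add0r.
by rewrite ke' mulr_gt0.
Qed.

(** [subharmonic_on] compares with harmonic functions only. At an interior maximum c of v - w, the
    second order part of [w] plus the multiple of |x-c|^2 that cancels its trace is a harmonic
    polynomial, strictly above w - w(c) on small spheres. Shifted by v(c) and lowered by the gap it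
    still dominates [v] on a small sphere, but not at c. *)
Lemma perron_comparison Omega v w : (0 < n)%N -> open Omega -> ebounded Omega ->
  {within closure Omega, continuous v} -> subharmonic_on Omega v -> smooth w ->
  (forall x, Omega x -> laplacian w x < 0) -> (forall x, boundary Omega x -> v x <= w x) ->
  forall x, Omega x -> v x <= w x.
Proof.
move=> n0 oO bO cv sv sw lw vb x1 Ox1.
have cK := compact_closure bO.
have [c Kc Hc] : exists2 c, closure Omega c & forall y, closure Omega y -> v y - w y <= v c - w c.
  apply: (attains_max cK); first by exists x1; exact: subset_closure.
  have cw := continuous_subspaceT (A := closure Omega) (smooth_continuous sw).
  by move=> y; apply: continuousB; [exact: cv|exact: cw].
rewrite -subr_le0; apply: le_trans (Hc _ (subset_closure Ox1)) _; rewrite leNgt; apply/negP => m0.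
have Oc : Omega c.
  apply: contrapT => nO; have : boundary Omega c by rewrite boundary_open.
  by move=> /vb; rewrite -subr_le0 leNgt m0.
pose k := - laplacian w c / n%:R.
have nn : 0 < n%:R :> R by rewrite ltr0n.
have k0 : 0 < k by rewrite divr_gt0 // oppr_gt0 lw.
(* [k] is the value for which this matrix has trace 0; it is positive because the Laplacian of [w]
   is negative. *)
pose H i j := 2^-1 * (hess w i j c + k * (i == j)%:R).
have sH i j : H i j = H j i by rewrite /H /hess schwarz // eq_sym.
pose q x := quad H c x; have sq : smooth q by exact: smooth_quad.
pose l x := lin (grad w c) c x; have sl : smooth l by exact: smooth_lin.
pose h x := q x + l x; have sh : smooth h by exact: smoothD.
have ph i x : partial i h x = 2 * lin (\row_j H i j) c x + partial i w c.
  by rewrite /h (partial_sadd i x sq sl) partial_quad // partial_lin mxE.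
have linc b : lin b c c = 0 by rewrite /lin big1 // => i _; rewrite subrr mulr0.
have hh i j x : hess h i j x = hess w i j c + k * (i == j)%:R.
  rewrite /hess (_ : partial j h = fun x => 2 * lin (\row_l H j l) c x + partial j w c); last first.
    by apply/funext => y; exact: ph.
  have s2 : smooth (fun x => 2 * lin (\row_l H j l) c x) by apply: smoothZ; exact: smooth_lin.
  rewrite (partial_sadd i x s2 (smooth_cst _)) partial_cst addr0 (partialZ i _ (smooth_lin _ c)).
  rewrite partial_lin mxE /H mulVKf ?pnatr_eq0 // /hess schwarz //.
  by rewrite [j == i]eq_sym.
have lh x : laplacian h x = 0.
  rewrite /laplacian; transitivity (\sum_i (hess w i i c + k * (i == i)%:R)).
    by apply: eq_bigr => i _; exact: hh.
  under eq_bigr do rewrite eqxx mulr1.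
  rewrite big_split /= sumr_const card_ord -[_ *+ n]mulr_natl -/(laplacian w c).
  by rewrite /k mulrC divfK ?gt_eqF // subrr.
have hc : h c = 0.
  by rewrite /h /l linc addr0 /q /quad big1 // => i _; rewrite subrr mul0r.
(* h + const exceeds v on small spheres around the contact point c *)
pose f x := h x - (w x - w c).
have swc : smooth (fun x => w x - w c) by apply: smoothB => //; exact: smooth_cst.
have swN : smooth (fun x => - (w x - w c)) by exact: smoothN.
have sf : smooth f by exact: smoothB.
have pwN i x : partial i (fun x => - (w x - w c)) x = - partial i w x.
  have E := partialN i (fun y => smooth_diff y swc); rewrite E.
  by rewrite (partial_sadd i x sw (smooth_cst (- w c))) partial_cst addr0.
have pf i x : partial i f x = partial i h x + - partial i w x.
  by rewrite /f (partial_sadd i x sh swN) pwN.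
have [r1 r10 f0] : exists2 r, 0 < r & forall x, eball c r x -> x != c -> 0 < f x.
  apply: (strict_minimum sf k0).
  - by rewrite /f hc !subrr.
  - by move=> i; rewrite pf ph linc mulr0 add0r subrr.
  - move=> i j; rewrite /hess (_ : partial j f = fun x => partial j h x + - partial j w x); last first.
      by apply/funext => y; exact: pf.
    have sj := smooth_partial j sw; have sjN := smoothN sj.
    rewrite (partial_sadd i c (smooth_partial j sh) sjN).
    have E := partialN i (fun y => smooth_diff y sj); rewrite E -/(hess h i j c) hh /hess.
    by rewrite addrAC subrr add0r.
have [r2 r20 r2O] := nbhs_cball (open_nbhs_nbhs (conj oO Oc)).
pose r := Num.min (r1 / 2) r2.
have r0 : 0 < r by rewrite lt_min divr_gt0.
have rO y : enorm (y - c) <= r -> Omega y.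
  by move=> yr; apply: r2O; rewrite /= (le_trans yr) // ge_min lexx orbT.
have bE y : boundary (eball c r) y -> enorm (y - c) = r by rewrite boundary_eball.
have fb y : boundary (eball c r) y -> 0 < f y.
  move=> /bE yr; apply: f0.
    by rewrite /eball /= yr gt_min ltr_pdivrMr // ltr_pMr // ltr1n.
  by apply/eqP => yc; move: yr; rewrite yc subrr enorm0 => r00; rewrite r00 ltxx in r0.
have [mu mu0 Hmu] : exists2 mu, 0 < mu & forall y, boundary (eball c r) y -> mu <= f y.
  have cS : compact (boundary (eball c r)).
    apply: (@subclosed_compact _ _ [set y | enorm (y - c) <= r]); last 2 first.
    - exact: compact_cball.
    - by move=> y /bE /= ->.
    rewrite boundary_open; last exact: open_eball.
    by apply: closedI; [exact: closed_closure|apply: open_closedC; exact: open_eball].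
  have [S0|S0] := pselect (boundary (eball c r) !=set0); last first.
    by exists 1 => // y yb; case: S0; exists y.
  have [y yb Hy] : exists2 y, boundary (eball c r) y & forall z, boundary (eball c r) z -> - f z <= - f y.
    apply: (attains_max cS S0); apply: continuous_subspaceT => y; apply: continuousN.
    exact: smooth_continuous.
  by exists (f y); [exact: fb|move=> z /Hy; rewrite lerN2].
pose g x := h x + (v c - mu).
have sg : smooth g by apply: smoothD => //; exact: smooth_cst.
have clO : closure (eball c r) `<=` Omega by rewrite closure_eball // => y /= /rO.
have cg : {within closure (eball c r), continuous g}.
  by apply: continuous_subspaceT; exact: smooth_continuous.
have hg : harmonic_on (eball c r) g.
  split; first exact: smooth_C2.
  move=> y _; rewrite (laplacianD y sh (smooth_cst _)) lh add0r.
  by apply: big1 => i _; rewrite !partial_cst.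
have vg y : boundary (eball c r) y -> v y <= g y.
  move=> yb; have yK : closure Omega y by apply: subset_closure; apply: rO; rewrite (bE y yb).
  by have := Hc y yK; have := Hmu y yb; rewrite /f /g; lra.
have := sv c r g r0 clO cg hg vg c (@eball_center _ _ c r r0).
by rewrite /g hc add0r leNgt gtrBl mu0.
Qed.

End comparison.

(** * Energy, near minimisers and supersolutions *)

Section potential.
Context {R : realType} {n : nat}.
Local Notation mu := (@lebesgue_row R n).
Local Notation mass := (@mass R n).
Implicit Types (psi chi w f e : 'rV[R]_n -> R) (x y c : 'rV[R]_n) (E N : set 'rV[R]_n).

Definition energy psi : R := Int (gdot psi psi).

Lemma gdot_ge0 psi x : 0 <= gdot psi psi x.
Proof. by apply: sumr_ge0 => i _; rewrite -expr2 sqr_ge0. Qed.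

Lemma energy_ge0 psi : 0 <= energy psi.
Proof. by apply: Int_ge0 => x; exact: gdot_ge0. Qed.

Lemma L1_gdot psi chi : smooth psi -> smooth chi -> bsupp chi -> L1 (gdot psi chi).
Proof. by move=> sp sc bc; apply: L1_smooth_bsupp; [exact: smooth_gdot|exact: bsupp_gdot]. Qed.

(** By parts against the first coordinate, the integral of psi^2 is that of -2 x_i psi partial_i
    psi, with |x_i| <= M on the support; Young's inequality absorbs half of the left side. *)
Lemma poincare (M : R) psi : (0 < n)%N -> smooth psi ->
  (forall x, M < enorm x -> psi x = 0) ->
  Int (fun x => psi x ^+ 2) <= 4 * M ^+ 2 * energy psi.
Proof.
move=> n0 sp p0; have bp : bsupp psi by exists M.
pose i : 'I_n := Ordinal n0.
have s2 : smooth (fun x => psi x * psi x) by exact: smoothM.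
have b2 : bsupp (fun x => psi x * psi x) by exact: bsuppMl.
have si := smooth_partial i sp.
have Lp : L1 (fun x => psi x ^+ 2) by exact: L1_smooth_bsupp.
have Lg : L1 (gdot psi psi) by exact: L1_gdot.
have sxp : smooth (fun x => x 0 i * partial i (fun x => psi x * psi x) x).
  by apply: smoothM; [exact: smooth_coord|exact: smooth_partial].
have Lx : L1 (fun x => x 0 i * partial i (fun x => psi x * psi x) x).
  by apply: L1_smooth_bsupp => //; apply: bsuppMr; exact: bsupp_partial.
have E : Int (fun x => psi x ^+ 2) = - Int (fun x => x 0 i * partial i (fun x => psi x * psi x) x).
  rewrite -(Int_by_parts i (smooth_coord i) s2 (or_intror b2)); congr Int.
  by apply/funext => x; rewrite partial_coord eqxx mul1r expr2.
have H : Int (fun x => psi x ^+ 2) <= 2^-1 * Int (fun x => psi x ^+ 2) + 2 * M ^+ 2 * energy psi.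
  rewrite {1}E -IntN // -IntZ // /energy -IntZ // -IntD; [|exact: L1Z|exact: L1Z].
  apply: le_Int; [exact: L1N|by apply: L1D; exact: L1Z|] => x.
  rewrite (partial_smul i x sp sp).
  have [xM|Mx] := leP (enorm x) M; last first.
    rewrite p0 // mulr0 mul0r addr0 mulr0 oppr0 expr0n /= mulr0 add0r.
    by apply: mulr_ge0; [apply: mulr_ge0 => //; exact: sqr_ge0|exact: gdot_ge0].
  have h1 : partial i psi x * partial i psi x <= gdot psi psi x.
    rewrite /gdot (bigD1 i) //= lerDl; apply: sumr_ge0 => j _.
    by rewrite -expr2 sqr_ge0.
  have h2 : x 0 i ^+ 2 <= M ^+ 2.
    rewrite -(@real_normK _ (x 0 i)) ?num_real // ler_sqr ?nnegrE //; last exact: le_trans (enorm_ge0 x) xM.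
    exact: le_trans (coord_le_enorm x i) xM.
  have h3 := gdot_ge0 psi x.
  apply: (@le_trans _ _ (2^-1 * psi x ^+ 2 + 2 * x 0 i ^+ 2 * (partial i psi x * partial i psi x))).
    have := sqr_ge0 (psi x + 2 * (x 0 i * partial i psi x)).
    by move: (psi x) (x 0 i) (partial i psi x) => p q r; lra.
  rewrite lerD2l; apply: ler_pM => //; last by rewrite ler_wpM2l.
    by apply: mulr_ge0 => //; exact: sqr_ge0.
  by rewrite -expr2 sqr_ge0.
by move: H; move: (Int _) (energy psi) => p q; lra.
Qed.

(** Competitors for the capacity of [N] relative to the ball of radius [M]. *)
Definition admissible (M : R) N psi : Prop :=
  [/\ smooth psi, forall x, 0 <= psi x, forall x, M < enorm x -> psi x = 0 &
      forall x, N x -> 1 <= psi x].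

Lemma energyD psi chi (s : R) : smooth psi -> smooth chi -> bsupp psi -> bsupp chi ->
  energy (fun x => psi x + s * chi x) = energy psi + 2 * s * Int (gdot psi chi) + s ^+ 2 * energy chi.
Proof.
move=> sp sc bp bc.
have L1' := L1_gdot sp sp bp; have L2' := L1_gdot sp sc bc; have L3' := L1_gdot sc sc bc.
rewrite /energy -(IntZ _ L2') -(IntZ _ L3') -(IntD L1' (L1Z _ L2')) -(IntD (L1D L1' (L1Z _ L2')) (L1Z _ L3')).
congr Int; apply/funext => x; rewrite /gdot !mulr_sumr -!big_split; apply: eq_bigr => i _ /=.
rewrite (partial_sadd i x sp (smoothZ s sc)) (partialZ i s sc).
by move: (partial i psi x) (partial i chi x) => p q; ring.
Qed.

Lemma variation_bound (p q r s eta : R) : 0 < eta ->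
  0 <= r -> p < s + eta ^+ 2 -> s <= p + 2 * eta * q + eta ^+ 2 * r -> - q <= eta * (1 + r).
Proof.
move=> eta0 r0 h1 h2; rewrite -(ler_pM2l eta0).
have h3 : 0 <= eta * (eta * (1 + r)) by rewrite !mulr_ge0 ?(ltW eta0) // addr_ge0.
by move: h1 h2 h3; rewrite !expr2; lra.
Qed.

(** The infimum of the energy may not be attained by a smooth function. A competitor within eta^2 of
    it, compared with psi + eta chi, satisfies the variational inequality up to an error of order
    eta. *)
Lemma near_minimiser (M eta : R) N psi1 : 0 < eta -> admissible M N psi1 ->
  exists psi, [/\ admissible M N psi, energy psi <= energy psi1 &
    forall chi, smooth chi -> (forall x, 0 <= chi x) -> (forall x, M < enorm x -> chi x = 0) ->
      - Int (gdot psi chi) <= eta * (1 + energy chi)].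
Proof.
move=> eta0 a1.
pose S : set R := [set energy psi | psi in admissible M N].
have lS : has_lbound S by exists 0 => _ [psi _ <-]; exact: energy_ge0.
have hS : has_inf S by split => //; exists (energy psi1), psi1.
have eta2 : 0 < eta ^+ 2 by rewrite exprn_gt0.
have [psi [ap Jp1 Jinf]] : exists psi, [/\ admissible M N psi, energy psi <= energy psi1 & energy psi < inf S + eta ^+ 2].
  have [_ [psi ap <-] h] := inf_adherent eta2 hS.
  case/orP: (le_total (energy psi) (energy psi1)) => h1; first by exists psi; split; [exact: ap|exact: h1|exact: h].
  by exists psi1; split; [exact: a1|exact: lexx|exact: le_lt_trans h1 h].
exists psi; split; [exact: ap|exact: Jp1|]; move=> chi sc c0 cM; have [sp p0 pM pN] := ap.
have bp : bsupp psi by exists M.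
have bc : bsupp chi by exists M.
have av : admissible M N (fun x => psi x + eta * chi x).
  split.
  - by apply: smoothD => //; exact: smoothZ.
  - by move=> x; rewrite addr_ge0 // mulr_ge0 // ltW.
  - by move=> x Mx; rewrite pM // cM // mulr0 addr0.
  - by move=> x /pN h; rewrite (le_trans h) // lerDl mulr_ge0 // ltW.
have : inf S <= energy (fun x => psi x + eta * chi x) by apply: ge_inf => //; exists (fun x => psi x + eta * chi x).
rewrite energyD // => h; move: (energy_ge0 chi) Jinf h.
exact: variation_bound.
Qed.

(** As f <= 1, integrating the mollifier in [x] first leaves at most [mass] times [e]. *)
Lemma tonelli_moll f e (l : R) : 0 < l -> mfun f -> (forall x, 0 <= f x) -> (forall x, f x <= 1) ->
  mfun e -> L1 e -> (forall x, 0 <= e x) -> L1 (fun x => f x * wmean e l x) ->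
  Int (fun x => f x * wmean e l x) <= mass * Int e.
Proof.
move=> l0 mf f0 f1 me Le e0 Lfw.
have ln0 : 0 <= l ^+ n by rewrite exprn_ge0 // ltW.
pose K (p : 'rV[R]_n * 'rV[R]_n) : R := f p.1 * (l ^+ n * (e p.2 * moll (l ^+ 2 * sqd p.1 p.2))).
have KE x y : K (x, y) = f x * (l ^+ n * (e y * moll (l ^+ 2 * sqd x y))) by [].
have mk : mfun (fun z : 'rV[R]_n => moll (l ^+ 2 * dotr z z)).
  have -> : (fun z : 'rV[R]_n => moll (l ^+ 2 * dotr z z)) = kern moll l.
    by apply/funext => z; rewrite /kern /sqd subr0.
  by apply: mfun_cont; apply: smooth_continuous; apply: smooth_kern; exact: smooth1_moll.
have msub : measurable_fun setT (fun p : 'rV[R]_n * 'rV[R]_n => p.2 - p.1).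
  apply: measurable_fun_row => i.
  have -> : (fun t : 'rV[R]_n * 'rV[R]_n => (t.2 - t.1) 0 i) = fun t => t.2 0 i - t.1 0 i.
    by apply/funext => t; rewrite !mxE.
  apply: measurable_funB.
    exact: (measurableT_comp (measurable_coord i) measurable_snd).
  exact: (measurableT_comp (measurable_coord i) measurable_fst).
have mK : measurable_fun setT (fun p => (K p)%:E).
  apply/measurable_EFinP; apply: measurable_funM.
    exact: (measurableT_comp mf measurable_fst).
  apply: measurable_funM; first exact: measurable_cst.
  apply: measurable_funM; first exact: (measurableT_comp me measurable_snd).
  exact: (measurableT_comp mk msub).
have K0 p : (0 <= (K p)%:E)%E.
  by rewrite lee_fin; apply: mulr_ge0 => //; apply: mulr_ge0 => //; apply: mulr_ge0 => //; exact: moll_ge0.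
have T := @fubini_tonelli _ _ _ _ R mu mu _ mK K0.
have Lx x : L1 (fun y => K (x, y)).
  have := L1Z (f x * l ^+ n) (@L1_moll _ _ e l x Le l0); congr L1.
  by apply/funext => y; rewrite KE [RHS]mulrA.
have Ix x : Int (fun y => K (x, y)) = f x * wmean e l x.
  rewrite wmeanE mulrA -IntZ; last exact: L1_moll.
  by congr Int; apply/funext => y; rewrite KE [LHS]mulrA.
have T1 : (\int[mu]_x \int[mu]_y (K (x, y))%:E = (Int (fun x => f x * wmean e l x))%:E)%E.
  rewrite -(L1_fin Lfw); apply: eq_integral => x _.
  exact: (etrans (L1_fin (Lx x)) (congr1 EFin (Ix x))).
rewrite -lee_fin -T1 T.
have -> : ((mass * Int e)%:E = \int[mu]_y (mass * e y)%:E)%E.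
  by rewrite -(IntZ mass Le); exact/esym/(L1_fin (L1Z mass Le)).
have Lm y : L1 (fun x => moll (l ^+ 2 * sqd y x)).
  have := @L1_bsupp _ _ (fun x => moll (l ^+ 2 * sqd y x)).
  apply.
    apply: smooth_continuous.
    exact: (@smooth_radial _ _ (fun s => moll (l ^+ 2 * s)) y (smooth1_scale _ smooth1_moll)).
  have b := @bsupp_kern R n moll l moll_ge1 l0.
  have := bsupp_shift y b; congr bsupp; apply/funext => x.
  by rewrite /kern sqd0 -enormN opprB -sqd_enorm.
have sqdC x y : sqd x y = sqd y x by rewrite !sqd_enorm enormBC.
have ml y : mfun (fun x => moll (l ^+ 2 * sqd x y)).
  by rewrite (_ : (fun x => _) = fun x => moll (l ^+ 2 * sqd y x)); [exact: L1_mfun|apply/funext => x; rewrite sqdC].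
apply: ge0_le_integral; first exact: measurableT.
- by move=> y _; apply: integral_ge0 => x _; exact: K0.
- exact: (@measurable_fun_fubini_tonelli_G _ _ _ _ R mu _ mK K0).
- by apply: mfun_EFin; apply: mfunM me; exact: mfun_cst.
- move=> y _.
  have -> : ((mass * e y)%:E = \int[mu]_x (e y * (l ^+ n * moll (l ^+ 2 * sqd y x)))%:E)%E.
    rewrite (L1_fin (L1Z (e y) (L1Z (l ^+ n) (Lm y)))) (IntZ (e y) (L1Z (l ^+ n) (Lm y))).
    by rewrite (IntZ (l ^+ n) (Lm y)) (Int_moll y l0) mulrC.
  apply: ge0_le_integral; first exact: measurableT.
  - by move=> x _; exact: K0.
  - apply: mfun_EFin; apply: (mfunM mf); apply: mfunM; first exact: mfun_cst.
    by apply: mfunM; [exact: (mfun_cst (e y))|exact: ml].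
  - apply: mfun_EFin; apply: mfunM; first exact: mfun_cst.
    by apply: mfunM; [exact: mfun_cst|exact: L1_mfun].
  - move=> x _; rewrite lee_fin KE sqdC [leRHS]mulrCA.
    by apply: (ler_piMl _ (f1 x)); exact: (mulr_ge0 ln0 (mulr_ge0 (e0 y) (moll_ge0 _))).
Qed.

Lemma le_add_sqr (p s : R) : 0 < s -> 0 <= p -> p <= s + s^-1 * p ^+ 2.
Proof.
move=> s0 p0; have h := sqr_ge0 (p - s); have h2 := mulr_ge0 p0 (ltW s0).
by rewrite -(ler_pM2l s0) mulrDr mulVKf ?gt_eqF // -expr2; move: h h2; lra.
Qed.

(** A near minimiser is almost superharmonic in the weak sense. Its mollification [w] is smooth,
    stays at least 1 on [E] since the competitor is so on the [delta]-neighbourhood, and its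
    Laplacian is bounded by testing the variational inequality with the kernel. The last clause
    combines the inequalities of Young and Poincare. *)
Lemma supersolution (M delta eps : R) E psi1 : (0 < n)%N -> 0 < delta -> 0 < eps -> 0 <= M ->
  admissible (M + 1) [set x | exists2 y, E y & enorm (x - y) < delta] psi1 ->
  exists w, [/\ smooth w, forall x, 0 <= w x, forall x, E x -> 1 <= w x,
    forall x, enorm x <= M -> laplacian w x <= eps &
    forall f, continuous f -> bsupp f -> (forall x, 0 <= f x) -> (forall x, f x <= 1) ->
      forall s, 0 < s -> Int (fun x => f x * w x) <=
        s * Int (\1_[set x : 'rV[R]_n | enorm (x - 0) <= M + 1]) + s^-1 * (4 * (M + 1) ^+ 2 * energy psi1)].
Proof.
move=> n0 d0 eps0 M0 a1; set N := [set x | exists2 y, E y & enorm (x - y) < delta] in a1.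
(* The kernel radius 1/l is at most 1 and at most [delta]: kernels centred in the ball of radius M
   stay in that of radius M + 1, and kernels centred in [E] stay where psi >= 1. *)
pose l := 1 + delta^-1.
have l0 : 0 < l by rewrite addr_gt0 // invr_gt0.
have l1 : l^-1 <= 1 by rewrite invf_le1 // lerDl invr_ge0 ltW.
have ld : l^-1 <= delta by rewrite -[delta]invrK lef_pV2 ?posrE ?invr_gt0 // lerDr.
have ln0 : 0 < l ^+ n by rewrite exprn_gt0.
have mass0 := @mass_gt0 R n.
have sk : smooth (kern moll l : 'rV[R]_n -> R) by apply: smooth_kern; exact: smooth1_moll.
have bk : bsupp (kern moll l : 'rV[R]_n -> R) by exact: (bsupp_kern moll_ge1 l0).
have [C C0 HC] : exists2 C, 0 <= C & forall i x, `|partial i (kern moll l : 'rV[R]_n -> R) x| <= C.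
  have /choice[Ci HCi] : forall i, exists C, 0 <= C /\ forall x, `|partial i (kern moll l : 'rV[R]_n -> R) x| <= C.
    move=> i; have [C C0 h] := smooth_bounded (smooth_partial i sk) (bsupp_partial i bk).
    by exists C.
  exists (\sum_i Ci i); first by apply: sumr_ge0 => i _; have [] := HCi i.
  move=> i x; have [_ h] := HCi i; apply: le_trans (h x) _.
  by rewrite (bigD1 i) //= lerDl; apply: sumr_ge0 => j _; have [] := HCi j.
pose B : set 'rV[R]_n := [set x | enorm (x - 0) <= M + 1].
have mB : measurable B.
  rewrite -[X in measurable X]setCK; apply: measurableC; apply: measurable_open.
  by apply: closed_openC; exact: closed_cball.
have LB : L1 (\1_B) by apply: (@L1_indic _ _ _ (M + 1)) => // x; rewrite /B /= subr0.
have IB0 : 0 <= Int (\1_B) by apply: Int_ge0 => x; rewrite indicE.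
pose C2 := n%:R * C ^+ 2 * Int (\1_B).
have C20 : 0 <= C2 by rewrite !mulr_ge0 // sqr_ge0.
(* [C2] bounds the energy of the kernel, so the variational error eta (1 + C2), times the
   normalising factor of the mollifier, is [eps]. *)
pose eta := eps / (mass^-1 * l ^+ n * (1 + C2)).
have den0 : 0 < mass^-1 * l ^+ n * (1 + C2).
  by rewrite mulr_gt0 ?mulr_gt0 ?invr_gt0 // ltr_pwDl.
have eta0 : 0 < eta by rewrite divr_gt0.
have [psi [ap Jp Hp]] := near_minimiser eta0 a1.
have [sp p0 pM pN] := ap.
have bp : bsupp psi by exists (M + 1).
have Lp : L1 psi by exact: L1_smooth_bsupp.
pose w x := mass^-1 * (l ^+ n * conv psi (kern moll l) x).
have sc : smooth (conv psi (kern moll l)) by exact: smooth_conv.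
have sw : smooth w by do 2 apply: smoothZ.
have wE x : w x = mass^-1 * wmean psi l x by [].
have w0 x : 0 <= w x.
  rewrite wE wmeanE !mulr_ge0 ?invr_ge0 ?(ltW mass0) ?(ltW ln0) //.
  by apply: Int_ge0 => y; rewrite mulr_ge0 // moll_ge0.
exists w; split => //.
- move=> x Ex; rewrite wE -(mulVf (lt0r_neq0 mass0)) ler_wpM2l ?invr_ge0 ?(ltW mass0) //.
  rewrite -(Int_moll x l0) wmeanE ler_wpM2l ?(ltW ln0) //.
  have Lm : L1 (fun y => moll (l ^+ 2 * sqd x y)).
    have := @L1_bsupp _ _ (fun y => moll (l ^+ 2 * sqd x y)); apply.
      apply: smooth_continuous.
      exact: (@smooth_radial _ _ (fun s => moll (l ^+ 2 * s)) x (smooth1_scale _ smooth1_moll)).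
    have := bsupp_shift x bk; congr bsupp; apply/funext => y.
    by rewrite /kern sqd0 -enormN opprB -sqd_enorm.
  apply: le_Int => // [|y]; first exact: L1_moll.
  have [h|h] := ltP (enorm (y - x)) l^-1.
    by rewrite ler_peMl ?moll_ge0 // pN //; exists x => //; exact: lt_le_trans ld.
  have h2 : 1 <= l ^+ 2 * sqd x y.
    rewrite sqd_enorm -exprMn -[X in X <= _](expr1n _ 2) ler_sqr ?nnegrE ?mulr_ge0 ?enorm_ge0 ?(ltW l0) //.
    by rewrite mulrC -ler_pdivrMr // div1r.
  by rewrite moll_ge1 // mulr0.
- move=> x xM; rewrite /w (laplacianZ _ x (smoothZ (l ^+ n) sc)) (laplacianZ _ x sc).
  rewrite laplacian_conv //.
  pose chi y := kern moll l (x - y).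
  have schi : smooth chi by exact: smooth_reflect.
  have bchi : bsupp chi by exact: bsupp_shift.
  have chi0 y : M + 1 < enorm y -> chi y = 0.
    move=> My; apply: (kern_supp moll_ge1 l0); apply: le_trans l1 _.
    have := enormD (y - x) x; rewrite subrK enormBC => h.
    by rewrite -(lerD2r (enorm x)); apply: le_trans h; apply: le_trans (ltW My); rewrite addrC lerD2r.
  have E1 : conv psi (laplacian (kern moll l)) x = - Int (gdot psi chi).
    apply: (etrans _ (Int_green sp schi (or_introl bchi))).
    have Ek y : laplacian (kern moll l) (x - y) = laplacian chi y.
      rewrite /chi reflectE; apply/esym/(etrans (laplacian_affine x (-1) y sk)).
      by rewrite sqrrN expr1n mul1r scaleN1r.
    rewrite /conv; apply: (congr1 Int); apply/funext => y.
    exact: (congr1 (fun t => psi y * t) (Ek y)).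
  have Jchi : energy chi <= C2.
    rewrite /energy /C2 -IntZ //; apply: le_Int; [exact: L1_gdot|exact: L1Z|] => y.
    have [yM|My] := leP (enorm (y - 0)) (M + 1); last first.
      rewrite indicE memNset ?mulr0; last by rewrite /B /=; apply/negP; rewrite -ltNge.
      have oN : open (~` B) by apply: closed_openC; exact: closed_cball.
      have Ny : (~` B) y by rewrite /B /=; apply/negP; rewrite -ltNge.
      rewrite /gdot big1 // => i _.
      rewrite (@partial_open _ _ i chi (fun=> 0 : R) (~` B) y) ?partial_cst ?mul0r // => z.
      by rewrite /B /= => /negP; rewrite -ltNge subr0 => /chi0.
    rewrite indicE mem_set // mulr1 -[n in n%:R * _]card_ord -sum1_card natr_sum mulr_suml.
    apply: ler_sum => i _; rewrite mul1r /chi partial_reflect // mulrNN -expr2.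
    by rewrite -[X in X <= _]real_normK ?num_real // ler_sqr ?nnegrE.
  have H : - Int (gdot psi chi) <= eta * (1 + C2).
    apply: le_trans (Hp chi schi _ chi0) _; first by move=> y; exact: kern_moll_ge0.
    by rewrite ler_wpM2l ?(ltW eta0) // lerD2l.
  rewrite E1 mulrA; apply: (@le_trans _ _ (mass^-1 * l ^+ n * (eta * (1 + C2)))).
    by rewrite ler_wpM2l // mulr_ge0 ?invr_ge0 ?(ltW mass0) ?(ltW ln0).
  by rewrite mulrCA /eta divfK ?lexx // gt_eqF.
- move=> f cf bf f0 f1 s s0.
  have Lfw : L1 (fun x => f x * wmean psi l x).
    apply: L1_bsupp; last exact: bsuppMl.
    by move=> x; apply: continuousM; [exact: cf|apply: smooth_continuous; exact: smoothZ].
  have mp : mfun psi by exact: L1_mfun.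
  have -> : Int (fun x => f x * w x) = mass^-1 * Int (fun x => f x * wmean psi l x).
    by rewrite -IntZ //; congr Int; apply/funext => x; rewrite wE mulrCA.
  apply: (@le_trans _ _ (Int psi)).
    rewrite mulrC ler_pdivrMr // mulrC; apply: tonelli_moll => //; exact: mfun_cont.
  have Lp2 : L1 (fun x => psi x ^+ 2) by apply: L1_smooth_bsupp; [exact: smoothX|have := @bsuppMl _ _ psi psi bp; congr bsupp].
  apply: (@le_trans _ _ (s * Int (\1_B) + s^-1 * Int (fun x => psi x ^+ 2))).
    rewrite -!IntZ // -IntD; [|exact: L1Z|exact: L1Z].
    apply: le_Int => // [|x]; first by apply: L1D; exact: L1Z.
    have [xB|Mx] := leP (enorm (x - 0)) (M + 1); last first.
      have -> : psi x = 0 by apply: pM; rewrite -[x]subr0.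
      by rewrite expr0n /= mulr0 addr0; apply: mulr_ge0 (ltW s0) _; rewrite indicE.
    rewrite indicE mem_set // mulr1.
    exact: le_add_sqr.
  rewrite lerD2l ler_wpM2l ?invr_ge0 ?(ltW s0) //.
  apply: le_trans (poincare n0 sp pM) _.
  by rewrite ler_wpM2l // mulr_ge0 // sqr_ge0.
Qed.

End potential.

(** * Cut-offs built from approximations of the solution near a boundary point *)

Section boundary_energy.
Context {R : realType} {n : nat}.
Local Notation mu := (@lebesgue_row R n).
Implicit Types (u phi zeta chi f U V : 'rV[R]_n -> R) (g : 'rV[R]_n -> 'rV[R]_n) (x y : 'rV[R]_n)
  (O Omega : set 'rV[R]_n).

Lemma sqr_sub_le (p q : R) : (p - q) ^+ 2 <= 2 * p ^+ 2 + 2 * q ^+ 2.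
Proof. have := sqr_ge0 (p + q); rewrite sqrrB sqrrD; lra. Qed.

Lemma sqr_add_le (p q : R) : (p + q) ^+ 2 <= 2 * p ^+ 2 + 2 * q ^+ 2.
Proof. have := sqr_ge0 (p - q); rewrite sqrrB sqrrD; lra. Qed.

Lemma sqr_add_le8 (p q : R) : (-2 * (p + q)) ^+ 2 <= 8 * p ^+ 2 + 8 * q ^+ 2.
Proof. by have := sqr_add_le p q; rewrite exprMn; lra. Qed.

Lemma L1_sqr_sub Omega f h : open Omega -> ebounded Omega -> L2 Omega f -> L2 Omega h ->
  L1 (fun x => \1_Omega x * (f x - h x) ^+ 2).
Proof.
move=> oO bO Lf Lh; have [mf Lf2 _] := L2_res oO bO Lf; have [mh Lh2 _] := L2_res oO bO Lh.
apply: (@L1_le _ _ _ (fun x => 2 * (\1_Omega x * f x ^+ 2) + 2 * (\1_Omega x * h x ^+ 2))).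
- have -> : (fun x => \1_Omega x * (f x - h x) ^+ 2) =
      fun x => (\1_Omega x * f x - \1_Omega x * h x) * (\1_Omega x * f x - \1_Omega x * h x).
    by apply/funext => x; rewrite -mulrBr mulrACA indic_sqr expr2.
  by apply: mfunM; exact: mfunB.
- by apply: L1D; exact: L1Z.
- move=> x; rewrite ger0_norm; last by apply: mulr_ge0 (sqr_ge0 _); rewrite indicE.
  have -> : 2 * (\1_Omega x * f x ^+ 2) + 2 * (\1_Omega x * h x ^+ 2) =
      \1_Omega x * (2 * f x ^+ 2 + 2 * h x ^+ 2).
    by rewrite mulrDr; congr (_ + _); exact: mulrCA.
  apply: ler_wpM2l; last exact: sqr_sub_le.
  by rewrite indicE.
Qed.

Lemma H01_approx Omega u g (eps : R) : open Omega -> ebounded Omega -> H01 Omega u g -> 0 < eps ->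
  exists phi, [/\ test_function Omega phi, Int (fun x => \1_Omega x * (phi x - u x) ^+ 2) <= eps &
    forall i, Int (fun x => \1_Omega x * (partial i phi x - g x 0 i) ^+ 2) <= eps].
Proof.
move=> oO bO [[Lu Lg _] [phi [tp c1 c2]]] e0; have mO := measurable_open oO.
have near0 (F : nat -> \bar R) : F k @[k --> \oo] --> 0%E -> \forall k \near \oo, (F k <= eps%:E)%E.
  move=> cF; have N : nbhs (0%E : \bar R) [set t : \bar R | (t <= eps%:E)%E].
    by exists eps => //= t; rewrite /ball_ /= sub0r normrN lee_fin => /ltW; apply: le_trans; exact: ler_norm.
  exact: cF N.
have [k [h1 h2]] : exists k,
    (\int[mu]_(x in Omega) ((phi k x - u x) ^+ 2)%:E <= eps%:E)%E /\
    (\int[mu]_(x in Omega) (enorm (grad (phi k) x - g x) ^+ 2)%:E <= eps%:E)%E.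
  have := filterI (near0 _ c1) (near0 _ c2) => -[N _ HN].
  by exists N; have [] := HN N (leqnn N).
exists (phi k); split => //.
  rewrite -lee_fin -L1_fin; last by apply: L1_sqr_sub => //; exact: test_L2.
  by rewrite -eint_restrict.
move=> i; have Li : L1 (fun x => \1_Omega x * (partial i (phi k) x - g x 0 i) ^+ 2).
  by apply: L1_sqr_sub (Lg i) => //; apply: test_L2 => //; exact: test_partial.
rewrite -lee_fin; apply: le_trans h2.
have LS : L1 (fun x => \sum_i \1_Omega x * (partial i (phi k) x - g x 0 i) ^+ 2).
  apply: L1_sum => j; apply: L1_sqr_sub (Lg j) => //; apply: test_L2 => //; exact: test_partial.
have E : (fun x => \1_Omega x * enorm (grad (phi k) x - g x) ^+ 2) =
    fun x => \sum_i \1_Omega x * (partial i (phi k) x - g x 0 i) ^+ 2.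
  apply/funext => x; rewrite enorm_sqr -mulr_sumr; congr (_ * _).
  by apply: eq_bigr => j _; rewrite !mxE expr2.
have -> : (\int[mu]_(x in Omega) (enorm (grad (phi k) x - g x) ^+ 2)%:E =
    (Int (fun x => \sum_i \1_Omega x * (partial i (phi k) x - g x 0 i) ^+ 2))%:E)%E.
  rewrite eint_restrict // -(L1_fin LS); apply: eq_integral => x _.
  exact: (congr1 (fun f => (f x)%:E) E).
rewrite lee_fin; apply: le_Int => // x.
rewrite (bigD1 i) //= lerDl; apply: sumr_ge0 => j _; apply: mulr_ge0 (sqr_ge0 _).
by rewrite indicE.
Qed.

Lemma lipschitz_bsupp f : smooth f -> bsupp f ->
  exists2 L, 0 <= L & forall x y, `|f x - f y| <= L * enorm (x - y).
Proof.
move=> sf bf.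
have /choice[C HC] : forall i, exists C, 0 <= C /\ forall x, `|partial i f x| <= C.
  move=> i; have [C C0 h] := smooth_bounded (smooth_partial i sf) (bsupp_partial i bf).
  by exists C.
exists (\sum_i C i); first by apply: sumr_ge0 => i _; have [] := HC i.
move=> x y; have [s _] := mvt_line y (x - y) (fun z => smooth_diff z sf) (@ltr01 R).
rewrite scale1r mul1r [y + _]addrC subrK => ->.
apply: le_trans (ler_norm_sum _ _ _) _; rewrite mulr_suml; apply: ler_sum => i _.
rewrite normrM mulrC ler_pM //; [by have [_] := HC i; apply|exact: coord_le_enorm].
Qed.

Lemma step_lip : exists2 C : R, 0 < C & forall s, `|step s| <= C * `|s|.
Proof.
have [C C0 HC] := @bounded_derive1_step R; exists C => // s.
have [s0|s0] := leP s 0; first by rewrite step_le0 // normr0 mulr_ge0 // ltW.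
have [| |t _] := @MVT R step (derive1 step) 0 s s0.
- move=> t _; rewrite derive1E; apply: derivableP; apply: smooth1_derivable; exact: smooth1_step.
- by apply: continuous_subspaceT; apply: smooth1_continuous; exact: smooth1_step.
rewrite (step_le0 (lexx 0)) !subr0 => ->.
by rewrite normrM ler_wpM2r.
Qed.

Lemma const_on_ball f c (r : R) : smooth f -> (forall i x, eball c r x -> partial i f x = 0) ->
  forall x, eball c r x -> f x = f c.
Proof.
move=> sf df x xr; have [s /andP[s0 s1]] := mvt_line c (x - c) (fun z => smooth_diff z sf) (@ltr01 R).
rewrite scale1r mul1r [c + (x - c)]addrC subrK => E; apply/eqP; rewrite -subr_eq0 E; apply/eqP.
apply: big1 => i _; rewrite df ?mulr0 // /eball /= addrAC subrr add0r enormZ gtr0_norm //.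
by apply: le_lt_trans xr; rewrite ler_piMl ?enorm_ge0 // ltW.
Qed.

Variables (Omega : set 'rV[R]_n) (u : 'rV[R]_n -> R) (g : 'rV[R]_n -> 'rV[R]_n)
  (B0 : set 'rV[R]_n) (U V : 'rV[R]_n -> R).
Hypotheses (oO : open Omega) (bO : ebounded Omega) (Hu : H01 Omega u g) (oB : open B0)
  (sU : smooth U) (sV : smooth V) (UV : forall x, B0 x -> U x * V x = 1)
  (uU : {ae mu, forall x, Omega x -> B0 x -> u x = U x}).

Let O := Omega `&` B0.
Let mO : measurable Omega. Proof. exact: measurable_open. Qed.
Let OO : O `<=` Omega. Proof. by move=> x []. Qed.
Let OB : O `<=` B0. Proof. by move=> x []. Qed.
Let Lu : L2 Omega u. Proof. by case: Hu => -[]. Qed.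
Let Lg i : L2 Omega (fun x => g x 0 i). Proof. by case: Hu => -[_ h _] _; exact: h. Qed.

Let L1_test_indic f phi : L1 (fun x => \1_Omega x * f x) -> test_function Omega phi ->
  L1 (fun x => \1_Omega x * f x * phi x).
Proof. by move=> Lf tp; exact: test_mulr_L1 Lf tp. Qed.

Lemma local_gradient i chi : test_function O chi ->
  Int (fun x => \1_Omega x * g x 0 i * chi x) = Int (fun x => partial i U x * chi x).
Proof.
move=> tc; have tO := test_sub OO tc; have sc := test_smooth tc; have bc := test_bsupp tc.
have [_ _ L1u] := L2_res oO bO Lu.
have [[_ _ wg] _] := Hu; have := wg chi tO i; rewrite !Int_restrict // => E.
have E1 : Int (fun x => \1_Omega x * (u x * partial i chi x)) = Int (fun x => U x * partial i chi x).
  apply: Int_ae_eq.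
  - have := L1_mfun (L1_test_indic L1u (test_partial i tO)); congr mfun.
    by apply/funext => x; rewrite mulrA.
  - apply: mfunM; apply: mfun_cont; apply: smooth_continuous => //; exact: smooth_partial.
  - apply: filterS uU => x ux; have [[Ox Bx]|nOx] := pselect (O x).
      by rewrite indicE mem_set // mul1r ux.
    by rewrite (test_out (test_partial i tc) nOx) !mulr0.
have -> : Int (fun x => \1_Omega x * g x 0 i * chi x) = Int (fun x => \1_Omega x * (g x 0 i * chi x)).
  by congr Int; apply/funext => x; rewrite mulrA.
apply: oppr_inj; rewrite -E E1 (Int_by_parts i sU sc (or_intror bc)) opprK //.
Qed.

(** When tested with chi^2 (partial i phi - partial i U), supported where u = U, the weak gradient
    may be replaced by that of [U]; Young's inequality then absorbs half of the left side. *)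
Lemma local_gradient_bound i phi chi (C : R) : test_function Omega phi -> test_function O chi ->
  (forall x, `|chi x| <= C) ->
  Int (fun x => (chi x * (partial i phi x - partial i U x)) ^+ 2) <=
  C ^+ 2 * Int (fun x => \1_Omega x * (partial i phi x - g x 0 i) ^+ 2).
Proof.
move=> tp tc Cc; have sp := test_smooth tp; have sc := test_smooth tc.
have tcO := test_sub OO tc.
pose a x := partial i phi x - partial i U x.
have sa : smooth a by apply: smoothB; exact: smooth_partial.
pose psi x := chi x * a x * chi x.
have tpsi : test_function O psi by apply: test_mull => //; exact: smoothM.
have bpsi := test_bsupp tpsi; have spsi := test_smooth tpsi.
have [mg _ L1g] := L2_res oO bO (Lg i).
have Lb := L1_sqr_sub oO bO (test_L2 mO (test_partial i tp)) (Lg i).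
have Lgp := L1_test_indic L1g (test_sub OO tpsi).
have LUp : L1 (fun x => partial i U x * psi x).
  by apply: L1_smooth_bsupp; [apply: smoothM => //; exact: smooth_partial|exact: bsuppMr].
have Lpp : L1 (fun x => partial i phi x * psi x).
  by apply: L1_smooth_bsupp; [apply: smoothM => //; exact: smooth_partial|exact: bsuppMr].
have La2 : L1 (fun x => (chi x * a x) ^+ 2).
  apply: L1_smooth_bsupp; first by apply: smoothX; exact: smoothM.
  by have := bsuppMl (fun x => chi x * a x * a x) (test_bsupp tc); congr bsupp; apply/funext => x; rewrite expr2; ring.
have E : Int (fun x => (chi x * a x) ^+ 2) = Int (fun x => partial i phi x * psi x - \1_Omega x * g x 0 i * psi x).
  rewrite IntB // local_gradient // -IntB //; congr Int; apply/funext => x.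
  by rewrite -mulrBl -/(a x) /psi expr2; move: (a x) (chi x) => p q; ring.
have H : Int (fun x => (chi x * a x) ^+ 2) <= 2^-1 * Int (fun x => (chi x * a x) ^+ 2) +
    2^-1 * (C ^+ 2 * Int (fun x => \1_Omega x * (partial i phi x - g x 0 i) ^+ 2)).
  rewrite {1}E -(IntZ (C ^+ 2) Lb) -(IntZ _ La2) -(IntZ _ (L1Z (C ^+ 2) Lb)) -(IntD (L1Z _ La2) (L1Z _ (L1Z (C ^+ 2) Lb))).
  apply: le_Int; [exact: L1B|by apply: L1D; do ?apply: L1Z|] => x.
  have [Ox|nOx] := pselect (Omega x); last first.
    rewrite /psi (test_out tcO nOx) !(mul0r, mulr0) subr0 expr0n /= mulr0 add0r.
    by rewrite indicE memNset // mul0r !mulr0.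
  rewrite indicE mem_set // !mul1r -mulrBl /psi.
  have h1 : (chi x * (partial i phi x - g x 0 i)) ^+ 2 <= C ^+ 2 * (partial i phi x - g x 0 i) ^+ 2.
    rewrite exprMn ler_wpM2r ?sqr_ge0 // -(@real_normK _ (chi x)) ?num_real //.
    by rewrite ler_sqr ?nnegrE //; exact: le_trans (Cc x).
  move: h1; have := sqr_ge0 (chi x * a x - chi x * (partial i phi x - g x 0 i)).
  move: (partial i phi x - g x 0 i) (a x) (chi x) (C ^+ 2) => b p q r; rewrite sqrrB !expr2; lra.
by move: H; move: (Int _) (_ * Int _) => p q; lra.
Qed.

(* As u V = 1 on Omega near x0, this tends to the indicator of the complement of
   Omega when phi tends to u in H^1_0. *)
Definition cutfun phi x : R := step (2 + -2 * (phi x * V x)).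

Lemma smooth_cutfun phi : smooth phi -> smooth (cutfun phi).
Proof.
move=> sp; apply: smooth_comp; first exact: smooth1_step.
by apply: smoothD; [exact: smooth_cst|apply: smoothZ; exact: smoothM].
Qed.

Lemma partial_cutfun phi i x : smooth phi -> partial i (cutfun phi) x =
  derive1 step (2 + -2 * (phi x * V x)) * (-2 * (partial i phi x * V x + phi x * partial i V x)).
Proof.
move=> sp; have spV : smooth (fun x => phi x * V x) by exact: smoothM.
have sz := smoothZ (-2) spV.
have s2 : smooth (fun x => 2 + -2 * (phi x * V x)) by apply: smoothD => //; exact: smooth_cst.
have dst : forall s : R, derivable (@step R) s 1 by move=> s; exact/smooth1_derivable/smooth1_step.
have E := partial_comp i (fun y => smooth_diff y s2) dst.
rewrite /cutfun E (partial_sadd i x (smooth_cst 2) sz) partial_cst add0r (partialZ i _ spV).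
by rewrite (partial_smul i x sp sV).
Qed.

Lemma UV_grad i x : B0 x -> partial i U x * V x + U x * partial i V x = 0.
Proof.
move=> Bx; rewrite -(partial_smul i x sU sV).
by rewrite (@partial_open _ _ i _ (fun=> 1 : R) B0 x) // partial_cst.
Qed.

(** Since U V = 1 on [B0], grad(phi V) = (grad phi - grad U) V + (phi - U) grad V there, and both
    differences are controlled in the integral sense. *)
Lemma cutfun_gradient zeta : test_function B0 zeta ->
  exists2 K, 0 <= K & forall phi i, test_function Omega phi ->
    Int (fun x => (zeta x * partial i (cutfun phi) x) ^+ 2) <=
    K * (Int (fun x => \1_Omega x * (phi x - u x) ^+ 2) +
         Int (fun x => \1_Omega x * (partial i phi x - g x 0 i) ^+ 2)).
Proof.
move=> tz; have sz := test_smooth tz; have bz := test_bsupp tz.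
have [Cs Cs0 HCs] := @bounded_derive1_step R.
have [C1 C10 HC1] := smooth_bounded (smoothM sz sV) (bsuppMl V bz).
have /choice[C2 HC2] : forall i, exists C, 0 <= C /\ forall x, `|zeta x * partial i V x| <= C.
  move=> i; have [C C0 h] := smooth_bounded (smoothM sz (smooth_partial i sV)) (bsuppMl (partial i V) bz).
  by exists C.
pose D := C1 + \sum_i C2 i.
have C2D i : C2 i <= D.
  rewrite /D (bigD1 i) //= addrCA lerDl addr_ge0 //.
  by apply: sumr_ge0 => j _; have [] := HC2 j.
have C1D : C1 <= D by rewrite lerDl; apply: sumr_ge0 => j _; have [] := HC2 j.
have D0 : 0 <= D by exact: le_trans C1D.
have CsD : 0 <= Cs * D by rewrite mulr_ge0 // ltW.
exists (8 * (Cs * D) ^+ 2); first by rewrite mulr_ge0 // sqr_ge0.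
move=> phi i tp; have sp := test_smooth tp.
pose s' x := derive1 step (2 + -2 * (phi x * V x)).
have ss' : smooth s'.
  apply: smooth_comp; first by apply: smooth1_derive; exact: smooth1_step.
  by apply: smoothD; [exact: smooth_cst|apply: smoothZ; exact: smoothM].
(* Where phi = 0 the argument of the derivative of [step] is 2, so [s'] vanishes: the product is
   supported within the support of [phi], hence in [Omega]. *)
have tz' f : smooth f -> test_function O (fun x => zeta x * s' x * f x).
  move=> sf; have [A [cA clA AB A0]] := test_elim tz; have [A' [cA' clA' AO A'0]] := test_elim tp.
  apply: (@test_intro _ _ O (A `&` A')).
  - by apply: smoothM => //; exact: smoothM.
  - apply: (subclosed_compact _ cA); [exact: closedI|by move=> x []].
  - exact: closedI.
  - by move=> x [/AB Bx /AO Ox].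
  - move=> x nA; have [Ax|/A0 ->] := pselect (A x); last by rewrite !mul0r.
    have /A'0 p0 : ~ A' x by move=> A'x; apply: nA.
    by rewrite /s' p0 mul0r mulr0 addr0 derive1_step_ge1 ?ler1n // mulr0 mul0r.
pose chi x := zeta x * s' x * V x; have tc : test_function O chi by exact: tz'.
pose chi2 x := zeta x * s' x * partial i V x.
have tc2 : test_function O chi2 by apply: tz'; exact: smooth_partial.
have bnd (f : 'rV[R]_n -> R) C x : `|zeta x * f x| <= C -> C <= D -> `|zeta x * s' x * f x| <= Cs * D.
  move=> h1 h2; rewrite mulrAC [_ * s' x]mulrC normrM ler_pM //; first exact: HCs.
  exact: le_trans h1 h2.
have cb x : `|chi x| <= Cs * D by exact: bnd (HC1 x) C1D.
have c2b x : `|chi2 x| <= Cs * D by have [_ h] := HC2 i; exact: bnd (h x) (C2D i).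
have La := local_gradient_bound i tp tc cb.
have L1a : L1 (fun x => (chi x * (partial i phi x - partial i U x)) ^+ 2).
  have sa : smooth (fun x => partial i phi x - partial i U x) by apply: smoothB; exact: smooth_partial.
  apply: L1_smooth_bsupp; first by apply: smoothX; apply: smoothM => //; exact: test_smooth tc.
  have := bsuppMl (fun x => (partial i phi x - partial i U x) * (chi x * (partial i phi x - partial i U x))) (test_bsupp tc).
  by congr bsupp; apply/funext => x; rewrite expr2 mulrA.
have Lpu := L1_sqr_sub oO bO (test_L2 mO tp) Lu.
have sc2 := test_smooth tc2.
have L2b : L1 (fun x => (chi2 x * (phi x - U x)) ^+ 2).
  have sa : smooth (fun x => phi x - U x) by exact: smoothB.
  apply: L1_smooth_bsupp; first by apply: smoothX; exact: smoothM.
  have := bsuppMl (fun x => (phi x - U x) * (chi2 x * (phi x - U x))) (test_bsupp tc2).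
  by congr bsupp; apply/funext => x; rewrite expr2 mulrA.
have sqC (s C t : R) : `|s| <= C -> (s * t) ^+ 2 <= C ^+ 2 * t ^+ 2.
  move=> sC; rewrite exprMn ler_wpM2r ?sqr_ge0 // -(@real_normK _ s) ?num_real //.
  by rewrite ler_sqr ?nnegrE //; exact: le_trans sC.
have Lc : Int (fun x => (chi2 x * (phi x - U x)) ^+ 2) <=
    (Cs * D) ^+ 2 * Int (fun x => \1_Omega x * (phi x - u x) ^+ 2).
  have L2c : L1 (fun x => chi2 x ^+ 2 * (\1_Omega x * (phi x - u x) ^+ 2)).
    have := L1Ml (C := (Cs * D) ^+ 2) Lpu (mfun_cont (smooth_continuous (smoothX 2 sc2))).
    have B x : `|chi2 x ^+ 2| <= (Cs * D) ^+ 2 by rewrite normrX ler_sqr ?nnegrE.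
    by move=> /(_ B); congr L1; apply/funext => x; rewrite mulrC.
  rewrite -(IntZ _ Lpu).
  have -> : Int (fun x => (chi2 x * (phi x - U x)) ^+ 2) = Int (fun x => chi2 x ^+ 2 * (\1_Omega x * (phi x - u x) ^+ 2)).
    apply: Int_ae_eq; [exact: L1_mfun L2b|exact: L1_mfun L2c|].
    apply: filterS uU => x ux; have [[Ox Bx]|nOx] := pselect (O x).
      by rewrite exprMn indicE mem_set // mul1r ux.
    by rewrite (test_out tc2 nOx) !mul0r expr0n /= mul0r.
  apply: le_Int => // [|x]; first exact: L1Z.
  apply: ler_wpM2r; first by apply: mulr_ge0 (sqr_ge0 _); rewrite indicE.
  by rewrite -(@real_normK _ (chi2 x)) ?num_real // ler_sqr ?nnegrE.
have H : Int (fun x => (zeta x * partial i (cutfun phi) x) ^+ 2) <=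
    8 * Int (fun x => (chi x * (partial i phi x - partial i U x)) ^+ 2) +
    8 * Int (fun x => (chi2 x * (phi x - U x)) ^+ 2).
  rewrite -(IntZ _ L1a) -(IntZ _ L2b) -(IntD (L1Z _ L1a) (L1Z _ L2b)).
  have scf := smooth_partial i (smooth_cutfun sp).
  apply: le_Int; last 1 first.
  - move=> x; rewrite partial_cutfun // -/(s' x).
    have [Bx|nBx] := pselect (B0 x); last first.
      by rewrite (test_out tz nBx) mul0r expr0n /= addr_ge0 // mulr_ge0 // sqr_ge0.
    have -> : zeta x * (s' x * (-2 * (partial i phi x * V x + phi x * partial i V x))) =
      -2 * (chi x * (partial i phi x - partial i U x) + chi2 x * (phi x - U x)).
      apply/esym; apply: (etrans _ (addr0 _)); rewrite -(mulr0 (2 * (zeta x * s' x))) -(UV_grad i Bx) /chi /chi2.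
      by move: (zeta x) (s' x) (partial i phi x) (V x) (phi x) (partial i V x) (partial i U x) (U x) => z s p v f dv du w; ring.
    exact: sqr_add_le8.
  - apply: L1_smooth_bsupp; first by apply: smoothX; exact: smoothM.
    have := bsuppMl (fun x => partial i (cutfun phi) x * (zeta x * partial i (cutfun phi) x)) bz.
    by congr bsupp; apply/funext => x; rewrite expr2 mulrA.
  - by apply: L1D; exact: L1Z.
apply: le_trans H _; rewrite -mulrA mulrDr mulrDr addrC.
by apply: lerD; apply: ler_wpM2l.
Qed.

(** In [Omega] and [B0], 2 - 2 phi V = 2 (U - phi) V, and [step] is bounded by a multiple of its
    argument. *)
Lemma cutfun_L2 zeta : test_function B0 zeta ->
  exists2 K, 0 <= K & forall phi, test_function Omega phi ->
    Int (fun x => \1_Omega x * (zeta x * cutfun phi x) ^+ 2) <=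
    K * Int (fun x => \1_Omega x * (phi x - u x) ^+ 2).
Proof.
move=> tz; have sz := test_smooth tz; have bz := test_bsupp tz.
have [Cs Cs0 HCs] := step_lip.
have [C1 C10 HC1] := smooth_bounded (smoothM sz sV) (bsuppMl V bz).
exists ((2 * Cs * C1) ^+ 2); first exact: sqr_ge0.
move=> phi tp; have sp := test_smooth tp; have scf := smooth_cutfun sp.
have Lpu := L1_sqr_sub oO bO (test_L2 mO tp) Lu.
have Lz : L1 (fun x => (zeta x * cutfun phi x) ^+ 2).
  apply: L1_smooth_bsupp; first by apply: smoothX; exact: smoothM.
  have := bsuppMl (fun x => cutfun phi x * (zeta x * cutfun phi x)) bz.
  by congr bsupp; apply/funext => x; rewrite expr2 mulrA.
have L0 : L1 (fun x => \1_Omega x * (zeta x * cutfun phi x) ^+ 2) by exact: L1_indicM.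
rewrite -(IntZ _ Lpu).
have C0 : 0 <= 2 * Cs * C1 by rewrite !mulr_ge0 // ltW.
pose h x := \1_Omega x * (zeta x * cutfun phi x) ^+ 2.
(* The bound on [h] holds only almost everywhere; the minimum satisfies it everywhere and has the
   same integral. *)
pose h' x := Num.min (h x) ((2 * Cs * C1) ^+ 2 * (\1_Omega x * (phi x - u x) ^+ 2)).
have LZ := L1Z ((2 * Cs * C1) ^+ 2) Lpu.
have h0 x : 0 <= h x by apply: mulr_ge0 (sqr_ge0 _); rewrite indicE.
have mh' : mfun h' by apply: measurable_minr; [exact: L1_mfun L0|exact: L1_mfun LZ].
have hh' : {ae mu, forall x, h x = h' x}.
  apply: filterS uU => x ux; rewrite /h'; apply/esym/min_idPl; rewrite /h [leRHS]mulrCA.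
  rewrite indicE; case: (boolP (x \in Omega)) => [|_]; last by rewrite !mul0r.
  rewrite inE => Ox; rewrite !mul1r -exprMn.
  have [Bx|nBx] := pselect (B0 x); last by rewrite (test_out tz nBx) mul0r expr0n /= sqr_ge0.
  rewrite -(@real_normK _ (zeta x * _)) ?num_real // -[X in _ <= X]real_normK ?num_real //.
  rewrite ler_sqr ?nnegrE // normrM.
  have -> : phi x - u x = - (U x * (1 - phi x * V x)).
    by rewrite mulrBr mulr1 mulrCA UV // mulr1 opprB ux.
  apply: (@le_trans _ _ (`|zeta x| * (Cs * `|2 + -2 * (phi x * V x)|))).
    by apply: ler_wpM2l => //; exact: HCs.
  have -> : 2 + -2 * (phi x * V x) = 2 * (V x * (U x * (1 - phi x * V x))).
    rewrite [V x * _]mulrA [V x * U x]mulrC UV // mul1r; move: (phi x * V x) => p; ring.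
  rewrite mulrN normrN !normrM [`|2|]ger0_norm // [`|Cs|]gtr0_norm // [`|C1|]ger0_norm //.
  have := HC1 x; rewrite normrM => hz.
  rewrite !mulrA; apply: ler_wpM2r => //; apply: ler_wpM2r => //.
  have -> : `|zeta x| * Cs * 2 * `|V x| = 2 * Cs * (`|zeta x| * `|V x|).
    by move: `|zeta x| `|V x| => p q; ring.
  by apply: ler_wpM2l => //; rewrite mulr_ge0 // ltW.
have Lh' : L1 h'.
  apply: L1_le L0 _ => // x; rewrite ger0_norm; first by rewrite /h' ge_min lexx.
  rewrite /h' le_min h0 /=; apply: mulr_ge0 (sqr_ge0 _) _.
  by apply: mulr_ge0 (sqr_ge0 _); rewrite indicE.
rewrite (Int_ae_eq (L1_mfun L0) mh' hh'); apply: le_Int => // x.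
by rewrite /h' ge_min lexx orbT.
Qed.

End boundary_energy.

(** * The complement near a boundary point where the trace does not vanish *)

Section capacity.
Context {R : realType} {n : nat}.
Local Notation mu := (@lebesgue_row R n).
Implicit Types (u phi psi zeta chi f U V : 'rV[R]_n -> R) (g : 'rV[R]_n -> 'rV[R]_n) (x y : 'rV[R]_n)
  (Omega : set 'rV[R]_n).

(** First [s] is taken small, then [e] in terms of [s]. Bounds of this shape come from p <= s +
    p^2/s with p^2 integrated to a multiple of [e]. *)
Lemma eq0_of_small (t A B : R) : 0 <= A -> 0 <= B ->
  (forall s e, 0 < s -> 0 < e -> `|t| <= A * s + B * s^-1 * e) -> t = 0.
Proof.
move=> A0 B0 H; apply/eqP; rewrite -normr_le0; apply/ler_addgt0Pl => e e0; rewrite addr0.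
pose s := e / (2 * (A + 1)); have A1 : 0 < 2 * (A + 1) by rewrite mulr_gt0 // ltr_wpDl.
have s0 : 0 < s by rewrite divr_gt0.
have B1 : 0 < 2 * (B * s^-1 + 1) by rewrite mulr_gt0 // ltr_wpDl // mulr_ge0 // invr_ge0 ltW.
pose e' := e / (2 * (B * s^-1 + 1)); have e'0 : 0 < e' by rewrite divr_gt0.
apply: le_trans (H s e' s0 e'0) _.
have h1 : 2 * (A + 1) * s = e by rewrite /s mulrC divfK // gt_eqF.
have h2 : 2 * (B * s^-1 + 1) * e' = e by rewrite /e' mulrC divfK // gt_eqF.
move: h1 h2; move: (B * s^-1) => C; rewrite !mulrDr !mulrDl !mulr1; lra.
Qed.

Variables (Omega : set 'rV[R]_n) (u : 'rV[R]_n -> R) (g : 'rV[R]_n -> 'rV[R]_n)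
  (x0 : 'rV[R]_n) (R0 : R) (U V : 'rV[R]_n -> R).
Hypotheses (oO : open Omega) (bO : ebounded Omega) (Hu : H01 Omega u g) (R00 : 0 < R0)
  (sU : smooth U) (sV : smooth V) (UV : forall x, eball x0 R0 x -> U x * V x = 1)
  (uU : {ae mu, forall x, Omega x -> eball x0 R0 x -> u x = U x}) (cx0 : closure Omega x0).

Let B0 := eball x0 R0.
Let oB : open B0. Proof. exact: open_eball. Qed.
Let mO : measurable Omega. Proof. exact: measurable_open. Qed.
Let F := cutfun V.

Let approx (e : R) : 0 < e -> exists phi, [/\ test_function Omega phi,
  Int (fun x => \1_Omega x * (phi x - u x) ^+ 2) <= e &
    forall i, Int (fun x => \1_Omega x * (partial i phi x - g x 0 i) ^+ 2) <= e].
Proof. exact: H01_approx. Qed.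

Let L1_sqr_test psi f : test_function B0 psi -> smooth f -> L1 (fun x => (psi x * f x) ^+ 2).
Proof.
move=> tp sf; have sp := test_smooth tp.
apply: L1_smooth_bsupp; first by apply: smoothX; exact: smoothM.
have := bsuppMl (fun x => f x * (psi x * f x)) (test_bsupp tp).
by congr bsupp; apply/funext => x; rewrite expr2 mulrA.
Qed.

Let ball_test_bound psi f (M s : R) : test_function B0 psi -> smooth f -> 0 < s ->
  (forall x, B0 x -> enorm x <= M) ->
  `|Int (fun x => psi x * f x)| <= s * Int (\1_B0) + s^-1 * Int (fun x => (psi x * f x) ^+ 2).
Proof.
move=> tp sf s0 BM; have sp := test_smooth tp.
have L1a : L1 (fun x => psi x * f x).
  by apply: L1_smooth_bsupp; [exact: smoothM|apply: bsuppMl; exact: test_bsupp tp].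
have L2a := L1_sqr_test tp sf.
have LB : L1 (\1_B0) by apply: L1_indic BM; exact: measurable_open.
apply: le_trans (abs_Int L1a) _; rewrite -(IntZ _ LB) -(IntZ _ L2a) -(IntD (L1Z _ LB) (L1Z _ L2a)).
apply: le_Int; [exact: L1_abs|by apply: L1D; exact: L1Z|] => x.
have [Bx|nBx] := pselect (B0 x); last first.
  rewrite (test_out tp nBx) mul0r normr0 expr0n /= mulr0 addr0.
  by apply: mulr_ge0 (ltW s0) _; rewrite indicE.
rewrite indicE mem_set // mulr1 -[(psi x * f x) ^+ 2]real_normK ?num_real //.
exact: le_add_sqr.
Qed.

(** The functions [cutfun V phi] equal 1 off [Omega]; near [x0] they tend to 0 in L^2 on [Omega] and
    their gradients tend to 0. Their limit, the indicator of the complement, thus has zero weak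
    gradient. *)
Lemma complement_weak_gradient psi i : test_function B0 psi ->
  Int (fun x => \1_(~` Omega) x * partial i psi x) = 0.
Proof.
move=> tp; have sp := test_smooth tp; have bp := test_bsupp tp.
have tip := test_partial i tp; have sip := test_smooth tip; have bip := test_bsupp tip.
have [K1 K10 H1] := cutfun_gradient oO bO Hu oB sU sV UV uU tp.
have [K2 K20 H2] := cutfun_L2 oO bO Hu sV UV uU tip.
have [M HM] := bounded_cball x0 R0.
have BM x : B0 x -> enorm x <= n%:R * (M + 1).
  move=> Bx; apply: le_trans (enorm_le_norm x) _; apply: ler_wpM2l => //.
  by apply: (HM.2 (M + 1)); rewrite ?ltrDl //=; exact: ltW.
have I0 : 0 <= Int (\1_B0 : 'rV[R]_n -> R) by apply: Int_ge0 => x; rewrite indicE.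
apply: (@eq0_of_small _ (2 * Int (\1_B0)) (2 * K1 + K2)); [by rewrite mulr_ge0|by rewrite addr_ge0 // mulr_ge0|].
move=> s e s0 e0; have [phi [tphi h1 h2]] := approx e0.
have sphi := test_smooth tphi; have sF : smooth (F phi) by exact: smooth_cutfun.
have siF := smooth_partial i sF.
have LFp : L1 (fun x => partial i psi x * F phi x).
  by apply: L1_smooth_bsupp; [exact: smoothM|exact: bsuppMl].
have E : Int (fun x => \1_(~` Omega) x * partial i psi x) =
    - Int (fun x => psi x * partial i (F phi) x) - Int (fun x => \1_Omega x * (partial i psi x * F phi x)).
  rewrite -(Int_by_parts i sp sF (or_introl bp)) -IntB //; last exact: L1_indicM.
  congr Int; apply/funext => x; have [Ox|nOx] := pselect (Omega x).
    have nC : ~ (~` Omega) x by move=> /(_ Ox).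
    by rewrite !indicE (mem_set Ox) (memNset nC) mul0r mul1r subrr.
  rewrite !indicE (memNset nOx) mem_set // mul0r subr0 mul1r /F /cutfun (test_out tphi nOx).
  by rewrite mul0r mulr0 addr0 step_ge1 ?mulr1 // ler1n.
rewrite E; apply: le_trans (ler_normB _ _) _; rewrite normrN.
have b1 := ball_test_bound tp siF s0 BM.
have b2 : `|Int (fun x => \1_Omega x * (partial i psi x * F phi x))| <=
    s * Int (\1_B0) + s^-1 * Int (fun x => \1_Omega x * (partial i psi x * F phi x) ^+ 2).
  have LB : L1 (\1_B0) by apply: L1_indic BM; exact: measurable_open.
  have L2a := L1_indicM mO (L1_sqr_test tip sF).
  apply: le_trans (abs_Int (L1_indicM mO LFp)) _.
  rewrite -(IntZ _ LB) -(IntZ _ L2a) -(IntD (L1Z _ LB) (L1Z _ L2a)).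
  apply: le_Int; [apply: L1_abs; exact: L1_indicM|by apply: L1D; exact: L1Z|] => x.
  have [Bx|nBx] := pselect (B0 x); last first.
    rewrite (test_out tip nBx) mul0r mulr0 normr0 expr0n /= !mulr0 addr0.
    by apply: mulr_ge0 (ltW s0) _; rewrite indicE.
  rewrite !indicE (mem_set Bx) mulr1; case: (x \in Omega); last first.
    by rewrite !mul0r normr0 mulr0 addr0 ltW.
  rewrite !mul1r -[(partial i psi x * F phi x) ^+ 2]real_normK ?num_real //.
  exact: le_add_sqr.
have := H1 phi i tphi; have := H2 phi tphi; have h3 := h2 i.
have s1 : 0 <= s^-1 by rewrite invr_ge0 ltW.
set P := Int (fun x => (psi x * partial i (F phi) x) ^+ 2) in b1 *.
set Q := Int (fun x => \1_Omega x * (partial i psi x * F phi x) ^+ 2) in b2 *.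
move=> hQ hP.
have hQ' : Q <= K2 * e by apply: le_trans hQ _; rewrite ler_wpM2l.
have hP' : P <= K1 * (2 * e).
  by apply: le_trans hP _; rewrite ler_wpM2l // mulr_natl mulr2n lerD.
apply: le_trans (lerD b1 b2) _.
have -> : s * Int (\1_B0) + s^-1 * P + (s * Int (\1_B0) + s^-1 * Q) =
   2 * Int (\1_B0) * s + s^-1 * (P + Q) by move: (Int (\1_B0)) (s^-1) => a b; ring.
rewrite lerD2l.
have -> : (2 * K1 + K2) * s^-1 * e = s^-1 * (K1 * (2 * e) + K2 * e).
  by move: (s^-1) => b; ring.
by rewrite ler_wpM2l // lerD.
Qed.

(* The weak gradient of the indicator of the complement vanishes near x0, hence so does
   the indicator, because Omega is open and accumulates at x0. *)
Lemma complement_null : exists2 r, 0 < r <= R0 & {ae mu, forall x, eball x0 r x -> Omega x}.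
Proof.
have R4 : 0 < R0 / 4 by rewrite divr_gt0.
have [x1 [Ox1 x1r]] := cx0 (@eball_nbhs _ _ x0 (R0 / 4) R4).
have [r1 r10 r1O] := nbhs_eball (open_nbhs_nbhs (conj oO Ox1)).
(* With r <= r1 the kernel ball about [x1] lies in [Omega], so the mollified indicator is 0 at [x1].
   With r <= R0/4 kernels centred in the half ball, which contains [x0] and [x1], are test functions
   of [B0]. *)
pose r := Num.min (R0 / 4) r1.
have r0 : 0 < r by rewrite lt_min R4.
have rR : r <= R0 / 4 by rewrite ge_min lexx.
have rr1 : r <= r1 by rewrite ge_min lexx orbT.
pose l := r^-1; have l0 : 0 < l by rewrite invr_gt0.
have sk : smooth (kern moll l : 'rV[R]_n -> R) by apply: smooth_kern; exact: smooth1_moll.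
have bk : bsupp (kern moll l : 'rV[R]_n -> R) by exact: (bsupp_kern moll_ge1 l0).
pose m x : R := \1_(B0 `\` Omega) x.
have mBO : measurable (B0 `\` Omega) by apply: measurableD => //; exact: measurable_open.
have [M HM] := bounded_cball x0 R0.
have Lm : L1 m.
  apply: (@L1_indic _ _ _ (n%:R * (M + 1))) => // x [Bx _].
  apply: le_trans (enorm_le_norm x) _; apply: ler_wpM2l => //.
  by apply: (HM.2 (M + 1)); rewrite ?ltrDl //=; exact: ltW.
have sc : smooth (conv m (kern moll l)) by exact: smooth_conv.
have tk x : eball x0 (R0 / 2) x -> test_function B0 (fun y => kern moll l (x - y)).
  move=> xr; apply: (@test_cball _ _ _ _ x r).
  - exact: smooth_reflect.
  - move=> y /= yx; rewrite /B0 /eball /=; have -> : y - x0 = (y - x) + (x - x0) by rewrite addrA subrK.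
    apply: le_lt_trans (enormD _ _) _; move: xr; rewrite /eball /= => xr.
    by move: yx xr rR R00; move: (enorm _) (enorm _) => p q; lra.
  - by move=> y yr; apply: (kern_supp moll_ge1 l0); rewrite /l invrK enormBC.
have c0 x : eball x0 (R0 / 2) x -> conv m (kern moll l) x = conv m (kern moll l) x0.
  move=> xr; apply: (const_on_ball sc _ xr) => i z zr.
  rewrite partial_conv // /conv.
  have E := complement_weak_gradient i (tk z zr).
  have -> : Int (fun y => m y * partial i (kern moll l) (z - y)) =
      - Int (fun x => \1_(~` Omega) x * partial i (fun y => kern moll l (z - y)) x).
    rewrite -IntN.
      congr Int; apply/funext => y; rewrite partial_reflect // mulrN opprK.
      have [By|nBy] := pselect (B0 y).
        by congr (_ * _); rewrite /m !indicE in_setD mem_set //= in_setC.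
      have := test_out (test_partial i (tk z zr)) nBy; rewrite partial_reflect // => /eqP.
      by rewrite oppr_eq0 => /eqP ->; rewrite !mulr0.
    apply: L1_indicM; first exact: measurableC.
    have tt := test_partial i (tk z zr).
    by apply: L1_smooth_bsupp; [exact: test_smooth tt|exact: test_bsupp tt].
  by rewrite E oppr0.
have mE x : conv m (kern moll l) x = Int (fun y => m y * moll (l ^+ 2 * sqd x y)).
  congr Int; apply/funext => y; congr (_ * _).
  by rewrite /kern sqd0 -enormN opprB -sqd_enorm.
have x1c : conv m (kern moll l) x1 = 0.
  rewrite mE (_ : (fun y => _) = fun=> 0); first exact: Int0.
  apply/funext => y; have [h|h] := ltP (enorm (y - x1)) r.
    rewrite /m indicE memNset ?mul0r // => -[_]; apply; apply: r1O.
    exact: lt_le_trans rr1.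
  rewrite moll_ge1 ?mulr0 // sqd_enorm -exprMn -[X in X <= _](expr1n _ 2) ler_sqr ?nnegrE ?mulr_ge0 ?enorm_ge0 ?(ltW l0) //.
  by rewrite /l mulrC ler_pdivlMr // mul1r.
have x1r2 : eball x0 (R0 / 2) x1 by apply: lt_trans x1r _; move: R00; lra.
have I0 : Int (fun y => m y * moll (l ^+ 2 * sqd x0 y)) = 0 by rewrite -mE -(c0 x1 x1r2).
exists r; first by rewrite r0 /=; apply: le_trans rR _; move: R00; lra.
have Lmm : L1 (fun y => m y * moll (l ^+ 2 * sqd x0 y)) by exact: L1_moll.
have := Int_eq0_ae Lmm _ I0.
have p0 y : 0 <= m y * moll (l ^+ 2 * sqd x0 y) by rewrite mulr_ge0 ?moll_ge0 // /m indicE.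
move=> /(_ p0); apply: filterS => y my yr; apply: contrapT => nOy; move: my.
have By : B0 y by apply: lt_le_trans yr _; apply: le_trans rR _; move: R00; lra.
rewrite /m indicE mem_set // mul1r => h.
have : 0 < moll (l ^+ 2 * sqd x0 y).
  apply: moll_gt0; rewrite sqd_enorm -exprMn -[X in _ < X](expr1n _ 2) ltr_sqr ?nnegrE ?mulr_ge0 ?enorm_ge0 ?(ltW l0) //.
  by rewrite /l mulrC ltr_pdivrMr // mul1r.
by rewrite h ltxx.
Qed.

End capacity.

(** * Competitors of small energy *)

Section small_energy.
Context {R : realType} {n : nat}.
Local Notation mu := (@lebesgue_row R n).

(** The competitor is a fixed cut-off [zeta] times [cutfun V phi], with [phi] close to [u]. The term
    with grad zeta is small because it only has to be integrated over [Omega], the complement being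
    null near [x0]. The thickness [delta] leaves room for the mollification in [supersolution]. *)
Lemma small_energy (Omega : set 'rV[R]_n) (u : 'rV[R]_n -> R) (g : 'rV[R]_n -> 'rV[R]_n)
    (M : R) (x0 : 'rV[R]_n) (R0 : R) (U V : 'rV[R]_n -> R) :
  open Omega -> (forall x, Omega x -> enorm x <= M) -> H01 Omega u g -> 0 < R0 ->
  smooth U -> smooth V -> (forall x, eball x0 R0 x -> U x * V x = 1) ->
  {ae mu, forall x, Omega x -> eball x0 R0 x -> u x = U x} -> closure Omega x0 ->
  exists2 r, 0 < r & forall eps, 0 < eps -> exists delta psi,
    [/\ 0 < delta, energy psi <= eps & admissible (M + 1)
      [set x | exists2 y, ~ Omega y /\ enorm (y - x0) <= r & enorm (x - y) < delta] psi].
Proof.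
move=> oO OM Hu R00 sU sV UV uU cx0; have bO : ebounded Omega by exists M.
have mO := measurable_open oO.
have [r1' /andP[r10' r1R'] Or1'] := complement_null oO bO Hu R00 sU sV UV uU cx0.
pose r1 := Num.min 1 r1'.
have r10 : 0 < r1 by rewrite lt_min ltr01.
have r1r : r1 <= r1' by rewrite ge_min lexx orbT.
have r11 : r1 <= 1 by rewrite ge_min lexx.
have sub x : eball x0 r1 x -> eball x0 r1' x by move=> h; exact: lt_le_trans r1r.
have Or1 : {ae mu, forall x, eball x0 r1 x -> Omega x} by apply: filterS Or1' => x h /sub /h.
pose B := eball x0 r1; have oB : open B by exact: open_eball.
have UV1 x : B x -> U x * V x = 1 by move=> /sub h; apply: UV; exact: lt_le_trans r1R'.
have uU1 : {ae mu, forall x, Omega x -> B x -> u x = U x}.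
  by apply: filterS uU => x h Ox /sub Bx; apply: h => //; exact: lt_le_trans r1R'.
have x0M : enorm x0 <= M by exact: (ebounded_closure OM).
have BM x : B x -> enorm x <= M + 1.
  move=> Bx; have := enormD (x - x0) x0; rewrite subrK => h; apply: le_trans h _.
  by rewrite addrC lerD // (le_trans (ltW Bx)).
(* The argument is 1 at distance r1/2 from [x0] and -1/4 at distance 3 r1/4. *)
pose zeta x := step (2 + - (4 / r1 ^+ 2) * sqd x0 x).
have r12 : 0 < r1 ^+ 2 by rewrite exprn_gt0.
have sz : smooth zeta.
  apply: smooth_comp; first exact: smooth1_step.
  by apply: smoothD; [exact: smooth_cst|apply: smoothZ; exact: smooth_sqd].
have z1 x : enorm (x - x0) <= r1 / 2 -> zeta x = 1.
  move=> xr; apply: step_ge1; rewrite sqd_enorm.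
  have : enorm (x - x0) ^+ 2 <= (r1 / 2) ^+ 2.
    by rewrite ler_sqr ?nnegrE ?enorm_ge0 // divr_ge0 // ltW.
  move=> h; have : 4 / r1 ^+ 2 * enorm (x - x0) ^+ 2 <= 4 / r1 ^+ 2 * (r1 / 2) ^+ 2.
    by apply: ler_wpM2l => //; rewrite divr_ge0 // ltW.
  have -> : 4 / r1 ^+ 2 * (r1 / 2) ^+ 2 = 1 by field; rewrite gt_eqF.
  by rewrite mulNr; move: (4 / r1 ^+ 2 * _) => p; lra.
have z0 x : 3 / 4 * r1 <= enorm (x - x0) -> zeta x = 0.
  move=> xr; apply: step_le0; rewrite sqd_enorm.
  have h34 : 0 <= 3 / 4 * r1 by apply: mulr_ge0 (ltW r10); rewrite divr_ge0.
  have : (3 / 4 * r1) ^+ 2 <= enorm (x - x0) ^+ 2 by rewrite ler_sqr ?nnegrE ?enorm_ge0.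
  move=> h; have : 4 / r1 ^+ 2 * (3 / 4 * r1) ^+ 2 <= 4 / r1 ^+ 2 * enorm (x - x0) ^+ 2.
    by apply: ler_wpM2l => //; rewrite divr_ge0 // ltW.
  have -> : 4 / r1 ^+ 2 * (3 / 4 * r1) ^+ 2 = 9 / 4 by field; rewrite gt_eqF.
  by rewrite mulNr; move: (4 / r1 ^+ 2 * _) => p; lra.
have tz : test_function B zeta.
  apply: (@test_cball _ _ _ _ x0 (3 / 4 * r1)) => // y /= yr; apply: le_lt_trans yr _.
  by move: r10; lra.
have zb x : ~ B x -> zeta x = 0 by exact: test_out.
have z0' x : 0 <= zeta x by exact: step_ge0.
have tiz i := test_partial i tz.
have [K1 K10 H1] := cutfun_gradient oO bO Hu oB sU sV UV1 uU1 tz.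
have /choice[K2 HK2] : forall i, exists K, 0 <= K /\ forall phi, test_function Omega phi ->
    Int (fun x => \1_Omega x * (partial i zeta x * cutfun V phi x) ^+ 2) <=
    K * Int (fun x => \1_Omega x * (phi x - u x) ^+ 2).
  by move=> i; have [K K0 h] := cutfun_L2 oO bO Hu sV UV1 uU1 (tiz i); exists K.
exists (r1 / 4); first by rewrite divr_gt0.
move=> eps eps0.
pose D := \sum_i (2 * (K1 * 2) + 2 * K2 i).
have D0 : 0 <= D.
  by apply: sumr_ge0 => i _; rewrite addr_ge0 ?mulr_ge0 //; have [] := HK2 i.
pose e := eps / (D + 1).
have e0 : 0 < e by rewrite divr_gt0 // ltr_wpDl.
have [phi [tp h1 h2]] := H01_approx oO bO Hu e0.
have sp := test_smooth tp; have bp := test_bsupp tp.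
have sF : smooth (cutfun V phi) by exact: smooth_cutfun.
have spsi : smooth (fun x => zeta x * cutfun V phi x) by exact: smoothM.
have bpsi : bsupp (fun x => zeta x * cutfun V phi x) by apply: bsuppMl; exact: test_bsupp tz.
have [L L0 HL] := lipschitz_bsupp (smoothM sp sV) (bsuppMl V bp).
(* phi V vanishes on the complement and is Lipschitz, so within [delta] it is at most 1/2 and the
   argument of [step] is at least 1. *)
pose delta := Num.min (r1 / 4) (2 * (L + 1))^-1.
have L1' : 0 < 2 * (L + 1) by rewrite mulr_gt0 // ltr_wpDl.
have d0 : 0 < delta by rewrite lt_min divr_gt0 //= invr_gt0.
exists delta, (fun x => zeta x * cutfun V phi x); split => //; last first.
  split => //.
  - by move=> x; rewrite mulr_ge0 // step_ge0.
  - move=> x Mx; rewrite zb ?mul0r // => /BM; apply/negP; rewrite -ltNge //.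
  - move=> x [y [nOy yr] xy].
    have -> : zeta x = 1.
      apply: z1; have -> : x - x0 = (x - y) + (y - x0) by rewrite addrA subrK.
      apply: le_trans (enormD _ _) _; have : enorm (x - y) <= r1 / 4.
        by apply: le_trans (ltW xy) _; rewrite ge_min lexx.
      by move: yr; move: (enorm _) (enorm _) => p q; lra.
    rewrite mul1r /cutfun step_ge1 //.
    have := HL x y; rewrite (test_out tp nOy) mul0r subr0 => hL.
    have : `|phi x * V x| <= 2^-1.
      apply: le_trans hL _; apply: (@le_trans _ _ (L * (2 * (L + 1))^-1)).
        by apply: ler_wpM2l => //; apply: le_trans (ltW xy) _; rewrite ge_min lexx orbT.
      by rewrite ler_pdivrMr // mulrA mulVf ?pnatr_eq0 // mul1r lerDl.
    by rewrite ler_norml => /andP[_]; move: (phi x * V x) => p; lra.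
have L2a i : L1 (fun x => (zeta x * partial i (cutfun V phi) x) ^+ 2).
  apply: L1_smooth_bsupp; first by apply: smoothX; apply: smoothM => //; exact: smooth_partial.
  have := bsuppMl (fun x => partial i (cutfun V phi) x * (zeta x * partial i (cutfun V phi) x)) (test_bsupp tz).
  by congr bsupp; apply/funext => x; rewrite expr2 mulrA.
have L2b i : L1 (fun x => (partial i zeta x * cutfun V phi x) ^+ 2).
  apply: L1_smooth_bsupp; first by apply: smoothX; apply: smoothM => //; exact: smooth_partial.
  have := bsuppMl (fun x => cutfun V phi x * (partial i zeta x * cutfun V phi x)) (test_bsupp (tiz i)).
  by congr bsupp; apply/funext => x; rewrite expr2 mulrA.
have Eb i : Int (fun x => (partial i zeta x * cutfun V phi x) ^+ 2) =
    Int (fun x => \1_Omega x * (partial i zeta x * cutfun V phi x) ^+ 2).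
  apply: Int_ae_eq; [exact: L1_mfun (L2b i)|exact: L1_mfun (L1_indicM mO (L2b i))|].
  apply: filterS Or1 => x hx; have [Bx|nBx] := pselect (B x).
    by rewrite indicE mem_set ?mul1r //; exact: hx.
  by rewrite (test_out (tiz i) nBx) mul0r expr0n /= mulr0.
have LS : L1 (fun x => \sum_i (2 * (partial i zeta x * cutfun V phi x) ^+ 2 + 2 * (zeta x * partial i (cutfun V phi) x) ^+ 2)).
  by apply: L1_sum => i; apply: L1D; exact: L1Z.
apply: (@le_trans _ _ (Int (fun x => \sum_i (2 * (partial i zeta x * cutfun V phi x) ^+ 2 + 2 * (zeta x * partial i (cutfun V phi) x) ^+ 2)))).
  apply: le_Int => // [|x]; first exact: L1_gdot.
  apply: ler_sum => i _; rewrite (partial_smul i x sz sF) -expr2; exact: sqr_add_le.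
rewrite Int_sum => [|i]; last by apply: L1D; exact: L1Z.
apply: (@le_trans _ _ (D * e)); last first.
  have -> : eps = (D + 1) * e by rewrite /e mulrC divfK // gt_eqF // ltr_wpDl.
  by rewrite ler_wpM2r ?(ltW e0) // lerDl.
rewrite /D mulr_suml; apply: ler_sum => i _; rewrite (IntD (L1Z _ (L2b i)) (L1Z _ (L2a i))).
rewrite (IntZ _ (L2b i)) (IntZ _ (L2a i)) Eb [leRHS]mulrDl [leRHS]addrC.
have [K20 HK] := HK2 i; have b1 := H1 phi i tp; have b2 := HK phi tp; have b3 := h2 i.
have b1' : Int (fun x => (zeta x * partial i (cutfun V phi) x) ^+ 2) <= K1 * 2 * e.
  by apply: le_trans b1 _; rewrite -mulrA ler_wpM2l // mulr_natl mulr2n lerD.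
have b2' : Int (fun x => \1_Omega x * (partial i zeta x * cutfun V phi x) ^+ 2) <= K2 i * e.
  by apply: le_trans b2 _; rewrite ler_wpM2l.
by apply: lerD; rewrite -[leRHS]mulrA ler_wpM2l.
Qed.

End small_energy.

(** * Perron solutions at a regular point *)

Section regular_boundary.
Context {R : realType} {n : nat}.
Local Notation mu := (@lebesgue_row R n).
Implicit Types (x y c : 'rV[R]_n).

Definition bump c (r : R) x : R := step (1 + - (r ^+ 2)^-1 * sqd c x).

Lemma smooth_bump c r : smooth (bump c r).
Proof.
apply: smooth_comp; first exact: smooth1_step.
by apply: smoothD; [exact: smooth_cst|apply: smoothZ; exact: smooth_sqd].
Qed.

Lemma bump_center c r : bump c r c = 1.
Proof. by rewrite /bump sqd_enorm subrr enorm0 expr0n /= mulr0 addr0 step_ge1. Qed.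

Lemma bump_out c r x : 0 < r -> r <= enorm (x - c) -> bump c r x = 0.
Proof.
move=> r0 h; rewrite /bump step_le0 // mulNr subr_le0 sqd_enorm mulrC ler_pdivlMr ?exprn_gt0 //.
by rewrite mul1r ler_sqr ?nnegrE ?enorm_ge0 ?(ltW r0).
Qed.

Lemma bsupp_bump c r : 0 < r -> bsupp (bump c r).
Proof.
move=> r0; exists (r + enorm c) => x h; apply: bump_out => //.
have := enormD (x - c) c; rewrite subrK => h2.
by rewrite -(lerD2r (enorm c)); exact: le_trans (ltW h) h2.
Qed.

Lemma within_continuous_at (A O : set 'rV[R]_n) (f : 'rV[R]_n -> R) x : open O -> O `<=` A ->
  {within A, continuous f} -> O x -> {for x, continuous f}.
Proof.
move=> oO OA cf Ox; have := continuous_subspaceW OA cf.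
by rewrite continuous_open_subspace // => /(_ x (mem_set Ox)).
Qed.

(** The supersolution of a competitor of small energy is at least 1 on the complement near [x0];
    after a small correction it dominates the datum, hence [v]. Its integrals against bounded
    weights are arbitrarily small, so v > 0 at a point is refuted by integrating over a small
    ball. *)
Lemma perron_nonpos (Omega : set 'rV[R]_n) (M r : R) x0 (v : 'rV[R]_n -> R) :
  (0 < n)%N -> open Omega -> (forall x, Omega x -> enorm x <= M) -> 0 < r ->
  (forall eps : R, 0 < eps -> exists delta psi, [/\ 0 < delta, energy psi <= eps & admissible (M + 1)
      [set x | exists2 y, ~ Omega y /\ enorm (y - x0) <= r & enorm (x - y) < delta] psi]) ->
  subfunction Omega (bump x0 r) v -> forall x, Omega x -> v x <= 0.
Proof.
move=> n0 oO OM r0 Hpsi [cv sv vb] x1 Ox1; rewrite leNgt; apply/negP => v0.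
have bO : ebounded Omega by exists M.
have M0 : 0 <= M by apply: le_trans (OM x1 Ox1); exact: enorm_ge0.
pose al := v x1 / 3; have al0 : 0 < al by rewrite divr_gt0.
have cv1 : {for x1, continuous v} by apply: (within_continuous_at oO _ cv) => //; exact: subset_closure.
have N : nbhs x1 (Omega `&` [set y | 2 * al < v y]).
  apply: filterI; first exact: open_nbhs_nbhs.
  apply: (cv1 [set t | 2 * al < t]); apply: open_nbhs_nbhs; split; first exact: open_gt.
  by rewrite /= /al; move: v0; lra.
have [rho rho0 HN] := nbhs_eball N.
pose k := bump x1 rho.
have ck : continuous k by apply: smooth_continuous; exact: smooth_bump.
have bk : bsupp k by exact: bsupp_bump.
have k0 x : 0 <= k x by exact: step_ge0.
have Lk : L1 k by exact: L1_bsupp.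
have Ik : 0 < Int k.
  rewrite lt_neqAle Int_ge0 // andbT; apply/eqP => /esym I0.
  have := Int_cont_eq0 ck Lk k0 I0 x1; rewrite /k bump_center => /eqP.
  by rewrite oner_eq0.
have : al * Int k = 0.
  pose B := Int (\1_[set x : 'rV[R]_n | enorm (x - 0) <= M + 1]).
  have B0 : 0 <= B by apply: Int_ge0 => x; rewrite indicE.
  apply: (@eq0_of_small _ _ B (4 * (M + 1) ^+ 2)) => //; first by rewrite mulr_ge0 // sqr_ge0.
  move=> s e s0 e0; have [delta [psi [d0 Epsi ad]]] := Hpsi e e0.
  (* The term - e1 |x|^2 turns a Laplacian of at most e1 into a negative one, and the constant e1
     M^2, at most [al], restores W >= w on the ball of radius M. *)
  pose e1 := al / (M ^+ 2 + 1).
  have M1 : 0 < M ^+ 2 + 1 by rewrite ltr_wpDl // sqr_ge0.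
  have e10 : 0 < e1 by rewrite divr_gt0.
  have [w [sw w0 wE lw wf]] := supersolution n0 d0 e10 M0 ad.
  pose W x := w x + - e1 * sqd 0 x + e1 * M ^+ 2.
  have sq : smooth (fun x : 'rV[R]_n => - e1 * sqd 0 x) by apply: smoothZ; exact: smooth_sqd.
  have sW1 : smooth (fun x => w x + - e1 * sqd 0 x) by exact: smoothD.
  have sW : smooth W by apply: smoothD => //; exact: smooth_cst.
  have Wge x : enorm x <= M -> w x <= W x.
    move=> xM; rewrite /W -addrA lerDl mulNr addrC subr_ge0 ler_wpM2l ?(ltW e10) //.
    by rewrite sqd0 ler_sqr ?nnegrE ?enorm_ge0.
  have vW : forall x, Omega x -> v x <= W x.
    apply: (perron_comparison n0 oO bO cv sv sW) => [x Ox|x bx].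
      rewrite /W (laplacianD x sW1 (smooth_cst _)) (laplacianD x sw sq) (laplacianZ _ x (smooth_sqd 0)).
      have lc : laplacian ((fun=> e1 * M ^+ 2) : 'rV[R]_n -> R) x = 0 by apply: big1 => i _; rewrite !partial_cst.
      rewrite laplacian_sqd lc.
      have h1 := lw x (OM x Ox); have h2 : 1 <= n%:R :> R by rewrite ler1n.
      rewrite addr0; apply: le_lt_trans (lerD h1 (lexx _)) _.
      rewrite mulNr subr_lt0 -[X in X < _]mulr1 ltr_pM2l //; apply: (@lt_le_trans _ _ (2 * 1)); first by rewrite mulr1 ltr1n.
      by rewrite ler_wpM2l.
    have xM : enorm x <= M by apply: (ebounded_closure OM); case: bx.
    have nOx : ~ Omega x by move: bx; rewrite boundary_open // => -[].
    apply: le_trans (vb x bx) _; apply: le_trans (Wge x xM).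
    have [h|h] := leP (enorm (x - x0)) r.
      by apply: le_trans (wE x (conj nOx h)); exact: step_le1.
    by rewrite bump_out // ltW.
  have kw x : al * k x <= k x * w x.
    have [h|h] := ltP (enorm (x - x1)) rho; last by rewrite /k bump_out // mulr0 mul0r.
    have [Ox /= vx] := HN x h; rewrite mulrC ler_wpM2l //.
    have := vW x Ox; rewrite /W => h1.
    have h2 : e1 * M ^+ 2 <= al.
      have -> : al = e1 * (M ^+ 2 + 1) by rewrite /e1 divfK // gt_eqF.
      by rewrite ler_wpM2l ?(ltW e10) // lerDl.
    have h3 : 0 <= e1 * sqd 0 x by rewrite mulr_ge0 ?(ltW e10) // sqd_ge0.
    by move: vx h1 h2 h3; rewrite mulNr; move: (e1 * _) (e1 * _) => p q; lra.
  have Lkw : L1 (fun x => k x * w x).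
    apply: L1_bsupp; last exact: bsuppMl.
    by move=> x; apply: continuousM; [exact: ck|exact: smooth_continuous].
  rewrite ger0_norm; last by rewrite mulr_ge0 ?(ltW al0) // ltW.
  rewrite -(IntZ _ Lk); apply: le_trans (le_Int (L1Z al Lk) Lkw kw) _.
  apply: le_trans (wf k ck bk k0 (fun x => step_le1 _) s s0) _.
  rewrite -/B [s * B]mulrC lerD2l.
  have -> : 4 * (M + 1) ^+ 2 * s^-1 * e = s^-1 * (4 * (M + 1) ^+ 2 * e) by move: (s^-1) ((M + 1) ^+ 2) => p q; ring.
  rewrite ler_wpM2l ?invr_ge0 ?(ltW s0) // ler_wpM2l // mulr_ge0 // sqr_ge0 //.
by apply/eqP; rewrite mulf_neq0 // gt_eqF.
Qed.

(** The datum is a bump equal to 1 at [x0]. If [U x0] were nonzero, all its subfunctions would be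
    nonpositive, and its Perron solution could not tend to 1. *)
Lemma regular_value_zero (Omega : set 'rV[R]_n) (u : 'rV[R]_n -> R) g x0 (R0 : R) (U : 'rV[R]_n -> R) :
  (0 < n)%N -> open Omega -> ebounded Omega -> H01 Omega u g -> regular_point Omega x0 ->
  0 < R0 -> smooth U -> {ae mu, forall x, Omega x -> eball x0 R0 x -> u x = U x} -> U x0 = 0.
Proof.
move=> n0 oO [M OM] Hu [bx0 reg] R00 sU uU; apply/eqP; apply: contrapT => /negP U0.
have cx0 : closure Omega x0 by case: bx0.
pose a := `|U x0| ^+ 2 / 2.
have a0 : 0 < a by rewrite divr_gt0 // exprn_gt0 // normr_gt0.
(* U times the inverse of U^2: an inverse of [U] near [x0], whatever its sign, and smooth on the
   whole space. *)
pose V x := U x * power a (-1) (U x * U x).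
have sU2 : smooth (fun x => U x * U x) by exact: smoothM.
have sV : smooth V by apply: smoothM => //; apply: smooth_comp => //; exact: smooth1_power.
have [R1 R10 HR1] : exists2 r, 0 < r & forall x, eball x0 r x -> 0 < U x * U x - a / 2.
  apply: near_pos; first by apply: smooth_continuous; apply: smoothB => //; exact: smooth_cst.
  rewrite -expr2 -(@real_normK _ (U x0)) ?num_real // subr_gt0 /a.
  have : 0 < `|U x0| ^+ 2 by rewrite exprn_gt0 // normr_gt0.
  by move: (`|U x0| ^+ 2) => p; lra.
pose r1 := Num.min R0 R1.
have r10 : 0 < r1 by rewrite lt_min R00.
have UV x : eball x0 r1 x -> U x * V x = 1.
  move=> xr; have := HR1 x _; have xR : eball x0 R1 x by apply: lt_le_trans xr _; rewrite ge_min lexx orbT.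
  move=> /(_ xR); rewrite subr_gt0 => h.
  rewrite /V mulrA /power posidE ?(ltW h) // mulN1r expRN lnK; last by rewrite posrE (lt_trans _ h) // divr_gt0.
  by rewrite mulfV // gt_eqF // (lt_trans _ h) // divr_gt0.
have uU1 : {ae mu, forall x, Omega x -> eball x0 r1 x -> u x = U x}.
  by apply: filterS uU => x h Ox xr; apply: h => //; apply: lt_le_trans xr _; rewrite ge_min lexx.
have [r r0 Hpsi] := small_energy oO OM Hu r10 sU sV UV uU1 cx0.
have cf : {within boundary Omega, continuous (bump x0 r)}.
  by apply: continuous_subspaceT; apply: smooth_continuous; exact: smooth_bump.
have := reg _ cf; rewrite bump_center => lim.
have P0 x : Omega x -> perron_solution Omega (bump x0 r) x <= 0.
  move=> Ox; rewrite /perron_solution.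
  (* The supremum of the empty set is 0 by convention, which also satisfies the bound. *)
  have [S0|S0] := pselect ([set v x | v in subfunction Omega (bump x0 r)] !=set0); last first.
    by rewrite sup_out // => -[].
  apply: ge_sup => // _ [v sv <-]; exact: (perron_nonpos n0 oO OM r0 Hpsi sv).
have N1 : nbhs (1 : R) [set t | 0 < t] by apply: open_nbhs_nbhs; split; [exact: open_gt|exact: ltr01].
have N2 : nbhs x0 [set x | Omega x -> 0 < perron_solution Omega (bump x0 r) x].
  exact: (lim _ N1).
have [x [Ox hx]] := cx0 _ N2.
by have := hx Ox; rewrite ltNge P0.
Qed.

(** From a point of [Omega], the ray leading away from [c] meets the boundary farther out, so the
    point is inside the sphere. The segment from [c] to a point off [Omega] meets the boundary no
    farther than that point, which is thus not inside. *)
Lemma ball_of_boundary (Omega : set 'rV[R]_n) c (T : R) : (0 < n)%N -> open Omega ->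
  ebounded Omega -> Omega c -> (forall x, boundary Omega x -> sqd c x = T) ->
  0 < Num.sqrt T /\ Omega = eball c (Num.sqrt T).
Proof.
move=> n0 oO bO Oc bT.
have e1 : 0 < enorm ('e_(Ordinal n0) : 'rV[R]_n) by rewrite enorm_delta ltr01.
have [s s0 bs] := ray_boundary oO bO Oc e1.
have T0 : 0 < T.
  rewrite -(bT _ bs) /sqd addrAC subrr add0r -enorm_sqr enormZ exprn_gt0 //.
  by rewrite gtr0_norm // mulr_gt0.
have sT : 0 < Num.sqrt T by rewrite sqrtr_gt0.
split => //; rewrite eballE // sqr_sqrtr ?(ltW T0) //; apply/seteqP; split => x /=.
  move=> Ox; have [->|xc] := eqVneq x c; first by rewrite sqd_enorm subrr enorm0 expr0n.
  have xc0 : 0 < enorm (x - c).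
    rewrite lt_neqAle enorm_ge0 andbT eq_sym; apply/eqP => /enorm_eq0 /eqP.
    by rewrite subr_eq0 (negbTE xc).
  have [t t0 bt] := ray_boundary oO bO Ox xc0.
  rewrite -(bT _ bt) !sqd_enorm.
  have -> : x + t *: (x - c) - c = (1 + t) *: (x - c) by rewrite scalerDl scale1r addrAC.
  rewrite ltr_sqr ?nnegrE ?enorm_ge0 // enormZ gtr0_norm ?addr_gt0 //.
  by rewrite ltr_pMl // ltrDl.
move=> xT; apply: contrapT => nOx.
pose S : set 'rV[R]_n := (fun s : R => c + s *: (x - c)) @` `[0, 1].
have cS : connected S.
  apply: connected_continuous_connected; first exact: segment_connected.
  have cg : continuous (fun s : R => c + s *: (x - c)).
    by move=> t; apply: cvgD; [exact: cvg_cst|exact: scalel_continuous].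
  exact: continuous_subspaceT.
have [||y [t]] := boundary_meets cS oO.
- by exists c; split => //; exists 0; rewrite ?scale0r ?addr0 //= in_itv /= lexx ler01.
- by exists x => //; exists 1; rewrite ?scale1r ?[c + _]addrC ?subrK //= in_itv /= lexx ler01.
rewrite /= in_itv /= => /andP[t0 t1] <- by_; have := bT _ by_.
rewrite sqd_enorm addrAC subrr add0r enormZ exprMn -sqd_enorm ger0_norm // => E.
have : t ^+ 2 * sqd c x <= sqd c x by rewrite ler_piMl ?sqd_ge0 // exprn_ile1.
by rewrite E leNgt xT.
Qed.

End regular_boundary.

(** * Overdetermination forces concentric balls *)

Section forward.
Context {R : realType}.

Lemma ebounded_bounded_set n (A : set 'rV[R]_n) : bounded_set A -> ebounded A.
Proof.
move=> [M [_ HM]]; exists (n%:R * (M + 1)) => x Ax; apply: le_trans (enorm_le_norm x) _.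
by apply: ler_wpM2l => //; apply: (HM (M + 1)) => //; rewrite ltrDl.
Qed.

Lemma overdetermined_concentric n (sg : R) a (D Omega : set 'rV[R]_n) :
  (2 <= n)%N -> 0 < sg -> sg != 1 -> (0 < a)%N -> is_eball D -> domain Omega -> bounded_set Omega ->
  compactly_contained D Omega -> (forall x, boundary Omega x -> regular_point Omega x) ->
  pair_overdetermination_type sg a 1 D Omega -> concentric_balls D Omega.
Proof.
move=> n2 sg0 sg1 a0 [c [r [r0 DE]]] [oO cO _] /ebounded_bounded_set bO DO reg [u us [om [omP srt]]].
have n0 : (0 < n)%N by exact: ltn_trans n2.
have oD : open D by rewrite DE; exact: open_eball.
have Dsub : D `<=` Omega by apply: subset_trans DO; exact: subset_closure.
have mD := measurable_open oD.
case: a a0 omP srt => // a _ omP.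
(* After the shift of [a], [om a] is the largest domain inside [D] and [om a.+1] the one between [D]
   and [Omega]; only the inclusions from [om a] onwards are kept. *)
rewrite mkseqS cat_rcons => /cat_sorted2[_] /=.
rewrite addn0 => /and4P[/asboolP i1 /asboolP i2 /asboolP i3 _].
have [] := omP a; first by rewrite addn1 ltnW.
move=> [oin cin ne_in] _ [_ _ _ [v [dv vu [k0 vk] [d vd]]]].
have [] := omP a.+1; first by rewrite addn1.
move=> [oout cout ne_out] cb [_ _ _ [v' [dv' vu' [k0' vk'] [d' vd']]]].
have [G ws] := two_phase_weak oO bO mD Dsub us.
have [g Hu _] := us.
rewrite DE in ws Dsub i1 i2 dv dv' oD.
have bD : boundary (eball c r) = [set x | sqd c x = r ^+ 2].
  rewrite boundary_eball //; apply/seteqP; split => x /=; rewrite sqd_enorm; first by move=> ->.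
  by move/eqP; rewrite eqrXn2 ?enorm_ge0 ?(ltW r0) // => /eqP.
have dvD x : eball c r x -> differentiable v x.
  move=> Dx; apply: dv; split; first exact: Dsub.
  by rewrite boundary_open // => -[].
have [b [k vE]] := inside_affine n0 sg0 oO bO r0 Dsub ws dvD vu oin ne_in i1 vk vd.
have uu : {ae lebesgue_row n, forall x, eball c r x -> u x = uin c b sg k x}.
  by apply: filterS vu => x h Dx; rewrite -h ?vE //; exact: Dsub.
have a0 : 0 < r ^+ 2 by rewrite exprn_gt0.
have [sP Pa dPa P2] := @profileP R n (r ^+ 2) sg n0 a0.
have dv'' x : Omega x -> sqd c x != r ^+ 2 -> differentiable v' x.
  by move=> Ox xr; apply: dv'; split => //; rewrite bD /=; exact/eqP.
have vo := outside_form sg0 oO cO bO r0 Dsub ws sP Pa dPa P2 uu dv'' vu'.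
have out x : ~ closure (eball c r) x -> r ^+ 2 < sqd c x.
  rewrite closure_eball //= sqd_enorm => /negP; rewrite -ltNge => h.
  by rewrite ltr_sqr ?nnegrE ?enorm_ge0 ?(ltW r0).
have bout x : boundary (om a.+1) x -> r ^+ 2 < sqd c x.
  rewrite boundary_open // => -[_ nx]; apply: out => h; apply: nx; exact: i2.
have bOm x : boundary (om a.+1) x -> Omega x by move=> [h _]; exact: i3.
pose O1 := Omega `&` [set x | r ^+ 2 < sqd c x].
have oO1 : open O1.
  apply: openI => //; have -> : [set x | r ^+ 2 < sqd c x] = [set x | - sqd c x < - r ^+ 2].
    by apply/seteqP; split => x /=; rewrite ltrN2.
  by apply: open_sublevel => x; apply: continuousN; exact: sqd_continuous.
have bom : ebounded (om a.+1).
  have [M OM] := bO; exists M => x ox; apply: OM; apply: i3; exact: subset_closure.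
have omc : om a.+1 c by apply: i2; apply: subset_closure; exact: eball_center.
have b0 : b = 0.
  apply: (@dipole_vanishes _ _ c b (r ^+ 2) sg k k0' d' (om a.+1)) => //.
  - by move=> x bx; rewrite -vo ?vk' //; [exact: bOm|exact: bout].
  - move=> x bx; rewrite -(vd' x bx); congr enorm; apply/rowP => i; rewrite !mxE.
    apply: (@partial_open _ _ i _ _ O1 x) => //.
      by split; [exact: bOm|exact: bout].
    by move=> y [Oy yr]; rewrite vo.
pose C0 := sg^-1 * (2^-1 * r ^+ 2 + k) - 2^-1 * r ^+ 2.
pose U x := 2^-1 * sqd c x + C0.
have sU : smooth U by apply: smoothD; [apply: smoothZ; exact: smooth_sqd|exact: smooth_cst].
have UE x : uout c b (r ^+ 2) sg k (@profile R n (r ^+ 2) sg) x = U x.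
  rewrite /uout /dipole b0 /lin big1 ?mulr0 ?addr0 // => i _.
  by rewrite mxE mul0r.
have bT x : boundary Omega x -> sqd c x = - 2 * C0.
  move=> bx; have nOx : ~ Omega x by move: bx; rewrite boundary_open // => -[].
  have xr : r ^+ 2 < sqd c x by apply: out => h; apply: nOx; apply: DO; rewrite DE.
  have [R0 R00 HR] : exists2 s, 0 < s & forall y, eball x s y -> 0 < sqd c y - r ^+ 2.
    apply: near_pos; last by rewrite subr_gt0.
    by apply: smooth_continuous; apply: smoothB; [exact: smooth_sqd|exact: smooth_cst].
  have : U x = 0.
    apply: (regular_value_zero n0 oO bO Hu (reg x bx) R00 sU).
    apply: filterS vu' => y h Oy yR; rewrite -h // vo ?UE //.
    by rewrite -subr_gt0; exact: HR.
  by rewrite /U; lra.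
have Oc : Omega c by apply: Dsub; exact: eball_center.
have [sT OE] := ball_of_boundary n0 oO bO Oc bT.
by exists c, r, (Num.sqrt (- 2 * C0)).
Qed.

End forward.

(** * Concentric balls *)

Section spheres.
Context {R : realType} {n : nat}.
Implicit Types (x y z c p q : 'rV[R]_n).

(** Radial projection onto the sphere about [c] of the segment from [p] to [q], both taken relative
    to [c]. *)
Definition arc c (r : R) p q : set 'rV[R]_n :=
  (fun t : R => c + (r / enorm (p + t *: (q - p))) *: (p + t *: (q - p))) @` `[0, 1].

Lemma arc_connected c r p q : (forall t : R, enorm (p + t *: (q - p)) != 0) -> connected (arc c r p q).
Proof.
move=> z0; apply: connected_continuous_connected; first exact: segment_connected.
apply: continuous_subspaceT => t.
have cz : {for t, continuous (fun t : R => p + t *: (q - p))}.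
  by apply: cvgD; [exact: cvg_cst|exact: scalel_continuous].
apply: cvgD; first exact: cvg_cst.
apply: cvgZ => //; apply: cvgM; first exact: cvg_cst.
apply: cvgV; first exact: z0.
have ce : continuous (@enorm R n).
  have -> : @enorm R n = fun z => Num.sqrt (sqd 0 z) by apply/funext => z; rewrite /enorm /sqd subr0.
  by move=> z; exact: (continuous_comp (@sqd_continuous R n 0 z) (@sqrt_continuous R _)).
exact: (continuous_comp cz (ce _)).
Qed.

(** Every point other than the antipode of [p] is joined to [p] by an arc, since the segment misses
    the centre; the antipode is reached through [m], in a second coordinate direction. *)
Lemma sphere_connected c r : (2 <= n)%N -> 0 < r -> connected (boundary (eball c r)).
Proof.
move=> n2 r0; rewrite boundary_eball //.
have n0 : (0 < n)%N by exact: ltn_trans n2.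
pose p : 'rV[R]_n := r *: 'e_(Ordinal n0); pose m : 'rV[R]_n := r *: 'e_(Ordinal n2).
have nrm i : enorm (r *: 'e_i : 'rV[R]_n) = r by rewrite enormZ enorm_delta mulr1 gtr0_norm.
have np : enorm p = r by exact: nrm.
have nm : enorm m = r by exact: nrm.
have sph (a b : 'rV[R]_n) : enorm a = r -> enorm b = r -> a != - b ->
    forall t : R, enorm (a + t *: (b - a)) != 0.
  move=> na nb ab t; apply/eqP => /enorm_eq0 z0.
  have E : (1 - t) *: a = - t *: b.
    apply/eqP; rewrite -subr_eq0 scaleNr opprK scalerBl scale1r -addrA -scalerN -scalerDr.
    by rewrite [- a + b]addrC z0.
  have : `|1 - t| * r = `|t| * r by rewrite -{1}na -nb -!enormZ E scaleNr enormN.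
  move=> /(mulIf (lt0r_neq0 r0)) /eqP; rewrite eqr_norm2 => /orP[/eqP|/eqP] h.
    have t2 : t = 2^-1 by lra.
    move: E; rewrite t2 => E; move: ab; rewrite -subr_eq0 opprK => /eqP; apply.
    have h2 : 1 - 2^-1 = 2^-1 :> R by lra.
    rewrite h2 scaleNr in E; have : 2^-1 *: (a + b) = 0 by rewrite scalerDr E addNr.
    by move=> /eqP; rewrite scaler_eq0 invr_eq0 pnatr_eq0 /= => /eqP.
  have h1 : (1 : R) = 0 by lra.
  by move/eqP: h1; rewrite oner_eq0.
have arcS (a b : 'rV[R]_n) : (forall t : R, enorm (a + t *: (b - a)) != 0) ->
    arc c r a b `<=` [set x | enorm (x - c) = r].
  move=> z0 _ [t _ <-] /=; rewrite addrAC subrr add0r enormZ normrM normfV.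
  by rewrite [`|enorm _|]ger0_norm ?enorm_ge0 // gtr0_norm // divfK.
have arc0 (a b : 'rV[R]_n) : enorm a = r -> arc c r a b (c + a).
  move=> na; exists 0; first by rewrite /= in_itv /= lexx ler01.
  by rewrite scale0r addr0 na divff ?scale1r // gt_eqF.
have arc1 (a b : 'rV[R]_n) : enorm b = r -> arc c r a b (c + b).
  move=> nb; exists 1; first by rewrite /= in_itv /= lexx ler01.
  by rewrite scale1r [a + _]addrC subrK nb divff ?scale1r // gt_eqF.
have pm : p != - m.
  apply/eqP => /rowP/(_ (Ordinal n0)); rewrite !mxE !eqxx /= mulr1 mulr0 oppr0.
  by move=> h; move: r0; rewrite h ltxx.
have mp : m != - - p.
  rewrite opprK; apply/eqP => /rowP/(_ (Ordinal n0)); rewrite !mxE !eqxx /= mulr1 mulr0.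
  by move=> h; move: r0; rewrite -h ltxx.
have nNp : enorm (- p) = r by rewrite enormN.
pose A x := if x - c == - p then arc c r p m `|` arc c r m (- p) else arc c r p (x - c).
have -> : [set x | enorm (x - c) = r] = \bigcup_(x in [set x | enorm (x - c) = r]) A x.
  apply/seteqP; split => [x /= xr|y [x /= xr]].
    exists x => //; rewrite /A; case: eqP => [E|_].
      by right; have := arc1 m (- p) nNp; rewrite -E [c + _]addrC subrK.
    by have := arc1 p (x - c) xr; rewrite [c + _]addrC subrK.
  rewrite /A; case: eqP => [_ [|]|/eqP ne].
  - by apply: arcS; exact: sph.
  - by apply: arcS; exact: sph.
  - apply: arcS; apply: sph => //; apply: contra ne => /eqP ->.
    by rewrite opprK.
apply: bigcup_connected.
  exists (c + p) => x _; rewrite /A; case: ifP => _; last exact: arc0.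
  by left; exact: arc0.
move=> x /= xr; rewrite /A; case: eqP => [_|/eqP ne].
  apply: connectedU; last 2 first.
  - by apply: arc_connected; exact: sph.
  - by apply: arc_connected; exact: sph.
  by exists (c + m); split; [exact: arc1|exact: arc0].
apply: arc_connected; apply: sph => //; apply: contra ne => /eqP ->.
by rewrite opprK.
Qed.

End spheres.

Section smooth_positive_part.
Context {R : realType}.
Implicit Types (l z : R).

(* Smooth approximation of the positive part of z, and its derivative. *)
Definition spos l z : R := z * step (l * z - 1).
Definition dspos l z : R := step (l * z - 1) + l * z * derive1 step (l * z - 1).

Lemma smooth1_spos l : smooth1 (spos l).
Proof.
apply: smooth1M; first exact: smooth1_id.
apply: smooth1_comp; first exact: smooth1_step.
apply: smooth1D; last exact: smooth1_cst.
by apply: smooth1M; [exact: smooth1_cst|exact: smooth1_id].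
Qed.

Lemma derive1_spos l z : derive1 (spos l) z = dspos l z.
Proof.
have sl : smooth1 (fun z : R => l * (z - 0) + (-1)).
  apply: smooth1D; last exact: smooth1_cst.
  apply: smooth1M; first exact: smooth1_cst.
  by apply: smooth1D; [exact: smooth1_id|exact: smooth1_cst].
have E0 : (fun z => step (l * z - 1)) = fun z => step (l * (z - 0) + (-1)).
  by apply/funext => t; rewrite subr0.
have ss : smooth1 (fun z => step (l * z - 1)) by rewrite E0; exact: smooth1_comp smooth1_step sl.
have d1 (t : R) : derivable (fun x : R => x) t 1 by apply: smooth1_derivable; exact: smooth1_id.
have d2 (t : R) : derivable (fun z => step (l * z - 1)) t 1 by exact: smooth1_derivable.
have E := derive1M d1 d2.
rewrite /spos E derive1_ident mul1r E0 derive1_cutoff subr0 /dspos.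
by rewrite mulrCA mulrA.
Qed.

Lemma dspos_le0 l z : 0 < l -> z <= 0 -> dspos l z = 0.
Proof.
move=> l0 z0; have h : l * z - 1 <= 0 by have := mulr_ge0_le0 (ltW l0) z0; lra.
by rewrite /dspos step_le0 // derive1_step_le0 // mulr0 addr0.
Qed.

Lemma dspos_ge2 l z : 2 <= l * z -> dspos l z = 1.
Proof.
move=> h; have h1 : 1 <= l * z - 1 by lra.
by rewrite /dspos step_ge1 // derive1_step_ge1 // mulr0 addr0.
Qed.

Lemma dspos_bound : exists2 C : R, 0 <= C & forall l z, `|dspos l z| <= C.
Proof.
have [C C0 HC] := @bounded_derive1_step R.
exists (1 + 2 * C); first by rewrite addr_ge0 // mulr_ge0 // ltW.
move=> l z; have [h|h] := ltP (l * z) 1.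
  have h1 : l * z - 1 <= 0 by lra.
  rewrite /dspos step_le0 // derive1_step_le0 // mulr0 addr0 normr0.
  by rewrite addr_ge0 // mulr_ge0 // ltW.
have [h2|h2] := leP (l * z) 2; last first.
  by rewrite dspos_ge2 ?(ltW h2) // normr1 lerDl mulr_ge0 // ltW.
apply: le_trans (ler_normD _ _) _; apply: lerD.
  by rewrite ger0_norm ?step_ge0 ?step_le1.
rewrite normrM ger0_norm; last by lra.
by apply: ler_pM => //; lra.
Qed.

Lemma spos_le0 l z : 0 < l -> l * z <= 1 -> spos l z = 0.
Proof. by move=> l0 h; rewrite /spos step_le0 ?mulr0 // subr_le0. Qed.

Lemma spos_bound l z : 0 < l -> 0 <= spos l z <= Num.max z 0.
Proof.
move=> l0; have [z0|z0] := leP z 0.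
  rewrite spos_le0 ?lexx //.
  by apply: le_trans (mulr_ge0_le0 (ltW l0) z0) _.
rewrite /spos mulr_ge0 ?(ltW z0) ?step_ge0 //=.
by rewrite ler_piMr ?(ltW z0) // step_le1.
Qed.

Lemma cvg_spos z : spos (k.+1)%:R z @[k --> \oo] --> (Num.max z 0 : R).
Proof.
have [z0|z0] := leP z 0.
  rewrite (_ : (fun _ => _) = fun=> 0); first exact: cvg_cst.
  apply/funext => k; apply: spos_le0; rewrite ?ltr0n //.
  by apply: le_trans (mulr_ge0_le0 _ z0) _.
apply: cvg_near_cst; near=> k; rewrite /spos step_ge1 ?mulr1 //.
have : 2 <= (k.+1)%:R * z.
  rewrite -ler_pdivrMr //; apply: (@le_trans _ _ k%:R); last by rewrite ler_nat.
  near: k; exact: nbhs_infty_ger.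
lra.
Unshelve. all: by end_near. Qed.

Lemma cvg_dspos z : dspos (k.+1)%:R z @[k --> \oo] --> (((0 < z)%R : nat)%:R : R).
Proof.
have [z0|z0] := leP z 0 => /=.
  rewrite (_ : (fun _ => _) = fun=> 0); first exact: cvg_cst.
  by apply/funext => k; apply: dspos_le0.
apply: cvg_near_cst; near=> k; apply: dspos_ge2.
rewrite -ler_pdivrMr //; apply: (@le_trans _ _ k%:R); last by rewrite ler_nat.
near: k; exact: nbhs_infty_ger.
Unshelve. all: by end_near. Qed.

End smooth_positive_part.

(** * Limits of test functions in H^1_0 *)

Section sobolev_limits.
Context {R : realType} {n : nat}.
Local Notation mu := (@lebesgue_row R n).
Implicit Types (f h u : 'rV[R]_n -> R) (g : 'rV[R]_n -> 'rV[R]_n) (x : 'rV[R]_n) (Omega : set 'rV[R]_n).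

Lemma cvg_sum_fin (I : Type) (s : seq I) (F : I -> nat -> R) (l : I -> R) :
  (forall i, F i k @[k --> \oo] --> l i) ->
  \sum_(i <- s) F i k @[k --> \oo] --> \sum_(i <- s) l i.
Proof.
move=> Fl; elim: s => [|i s IH].
  by under eq_fun do rewrite big_nil; rewrite big_nil; exact: cvg_cst.
under eq_fun do rewrite big_cons.
by rewrite big_cons; apply: cvgD.
Qed.

(** On a bounded set, uniform bounds turn pointwise convergence into L^2 convergence, for the
    functions and for the gradients; the pointwise limit of the gradients is then the weak
    gradient. *)
Lemma H01_limit Omega (phi : nat -> 'rV[R]_n -> R) u g C : open Omega -> ebounded Omega ->
  (forall k, test_function Omega (phi k)) ->
  (forall k x, Omega x -> `|phi k x| <= C) ->
  (forall k i x, Omega x -> `|partial i (phi k) x| <= C) ->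
  (forall x, phi k x @[k --> \oo] --> u x) ->
  (forall i x, partial i (phi k) x @[k --> \oo] --> g x 0 i) ->
  H01 Omega u g.
Proof.
move=> oO bO tp bp bd cu cg; have mO := measurable_open oO.
pose B x : R := `|C| * \1_Omega x.
have B0 x : 0 <= B x by rewrite mulr_ge0 // indicE.
have LB : L1 B by apply: L1Z; exact: L1_indic_open.
have LB2 : L1 (fun x => B x ^+ 2).
  have -> : (fun x => B x ^+ 2) = fun x => `|C| ^+ 2 * \1_Omega x.
    by apply/funext => x; rewrite exprMn; congr (_ * _); rewrite expr2 indic_sqr.
  by apply: L1Z; exact: L1_indic_open.
have bnd f x : (Omega x -> `|f x| <= C) -> (~ Omega x -> f x = 0) -> `|f x| <= B x.
  move=> h1 h2; rewrite /B indicE; case: (boolP (x \in Omega)) => [|].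
    by rewrite inE mulr1 => /h1 h; apply: le_trans h (ler_norm _).
  by rewrite notin_setE mulr0 => /h2 ->; rewrite normr0.
have bp' k x : `|phi k x| <= B x by apply: bnd => [/bp//|]; exact: test_out.
have bd' k i x : `|partial i (phi k) x| <= B x.
  by apply: bnd => [/bd//|]; apply: test_out; exact: test_partial.
have lim_le (F : nat -> R) l b : F k @[k --> \oo] --> l -> (forall k, `|F k| <= b) -> `|l| <= b.
  by move=> cF bF; apply: cvgr_to_le (cvg_norm cF) _; exact: nearW.
have bu x : `|u x| <= B x by apply: lim_le (cu x) _ => k; exact: bp'.
have bg i x : `|g x 0 i| <= B x by apply: lim_le (cg i x) _ => k; exact: bd'.
have mp k : mfun (phi k) by apply: mfun_cont; apply: smooth_continuous; exact: test_smooth (tp k).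
have md k i : mfun (partial i (phi k)).
  by apply: mfun_cont; apply: smooth_continuous; exact: test_smooth (test_partial i (tp k)).
have mu' : mfun u by apply: (@measurable_fun_cvg _ _ R setT phi) => [k|x _]; [exact: mp|exact: cu].
have mg i : mfun (fun x => g x 0 i).
  by apply: (@measurable_fun_cvg _ _ R setT (fun k => partial i (phi k))) => [k|x _]; [exact: md|exact: cg].
have L2b f : mfun f -> (forall x, `|f x| <= B x) -> L2 Omega f.
  move=> mf bf; apply: L2_intro => //; apply: L1_le LB2 _; first by rewrite (_ : (fun x => _) = fun x => f x * f x) //; exact: mfunM.
  move=> x; rewrite normrX; apply: lerXn2r; rewrite ?nnegrE //.
have Lu : L2 Omega u by exact: L2b.
have Lg i : L2 Omega (fun x => g x 0 i) by exact: L2b.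
have pass f (F : nat -> 'rV[R]_n -> R) psi : mfun f -> (forall k, mfun (F k)) ->
    (forall k x, `|F k x| <= B x) -> (forall x, F k x @[k --> \oo] --> f x) -> test_function Omega psi ->
    \int[mu]_(x in Omega) (F k x * psi x) @[k --> \oo] --> \int[mu]_(x in Omega) (f x * psi x).
  move=> mf mF bF cF tq; have sq := test_smooth tq.
  have [K K0 HK] := smooth_bounded sq (test_bsupp tq).
  have mq : mfun psi by apply: mfun_cont; exact: smooth_continuous.
  rewrite Int_restrict //; under eq_fun do rewrite Int_restrict //.
  have [| | | | |_ //] := @Int_cvg R n (fun k x => \1_Omega x * (F k x * psi x)) (fun x => \1_Omega x * (f x * psi x))
    (fun x => K * B x).
  - by move=> k; apply: mfunM; [exact: mfun_indic|exact: mfunM].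
  - by apply: mfunM; [exact: mfun_indic|exact: mfunM].
  - exact: L1Z.
  - move=> k x; rewrite normrM normrM [leRHS]mulrC -[leRHS]mul1r.
    apply: ler_pM (indic_le1 _ _) _ => //.
    by apply: ler_pM => //; exact: bF.
  - by move=> x; apply: cvgM; [exact: cvg_cst|apply: cvgM; [exact: cF|exact: cvg_cst]].
have err f (F : nat -> 'rV[R]_n -> R) : mfun f -> (forall x, `|f x| <= B x) -> (forall k, mfun (F k)) ->
    (forall k x, `|F k x| <= B x) -> (forall x, F k x @[k --> \oo] --> f x) ->
    Int (fun x => \1_Omega x * (F k x - f x) ^+ 2) @[k --> \oo] --> (0 : R).
  move=> mf bf mF bF cF.
  have [| | | | |_] := @Int_cvg R n (fun k x => \1_Omega x * (F k x - f x) ^+ 2) (fun _ : 'rV[R]_n => 0 : R)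
    (fun x => 4 * B x ^+ 2).
  - move=> k; apply: mfunM; first exact: mfun_indic.
    by rewrite (_ : (fun x => _) = fun x => (F k x - f x) * (F k x - f x)) //; apply: mfunM; exact: mfunB.
  - exact: mfun_cst.
  - exact: L1Z.
  - move=> k x; rewrite normrM -[leRHS]mul1r; apply: ler_pM (indic_le1 _ _) _ => //.
    rewrite ger0_norm ?sqr_ge0 //; apply: le_trans (sqr_sub_le _ _) _.
    have sq (t : R) : `|t| <= B x -> t ^+ 2 <= B x ^+ 2.
      by move=> h; rewrite -(@real_normK _ t) ?num_real //; apply: lerXn2r; rewrite ?nnegrE.
    by have := sq _ (bF k x); have := sq _ (bf x); move: (F k x ^+ 2) (f x ^+ 2) (B x ^+ 2) => p q b; lra.
  - move=> x; have c0 : F k x - f x @[k --> \oo] --> (0 : R).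
      by rewrite -(subrr (f x)); apply: cvgB; [exact: cF|exact: cvg_cst].
    rewrite -(mulr0 (\1_Omega x)); apply: cvgM; first exact: cvg_cst.
    by rewrite -(mulr0 (0 : R)); apply: cvgM.
  - by rewrite Int0.
split.
  split => // psi tq i.
  have c1 := pass u phi (partial i psi) mu' mp bp' cu (test_partial i tq).
  have c2 := pass (fun x => g x 0 i) (fun k => partial i (phi k)) psi (mg i) (md^~ i) (bd'^~ i) (cg i) tq.
  have E k : \int[mu]_(x in Omega) (phi k x * partial i psi x) =
      - \int[mu]_(x in Omega) (partial i (phi k) x * psi x).
    rewrite (test_weak_gradient mO (test_smooth (tp k)) tq i).
    by under eq_Rintegral do rewrite mxE.
  by rewrite (funext E) in c1; apply: cvg_unique c1 (cvgN c2).
exists phi; split => //.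
  have -> : (fun k => \int[mu]_(x in Omega) ((phi k x - u x) ^+ 2)%:E)%E =
      fun k => (Int (fun x => \1_Omega x * (phi k x - u x) ^+ 2))%:E.
    apply/funext => k; rewrite -L1_fin; last by apply: L1_sqr_sub => //; exact: test_L2.
    by rewrite -eint_restrict.
  apply: cvg_EFin; first exact: nearW.
  exact: (err u phi mu' bu mp bp' cu).
have Ls k i : L1 (fun x => \1_Omega x * (partial i (phi k) x - g x 0 i) ^+ 2).
  by apply: L1_sqr_sub (Lg i) => //; apply: test_L2 => //; exact: test_partial.
have -> : (fun k => \int[mu]_(x in Omega) (enorm (grad (phi k) x - g x) ^+ 2)%:E)%E =
    fun k => (\sum_i Int (fun x => \1_Omega x * (partial i (phi k) x - g x 0 i) ^+ 2))%:E.
  apply/funext => k; rewrite -(Int_sum _ _ (Ls k)) -L1_fin; last exact: L1_sum (Ls k).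
  rewrite (@eint_restrict _ _ Omega _ mO); apply: eq_integral => x _; congr (_%:E).
  rewrite enorm_sqr -mulr_sumr; congr (_ * _).
  by apply: eq_bigr => j _; rewrite !mxE expr2.
apply: cvg_EFin; first exact: nearW.
have := @cvg_sum_fin _ (index_enum 'I_n) _ _ (fun i => err (fun x => g x 0 i) (fun k => partial i (phi k))
  (mg i) (bg i) (md^~ i) (bd'^~ i) (cg i)).
by rewrite big1_eq.
Qed.

Lemma L2_diff_small Omega w f h M s : open Omega -> ebounded Omega -> L2 Omega f -> L2 Omega h ->
  mfun w -> (forall x, Omega x -> `|w x| <= M) -> 0 <= M -> 0 < s ->
  L1 (fun x => \1_Omega x * (w x * (f x - h x))) /\
  `|Int (fun x => \1_Omega x * (w x * (f x - h x)))| <=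
    M * (s * Int (\1_Omega) + s^-1 * Int (fun x => \1_Omega x * (f x - h x) ^+ 2)).
Proof.
move=> oO bO Lf Lh mw wM M0 s0.
have L1O := L1_indic_open oO bO; have Ld := L1_sqr_sub oO bO Lf Lh.
have LG : L1 (fun x => M * (s * \1_Omega x + s^-1 * (\1_Omega x * (f x - h x) ^+ 2))).
  by apply: L1Z; apply: L1D; exact: L1Z.
have fG x : `|\1_Omega x * (w x * (f x - h x))| <=
    M * (s * \1_Omega x + s^-1 * (\1_Omega x * (f x - h x) ^+ 2)).
  rewrite indicE; case: (boolP (x \in Omega)) => [|_]; last first.
    by rewrite !mul0r !mulr0 normr0 addr0 mulr0.
  rewrite inE => Ox; rewrite !mul1r mulr1 normrM; apply: ler_pM => //; first exact: wM.
  apply: le_trans (le_add_sqr s0 (normr_ge0 _)) _.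
  by rewrite real_normK ?num_real.
have mF : mfun (fun x => \1_Omega x * (w x * (f x - h x))).
  have [mf _ _] := L2_res oO bO Lf; have [mh _ _] := L2_res oO bO Lh.
  have -> : (fun x => \1_Omega x * (w x * (f x - h x))) =
      fun x => w x * (\1_Omega x * f x - \1_Omega x * h x).
    by apply/funext => x; rewrite -mulrBr mulrCA.
  by apply: mfunM => //; exact: mfunB.
have LF := L1_le mF LG fG; split => //.
apply: le_trans (abs_Int LF) _; apply: le_trans (le_Int (L1_abs LF) LG fG) _.
rewrite (IntZ M (L1D (L1Z s L1O) (L1Z s^-1 Ld))) (IntD (L1Z s L1O) (L1Z s^-1 Ld)).
by rewrite (IntZ s L1O) (IntZ s^-1 Ld).
Qed.

Lemma add_opp_bound (X Y X' Y' m1 m2 I s t e : R) : X' + Y' = 0 ->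
  `|X' - X| <= m1 * (s * I + t * e) -> `|Y' - Y| <= m2 * (s * I + t * e) ->
  `|X + Y| <= (m1 + m2) * I * s + (m1 + m2) * t * e.
Proof.
move=> E B1 B2; have -> : X + Y = - ((X' - X) + (Y' - Y)).
  by rewrite addrACA E add0r -opprD opprK.
rewrite normrN; apply: le_trans (ler_normD _ _) _; apply: le_trans (lerD B1 B2) _.
by rewrite le_eqVlt; apply/orP; left; apply/eqP; ring.
Qed.

(** [f] may be nonzero at the boundary; the boundary term is absent because [u] is a limit of test
    functions. The approximation errors are removed by [eq0_of_small]. *)
Lemma H01_by_parts Omega u g f i : open Omega -> ebounded Omega -> H01 Omega u g -> smooth f ->
  [/\ L1 (fun x => \1_Omega x * (f x * g x 0 i)), L1 (fun x => \1_Omega x * (partial i f x * u x)) &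
  Int (fun x => \1_Omega x * (f x * g x 0 i)) = - Int (fun x => \1_Omega x * (partial i f x * u x))].
Proof.
move=> oO bO Hu sf; have mO := measurable_open oO.
have [[Lu /(_ i) Lg _] _] := Hu.
have [M OM] := bO.
have cf := smooth_continuous sf; have cd := smooth_continuous (smooth_partial i sf).
have [m1 m10 b1] := continuous_bounded_on OM cf.
have [m2 m20 b2] := continuous_bounded_on OM cd.
have Lw (w : 'rV[R]_n -> R) (m : R) (v : 'rV[R]_n -> R) : continuous w -> (forall x, Omega x -> `|w x| <= m) -> 0 <= m -> L2 Omega v ->
    L1 (fun x => \1_Omega x * (w x * v x)).
  move=> cw wm m0 Lv; have [_ _ L] := L2_res oO bO Lv.
  apply: (@L1_le _ _ _ (fun x => m * `|\1_Omega x * v x|)).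
  - have -> : (fun x => \1_Omega x * (w x * v x)) = fun x => w x * (\1_Omega x * v x).
      by apply/funext => x; rewrite mulrCA.
    by apply: mfunM; [exact: mfun_cont|exact: L1_mfun L].
  - by apply: L1Z; exact: L1_abs.
  - move=> x; rewrite mulrCA normrM indicE; case: (boolP (x \in Omega)) => [|_].
      by rewrite inE => /wm h; apply: ler_wpM2r.
    by rewrite !mul0r normr0 !mulr0.
have L1g := Lw _ _ _ cf b1 m10 Lg; have L1u := Lw _ _ _ cd b2 m20 Lu; split => //.
apply/eqP; rewrite -subr_eq0 opprK; apply/eqP.
have IO : 0 <= Int (\1_Omega : 'rV[R]_n -> R) by apply: Int_ge0 => x; rewrite indicE.
apply: (@eq0_of_small _ _ ((m1 + m2) * Int (\1_Omega)) (m1 + m2)).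
- by apply: mulr_ge0 IO; exact: addr_ge0.
- exact: addr_ge0.
move=> s e s0 e0; have [phi [tp h1 /(_ i) h2]] := H01_approx oO bO Hu e0.
have sp := test_smooth tp; have bp := test_bsupp tp.
have E : Int (fun x => \1_Omega x * (f x * partial i phi x)) +
    Int (fun x => \1_Omega x * (partial i f x * phi x)) = 0.
  rewrite (_ : (fun x => \1_Omega x * (f x * _)) = fun x => f x * partial i phi x); last first.
    by apply/funext => x; rewrite (test_indicl f x (test_partial i tp)).
  rewrite (_ : (fun x => \1_Omega x * (partial i f x * _)) = fun x => partial i f x * phi x); last first.
    by apply/funext => x; rewrite (test_indicl (partial i f) x tp).
  by rewrite (Int_by_parts i sf sp (or_intror bp)) subrr.
have Lp := test_L2 mO tp; have Ld := test_L2 mO (test_partial i tp).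
have Lpf := Lw _ _ _ cf b1 m10 Ld; have Lpu := Lw _ _ _ cd b2 m20 Lp.
have [_ B1] := L2_diff_small oO bO Ld Lg (mfun_cont cf) b1 m10 s0.
have [_ B2] := L2_diff_small oO bO Lp Lu (mfun_cont cd) b2 m20 s0.
have D w v1 v2 : L1 (fun x => \1_Omega x * (w x * v1 x)) -> L1 (fun x => \1_Omega x * (w x * v2 x)) ->
    Int (fun x => \1_Omega x * (w x * (v1 x - v2 x))) =
    Int (fun x => \1_Omega x * (w x * v1 x)) - Int (fun x => \1_Omega x * (w x * v2 x)).
  move=> l1 l2; rewrite -(IntB l1 l2); congr Int; apply/funext => x.
  by rewrite mulrBr mulrBr.
move: B1 B2; rewrite (D _ _ _ Lpf L1g) (D _ _ _ Lpu L1u).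
have sV : 0 <= s^-1 by rewrite invr_ge0 ltW.
have le_e m a : 0 <= m -> a <= e -> m * (s * Int (\1_Omega : 'rV[R]_n -> R) + s^-1 * a) <=
    m * (s * Int (\1_Omega) + s^-1 * e).
  by move=> m0 ae; apply: (ler_wpM2l m0); apply: lerD (lexx _) (ler_wpM2l sV ae).
move=> /le_trans/(_ (le_e _ _ m10 h2)) B1 /le_trans/(_ (le_e _ _ m20 h1)) B2.
exact: (add_opp_bound E B1 B2).
Qed.

End sobolev_limits.

(** * The explicit solution for concentric balls *)

Section radial_solution.
Context {R : realType} {n : nat}.
Variables (c : 'rV[R]_n) (r s sg : R).
Hypotheses (r0 : 0 < r) (rs : r < s) (sg0 : 0 < sg).
Local Notation mu := (@lebesgue_row R n).
Implicit Types (x y : 'rV[R]_n).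

Let D := eball c r.
Let O := eball c s.
Let kap := sg^-1 - 1.
Let s0 : 0 < s. Proof. exact: lt_trans rs. Qed.
Let rs2 : r ^+ 2 < s ^+ 2.
Proof. by rewrite ltr_sqr ?nnegrE // ltW. Qed.
Let oO : open O. Proof. exact: open_eball. Qed.
Let oD : open D. Proof. exact: open_eball. Qed.
Let bO : ebounded O.
Proof.
exists (s + enorm c) => x xs; rewrite -(subrK c x).
by apply: le_trans (enormD _ _) _; apply: lerD (ltW xs) (lexx _).
Qed.

(** Equal to (|x-c|^2 - s^2)/2 between the spheres, with gradient (x-c)/sg in the inner ball. The
    positive parts are limits of smooth functions vanishing near the outer sphere, which gives
    membership in H^1_0 without gluing. *)
Definition radial_solution x : R :=
  - 2^-1 * (Num.max (s ^+ 2 - sqd c x) 0 + kap * Num.max (r ^+ 2 - sqd c x) 0).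

Definition radial_gradient x : 'rV[R]_n :=
  (((0 < s ^+ 2 - sqd c x)%R : nat)%:R + kap * ((0 < r ^+ 2 - sqd c x)%R : nat)%:R) *: (x - c).

Let appr (k : nat) x : R :=
  - 2^-1 * (spos k.+1%:R (s ^+ 2 - sqd c x) + kap * spos k.+1%:R (r ^+ 2 - sqd c x)).

Let smooth_subsqd (A : R) : smooth (fun x => A - sqd c x).
Proof. by apply: smoothB; [exact: smooth_cst|exact: smooth_sqd]. Qed.

Let smooth_spos l (A : R) : smooth (fun x => spos l (A - sqd c x)).
Proof. exact: smooth_comp (smooth1_spos l) (smooth_subsqd A). Qed.

Let partial_spos l (A : R) i : partial i (fun x => spos l (A - sqd c x)) =
  fun x => dspos l (A - sqd c x) * (-2 * (x 0 i - c 0 i)).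
Proof.
rewrite (@partial_comp _ _ i (spos l) (fun x => A - sqd c x)).
- apply/funext => x; rewrite derive1_spos; congr (_ * _).
  have -> : (fun x => A - sqd c x) = fun x => A + -1 * sqd c x.
    by apply/funext => y; rewrite mulN1r.
  have sc : smooth (fun _ : 'rV[R]_n => A) by exact: smooth_cst.
  have sq : smooth (fun x => -1 * sqd c x) by apply: smoothZ; exact: smooth_sqd.
  rewrite (partialD i (fun y => smooth_diff y sc) (fun y => smooth_diff y sq)).
  by rewrite partial_cst (partialZ i (-1) (smooth_sqd c)) partial_sqd add0r; ring.
- by move=> x; exact: smooth_diff.
- by move=> z; apply: smooth1_derivable; exact: smooth1_spos.
Qed.

Let smooth_appr k : smooth (appr k).
Proof. by apply: smoothZ; apply: smoothD => //; exact: smoothZ. Qed.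

Let partial_appr k i : partial i (appr k) = fun x =>
  (dspos k.+1%:R (s ^+ 2 - sqd c x) + kap * dspos k.+1%:R (r ^+ 2 - sqd c x)) * (x 0 i - c 0 i).
Proof.
have s1 := smooth_spos k.+1%:R (s ^+ 2); have s2 := smooth_spos k.+1%:R (r ^+ 2).
have s3 := smoothZ kap s2.
rewrite (partialZ i (- 2^-1) (smoothD s1 s3)).
rewrite (partialD i (fun y => smooth_diff y s1) (fun y => smooth_diff y s3)).
rewrite (partialZ i kap s2) !partial_spos; apply/funext => x.
by move: (dspos _ (s ^+ 2 - _)) (dspos _ (r ^+ 2 - _)) (x 0 i - c 0 i) => p q z; field.
Qed.

Let test_appr k : test_function O (appr k).
Proof.
have clC : closed [set x | sqd c x <= s ^+ 2 - k.+1%:R^-1].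
  by apply: closed_sublevel; exact: sqd_continuous.
have k0 : 0 < k.+1%:R^-1 :> R by rewrite invr_gt0 ltr0n.
apply: (test_intro (smooth_appr k) _ clC).
- apply: subclosed_compact clC (@compact_cball R n c s) _ => x /= xs.
  rewrite (enorm_le _ (ltW s0)); apply: le_trans xs _.
  by rewrite gerBl ltW.
- move=> x /= xs; rewrite /O eballE //=; apply: le_lt_trans xs _.
  by rewrite gtrBl.
move=> x /= /negP; rewrite -ltNge => xs.
have l0 : 0 < k.+1%:R :> R by rewrite ltr0n.
have h1 : k.+1%:R * (s ^+ 2 - sqd c x) <= 1.
  rewrite -ler_pdivlMl // mulr1; move: xs; move: (sqd c x) k.+1%:R^-1 (s ^+ 2) => t z y; lra.
have h2 : k.+1%:R * (r ^+ 2 - sqd c x) <= 1.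
  by apply: le_trans h1; rewrite ler_pM2l // lerD2r ltW.
by rewrite /appr !spos_le0 // mulr0 addr0 mulr0.
Qed.

Lemma H01_radial_solution : H01 O radial_solution radial_gradient.
Proof.
have [C C0 HC] := @dspos_bound R.
have coord x i : O x -> `|x 0 i - c 0 i| <= s.
  move=> xs; have := coord_le_enorm (x - c) i; rewrite !mxE => h.
  by apply: le_trans h _; exact: ltW.
have absle (p q m1 : R) : `|p| <= m1 -> `|q| <= m1 -> `|p + kap * q| <= (1 + `|kap|) * m1.
  move=> h1 h2; apply: le_trans (ler_normD _ _) _; rewrite [leRHS]mulrDl mul1r; apply: lerD => //.
  by rewrite normrM; apply: ler_wpM2l.
pose C1 := (1 + `|kap|) * s ^+ 2; pose C2 := (1 + `|kap|) * C * s.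
have C10 : 0 <= C1 by rewrite mulr_ge0 ?sqr_ge0 // addr_ge0.
have C20 : 0 <= C2 by rewrite !mulr_ge0 ?addr_ge0 // ltW.
apply: (@H01_limit _ _ _ appr _ _ (C1 + C2) oO bO test_appr).
- move=> k x _; apply: (@le_trans _ _ C1); last by rewrite lerDl.
  have l0 : 0 < k.+1%:R :> R by rewrite ltr0n.
  have sp (A : R) : A <= s ^+ 2 -> `|spos k.+1%:R (A - sqd c x)| <= s ^+ 2.
    move=> As; have /andP[h1 h2] := spos_bound (A - sqd c x) l0.
    rewrite ger0_norm //; apply: le_trans h2 _; rewrite ge_max sqr_ge0 andbT.
    by rewrite lerBlDr; apply: le_trans As _; rewrite lerDl sqd_ge0.
  rewrite /appr normrM normrN; have := absle _ _ _ (sp _ (lexx _)) (sp _ (ltW rs2)).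
  rewrite -/C1; move: `|_ + _| => t tC.
  rewrite ger0_norm ?invr_ge0 //; apply: le_trans (ler_wpM2l _ tC) _; first by rewrite invr_ge0.
  by move: C1 C10 {sp tC C20} => z z0; lra.
- move=> k i x Ox; apply: (@le_trans _ _ C2); last by rewrite lerDr.
  rewrite partial_appr normrM; apply: ler_pM => //; last exact: coord.
  exact: absle.
- move=> x; apply: cvgM; first exact: cvg_cst.
  apply: cvgD; first exact: cvg_spos.
  by apply: cvgM; [exact: cvg_cst|exact: cvg_spos].
- move=> i x; rewrite /radial_gradient !mxE; under eq_fun do rewrite partial_appr.
  apply: cvgM; last exact: cvg_cst.
  apply: cvgD; first exact: cvg_dspos.
  by apply: cvgM; [exact: cvg_cst|exact: cvg_dspos].
Qed.

Let DO : D `<=` O.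
Proof. by move=> x xr; exact: lt_trans rs. Qed.

Let conductivity_gradient x : O x -> conductivity sg D O x *: radial_gradient x = x - c.
Proof.
move=> Ox; have : 0 < s ^+ 2 - sqd c x by move: Ox; rewrite /O eballE //= subr_gt0.
rewrite /radial_gradient => ->; rewrite /conductivity !indicE scalerA -[RHS]scale1r; congr (_ *: _).
have [Dx|nDx] := pselect (D x).
  rewrite (mem_set Dx) memNset; last by case.
  move: Dx; rewrite /D eballE //= -subr_gt0 => ->.
  by rewrite /kap !mulr1 addr0 addrC subrK divff ?gt_eqF.
rewrite (memNset nDx) (mem_set (conj Ox nDx : (O `\` D) x)); move: nDx; rewrite /D eballE //= => /negP.
rewrite -leNgt -subr_le0 leNgt => /negbTE ->.
by rewrite !mulr0 add0r addr0 mulr1.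
Qed.

(** The flux, conductivity times gradient, is x - c in the whole ball, and its divergence is n. *)
Lemma radial_two_phase_solution : two_phase_solution sg D O radial_solution.
Proof.
have mO : measurable O by exact: measurable_open.
exists radial_gradient; first exact: H01_radial_solution.
move=> phi h H; rewrite !Int_restrict //.
have sB i : smooth (fun x => x 0 i - c 0 i : R) by exact: smooth_coordB.
have ibp i := H01_by_parts i oO bO H (sB i).
have L1i i : L1 (fun x => \1_O x * ((x 0 i - c 0 i) * h x 0 i)) by have [] := ibp i.
have -> : (fun x => \1_O x * (conductivity sg D O x * dotr (radial_gradient x) (h x))) =
    fun x => \sum_i \1_O x * ((x 0 i - c 0 i) * h x 0 i).
  apply/funext => x; rewrite -mulr_sumr indicE.
  case: (boolP (x \in O)) => [|_]; last by rewrite !mul0r.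
  rewrite inE => Ox; rewrite !mul1r -dotrZl conductivity_gradient //.
  by apply: eq_bigr => i _; rewrite !mxE.
rewrite (Int_sum _ _ L1i).
have -> : \sum_i Int (fun x => \1_O x * ((x 0 i - c 0 i) * h x 0 i)) =
    \sum_(i < n) - Int (fun x => \1_O x * phi x).
  apply: eq_bigr => i _; have [_ _ ->] := ibp i.
  by congr (- Int _); apply/funext => x; rewrite partial_coordB eqxx mul1r.
by rewrite sumr_const card_ord mulNrn opprK mulr_natl.
Qed.

Let local_quadratic v (p q : R) (U : set 'rV[R]_n) x : open U -> U x ->
  (forall y, U y -> v y = p * sqd c y + q) ->
  differentiable v x /\ enorm (grad v x) = `|2 * p| * enorm (x - c).
Proof.
move=> oU Ux vE; have sZ : smooth (fun y => p * sqd c y) by apply: smoothZ; exact: smooth_sqd.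
have sc : smooth (fun _ : 'rV[R]_n => q) by exact: smooth_cst.
have sF := smoothD sZ sc; split.
  apply: (@near_differentiable _ _ (fun y => p * sqd c y + q)); last exact: smooth_diff.
  by apply: filterS (open_nbhs_nbhs (conj oU Ux)) => y /vE.
rewrite -enormZ; congr enorm; apply/rowP => i; rewrite !mxE (partial_open i oU Ux vE).
rewrite (partialD i (fun y => smooth_diff y sZ) (fun y => smooth_diff y sc)).
by rewrite partial_cst addr0 (partialZ i p (smooth_sqd c)) partial_sqd; ring.
Qed.

Let radial_regular x : O x -> enorm (x - c) != r ->
  differentiable radial_solution x /\
  enorm (grad radial_solution x) =
    `|2 * (if enorm (x - c) < r then 2^-1 * sg^-1 else 2^-1)| * enorm (x - c).
Proof.
move=> Ox xr; have [h|h] := ltP (enorm (x - c)) r.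
  apply: (@local_quadratic _ _ (- 2^-1 * (s ^+ 2 + kap * r ^+ 2)) D) => // y yr.
  have := DO yr; move: yr; rewrite /D /O !eballE //= => y1 y2.
  rewrite /radial_solution !max_l ?subr_ge0 ?(ltW y1) ?(ltW y2) // /kap.
  by move: (sqd c y) sg^-1 => t z; ring.
have h' : r < enorm (x - c) by rewrite lt_neqAle eq_sym xr.
apply: (@local_quadratic _ _ (- 2^-1 * s ^+ 2) (O `&` [set y | r ^+ 2 < sqd c y])).
- apply: openI => //; apply: (@open_comp _ _ (sqd c) [set y | r ^+ 2 < y]); last exact: open_gt.
  by move=> y _; exact: sqd_continuous.
- by split => //=; rewrite /sqd -enorm_sqr ltr_sqr ?nnegrE ?enorm_ge0 // ltW.
move=> y [Oy /= yr]; move: Oy; rewrite /O eballE //= => y1.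
rewrite /radial_solution max_l ?subr_ge0 ?(ltW y1) // max_r ?subr_le0 ?(ltW yr) // mulr0 addr0.
by move: (sqd c y) => t; ring.
Qed.

Lemma radial_level_set rho : 0 < rho -> rho < s -> rho != r ->
  overdetermined_level_set D O radial_solution (eball c rho).
Proof.
move=> p0 ps pr; split.
- by split; [exact: open_eball|exact: connected_eball|exists c; exact: eball_center].
- by rewrite /compactly_contained closure_eball //; exact: eball_sub_closed.
- rewrite !boundary_eball //; apply/seteqP; split => // x [/= -> E].
  by move: pr; rewrite E eqxx.
exists radial_solution; rewrite !boundary_eball //; split.
- by move=> x [Ox /= /eqP xr]; have [] := radial_regular Ox xr.
- exact: aeW.
- exists (- 2^-1 * (Num.max (s ^+ 2 - rho ^+ 2) 0 + kap * Num.max (r ^+ 2 - rho ^+ 2) 0)) => x /= xp.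
  by rewrite /radial_solution /sqd -enorm_sqr xp.
- exists (`|2 * (if rho < r then 2^-1 * sg^-1 else 2^-1)| * rho) => x /= xp.
  have Ox : O x by rewrite /O /eball /= xp.
  by have [] := radial_regular Ox; rewrite ?xp.
Qed.

Lemma radial_overdetermination (a : nat) : (2 <= n)%N ->
  overdetermination_type a 1 D O radial_solution.
Proof.
move=> n2.
(* The first a + 1 increments bring [rho a] to r, the next two bring [rho a.+2] to s; the level
   domains, [D] and [O] are then consecutive balls of one increasing sequence. *)
pose step j : R := if (j <= a)%N then r / a.+1%:R else (s - r) / 2.
have step0 j : 0 < step j by rewrite /step; case: ifP => _; rewrite divr_gt0 // subr_gt0.
pose rho j := \sum_(i < j.+1) step i.
have rho_lt : {homo rho : i j / (i < j)%N >-> i < j}.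
  apply: homo_ltn => [x y z|i]; first exact: lt_trans.
  by rewrite {2}/rho big_ord_recr /= ltrDl.
have rho0 j : 0 < rho j.
  case: j => [|j]; first by rewrite /rho big_ord1.
  by apply: lt_trans (rho_lt 0 j.+1 _); rewrite // /rho big_ord1.
have rhoa : rho a = r.
  rewrite /rho (eq_bigr (fun=> r / a.+1%:R)); last by move=> i _; rewrite /step -ltnS ltn_ord.
  by rewrite sumr_const card_ord -(mulr_natr (r / a.+1%:R)) divfK // pnatr_eq0.
have step_gt j : (a < j)%N -> step j = (s - r) / 2 by rewrite /step ltnNge => /negbTE ->.
have rhos : rho a.+2 = s.
  rewrite /rho 2!big_ord_recr /= -/(rho a) rhoa !step_gt //; lra.
have rho_inj i : (i != a)%N -> rho i != r.
  move=> ia; rewrite -rhoa; case: (ltngtP i a) ia => // h _.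
    by rewrite lt_eqF // rho_lt.
  by rewrite gt_eqF // rho_lt.
(* The index [a] belongs to [D] and is skipped, as level sets must avoid its boundary. *)
pose om i := eball c (rho (if (i < a)%N then i else i.+1)).
exists om; split.
  move=> i ia; pose j := if (i < a)%N then i else i.+1.
  have ja : (j != a)%N.
    rewrite /j; case: ltnP => h; first by rewrite neq_ltn h.
    by rewrite neq_ltn ltnS h orbT.
  have js : (j < a.+2)%N.
    by move: ia; rewrite /j addn1 => ia; case: ifP => _; [exact: ltn_trans ia _|rewrite ltnS].
  split; first by split; [exact: open_eball|exact: connected_eball|exists c; exact: eball_center].
    exact: sphere_connected.
  by apply: radial_level_set => //; [rewrite -rhos; exact: rho_lt|exact: rho_inj].
have -> : mkseq om a ++ D :: rcons (mkseq (fun i => om (a + i)%N) 1) O =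
    [seq eball c (rho j) | j <- iota 0 (a + 3)].
  rewrite iotaD map_cat add0n; congr (_ ++ _).
    by apply/eq_in_map => i; rewrite mem_iota /= add0n /om => ->.
  by rewrite /mkseq /= addn0 /om ltnn rhoa rhos.
apply: (@homo_sorted _ _ _ ltn) (iota_ltn_sorted 0 (a + 3)) => i j ij.
apply/asboolP; rewrite /compactly_contained closure_eball //.
by apply: eball_sub_closed; exact: rho_lt.
Qed.

End radial_solution.

Section converse.
Context {R : realType} {n : nat}.
Implicit Types (D Omega : set 'rV[R]_n).

Lemma concentric_overdetermined (sg : R) (a : nat) D Omega : (2 <= n)%N -> 0 < sg ->
  compactly_contained D Omega -> concentric_balls D Omega ->
  pair_overdetermination_type sg a 1 D Omega.
Proof.
move=> n2 sg0 DO [c [r [s [r0 s0 DE OE]]]].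
move: DO; rewrite DE OE /compactly_contained closure_eball // => rs.
(* A point of the inner sphere lies in the closure of [D], hence in [Omega]. *)
have {}rs : r < s.
  have n0 : (0 < n)%N by exact: ltn_trans n2.
  have E : enorm (c + r *: 'e_(Ordinal n0) - c) = r.
    by rewrite addrAC subrr add0r enormZ enorm_delta mulr1 gtr0_norm.
  by rewrite -{1}E; apply: rs; rewrite /= E.
exists (radial_solution c r s sg); first exact: radial_two_phase_solution.
exact: radial_overdetermination.
Qed.

End converse.

Theorem theorem2 (R : realType) (N : nat) (hN : (2 <= N)%N)
  (sigma_c : R) (sigma_c_gt0 : 0 < sigma_c) (sigma_c_neq1 : sigma_c != 1)
  (a : nat) (ha : (0 < a)%N)
  (D0 Omega : set 'rV[R]_N)
  (hD0 : is_eball D0)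
  (hOmega : domain Omega) (Omega_bounded : bounded_set Omega)
  (hD0Omega : compactly_contained D0 Omega)
  (Omega_regular : forall x, boundary Omega x -> regular_point Omega x) :
  pair_overdetermination_type sigma_c a 1 D0 Omega <->
  concentric_balls D0 Omega.
Proof.
split; last exact: concentric_overdetermined.
exact: (overdetermined_concentric hN sigma_c_gt0 sigma_c_neq1 ha hD0 hOmega Omega_bounded hD0Omega
  Omega_regular).
Qed.
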